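(* (i) Let $(\mathcal K,d)$ be a metric tame Kuranishi atlas with nested reductions $\mathcal C\sqsubset\mathcal V$ and equivariant norms $\|\cdot\|$ on the obstruction spaces. Then for any $0<\delta<\delta_{\mathcal V}$ and $0<\sigma\le\sigma(\mathcal V,\mathcal C,\|\cdot\|,\delta)$ there exists a $(\mathcal V,\mathcal C,\|\cdot\|,\delta,\sigma)$-adapted perturbation $\nu$ of $\mathsf s_{\mathcal K}|_{\mathcal V}^{\setminus\Gamma}$. (ii) Let $(\mathcal K,d)$ be a metric tame Kuranishi cobordism with nested cobordism reductions $\mathcal C\sqsubset\mathcal V$, equivariant norms $\|\cdot\|$ on the obstruction spaces, and minimal collar width $\varepsilon>0$ of $(\mathcal K,d)$ and the reductions $\mathcal C,\mathcal V$. Then, given $0<\delta<\min\{\varepsilon,\delta_{\mathcal V}\}$, $0<\sigma\le\sigma_{\rm rel}(\mathcal V,\mathcal C,\|\cdot\|,\delta)$, and perturbations $\nu^\alpha$ of $\mathsf s_{\partial^\alpha\mathcal K}|_{\partial^\alpha\mathcal V}^{\setminus\Gamma}$ for $\alpha=0,1$ that are $(\partial^\alpha\mathcal V,\partial^\alpha\mathcal C,\partial^\alpha\|\cdot\|,\delta,\sigma)$-adapted, there exists an admissible, precompact, transverse cobordism perturbation $\nu$ of $\mathsf s_{\mathcal K}|_{\mathcal V}^{\setminus\Gamma}$ with $\pi_{\mathcal K}\bigl(\bigcup_I(s_I|_{V_I}+\nu_I)^{-1}(0)\bigr)\subset\pi_{\mathcal K}(\mathcal C)$ and $\nu|_{\partial^\alpha\mathcal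 V}=\nu^\alpha$ for $\alpha=0,1$. (iii) In the case of a product cobordism $[0,1]\times\mathcal K$ (of a metric tame Kuranishi atlas $(\mathcal K,d)$) with product metric and nested product reductions $[0,1]\times\mathcal C\sqsubset[0,1]\times\mathcal V$, (ii) holds for all $0<\delta<\delta_{[0,1]\times\mathcal V}$ without restriction from the collar width.
   Context: Group quotients. Manifolds are smooth, finite dimensional, second countable; $A\sqsubset B$ means that $A$ is a precompact subset of $B$. A group quotient $(U,\Gamma)$ is a manifold $U$ with a smooth action of a finite group $\Gamma$; $\underline U:=U/\Gamma$ has the quotient topology, $\pi:U\to\underline U$ is the projection. A group covering $(\widetilde U,\widetilde\Gamma,\rho,\rho^\Gamma)$ of $(U,\Gamma)$ consists of a surjective homomorphism $\rho^\Gamma:\widetilde\Gamma\to\Gamma$, a group quotient $(\widetilde U,\widetilde\Gamma)$ on which $\ker\rho^\Gamma$ acts freely, and a map $\rho:\widetilde U\to U$ that is the quotient map $\widetilde U\to\widetilde U/\ker\rho^\Gamma$ followed by a diffeomorphism $\widetilde U/\ker\rho^\Gamma\cong U$ equivariant for the induced $\Gamma$-actions. It induces a homeomorphism $\underline\rho$ between the quotients. Charts and atlases. A Kuranishi chart for $X$ is $\mathbf K=(U,E,\Gamma,s,\psi)$: a manifold $U$, a finite dimensional vector space $E$, a finite group $\Gamma$ acting smoothly on $U$ and linearly on $E$, a smooth $\Gamma$-equivariant $s:U\to E$, and a continuous $\psi:s^{-1}(0)\to X$ inducing a homeomorphism $\underline\psi:s^{-1}(0)/\Gamma\to F$ onto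 an open set $F\subset X$ (the footprint). Its dimension is $\dim U-\dim E$. A weak Kuranishi atlas $\mathcal K=(\mathbf K_I,\widehat\Phi_{IJ})$ of some dimension on a compact metrizable space $X$ consists of: - finitely many basic charts $\mathbf K_i=(U_i,E_i,\Gamma_i,s_i,\psi_i)$, $i=1,\dots,N$, of this dimension with $X=\bigcup_iF_i$; set $\mathcal I_{\mathcal K}=\{\emptyset\ne I\subset\{1,\dots,N\}: F_I:=\bigcap_{i\in I}F_i\neq\emptyset\}$; - for each $I\in\mathcal I_{\mathcal K}$ a chart $\mathbf K_I=(U_I,E_I,\Gamma_I,s_I,\psi_I)$ with footprint $F_I$, $\Gamma_I=\prod_{i\in I}\Gamma_i$, $E_I=\prod_{i\in I}E_i$ with product action, $\mathbf K_{\{i\}}=\mathbf K_i$; $\pi_I:U_I\to\underline U_I$; - for $I\subsetneq J$ in $\mathcal I_{\mathcal K}$ a coordinate change $\widehat\Phi_{IJ}$: an open $\underline U_{IJ}\subset\underline U_I$ with $\underline U_{IJ}\cap\underline\psi_I^{-1}(F_I)=\underline\psi_I^{-1}(F_J)$; with $U_{IJ}:=\pi_I^{-1}(\underline U_{IJ})$, a $\Gamma_J$-invariant submanifold $\widetilde U_{IJ}\subset U_J$ on which $\Gamma_{J\setminus I}=\prod_{j\in J\setminus I}\Gamma_j$ acts freely and a group covering $(\widetilde U_{IJ},\Gamma_J,\rho_{IJ},\rho^\Gamma_{IJ})$ of $(U_{IJ},\Gamma_I)$ with $\rho^\Gamma_{IJ}:\Gamma_J\to\Gamma_I$ the natural projection;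 with the natural inclusion $\widehat\phi_{IJ}:E_I\to E_J$ one requires $s_J=\widehat\phi_{IJ}\circ s_I\circ\rho_{IJ}$ on $\widetilde U_{IJ}$, $\psi_J=\psi_I\circ\rho_{IJ}$ on $s_J^{-1}(0)\cap\widetilde U_{IJ}=\rho_{IJ}^{-1}(s_I^{-1}(0))$, and the index condition: for $u\in\widetilde U_{IJ}$ and $s_{IJ}:=s_I\circ\rho_{IJ}$, $\ker d_us_{IJ}=\ker d_us_J$, and whenever $E_I={\rm im}\,d_us_{IJ}\oplus C$ then $E_J={\rm im}\,d_us_J\oplus\widehat\phi_{IJ}(C)$; - the weak cocycle condition: for $I\subsetneq J\subsetneq K$, $\rho_{IK}=\rho_{IJ}\circ\rho_{JK}$ on $\widetilde U_{IK}\cap\rho_{JK}^{-1}(\widetilde U_{IJ}\cap U_{JK})$. Let $\underline\phi_{IJ}:\underline U_{IJ}\to\underline U_J$ be $\underline\rho_{IJ}^{-1}$ followed by the inclusion; $\widetilde U_{II}:=U_I$, $\rho_{II}={\rm id}$, $\underline U_{II}=\underline U_I$, $\underline\phi_{II}={\rm id}$. $\mathcal K$ is tame if for all $I,J,K\in\mathcal I_{\mathcal K}$ (equalities allowed, $\underline U_{IL}:=\emptyset$ if $L\notin\mathcal I_{\mathcal K}$): $\underline U_{IJ}\cap\underline U_{IK}=\underline U_{I(J\cup K)}$ for $I\subset J,K$, and $\underline\phi_{IJ}(\underline U_{IK})=\{\pi_J(y)\in\underline U_{JK}: s_J(y)\in\widehat\phi_{IJ}(E_I)\}$ for $I\subset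 J\subset K$. A tame weak atlas is a Kuranishi atlas (cocycle condition $\underline U_{IJ}\cap\underline\phi_{IJ}^{-1}(\underline U_{JK})\subset\underline U_{IK}$). $|\mathcal K|$ is the quotient of $\bigsqcup_IU_I$ by the equivalence relation generated by $(I,\gamma^{-1}\rho_{IJ}(y))\sim(J,y)$ for $I\subset J$, $y\in\widetilde U_{IJ}$, $\gamma\in\Gamma_I$; $\pi_{\mathcal K}:\bigsqcup U_I\to|\mathcal K|$ is the projection. Kuranishi cobordisms. $A^0_\varepsilon=[0,\varepsilon)$, $A^1_\varepsilon=(1-\varepsilon,1]$. A compact collared cobordism $(Y,\iota^0_Y,\iota^1_Y)$ is a compact metrizable space with disjoint, possibly empty, closed subsets $\partial^0Y,\partial^1Y$ and, for some $\varepsilon>0$, homeomorphisms $\iota^\alpha_Y$ from $A^\alpha_\varepsilon\times\partial^\alpha Y$ onto disjoint open neighbourhoods of $\partial^\alpha Y$ extending the inclusions at $t=\alpha$. A Kuranishi cobordism on $Y$ is defined like a Kuranishi atlas on $Y$ except: if $F_I$ meets $\partial^0Y\cup\partial^1Y$ then in small collars $F_I$ is of product form $\iota^\alpha_Y(A^\alpha_\delta\times\partial^\alpha F_I)$ or empty, with $\partial^\alpha F_I=F_I\cap\partial^\alpha Y$; $U_I$ is a manifold with boundary $\partial^0U_I\sqcup\partial^1U_I$ ($\partial^\alpha U_I\neq\emptyset$ iff $\partial^\alpha F_I\ne\emptyset$) with $\Gamma_I$-equivariant tubular neighbourhood diffeomorphisms $\iota^\alpha_I:A^\alpha_\varepsilon\times\partial^\alpha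 U_I\to U_I$ and there are charts $\partial^\alpha\mathbf K_I=(\partial^\alpha U_I,E_I,\Gamma_I,s^\alpha_I,\psi^\alpha_I)$ for $\partial^\alpha Y$ with footprint $\partial^\alpha F_I$, $s_I(\iota_I^\alpha(t,x))=s^\alpha_I(x)$ and $\psi_I(\iota^\alpha_I(t,x))=\iota^\alpha_Y(t,\psi^\alpha_I(x))$; all other charts have footprints precompact in $Y\setminus(\partial^0Y\cup\partial^1Y)$ and domains without boundary; if $F_J\cap\partial^\alpha Y\ne\emptyset$ then $\widehat\Phi_{IJ}$ is in a small collar the product of ${\rm id}_{A^\alpha_\varepsilon}$ with a coordinate change $\partial^\alpha\widehat\Phi_{IJ}:\partial^\alpha\mathbf K_I\to\partial^\alpha\mathbf K_J$; if only $F_I$ meets $\partial^\alpha Y$ then $U_{IJ}$ is disjoint from a collar of $\partial^\alpha U_I$. The boundary restrictions form Kuranishi atlases $\partial^\alpha\mathcal K$ on $\partial^\alpha Y$ with $\mathcal I_{\partial^\alpha\mathcal K}=\{I:F_I\cap\partial^\alpha Y\ne\emptyset\}$. The collar width is the size of the collars on which all this product structure holds. The product cobordism $[0,1]\times\mathcal K$ on $[0,1]\times X$ has charts $([0,1]\times U_I,E_I,\Gamma_I,s_I\circ{\rm pr}_{U_I},{\rm id}\times\psi_I)$ and product coordinate changes. Metrics. An admissible metric on $|\mathcal K|$ is a bounded metric $d$ on the set $|\mathcal K|$ whose pullback to each $\underline U_I$, under the map induced by $\pi_{\mathcal K}$, is a metric inducing the quotient topology of $\underline U_I$. A metric tame atlas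 is a tame atlas with an admissible metric; for a metric tame cobordism $d$ is also collared: for some $\varepsilon>0$, with $\iota^\alpha_{|\mathcal K|}:A^\alpha_\varepsilon\times|\partial^\alpha\mathcal K|\to|\mathcal K|$ induced by the $\iota^\alpha_I$, $d(\iota^\alpha_{|\mathcal K|}(t,p),\iota^\alpha_{|\mathcal K|}(t',p'))=|t-t'|+d^\alpha(p,p')$ with $d^\alpha$ the restriction of $d$ to $|\partial^\alpha\mathcal K|$ (so $(\partial^\alpha\mathcal K,d^\alpha)$ is a metric tame atlas), and points outside the $\varepsilon$-collar have distance at least $\varepsilon-|\alpha-t|$ from $\iota^\alpha_{|\mathcal K|}(t,p)$. For $S\subset U_I$ let $\widehat B^I_\delta(S)=\{y\in U_I:\exists s\in S, d(\pi_{\mathcal K}(y),\pi_{\mathcal K}(s))<\delta\}$ and for $Q\subset|\mathcal K|$ let $B_\delta(Q)$ be its $\delta$-neighbourhood in $(|\mathcal K|,d)$. Reductions. A (cobordism) reduction $\mathcal V=\bigsqcup_IV_I$ consists of $\Gamma_I$-invariant open $V_I\sqsubset U_I$, possibly empty, with: $V_I\cap s_I^{-1}(0)\neq\emptyset$ if $V_I\ne\emptyset$; $\pi_{\mathcal K}(\overline{V_I})\cap\pi_{\mathcal K}(\overline{V_J})\neq\emptyset$ implies $I\subset J$ or $J\subset I$; $\pi_{\mathcal K}(\bigsqcup s_I^{-1}(0))\subset\pi_{\mathcal K}(\mathcal V)$. In the cobordism case also: for $I\in\mathcal I_{\partial^\alpha\mathcal K}$ there are $\varepsilon>0$ and $\partial^\alpha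 V_I\subset\partial^\alpha U_I$, nonempty iff $V_I\cap\psi_I^{-1}(\partial^\alpha F_I)\ne\emptyset$, with $(\iota_I^\alpha)^{-1}(V_I)\cap(A^\alpha_\varepsilon\times\partial^\alpha U_I)=A^\alpha_\varepsilon\times\partial^\alpha V_I$; then $\partial^\alpha\mathcal V:=\bigsqcup\partial^\alpha V_I$. Nested $\mathcal C\sqsubset\mathcal V$: $C_I\sqsubset V_I$ for all $I$. Perturbations. A (cobordism) perturbation $\nu$ of $\mathsf s_{\mathcal K}|_{\mathcal V}^{\setminus\Gamma}$ is a family of smooth maps $\nu_I:V_I\to E_I$ with $\nu_J=\widehat\phi_{IJ}\circ\nu_I\circ\rho_{IJ}$ on $\widetilde V_{IJ}:=V_J\cap\rho_{IJ}^{-1}(V_I)$ for $I\subsetneq J$ and, in the cobordism case, $\nu_I(\iota^\alpha_I(t,x))=\nu_I^\alpha(x)$ for $t\in A^\alpha_\varepsilon$, $x\in\partial^\alpha V_I$, for some $\varepsilon>0$ and maps $\nu_I^\alpha$; $\nu|_{\partial^\alpha\mathcal V}:=(\nu^\alpha_I)$. It is admissible if $d_y\nu_J(T_yV_J)\subset{\rm im}\,\widehat\phi_{IJ}$ for $I\subsetneq J$, $y\in\widetilde V_{IJ}$; transverse if each $s_I|_{V_I}+\nu_I$ is transverse to $0$; precompact if there is a (cobordism) reduction $\mathcal C\sqsubset\mathcal V$ with $\pi_{\mathcal K}(\bigcup_I(s_I|_{V_I}+\nu_I)^{-1}(0))\subset\pi_{\mathcal K}(\mathcal C)$. Constants. Equivariant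 norms: $\Gamma_i$-invariant norms on the $E_i$, and $\|(e_j)_{j\in J}\|=\max_j\|e_j\|$ on $E_J$; $\partial^\alpha\|\cdot\|$ is the collection of these norms for $I\in\mathcal I_{\partial^\alpha\mathcal K}$. Fix $\delta_{\mathcal V}\in(0,\frac14]$ such that for all $\delta<\delta_{\mathcal V}$: $\widehat B^I_{2\delta}(V_I)\sqsubset U_I$ for all $I$, and $B_{2\delta}(\pi_{\mathcal K}(V_I))\cap B_{2\delta}(\pi_{\mathcal K}(V_J))\ne\emptyset$ implies $I\subset J$ or $J\subset I$. For $0<\delta<\delta_{\mathcal V}$ and real $k\ge0$ put $V^k_I=\widehat B^I_{2^{-k}\delta}(V_I)$, $N^k_{JI}=V^k_J\cap\rho_{IJ}^{-1}(V^k_I)$ for $I\subsetneq J$, $\eta_k=2^{-k}(1-2^{-1/4})\delta$, $\widetilde C_J=\bigcup_{K\supset J}\rho_{JK}(C_K)$, and $$\sigma(\mathcal V,\mathcal C,\|\cdot\|,\delta)=\min_J\inf\Bigl\{\|s_J(x)\|: x\in\overline{V_J^{|J|}}\setminus\bigl(\widetilde C_J\cup\textstyle\bigcup_{I\subsetneq J}\widehat B^J_{\eta_{|J|-1/2}}(N^{|J|-1/4}_{JI})\bigr)\Bigr\}>0,$$ $$\sigma'(\mathcal V,\mathcal C,\|\cdot\|,\delta)=\min_J\inf\Bigl\{\|s_J(x)\|: x\in\overline{V_J^{|J|+1}}\setminus\bigl(\widetilde C_J\cup\textstyle\bigcup_{I\subsetneq J}\widehat B^J_{\eta_{|J|+1/2}}(N^{|J|+3/4}_{JI})\bigr)\Bigr\}>0,$$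 and for cobordisms $\sigma_{\rm rel}(\mathcal V,\mathcal C,\|\cdot\|,\delta)=\min\{\sigma(\partial^0\mathcal V,\partial^0\mathcal C,\partial^0\|\cdot\|,\delta),\sigma(\partial^1\mathcal V,\partial^1\mathcal C,\partial^1\|\cdot\|,\delta),\sigma'(\mathcal V,\mathcal C,\|\cdot\|,\delta)\}$. Adapted. For $0<\delta<\delta_{\mathcal V}$ and $0<\sigma\le\sigma(\mathcal V,\mathcal C,\|\cdot\|,\delta)$, a perturbation $\nu$ of a metric tame atlas is $(\mathcal V,\mathcal C,\|\cdot\|,\delta,\sigma)$-adapted if each $\nu_I$ extends to a smooth map $V_I^{|I|}\to E_I$, also denoted $\nu_I$, so that for all $k=1,\dots,\max_{I}|I|$ and all $|I|\le k$: (a) $\nu_I=\widehat\phi_{HI}\circ\nu_H\circ\rho_{HI}$ on $\rho_{HI}^{-1}(V^k_H)\cap V^k_I$ for $H\subsetneq I$; (b) $s_I|_{V^k_I}+\nu_I$ is transverse to $0$; (c) $\nu_I(\widehat B^I_{\eta_k}(N^k_{IH}))\subset\widehat\phi_{HI}(E_H)$ for $H\subsetneq I$; (d) $\pi_{\mathcal K}((s_I|_{V_I^k}+\nu_I)^{-1}(0))\subset\pi_{\mathcal K}(\mathcal C)$; (e) $\sup_{V^k_I}\|\nu_I\|<\sigma$. *)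

(* Defs.v *)
From HB Require Import structures.
From Stdlib Require Import Relations.Relation_Operators.
From mathcomp Require Import all_boot all_order all_algebra all_fingroup.
From mathcomp Require Import all_classical all_reals all_analysis.
Set Implicit Arguments.
Unset Strict Implicit.
Unset Printing Implicit Defensive.
Import Order.TTheory GRing.Theory Num.Theory numFieldNormedType.Exports.
Import VectorInternalTheory.
Local Open Scope classical_set_scope.
Local Open Scope ring_scope.

(* All spaces (the space X, manifolds, submanifolds, boundaries) are subsets
   of ambient topological types and carry the subspace topology; ambient points
   outside these sets are never used. *)

Section Spaces.
Context {T : topologicalType}.
Implicit Types A B W : set T.

Definition relopen A W := exists2 O : set T, open O & W = A `&` O.
Definition relclosed A W := exists2 O : set T, closed O & W = A `&` O.

(* A is a precompact subset of B *)
Definition precompact_in A B :=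
  A `<=` B /\ precompact ((@set_val T B) @^-1` A).

Definition is_metric (R : realType) (S : Type) (D : set S) (d : S -> S -> R) :=
  [/\ forall x y, D x -> D y -> (d x y = 0 <-> x = y),
      forall x y, D x -> D y -> d x y = d y x
    & forall x y z, D x -> D y -> D z -> d x z <= d x y + d y z].

Definition metrizable (R : realType) A :=
  exists2 m : T -> T -> R, is_metric A m &
    forall W, W `<=` A ->
      (relopen A W <->
       forall x, W x ->
         exists2 r, 0 < r & forall y, A y -> m x y < r -> W y).

End Spaces.

Section Smooth.
Context {R : realType}.

Fixpoint Ck {n m : nat} (k : nat) (O : set 'rV[R]_n)
    (f : 'rV[R]_n -> 'rV[R]_m) : Prop :=
  match k with
  | 0%N => forall x, O x -> {for x, continuous f}
  | k'.+1 => (forall x, O x -> differentiable f x) /\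
             (forall v, Ck k' O (fun x => 'D_v f x))
  end.

Definition smooth_near {n m : nat} (f : 'rV[R]_n -> 'rV[R]_m) p :=
  exists2 O, open_nbhs p O & forall k, Ck k O f.

(* Smoothness on an arbitrary subset P: local smooth extensions exist. *)
Definition smooth_on {n m : nat} (P : set 'rV[R]_n) (f : 'rV[R]_n -> 'rV[R]_m) :=
  forall p, P p -> exists2 g, smooth_near g p &
    \forall z \near p, P z -> g z = f z.

Definition interior_point {n : nat} (P : set 'rV[R]_n) (p : 'rV[R]_n) := nbhs p P.

(* near p, P is a closed half space whose boundary hyperplane
   {z_0 = p_0} passes through p *)
Definition boundary_point {n : nat} (P : set 'rV[R]_n) (p : 'rV[R]_n) :=
  exists2 i : 'I_n, i = 0%N :> nat &
    (\forall z \near p, P z <-> p 0 i <= z 0 i) \/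
    (\forall z \near p, P z <-> z 0 i <= p 0 i).

End Smooth.

Section Manifolds.
Context {R : realType}.

Record chart (T : topologicalType) (n : nat) := Chart {
  cdom : set T ;
  cmap : T -> 'rV[R]_n ;
  cinv : 'rV[R]_n -> T }.

Record manifold (T : topologicalType) := Manifold {
  mdim : nat ;
  mset : set T ;
  mcharts : set (chart T mdim) }.
Arguments mcharts {T} M _ : rename.

Definition transition {T : topologicalType} {n : nat} (c c' : chart T n) :=
  smooth_on (cmap c @` (cdom c `&` cdom c')) (cmap c' \o cinv c).

Record topological_chart {T : topologicalType} {n : nat} (S : set T)
    (c : chart T n) : Prop := {
  tc_open : relopen S (cdom c) ;
  tc_cancel : forall x, cdom c x -> cinv c (cmap c x) = x ;
  tc_cont : {within cdom c, continuous (cmap c)} ;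
  tc_inv_cont : {within cmap c @` cdom c, continuous (cinv c)} ;
  tc_image : forall p, (cmap c @` cdom c) p ->
    interior_point (cmap c @` cdom c) p \/
    boundary_point (cmap c @` cdom c) p }.

Record is_manifold {T : topologicalType} (M : manifold T) : Prop := {
  im_hausdorff : hausdorff_space (set_type (mset M)) ;
  im_second_countable : @second_countable (set_type (mset M)) ;
  im_charts : forall c, mcharts M c -> topological_chart (mset M) c ;
  im_cover : forall x, mset M x -> exists2 c, mcharts M c & cdom c x ;
  im_smooth : forall c c', mcharts M c -> mcharts M c' -> transition c c' }.

(* membership in the maximal smooth atlas *)
Definition compatible {T : topologicalType} (M : manifold T)
    (c : chart T (mdim M)) :=
  topological_chart (mset M) c /\
  forall c', mcharts M c' -> transition c c' /\ transition c' c.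

Definition mbdry {T : topologicalType} (M : manifold T) : set T :=
  [set x | exists c, [/\ mcharts M c, cdom c x &
    boundary_point (cmap c @` cdom c) (cmap c x)]].

Definition smooth_map {T T' : topologicalType} (M : manifold T)
    (M' : manifold T') (A : set T) (f : T -> T') :=
  [/\ forall x, A x -> mset M' (f x),
      {within A, continuous f}
    & forall c c', mcharts M c -> mcharts M' c' ->
        smooth_on (cmap c @` (A `&` cdom c `&` f @^-1` cdom c'))
                  (cmap c' \o f \o cinv c)].

Definition flat {n : nat} (m : nat) (z : 'rV[R]_n) :=
  forall i : 'I_n, (m <= i)%N -> z 0 i = 0.

(* In a chart adapted at x, the subset A is the coordinate slice R^m x 0,
   and T_xA corresponds to the vectors v with [flat m v]. *)
Definition adapted_chart {T : topologicalType} (M : manifold T) (m : nat)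
    (A : set T) (x : T) (c : chart T (mdim M)) :=
  [/\ compatible c, cdom c x
    & forall y, cdom c y -> (A y <-> flat m (cmap c y))].

Definition submanifold {T : topologicalType} (M : manifold T) (m : nat)
    (A : set T) :=
  [/\ A `<=` mset M, (m <= mdim M)%N
    & forall x, A x -> exists c : chart T (mdim M), adapted_chart m A x c].

Definition local_diffeo {T T' : topologicalType} (M : manifold T)
    (M' : manifold T') (A : set T) (f : T -> T') :=
  smooth_map M M' A f /\
  forall x, A x -> exists2 W, relopen A W /\ W x &
    relopen (mset M') (f @` W) /\
    exists2 g : T' -> T, forall w, W w -> g (f w) = w &
      smooth_map M' M (f @` W) g.

Definition prod_chart (A : set R) {T : topologicalType} {n : nat}
    (c : chart T n) : chart (R * T)%type (1 + n) :=
  Chart (A `*` cdom c)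
    (fun p => row_mx (const_mx p.1) (cmap c p.2))
    (fun z => (lsubmx z 0 0, cinv c (rsubmx z))).

(* A x M for an interval A *)
Definition itv_prod (A : set R) {T : topologicalType} (M : manifold T) :
    manifold (R * T)%type :=
  @Manifold _ (1 + mdim M) (A `*` mset M) [set prod_chart A c | c in mcharts M].

Definition slice_chart (a : R) {T : topologicalType} {n : nat}
    (c : chart T n) : chart (R * T)%type n :=
  Chart ([set a] `*` cdom c) (fun p => cmap c p.2) (fun z => (a, cinv c z)).

(* {a} x M *)
Definition slice (a : R) {T : topologicalType} (M : manifold T) :
    manifold (R * T)%type :=
  @Manifold _ (mdim M) ([set a] `*` mset M)
    [set slice_chart a c | c in mcharts M].

End Manifolds.
Arguments mcharts {R T} M _ : rename.

Section Obstruction.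
Context {R : realType}.

(* E_i, Gamma_i and the action of Gamma_i on E_i, for i = 1, ..., N *)
Record obst := Obst {
  oN : nat ;
  oE : 'I_oN -> vectType R ;
  oG : 'I_oN -> finGroupType ;
  oact : forall i, oG i -> oE i -> oE i }.

Record linear_actions (O : obst) : Prop := {
  la_one : forall (i : 'I_(oN O)) (e : oE i), oact 1%g e = e ;
  la_mul : forall (i : 'I_(oN O)) (g h : oG i) (e : oE i),
    oact (g * h)%g e = oact g (oact h e) ;
  la_lin : forall (i : 'I_(oN O)) (g : oG i) (a : R) (e e' : oE i),
    oact g (a *: e + e') = a *: oact g e + oact g e' }.

Context {O : obst}.
Notation Index := {set 'I_(oN O)}.

Definition elt (I : Index) : finType := {i : 'I_(oN O) | i \in I}.
Definition oEI (I : Index) := forall i : elt I, oE (sval i).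
Definition oGI (I : Index) := forall i : elt I, oG (sval i).

(* the natural map between partial products: common components are kept,
   missing ones are filled with d *)
Definition transfer (F : 'I_(oN O) -> Type) (d : forall i, F i) (I J : Index)
    (e : forall i : elt I, F (sval i)) : forall j : elt J, F (sval j) :=
  fun j => match @idP (sval j \in I) with
           | ReflectT h => e (exist _ (sval j) h)
           | ReflectF _ => d (sval j)
           end.

Definition phihat (I J : Index) : oEI I -> oEI J :=
  @transfer (fun i => oE i) (fun i => 0) I J.
Definition rhoG (I J : Index) : oGI J -> oGI I :=
  @transfer (fun i => oG i) (fun i => 1%g) J I.

Definition e0 {I} : oEI I := fun i => 0.
Definition eadd {I} (e e' : oEI I) : oEI I := fun i => e i + e' i.
Definition escale {I} (a : R) (e : oEI I) : oEI I := fun i => a *: e i.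
Definition eact {I} (g : oGI I) (e : oEI I) : oEI I := fun i => oact (g i) (e i).
Definition g1 {I} : oGI I := fun i => 1%g.
Definition gmul {I} (g h : oGI I) : oGI I := fun i => (g i * h i)%g.
Definition ginv {I} (g : oGI I) : oGI I := fun i => (g i)^-1%g.

Definition subspace_of {I} (C : set (oEI I)) :=
  C e0 /\ forall a e e', C e -> C e' -> C (eadd (escale a e) e').

(* E_I is the direct sum of A and C *)
Definition direct_sum {I} (A C : set (oEI I)) :=
  (forall e, exists2 a, A a & exists2 c, C c & e = eadd a c) /\
  (forall e, A e -> C e -> e = e0).

Record equivariant_norms (nrm : forall i, oE (o := O) i -> R) : Prop := {
  en_eq0 : forall (i : 'I_(oN O)) (e : oE i), nrm i e = 0 -> e = 0 ;
  en_scale : forall (i : 'I_(oN O)) (a : R) (e : oE i), nrm i (a *: e) = `|a| * nrm i e ;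
  en_triangle : forall (i : 'I_(oN O)) (e e' : oE i), nrm i (e + e') <= nrm i e + nrm i e' ;
  en_inv : forall (i : 'I_(oN O)) (g : oG i) (e : oE i), nrm i (oact g e) = nrm i e }.

Definition normI (nrm : forall i, oE (o := O) i -> R) {I} (e : oEI I) : R :=
  \big[Num.max/0]_(i : elt I) nrm (sval i) (e i).

Section VectorValued.
Context {T : topologicalType} (M : @manifold R T) {I : Index}.
Implicit Types (A : set T) (f : T -> oEI I).

Definition local_rep (c : chart T (mdim M)) f (i : elt I) :
    'rV[R]_(mdim M) -> 'rV[R]_(dim (oE (sval i))) :=
  fun z => v2r (f (cinv c z) i).

Definition smooth_vec A f :=
  forall c i, mcharts M c -> smooth_on (cmap c @` (A `&` cdom c)) (local_rep c f i).

(* e = d_x f (v) for f smooth on A, where v is tangent to A at x and is written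
   in the chart c; computed with a local smooth extension of f, on which the
   result does not depend for tangent v *)
Definition differential A f (c : chart T (mdim M)) x (v : 'rV[R]_(mdim M))
    (e : oEI I) :=
  forall i, exists2 g,
    smooth_near g (cmap c x) /\
    (\forall z \near cmap c x,
      (cmap c @` (A `&` cdom c)) z -> g z = local_rep c f i z)
    & v2r (e i) = 'D_v g (cmap c x).

(* im d_x f, for f defined on the open subset A of M *)
Definition im_diff A f x : set (oEI I) :=
  [set e | exists c v, [/\ mcharts M c, cdom c x & differential A f c x v e]].

End VectorValued.
End Obstruction.

Arguments obst : clear implicits.
Notation Index O := {set 'I_(oN O)}.

Section Kuranishi.
Context {R : realType}.

(* The data U_I, Gamma_I-action, s_I, F_i, psi_I, U_IJ, U~_IJ, rho_IJ.  Subsets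
   of the quotients U_I/Gamma_I are represented by their preimages in U_I.  The
   data at indices outside I_K is irrelevant; the basic chart K_i is the one
   with index {i}. *)
Record kdata (O : obst R) (T : Index O -> topologicalType) (X : topologicalType) :=
  KData {
  kU : forall I, @manifold R (T I) ;
  kact : forall I, oGI I -> T I -> T I ;
  ks : forall I, T I -> oEI I ;
  kF : 'I_(oN O) -> set X ;
  kpsi : forall I, T I -> X ;
  kUo : forall I J : Index O, set (T I) ;
  kUt : forall I J : Index O, set (T J) ;
  krho : forall I J : Index O, T J -> T I }.

Context {O : obst R} {T : Index O -> topologicalType} {X : topologicalType}.
Implicit Types (K : kdata T X) (I J H L : Index O).

Definition kdom K I : set (T I) := mset (kU K I).
Arguments kdom : clear implicits.
Definition footprint K I : set X := \bigcap_(i in [set i | i \in I]) kF K i.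
Definition idx K I : Prop := (I != finset.set0) /\ footprint K I !=set0.
Definition zeroset K I : set (T I) := [set x | kdom K I x /\ ks K x = e0].
Arguments zeroset : clear implicits.
Definition kinvariant K I (W : set (T I)) :=
  forall g x, W x -> W (kact K g x).
Arguments kinvariant : clear implicits.
Arguments kUo {O T X} _ _ _.
Arguments kUt {O T X} _ _ _.
Arguments krho {O T X} _ _ _ _.
Arguments kpsi {O T X} _ _ _.

Record is_kchart K (X0 : set X) I : Prop := {
  kc_manifold : is_manifold (kU K I) ;
  kc_act_smooth : forall g, smooth_map (kU K I) (kU K I) (kdom K I) (kact K g) ;
  kc_act1 : forall x, kdom K I x -> kact K g1 x = x ;
  kc_actM : forall g h x, kdom K I x ->
    kact K (gmul g h) x = kact K g (kact K h x) ;
  kc_s_smooth : smooth_vec (kU K I) (kdom K I) (@ks _ _ _ K I) ;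
  kc_s_equiv : forall g x, kdom K I x -> ks K (kact K g x) = eact g (ks K x) ;
  kc_F_open : relopen X0 (footprint K I) ;
  (* psi_I induces a homeomorphism s_I^-1(0)/Gamma_I -> F_I *)
  kc_psi_cont : {within zeroset K I, continuous (kpsi K I)} ;
  kc_psi_onto : kpsi K I @` zeroset K I = footprint K I ;
  kc_psi_fib : forall x y, zeroset K I x -> zeroset K I y ->
    (kpsi K I x = kpsi K I y <-> exists g, y = kact K g x) ;
  kc_psi_open : forall W, relopen (zeroset K I) W -> kinvariant K I W ->
    relopen (footprint K I) (kpsi K I @` W) }.

Record coordinate_change K I J : Prop := {
  cc_U_open : relopen (kdom K I) (kUo K I J) ;
  cc_U_inv : kinvariant K I (kUo K I J) ;
  cc_F : forall x, zeroset K I x ->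
    (kUo K I J x <-> footprint K J (kpsi K I x)) ;
  cc_Ut_sub : submanifold (kU K J) (mdim (kU K I)) (kUt K I J) ;
  cc_Ut_inv : kinvariant K J (kUt K I J) ;
  cc_free : forall (g : oGI J) y, kUt K I J y ->
    rhoG (I := I) g = g1 -> kact K g y = y -> g = g1 ;
  (* rho_IJ is the quotient map by ker rho^Gamma_IJ followed by a
     Gamma_I-equivariant diffeomorphism onto U_IJ: the smooth structure of the
     quotient is the one making the quotient map a local diffeomorphism *)
  cc_rho_onto : krho K I J @` kUt K I J = kUo K I J ;
  cc_rho_fib : forall y y', kUt K I J y -> kUt K I J y' ->
    (krho K I J y = krho K I J y' <->
     exists2 g, rhoG (I := I) g = g1 & y' = kact K g y) ;
  cc_rho_equiv : forall (g : oGI J) y, kUt K I J y ->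
    krho K I J (kact K g y) = kact K (rhoG g) (krho K I J y) ;
  cc_rho_diffeo : local_diffeo (kU K J) (kU K I) (kUt K I J) (krho K I J) ;
  cc_s : forall y, kUt K I J y ->
    ks K y = phihat (J := J) (ks K (krho K I J y)) ;
  cc_zero : zeroset K J `&` kUt K I J =
    kUt K I J `&` krho K I J @^-1` zeroset K I ;
  cc_psi : forall y, kUt K I J y -> zeroset K J y ->
    kpsi K J y = kpsi K I (krho K I J y) ;
  cc_ker : forall (u : T J) (c : chart (T J) (mdim (kU K J))),
    kUt K I J u -> adapted_chart (mdim (kU K I)) (kUt K I J) u c ->
    forall v,
      (flat (mdim (kU K I)) v /\
       differential (kUt K I J) (@ks _ _ _ K I \o krho K I J) c u v e0) <->
      differential (kdom K J) (@ks _ _ _ K J) c u v e0 ;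
  cc_coker : forall (u : T J) (c : chart (T J) (mdim (kU K J))),
    kUt K I J u -> adapted_chart (mdim (kU K I)) (kUt K I J) u c ->
    forall C : set (oEI I), subspace_of C ->
      direct_sum [set e | exists2 v, flat (mdim (kU K I)) v &
        differential (kUt K I J) (@ks _ _ _ K I \o krho K I J) c u v e] C ->
      direct_sum [set e | exists v,
        differential (kdom K J) (@ks _ _ _ K J) c u v e]
        (phihat (J := J) @` C) }.

(* A weak Kuranishi atlas of dimension n on X0, except that the domains may
   have boundary. *)
Record weak_kuranishi (n : int) (X0 : set X) K : Prop := {
  wk_lin : linear_actions O ;
  wk_compact : compact X0 ;
  wk_metrizable : metrizable R X0 ;
  wk_cover : X0 = \bigcup_i kF K i ;
  wk_charts : forall I, idx K I -> is_kchart K X0 I ;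
  wk_dim : forall i, idx K [set i]%SET ->
    (mdim (kU K [set i]%SET))%:Z = n + (dim (oE i))%:Z ;
  wk_id : forall I, idx K I ->
    [/\ kUo K I I = kdom K I, kUt K I I = kdom K I
      & forall x, kdom K I x -> krho K I I x = x] ;
  wk_change : forall I J, idx K I -> idx K J -> I \proper J ->
    coordinate_change K I J ;
  wk_cocycle : forall I J L, idx K I -> idx K J -> idx K L ->
    I \proper J -> J \proper L ->
    forall y, kUt K I L y -> kUt K J L y ->
      kUt K I J (krho K J L y) -> kUo K J L (krho K J L y) ->
      krho K I L y = krho K I J (krho K J L y) }.

Definition without_boundary K := forall I, idx K I -> mbdry (kU K I) = set0.

Definition weak_atlas (n : int) (X0 : set X) K :=
  weak_kuranishi n X0 K /\ without_boundary K.

Definition Uo K I L : set (T I) := [set x | idx K L /\ kUo K I L x].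
Arguments Uo : clear implicits.

(* The preimage in U_J of the image of U_IL under the map induced by
   rho_IJ^-1 consists of the y in U~_IJ with rho_IJ(y) in U_IL. *)
Definition tame K :=
  (forall I J L, idx K I -> idx K J -> idx K L -> I \subset J -> I \subset L ->
    Uo K I J `&` Uo K I L = Uo K I (J :|: L)%SET) /\
  (forall I J L, idx K I -> idx K J -> idx K L -> I \subset J -> J \subset L ->
    kUt K I J `&` krho K I J @^-1` Uo K I L =
    [set y | Uo K J L y /\ range (phihat (I := I) (J := J)) (ks K y)]).

(* |K| is the set of equivalence classes of the points of the disjoint union
   of the U_I, a class being a subset of the total type. *)
Definition kpoint := {I : Index O & T I}.

Inductive glue K : kpoint -> kpoint -> Prop :=
  Glue I J (g : oGI I) (y : T J) of idx K I & idx K J & I \subset J &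
      kUt K I J y :
    glue K (existT _ I (kact K (ginv g) (krho K I J y))) (existT _ J y).

Definition equiv K : kpoint -> kpoint -> Prop := clos_refl_sym_trans kpoint (glue K).

Definition piK K I (x : T I) : set kpoint := equiv K (existT _ I x).
Arguments piK : clear implicits.

Definition realization K : set (set kpoint) :=
  [set p | exists I x, [/\ idx K I, kdom K I x & p = piK K I x]].

Implicit Types (d : set kpoint -> set kpoint -> R) (V C : forall I, set (T I)).

Record admissible_metric K d : Prop := {
  am_metric : is_metric (realization K) d ;
  am_bounded : exists B, forall p q, realization K p -> realization K q ->
    d p q <= B ;
  am_sep : forall I x y, idx K I -> kdom K I x -> kdom K I y ->
    d (piK K I x) (piK K I y) = 0 -> exists g, y = kact K g x ;
  am_top : forall I (W : set (T I)), idx K I -> W `<=` kdom K I ->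
    kinvariant K I W ->
    (relopen (kdom K I) W <->
     forall x, W x -> exists2 r, 0 < r &
       forall y, kdom K I y -> d (piK K I x) (piK K I y) < r -> W y) }.

Definition metric_tame_atlas (n : int) (X0 : set X) K d :=
  [/\ weak_atlas n X0 K, tame K & admissible_metric K d].

Definition Bhat K d I (r : R) (S : set (T I)) : set (T I) :=
  [set y | kdom K I y /\ exists2 s, S s & d (piK K I y) (piK K I s) < r].
Arguments Bhat : clear implicits.

Definition nbhd K d (r : R) (Q : set (set kpoint)) : set (set kpoint) :=
  [set p | realization K p /\ exists2 q, Q q & d p q < r].

Definition closure_in K I (A : set (T I)) := kdom K I `&` closure A.
Arguments closure_in : clear implicits.

Definition piKV K V : set (set kpoint) :=
  \bigcup_(I in idx K) (piK K I @` V I).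

Record reduction K V : Prop := {
  rd_open : forall I, idx K I -> relopen (kdom K I) (V I) ;
  rd_inv : forall I, idx K I -> kinvariant K I (V I) ;
  rd_prec : forall I, idx K I -> precompact_in (V I) (kdom K I) ;
  rd_zero : forall I, idx K I -> V I !=set0 -> (V I `&` zeroset K I) !=set0 ;
  rd_disj : forall I J, idx K I -> idx K J ->
    (piK K I @` closure_in K I (V I) `&`
     piK K J @` closure_in K J (V J)) !=set0 ->
    I \subset J \/ J \subset I ;
  rd_cover : piKV K (zeroset K) `<=` piKV K V }.

Definition nested K C V := forall I, idx K I -> precompact_in (C I) (V I).

Implicit Types nu : forall I, T I -> oEI I.

Definition snu K nu I (x : T I) : oEI I := eadd (ks K x) (nu I x).
Arguments snu : clear implicits.

Record perturbation K V nu : Prop := {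
  pt_smooth : forall I, idx K I -> smooth_vec (kU K I) (V I) (nu I) ;
  pt_compat : forall I J y, idx K I -> idx K J -> I \proper J ->
    V J y -> kUt K I J y -> V I (krho K I J y) ->
    nu J y = phihat (nu I (krho K I J y)) }.

Definition admissible_pert K V nu :=
  forall I J y, idx K I -> idx K J -> I \proper J ->
    V J y -> kUt K I J y -> V I (krho K I J y) ->
    im_diff (kU K J) (V J) (nu J) y `<=` range (phihat (I := I) (J := J)).

Definition transverse_on K nu I (A : set (T I)) :=
  forall x, A x -> snu K nu I x = e0 ->
    im_diff (kU K I) A (snu K nu I) x = setT.
Arguments transverse_on : clear implicits.

Definition transverse K V nu := forall I, idx K I -> transverse_on K nu I (V I).

(* the perturbed zero set, projected to |K| *)
Definition pert_zero K V nu : set (set kpoint) :=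
  piKV K (fun I => [set x | V I x /\ snu K nu I x = e0]).

Definition is_delta_V K d V (dV : R) :=
  0 < dV <= 4^-1 /\
  forall r, 0 < r < dV ->
    (forall I, idx K I ->
      precompact_in (Bhat K d I (2 * r) (V I)) (kdom K I)) /\
    (forall I J, idx K I -> idx K J ->
      (nbhd K d (2 * r) (piK K I @` V I) `&`
       nbhd K d (2 * r) (piK K J @` V J)) !=set0 ->
      I \subset J \/ J \subset I).

Definition Vk K d V (delta k : R) I : set (T I) :=
  Bhat K d I (2 `^ (- k) * delta) (V I).
Arguments Vk : clear implicits.

(* N^k_JI, a subset of U_J *)
Definition Nk K d V (delta k : R) I J : set (T J) :=
  Vk K d V delta k J `&` (kUt K I J `&` krho K I J @^-1` Vk K d V delta k I).
Arguments Nk : clear implicits.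

Definition eta (delta k : R) : R := 2 `^ (- k) * (1 - 2 `^ (- 4^-1)) * delta.

Definition Ctilde K C J : set (T J) :=
  [set x | exists L, [/\ idx K L, J \subset L
     & (krho K J L @` (C L `&` kUt K J L)) x]].
Arguments Ctilde : clear implicits.

(* sigma_V is the case a = 0 and sigma_V' the case a = 1; the value is +oo when
   all the sets below are empty *)
Definition sigma_shift (a : R) K d V C (nrm : forall i, oE (o := O) i -> R)
    (delta : R) : \bar R :=
  \big[Order.min/+oo%E]_(J : Index O | `[< idx K J >])
    ereal_inf [set (normI nrm (ks K x))%:E | x in
      closure_in K J (Vk K d V delta (#|J|%:R + a) J) `\`
      (Ctilde K C J `|`
       \bigcup_(I in [set I : Index O | idx K I /\ I \proper J])
         Bhat K d J (eta delta (#|J|%:R - 2^-1 + a))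
           (Nk K d V delta (#|J|%:R - 4^-1 + a) I J))].

Definition sigma_V := sigma_shift 0.
Definition sigma_V' := sigma_shift 1.

Record adapted K d V C (nrm : forall i, oE (o := O) i -> R) (delta sig : R)
    nu : Prop := {
  ad_pert : perturbation K V nu ;
  ad_ext : exists mu : forall I, T I -> oEI I,
    (forall I, idx K I ->
       (forall x, V I x -> mu I x = nu I x) /\
       smooth_vec (kU K I) (Vk K d V delta #|I|%:R I) (mu I)) /\
    forall k : nat,
      (1 <= k <= \max_(I : Index O | `[< idx K I >]) #|I|)%N ->
    forall I, idx K I -> (#|I| <= k)%N ->
    [/\ forall H x, idx K H -> H \proper I ->
          Vk K d V delta k%:R I x -> kUt K H I x ->
          Vk K d V delta k%:R H (krho K H I x) ->
          mu I x = phihat (mu H (krho K H I x)),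
        transverse_on K mu I (Vk K d V delta k%:R I),
        forall H x, idx K H -> H \proper I ->
          Vk K d V delta #|I|%:R I x ->
          Bhat K d I (eta delta k%:R) (Nk K d V delta k%:R H I) x ->
          range (phihat (I := H) (J := I)) (mu I x),
        forall x, Vk K d V delta k%:R I x -> snu K mu I x = e0 ->
          piKV K C (piK K I x)
      & (ereal_sup [set (normI nrm (mu I x))%:E | x in Vk K d V delta k%:R I]
         < sig%:E)%E] }.

End Kuranishi.

Arguments kdom {R O T X} K I.
Arguments zeroset {R O T X} K I.
Arguments piK {R O T X} K I x.
Arguments kpoint {R O} T.
Arguments kUo {R O T X} _ _ _.
Arguments kUt {R O T X} _ _ _.
Arguments krho {R O T X} _ _ _ _.
Arguments kpsi {R O T X} _ _ _.
Arguments ks {R O T X} _ _ _.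

Section Cobordism.
Context {R : realType}.

Definition endpoint (alpha : bool) : R := alpha%:R.

Definition collar (alpha : bool) (eps : R) : set R :=
  [set t | if alpha then 1 - eps < t <= 1 else 0 <= t < eps].

(* The boundary pieces of Y and of the U_I are subsets of Y and of U_I, so that
   the inclusions at t = alpha are identities. *)
Record cobdata (O : obst R) (T : Index O -> topologicalType)
    (Y : topologicalType) := CobData {
  cK :> kdata T Y ;
  cdY : bool -> set Y ;
  ciotaY : bool -> R -> Y -> Y ;
  cbd : bool -> kdata T Y ;
  ciota : bool -> forall I, R -> T I -> T I }.

Context {O : obst R} {T : Index O -> topologicalType} {Y : topologicalType}.
Implicit Types (Q : cobdata T Y) (I J : Index O) (alpha : bool).

Definition collarY Q (eps : R) alpha (A : set Y) : set Y :=
  [set ciotaY Q alpha p.1 p.2 | p in collar alpha eps `*` A].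
Definition collarI Q (eps : R) alpha I (A : set (T I)) : set (T I) :=
  [set ciota Q alpha p.1 p.2 | p in collar alpha eps `*` A].

Record collared_space (eps : R) (Y0 : set Y) Q : Prop := {
  cs_closed : forall alpha, relclosed Y0 (cdY Q alpha) ;
  cs_disj : cdY Q false `&` cdY Q true = set0 ;
  cs_incl : forall alpha y, cdY Q alpha y ->
    ciotaY Q alpha (endpoint alpha) y = y ;
  cs_open : forall alpha, relopen Y0 (collarY Q eps alpha (cdY Q alpha)) ;
  cs_disj_collars : collarY Q eps false (cdY Q false) `&`
    collarY Q eps true (cdY Q true) = set0 ;
  cs_cont : forall alpha, {within collar alpha eps `*` cdY Q alpha,
    continuous (fun p : R * Y => ciotaY Q alpha p.1 p.2)} ;
  cs_inv : forall alpha, exists2 j : Y -> R * Y,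
    forall t y, collar alpha eps t -> cdY Q alpha y ->
      j (ciotaY Q alpha t y) = (t, y) &
    {within collarY Q eps alpha (cdY Q alpha), continuous j} }.

Record collared_chart (eps : R) Q alpha I : Prop := {
  cl_incl : forall x, kdom (cbd Q alpha) I x ->
    ciota Q alpha (endpoint alpha) x = x ;
  cl_open : relopen (kdom Q I)
    (collarI Q eps alpha (kdom (cbd Q alpha) I)) ;
  cl_smooth : smooth_map
    (itv_prod (collar alpha eps) (kU (cbd Q alpha) I)) (kU Q I)
    (collar alpha eps `*` kdom (cbd Q alpha) I)
    (fun p => ciota Q alpha p.1 p.2) ;
  cl_inv : exists2 j : T I -> R * T I,
    forall t x, collar alpha eps t -> kdom (cbd Q alpha) I x ->
      j (ciota Q alpha t x) = (t, x) &
    smooth_map (kU Q I) (itv_prod (collar alpha eps) (kU (cbd Q alpha) I))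
      (collarI Q eps alpha (kdom (cbd Q alpha) I)) j ;
  cl_equiv : forall g t x, collar alpha eps t -> kdom (cbd Q alpha) I x ->
    ciota Q alpha t (kact (cbd Q alpha) g x) = kact Q g (ciota Q alpha t x) ;
  cl_s : forall t x, collar alpha eps t -> kdom (cbd Q alpha) I x ->
    ks Q I (ciota Q alpha t x) = ks (cbd Q alpha) I x ;
  cl_psi : forall t x, collar alpha eps t -> zeroset (cbd Q alpha) I x ->
    kpsi Q I (ciota Q alpha t x) =
    ciotaY Q alpha t (kpsi (cbd Q alpha) I x) }.

Record collared_change (eps : R) Q alpha I J : Prop := {
  cg_U : kUo Q I J `&` collarI Q eps alpha (kdom (cbd Q alpha) I) =
    collarI Q eps alpha (kUo (cbd Q alpha) I J) ;
  cg_Ut : kUt Q I J `&` collarI Q eps alpha (kdom (cbd Q alpha) J) =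
    collarI Q eps alpha (kUt (cbd Q alpha) I J) ;
  cg_rho : forall t y, collar alpha eps t -> kUt (cbd Q alpha) I J y ->
    krho Q I J (ciota Q alpha t y) =
    ciota Q alpha t (krho (cbd Q alpha) I J y) }.

(* A Kuranishi cobordism (satisfying the weak cocycle condition) of dimension
   n on Y0 with collar width eps. *)
Record kuranishi_cobordism (eps : R) (n : int) (Y0 : set Y) Q : Prop := {
  kb_eps : 0 < eps ;
  kb_space : collared_space eps Y0 Q ;
  kb_main : weak_kuranishi n Y0 Q ;
  kb_bd : forall alpha, weak_atlas (n - 1) (cdY Q alpha) (cbd Q alpha) ;
  kb_bd_F : forall alpha i, kF (cbd Q alpha) i = kF Q i `&` cdY Q alpha ;
  kb_F_collar : forall alpha I, idx Q I ->
    footprint Q I `&` collarY Q eps alpha (cdY Q alpha) =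
    collarY Q eps alpha (footprint Q I `&` cdY Q alpha) ;
  kb_F_int : forall I, idx Q I -> (forall alpha, ~ idx (cbd Q alpha) I) ->
    precompact_in (footprint Q I) (Y0 `\` (cdY Q false `|` cdY Q true)) ;
  kb_bdry_ex : forall alpha I, idx Q I ->
    (kdom (cbd Q alpha) I !=set0 <-> idx (cbd Q alpha) I) ;
  kb_bdry : forall I, idx Q I ->
    mbdry (kU Q I) = kdom (cbd Q false) I `|` kdom (cbd Q true) I ;
  kb_bdry_disj : forall I, idx Q I ->
    kdom (cbd Q false) I `&` kdom (cbd Q true) I = set0 ;
  kb_charts : forall alpha I, idx (cbd Q alpha) I ->
    collared_chart eps Q alpha I ;
  kb_changes : forall alpha I J, idx (cbd Q alpha) I -> idx (cbd Q alpha) J ->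
    I \proper J -> collared_change eps Q alpha I J ;
  kb_changes_int : forall alpha I J, idx (cbd Q alpha) I -> idx Q J ->
    I \proper J -> ~ idx (cbd Q alpha) J ->
    kUo Q I J `&` collarI Q eps alpha (kdom (cbd Q alpha) I) = set0 }.

Implicit Types (d : set (kpoint T) -> set (kpoint T) -> R)
  (V C : forall I, set (T I)) (nu : forall I, T I -> oEI I).

(* the map A^alpha_eps x |bd^alpha K| -> |K| induced by the iota_I: the class p
   is sent to the class of the images of its representatives *)
Definition iotaK Q alpha (t : R) (p : set (kpoint T)) : set (kpoint T) :=
  [set q | exists2 x, p x &
    equiv Q (existT _ (projT1 x) (ciota Q alpha t (projT2 x))) q].

Definition bd_metric Q d alpha : set (kpoint T) -> set (kpoint T) -> R :=
  fun p q => d (iotaK Q alpha (endpoint alpha) p)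
               (iotaK Q alpha (endpoint alpha) q).

Record collared_metric (eps : R) Q d : Prop := {
  cm_prod : forall alpha t t' p p',
    collar alpha eps t -> collar alpha eps t' ->
    realization (cbd Q alpha) p -> realization (cbd Q alpha) p' ->
    d (iotaK Q alpha t p) (iotaK Q alpha t' p') =
    `|t - t'| + bd_metric Q d alpha p p' ;
  cm_far : forall alpha t p q,
    collar alpha eps t -> realization (cbd Q alpha) p ->
    realization Q q ->
    (forall t' p', collar alpha eps t' -> realization (cbd Q alpha) p' ->
      q <> iotaK Q alpha t' p') ->
    eps - `|endpoint alpha - t| <= d q (iotaK Q alpha t p) }.

Definition metric_tame_cobordism (eps : R) (n : int) (Y0 : set Y) Q d :=
  [/\ kuranishi_cobordism eps n Y0 Q, tame Q, admissible_metric Q d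
    & collared_metric eps Q d].

(* bd^alpha V_I, regarded as a subset of bd^alpha U_I *)
Definition bd_set Q V alpha : forall I, set (T I) :=
  fun I => kdom (cbd Q alpha) I `&` V I.
Arguments bd_set : clear implicits.

Record cobordism_reduction (eps : R) Q V : Prop := {
  cr_red : reduction Q V ;
  cr_nonempty : forall alpha I, idx (cbd Q alpha) I ->
    (bd_set Q V alpha I !=set0 <->
     exists x, [/\ V I x, zeroset Q I x & cdY Q alpha (kpsi Q I x)]) ;
  cr_collar : forall alpha I t x, idx (cbd Q alpha) I ->
    collar alpha eps t -> kdom (cbd Q alpha) I x ->
    (V I (ciota Q alpha t x) <-> bd_set Q V alpha I x) }.

Definition cobordism_perturbation Q V nu :=
  perturbation Q V nu /\
  exists2 eps, 0 < eps & forall alpha,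
    exists nub : forall I, T I -> oEI I, forall I t x,
      idx (cbd Q alpha) I -> collar alpha eps t -> bd_set Q V alpha I x ->
      nu I (ciota Q alpha t x) = nub I x.

(* nu|_{bd^alpha V} = nub *)
Definition restricts_to Q V alpha nu (nub : forall I, T I -> oEI I) :=
  forall I x, idx (cbd Q alpha) I -> bd_set Q V alpha I x -> nu I x = nub I x.

Definition precompact_pert Q V nu :=
  exists C eps, [/\ 0 < eps, cobordism_reduction eps Q C, nested Q C V
    & pert_zero Q V nu `<=` piKV Q C].

Definition sigma_rel Q d V C (nrm : forall i, oE (o := O) i -> R) (delta : R) :
    \bar R :=
  Order.min
    (sigma_V (cbd Q false) (bd_metric Q d false)
      (bd_set Q V false) (bd_set Q C false) nrm delta)
    (Order.min
      (sigma_V (cbd Q true) (bd_metric Q d true)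
        (bd_set Q V true) (bd_set Q C true) nrm delta)
      (sigma_V' Q d V C nrm delta)).

Definition bd_adapted Q d V C (nrm : forall i, oE (o := O) i -> R)
    (delta sig : R) alpha nub :=
  adapted (cbd Q alpha) (bd_metric Q d alpha)
    (bd_set Q V alpha) (bd_set Q C alpha) nrm delta sig nub.

End Cobordism.
Arguments bd_set {R O T Y} Q V alpha I.

Section Product.
Context {R : realType} {O : obst R} {T : Index O -> topologicalType}
  {X : topologicalType}.
Implicit Types (K : kdata T X) (I J : Index O).

Definition prodT : Index O -> topologicalType := fun I => (R * T I)%type.

Definition unit_itv : set R := [set t | 0 <= t <= 1].

(* the atlas A x K, for a set A of parameters with a given manifold structure
   [prodM] on the products with A *)
Definition param_product (A : set R)
    (prodM : forall I, @manifold R (T I) -> @manifold R (prodT I)) K :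
    kdata prodT (R * X)%type :=
  @KData R O prodT (R * X)%type
    (fun I => prodM I (kU K I))
    (fun I g p => (p.1, kact K g p.2))
    (fun I p => ks K I p.2)
    (fun i => A `*` kF K i)
    (fun I p => (p.1, kpsi K I p.2))
    (fun I J => A `*` kUo K I J)
    (fun I J => A `*` kUt K I J)
    (fun I J p => (p.1, krho K I J p.2)).

Definition product_cobordism (X0 : set X) K :
    cobdata prodT (R * X)%type :=
  CobData
    (param_product unit_itv (fun I => itv_prod unit_itv) K)
    (fun alpha => [set endpoint alpha] `*` X0)
    (fun alpha t p => (t, p.2))
    (fun alpha => param_product [set endpoint alpha]
      (fun I => slice (endpoint alpha)) K)
    (fun alpha I t p => (t, p.2)).

Definition product_sets (V : forall I, set (T I)) I : set (prodT I) :=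
  unit_itv `*` V I.

(* the values on |[0,1] x K| of the product metric |t - t'| + d *)
Definition product_metric (X0 : set X) K
    (d : set (kpoint T) -> set (kpoint T) -> R)
    (D : set (kpoint prodT) -> set (kpoint prodT) -> R) :=
  forall I J t t' x y, idx K I -> idx K J -> unit_itv t -> unit_itv t' ->
    kdom K I x -> kdom K J y ->
    D (piK (product_cobordism X0 K) I (t, x))
      (piK (product_cobordism X0 K) J (t', y)) =
    `|t - t'| + d (piK K I x) (piK K J y).

End Product.
Arguments prodT {R O} T I.

(* Main.v *)
(* The perturbations nu_J are built by induction on |J|. Near a point of V_J that is
   close to some N_JI, with I maximal, a solution is phihat_IJ o nu_I o rho_IJ composed
   with a local retraction onto the submanifold U~_IJ; elsewhere it is 0, or the
   prescribed value near the boundary of a cobordism. The conditions are convex, so the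
   local solutions can be averaged. Where the result takes values in E_I, tameness puts
   its zeros on U~_IJ, and the index condition gives transversality there; on the
   remaining compact set the section is made transverse by adding small terms
   beta^2 A, with A affine in a chart. The parameters A with a degenerate zero are
   nowhere dense, by a counting argument in place of Sard's theorem, so Baire's theorem
   provides good ones. Zeros outside C are excluded by the bound sigma on |s_J|.
   On a cobordism the boundary perturbations are first extended constantly along
   collars shrinking with |J|; the constant delta < eps keeps these collars compatible
   with all neighbourhoods used, and on a product the collar is the whole interval. *)
From HB Require Import structures.
From Stdlib Require Import Relations.Relation_Operators.
From mathcomp Require Import all_boot all_order all_algebra all_fingroup.
From mathcomp Require Import all_classical all_reals all_analysis.
From mathcomp Require Import ring lra.
Require Import Defs.
Set Implicit Arguments.
Unset Strict Implicit.
Unset Printing Implicit Defensive.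
Import Order.TTheory GRing.Theory Num.Theory numFieldNormedType.Exports.
Import VectorInternalTheory.
Local Open Scope classical_set_scope.
Local Open Scope ring_scope.

(** * Smooth germs *)

(** Stage J must agree with all earlier stages on sets known only through distances in |K|, so every
    stage gives up some room. It starts on the neighbourhood of V_J of radius [dl J] and ends at
    half that radius. The quarter powers of 2 in the definition of sigma subdivide this halving:
    with w = 2^(-1/4), the radii (1 - w) dl J times 1, w and w^2 serve to select the relevant
    indices, to glue, and to switch off the generic term. The norm bounds [tau n] increase strictly
    below sigma, one increment paying for one generic term, and each stage loses five of the nested
    collars [BB n]. An adapted boundary perturbation is controlled only at radius 2^(-|J|) delta, so
    on a cobordism all radii start one halving later; this is the passage from sigma to sigma'.
    Tameness makes U~_IJ the preimage of E_I under s_J, a closed set. So a point lies on the U~_IJ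
    of largest relevant index, where the induced solution is used, or has a neighbourhood missing
    it, where 0 is used. Domains may have boundary, so smoothness means local extension, and
    derivatives must be shown not to depend on the extension. *)

Section SmoothCalculus.
Context {R : realType}.

(** Version of [Ck] between arbitrary normed modules: scalar functions can be multiplied and
    inverted, and [Ck_coord] reduces a row-valued map to its scalar coordinates. *)
Fixpoint Cn {V W : normedModType R} (k : nat) (O : set V) (f : V -> W) : Prop :=
  match k with
  | 0%N => forall x, O x -> {for x, continuous f}
  | k'.+1 => (forall x, O x -> differentiable f x) /\
             (forall v, Cn k' O (fun x => 'D_v f x))
  end.

Lemma near_open (T : topologicalType) (p : T) (P : set T) :
  (\forall x \near p, P x) -> exists Q, [/\ open Q, Q p & Q `<=` P].
Proof. by rewrite /prop_near1 /= nbhsE => -[Q [Qo Qp] QP]; exists Q. Qed.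

Lemma near_neq0 (T : topologicalType) (f : T -> R) (p : T) :
  {for p, continuous f} -> f p != 0 -> \forall q \near p, f q != 0.
Proof.
move=> /cvgrPdist_lt/(_ `|f p|) H; rewrite -normr_gt0 => /H.
by apply: filterS => q; apply: contraTneq => ->; rewrite subr0 ltxx.
Qed.

(** The first-order expansion at [x] only sees the germ of the map, and [diff_unique] recovers the
    differential from it. *)
Lemma near_eq_differentiable (V W : normedModType R) (f g : V -> W) x :
  (\near x, f x = g x) -> differentiable f x -> differentiable g x.
Proof.
move=> fg df.
have dfe := diff_locally df.
have gE : g \o shift x = cst (g x) + 'd f x +o_ 0 id.
  apply/eqaddoP => e e0.
  move/eqaddoP : dfe => /(_ e e0) H.
  have fgx : f x = g x by exact: (nbhs_singleton fg).
  have fg0 : \forall y \near (0 : V), f (shift x y) = g (shift x y).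
    by move: fg; rewrite (near_shift 0) subr0.
  by apply: filterS2 fg0 H => y; rewrite /= !fctE /= => <-; rewrite -fgx.
have cf : continuous ('d f x) by exact: diff_continuous.
have gd := diff_unique cf gE.
by apply/diff_locallyP; rewrite gd.
Unshelve. all: by end_near. Qed.

Lemma Cn_ext (V W : normedModType R) k (O : set V) (f g : V -> W) :
  open O -> (forall x, O x -> f x = g x) -> Cn k O f -> Cn k O g.
Proof.
move=> Oo; elim: k f g => [|k IH] f g fg /=.
  move=> fc x Ox; rewrite /prop_for /continuous_at -(fg x Ox).
  apply: cvg_trans (fc x Ox); apply: near_eq_cvg.
  by apply: filterS (open_nbhs_nbhs (conj Oo Ox)).
have nfg x : O x -> \forall y \near x, f y = g y.
  by move=> Ox; apply: filterS (open_nbhs_nbhs (conj Oo Ox)).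
move=> [df Df]; split=> [x Ox|v].
  by apply: near_eq_differentiable (df x Ox); exact: nfg.
by apply: IH (Df v) => x Ox; apply: near_eq_derive; exact: nfg.
Qed.

Lemma Cn_sub (V W : normedModType R) k (O O' : set V) (f : V -> W) :
  O' `<=` O -> Cn k O f -> Cn k O' f.
Proof.
move=> OO; elim: k f => [|k IH] f /=; first by move=> H x /OO /H.
by move=> [df Df]; split=> [x /OO /df //|v]; exact: IH.
Qed.

Lemma Cn_pred (V W : normedModType R) k (O : set V) (f : V -> W) :
  Cn k.+1 O f -> Cn k O f.
Proof.
elim: k f => [|k IH] f.
  by move=> [df _] x Ox; apply: differentiable_continuous; exact: df.
by move=> [df Df]; split => // v; apply: (IH (fun x => 'D_v f x)); exact: Df.
Qed.

Lemma Cn_cst (V W : normedModType R) k (O : set V) (w : W) : Cn k O (fun _ : V => w).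
Proof.
elim: k w => [|k IH] w /=; first by move=> x _; exact: cvg_cst.
split=> [x _|v]; first exact: differentiable_cst.
have -> : (fun x : V => 'D_v (fun=> w) x) = (fun=> 0 : W); last exact: IH.
by apply/funext => x; exact: derive_cst.
Qed.

Lemma Cn_add (V W : normedModType R) k (O : set V) (f g : V -> W) : open O ->
  Cn k O f -> Cn k O g -> Cn k O (fun x => f x + g x).
Proof.
move=> Oo; elim: k f g => [|k IH] f g /=.
  by move=> fc gc x Ox; apply: cvgD; [exact: fc|exact: gc].
move=> [df Df] [dg Dg]; split=> [x Ox|v].
  by apply: differentiableD; [exact: df|exact: dg].
apply: Cn_ext (IH _ _ (Df v) (Dg v)) => // x Ox.
by rewrite deriveD //; apply: diff_derivable; [exact: df|exact: dg].
Qed.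

Lemma Cn_mul (V : normedModType R) k (O : set V) (f g : V -> R) : open O ->
  Cn k O f -> Cn k O g -> Cn k O (fun x => f x * g x).
Proof.
move=> Oo; elim: k f g => [|k IH] f g.
  by move=> fc gc x Ox; apply: cvgM; [exact: fc|exact: gc].
move=> fk gk; have f' := Cn_pred fk; have g' := Cn_pred gk.
move: fk gk => [df Df] [dg Dg]; split=> [x Ox|v].
  by apply: differentiableM; [exact: df|exact: dg].
apply: (@Cn_ext _ _ _ _ (fun x => f x * 'D_v g x + g x * 'D_v f x)) => //.
  move=> x Ox; rewrite deriveM //; apply: diff_derivable; [exact: df|exact: dg].
apply: (Cn_add Oo).
  exact: (IH f (fun x => 'D_v g x) f' (Dg v)).
exact: (IH g (fun x => 'D_v f x) g' (Df v)).
Qed.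

Lemma Cn_scale (V W : normedModType R) k (O : set V) (f : V -> R) (w : W) :
  open O -> Cn k O f -> Cn k O (fun x => f x *: w).
Proof.
move=> Oo; elim: k f => [|k IH] f.
  by move=> fc x Ox; apply: cvgZr_tmp; exact: fc.
move=> [df Df]; split=> [x Ox|v].
  by apply: differentiableZl; exact: df.
apply: Cn_ext (IH _ (Df v)) => // x Ox.
have dfx := df x Ox; have dw := @differentiableZl R V W f w x dfx.
by rewrite !deriveE// diffZl.
Qed.

Lemma Cn_inv (V : normedModType R) k (O : set V) (f : V -> R) : open O ->
  (forall x, O x -> f x != 0) -> Cn k O f -> Cn k O (fun x => (f x)^-1).
Proof.
move=> Oo f0; elim: k => [|k IH].
  by move=> fc x Ox; apply: cvgV; [exact: f0|exact: fc].
move=> fk; have f' := IH (Cn_pred fk); move: fk => [df Df].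
split=> [x Ox|v]; first by apply: differentiableV; [exact: df|exact: f0].
apply: (@Cn_ext _ _ _ _ (fun x => (-1 * 'D_v f x) * ((f x)^-1 * (f x)^-1))) => //.
  move=> x Ox; rewrite deriveV; [|exact: f0|exact/diff_derivable/df].
  rewrite -[_ *: _]/(_ * _) /=. by rewrite mulN1r mulNr mulrC -invfM -expr2 -exprVn mulNr exprVn.
apply: (Cn_mul Oo); last exact: (Cn_mul Oo).
exact: (@Cn_mul V k O (fun=> -1) (fun x => 'D_v f x) Oo (Cn_cst _ _ _) (Df v)).
Qed.

Lemma Cn_sum (V W : normedModType R) (I : Type) (r : seq I) k (O : set V)
    (f : I -> V -> W) : open O ->
  (forall i, Cn k O (f i)) -> Cn k O (fun x => \sum_(i <- r) f i x).
Proof.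
move=> Oo fk; elim: r => [|i r IH].
  by apply: Cn_ext (Cn_cst k O 0) => // x _; rewrite big_nil.
by apply: Cn_ext (Cn_add Oo (fk i) IH) => // x _; rewrite big_cons.
Qed.

Lemma Cn_coord m n k (O : set 'M[R]_(m, n)) i j : Cn k O (fun M : 'M[R]_(m, n) => M i j).
Proof.
case: k => [x _|k]; first exact: coord_continuous.
split=> [x _|v]; first exact: differentiable_coord.
rewrite (_ : (fun x => _) = (fun=> v i j)); first exact: Cn_cst.
apply/funext => x; rewrite deriveE; last exact: differentiable_coord.
have @g : {linear 'M[R]_(m, n) -> R}.
  by exists (fun N : 'M[R]_(_, _) => N i j); do 2![eexists]; do ?[constructor];
     rewrite ?mxE// => ? *; rewrite ?mxE//; move=> ?; rewrite !mxE.
by rewrite (_ : (fun _ => _) = g) // diff_lin //; exact: coord_continuous.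
Qed.

Lemma row_sum_coord n (v : 'rV[R]_n) : v = \sum_(i < n) v 0 i *: delta_mx 0 i.
Proof. by rewrite [LHS]row_sum_delta. Qed.

Lemma differentiable_row (V : normedModType R) m (f : V -> 'rV[R]_m) x :
  (forall i, differentiable (fun y => f y 0 i) x) -> differentiable f x.
Proof.
move=> fd; rewrite (_ : f = \sum_(i < m) (fun y => f y 0 i *: delta_mx 0 i)).
  by apply: differentiable_sum => i; exact: (@differentiableZl R V _ (fun y => f y 0 i)).
by apply/funext => y; rewrite fct_sumE -row_sum_coord.
Qed.

Lemma derive_coord (V : normedModType R) m (f : V -> 'rV[R]_m) x v i :
  differentiable f x -> 'D_v (fun y => f y 0 i) x = ('D_v f x) 0 i.
Proof.
move=> fd; have fi : differentiable (fun y => f y 0 i) x.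
  by apply: (@differentiable_comp _ _ _ _ f (fun M : 'rV[R]_m => M 0 i)) => //; exact: differentiable_coord.
rewrite !deriveE// (@diff_comp _ _ _ _ f (fun M : 'rV[R]_m => M 0 i)) //=; last exact: differentiable_coord.
have @g : {linear 'rV[R]_m -> R}.
  by exists (fun N : 'rV[R]_m => N 0 i); do 2![eexists]; do ?[constructor];
     rewrite ?mxE// => ? *; rewrite ?mxE//; move=> ?; rewrite !mxE.
by rewrite (_ : (fun M : 'rV[R]_m => M 0 i) = g) // diff_lin //; exact: coord_continuous.
Qed.

Lemma Ck_coord n m k (O : set 'rV[R]_n) (f : 'rV[R]_n -> 'rV[R]_m) : open O ->
  Ck k O f <-> forall i, Cn k O (fun y => f y 0 i).
Proof.
move=> Oo; elim: k f => [|k IH] f.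
  split=> [fc i x Ox|fc x Ox].
    by apply: (@continuous_comp _ _ _ f (fun M : 'rV[R]_m => M 0 i)); [exact: fc|exact: coord_continuous].
  rewrite (_ : f = fun y => \sum_(i < m) f y 0 i *: delta_mx 0 i); last first.
    by apply/funext => y; rewrite -row_sum_coord.
  apply: (@Cn_sum _ _ _ (index_enum _) 0 O (fun i y => f y 0 i *: delta_mx 0 i)) => // i.
  exact: (@Cn_scale _ _ 0).
split=> [[df Df] i|fi].
  split=> [x Ox|v].
    by apply: (@differentiable_comp _ _ _ _ f (fun M : 'rV[R]_m => M 0 i)); [exact: df|exact: differentiable_coord].
  have /IH/(_ i) := Df v; apply: Cn_ext => // x Ox.
  by rewrite derive_coord//; exact: df.
have df x : O x -> differentiable f x.
  by move=> Ox; apply: differentiable_row => i; have [H _] := fi i; exact: H.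
split=> // v; apply/IH => i; have [_ /(_ v)] := fi i; apply: Cn_ext => // x Ox.
by rewrite derive_coord//; exact: df.
Qed.

Lemma derive_comp n (V W : normedModType R) (f : V -> 'rV[R]_n) (g : 'rV[R]_n -> W) x v :
  differentiable f x -> differentiable g (f x) ->
  'D_v (g \o f) x = 'D_('D_v f x) g (f x).
Proof.
move=> fd gd; rewrite deriveE; last exact: differentiable_comp.
by rewrite diff_comp//= !deriveE.
Qed.

Lemma derive_comp_sum n (V : normedModType R) (f : V -> 'rV[R]_n) (g : 'rV[R]_n -> R) x v :
  differentiable f x -> differentiable g (f x) ->
  'D_v (g \o f) x = \sum_(i < n) 'D_v (fun y => f y 0 i) x * 'D_(delta_mx 0 i) g (f x).
Proof.
move=> fd gd; rewrite derive_comp// deriveE// [X in 'd g _ X]row_sum_coord linear_sum.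
by apply: eq_bigr => i _; rewrite (derive_coord v i fd) (deriveE _ gd) linearZ.
Qed.

(** By the chain rule in coordinates, the derivative is a sum of products of functions covered by
    the induction hypothesis. *)
Lemma Cn_comp n (V : normedModType R) k (O : set V) (P : set 'rV[R]_n)
    (f : V -> 'rV[R]_n) (g : 'rV[R]_n -> R) : open O -> open P ->
  (forall x, O x -> P (f x)) ->
  (forall i, Cn k O (fun y => f y 0 i)) -> Cn k P g -> Cn k O (fun x => g (f x)).
Proof.
move=> Oo Po OP; elim: k g => [|k IH] g.
  move=> fc gc x Ox; apply: continuous_comp; last by apply: gc; exact: OP.
  rewrite (_ : f = fun y => \sum_(i < n) f y 0 i *: delta_mx 0 i); last first.
    by apply/funext => y; rewrite -row_sum_coord.
  apply: (@Cn_sum _ _ _ (index_enum _) 0 O (fun i y => f y 0 i *: delta_mx 0 i)) => // i.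
  exact: (@Cn_scale _ _ 0).
move=> fk gk; have fk' i := Cn_pred (fk i).
have fd x : O x -> differentiable f x.
  by move=> Ox; apply: differentiable_row => i; have [H _] := fk i; exact: H.
have [gd Dg] := gk.
split=> [x Ox|v].
  by apply: differentiable_comp; [exact: fd|exact/gd/OP].
apply: (@Cn_ext _ _ _ _ (fun x => \sum_(i < n) 'D_v (fun y => f y 0 i) x * 'D_(delta_mx 0 i) g (f x))) => //.
  by move=> x Ox; rewrite -derive_comp_sum//; [exact: fd|exact/gd/OP].
apply: Cn_sum => // i; have [_ Df] := fk i.
apply: (@Cn_mul _ _ _ (fun x => 'D_v (fun y => f y 0 i) x) (fun x => 'D_(delta_mx 0 i) g (f x))) => //.
  exact: Df.
by apply: (IH (fun y => 'D_(delta_mx 0 i) g y)) => //; exact: Dg.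
Qed.

Lemma Cn_opp (V W : normedModType R) k (O : set V) (f : V -> W) : open O ->
  Cn k O f -> Cn k O (fun x => - f x).
Proof.
move=> Oo; elim: k f => [|k IH] f.
  by move=> fc x Ox; apply: cvgN; exact: fc.
move=> [df Df]; split=> [x Ox|v]; first by apply: differentiableN; exact: df.
apply: Cn_ext (IH _ (Df v)) => // x Ox.
by rewrite deriveN//; apply: diff_derivable; exact: df.
Qed.

(** Scalar form of [smooth_near]: one neighbourhood serves all orders of differentiability, so
    smoothness is an open condition ([sgerm_near]). *)
Definition sgerm {n} (f : 'rV[R]_n -> R) p :=
  exists2 O, open_nbhs p O & forall k, Cn k O f.

Lemma sgerm2 n (f g h : 'rV[R]_n -> R) p :
  (forall O k, open O -> Cn k O f -> Cn k O g -> Cn k O h) ->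
  sgerm f p -> sgerm g p -> sgerm h p.
Proof.
move=> H [ O [Oo Op] fk] [ O' [Oo' Op'] gk].
have OO : open (O `&` O') by exact: openI.
exists (O `&` O') => [|k]; first by split.
apply: H => //.
  by apply: Cn_sub (fk k) => x [].
by apply: Cn_sub (gk k) => x [].
Qed.

Lemma sgermD n (f g : 'rV[R]_n -> R) p :
  sgerm f p -> sgerm g p -> sgerm (fun x => f x + g x) p.
Proof. by apply: sgerm2 => O k; exact: Cn_add. Qed.

Lemma sgermM n (f g : 'rV[R]_n -> R) p :
  sgerm f p -> sgerm g p -> sgerm (fun x => f x * g x) p.
Proof. by apply: sgerm2 => O k; exact: Cn_mul. Qed.

Lemma sgermC n (a : R) (p : 'rV[R]_n) : sgerm (fun=> a) p.
Proof. by exists setT => [|k]; [split=> //; exact: openT|exact: Cn_cst]. Qed.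

Lemma sgerm_coord n i (p : 'rV[R]_n) : sgerm (fun x => x 0 i) p.
Proof. by exists setT => [|k]; [split=> //; exact: openT|exact: Cn_coord]. Qed.

Lemma sgerm_diff n (f : 'rV[R]_n -> R) p : sgerm f p -> differentiable f p.
Proof. by move=> [ O [_ Op] fk]; have [df _] := fk 1%N; exact: df. Qed.

Lemma sgerm_derivable n (f : 'rV[R]_n -> R) p v : sgerm f p -> derivable f p v.
Proof. by move=> /sgerm_diff; exact: diff_derivable. Qed.

Lemma sgerm_continuous n (f : 'rV[R]_n -> R) p : sgerm f p -> {for p, continuous f}.
Proof. by move=> /sgerm_diff; exact: differentiable_continuous. Qed.

Lemma sgerm_near n (f : 'rV[R]_n -> R) p : sgerm f p -> \forall q \near p, sgerm f q.
Proof.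
move=> [ O [Oo Op] fk]; apply: filterS (open_nbhs_nbhs (conj Oo Op)) => q Oq.
by exists O.
Qed.

Lemma sgerm_eq n (f g : 'rV[R]_n -> R) p : f =1 g -> sgerm f p -> sgerm g p.
Proof. by move=> /funext ->. Qed.

Lemma sgermN n (f : 'rV[R]_n -> R) p : sgerm f p -> sgerm (fun x => - f x) p.
Proof.
by move=> fp; apply: sgerm_eq (sgermM (sgermC (-1) p) fp) => q; rewrite mulN1r.
Qed.

Lemma sgermV n (f : 'rV[R]_n -> R) p : f p != 0 ->
  sgerm f p -> sgerm (fun x => (f x)^-1) p.
Proof.
move=> f0 fp; have fc := sgerm_continuous fp.
have [Q [Qo Qp fQ]] : exists Q, [/\ open Q, Q p & Q `<=` [set q | f q != 0]].
  by apply: near_open; exact: near_neq0. move: fp => [ O [Oo Op] fk].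
have OQ : open (O `&` Q) by exact: openI.
exists (O `&` Q) => [|k]; first by split.
apply: (@Cn_inv _ _ _ f) => // [x [_ /fQ]//|].
by apply: Cn_sub (fk k) => x [].
Qed.

Lemma sgerm_sum n (I : Type) (r : seq I) (f : I -> 'rV[R]_n -> R) p :
  (forall i, sgerm (f i) p) -> sgerm (fun x => \sum_(i <- r) f i x) p.
Proof.
move=> fk; elim: r => [|i r IH].
  by apply: sgerm_eq (sgermC 0 p) => q; rewrite big_nil.
by apply: sgerm_eq (sgermD (fk i) IH) => q; rewrite big_cons.
Qed.

Lemma sgerm_derive n (f : 'rV[R]_n -> R) p v : sgerm f p -> sgerm (fun x => 'D_v f x) p.
Proof. by move=> [ O Op fk]; exists O => // k; have [_] := fk k.+1; exact. Qed.

Definition smooth_rows {n m} (f : 'rV[R]_n -> 'rV[R]_m) p :=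
  forall i, sgerm (fun y => f y 0 i) p.

Lemma smooth_rowsP n m (f : 'rV[R]_n -> 'rV[R]_m) p :
  smooth_near f p <-> smooth_rows f p.
Proof.
split=> [[ O [Oo Op] fk] i|fi].
  by exists O => // k; have /(Ck_coord _ _ Oo) := fk k; exact.
have /choice[ O HO] : forall i, exists Q, open_nbhs p Q /\ forall k, Cn k Q (fun y => f y 0 i).
  by move=> i; have [ O Op fk] := fi i; exists O.
have Oo : open (\big[setI/setT]_(i < m) O i).
  by apply: big_ind => [|A B|i _]; [exact: openT|exact: openI|have [[]] := HO i].
have OE i : \big[setI/setT]_(j < m) O j `<=` O i.
  by rewrite (bigD1 i)//= => x [].
exists (\big[setI/setT]_(i < m) O i) => [|k].
  split=> //; apply: (big_ind (fun A : set _ => A p)) => // i _.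
  by have [[]] := HO i.
apply/(Ck_coord _ _ Oo) => i; have [_ /(_ k)] := HO i; exact: Cn_sub.
Qed.

Lemma smooth_rows_diff n m (f : 'rV[R]_n -> 'rV[R]_m) p :
  smooth_rows f p -> differentiable f p.
Proof. by move=> fi; apply: differentiable_row => i; exact: sgerm_diff. Qed.

Lemma smooth_rows_continuous n m (f : 'rV[R]_n -> 'rV[R]_m) p :
  smooth_rows f p -> {for p, continuous f}.
Proof. by move=> /smooth_rows_diff; exact: differentiable_continuous. Qed.

Lemma sgerm_comp n m (f : 'rV[R]_n -> 'rV[R]_m) (g : 'rV[R]_m -> R) p :
  smooth_rows f p -> sgerm g (f p) -> sgerm (fun x => g (f x)) p.
Proof.
move=> /[dup] /smooth_rows_continuous fc /smooth_rowsP[ O [Oo Op] fk] [Q [Qo Qp] gk].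
have : nbhs p (f @^-1` Q) by apply: fc; exact: open_nbhs_nbhs.
rewrite nbhsE => -[P [Po Pp] PQ].
have OP : open (O `&` P) by exact: openI.
exists (O `&` P) => [|k]; first by split.
apply: (@Cn_comp _ _ _ _ Q f g) => // [x [_ /PQ]//|i].
by have /(Ck_coord _ _ Oo)/(_ i) := fk k; apply: Cn_sub => x [].
Qed.

Lemma smooth_rows_comp n m l (f : 'rV[R]_n -> 'rV[R]_m) (g : 'rV[R]_m -> 'rV[R]_l) p :
  smooth_rows f p -> smooth_rows g (f p) -> smooth_rows (g \o f) p.
Proof. by move=> fp gp i; apply: (sgerm_comp (g := fun y => g y 0 i)) => //; exact: gp. Qed.

Lemma near_norm (V : normedModType R) (p : V) (P : set V) :
  (\forall q \near p, P q) -> exists2 r : R, 0 < r & forall q, `|q - p| < r -> P q.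
Proof.
move=> /nbhs_ballP[r r0 H]; exists r => // q qr; apply: H.
by rewrite -ball_normE /= distrC.
Qed.

Lemma mx_norm_ltP m n (A : 'M[R]_(m, n)) (r : R) : 0 < r ->
  (forall i j, `|A i j| < r) -> `|A| < r.
Proof.
move=> r0 H; rewrite /Num.norm/= mx_normrE; apply: bigmax_lt => // -[i j] _.
Qed.

Lemma coord_le_norm m n (A : 'M[R]_(m, n)) i j : `|A i j| <= `|A|.
Proof.
rewrite [leRHS]/Num.norm/= mx_normrE.
exact: (@le_bigmax _ _ _ 0 (fun ij => `|A ij.1 ij.2|) (i, j)).
Qed.

(** Mean value theorem on the segment from [y] to [x]: on a small ball each partial derivative stays
    below its modulus at [p] plus 1, and [L] is the sum of these bounds. The counting argument of
    [local_genericity] rests on such estimates. *)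
Lemma sgerm_lipschitz n (f : 'rV[R]_n -> R) p : sgerm f p ->
  exists r L : R, [/\ 0 < r, 0 <= L & forall x y, `|x - p| < r -> `|y - p| < r ->
    `|f x - f y| <= L * `|x - y|].
Proof.
move=> fp; have := sgerm_near fp.
have dfc i : \forall q \near p, `|'D_(delta_mx 0 i) f q| < `|'D_(delta_mx 0 i) f p| + 1.
  have c := sgerm_continuous (sgerm_derive (delta_mx 0 i) fp).
  have /cvgrPdist_lt/(_ 1 ltr01) := c; apply: filterS => q /= H.
  rewrite -ltrBlDl; apply: le_lt_trans H; rewrite distrC; exact: lerB_dist.
have Dn : \forall q \near p, forall i, `|'D_(delta_mx 0 i) f q| < `|'D_(delta_mx 0 i) f p| + 1.
  exact: (@filter_forall _ _ _ _ (nbhs_filter p) dfc).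
move=> fn; have [r r0 rP] := near_norm (filterI Dn fn).
have r0' : 0 < r by exact: r0.
pose L := \sum_(i < n) (`|'D_(delta_mx 0 i) f p| + 1).
have L0 : 0 <= L by apply: sumr_ge0 => i _; rewrite addr_ge0.
exists r, L; split=> // x y xr yr.
pose w := x - y; pose l (t : R) := y + t *: w.
have lr t : 0 <= t <= 1 -> `|l t - p| < r.
  move=> /andP[t0 t1]; rewrite /l /w.
  rewrite (_ : _ - p = t *: (x - p) + (1 - t) *: (y - p)); last first.
    by apply/rowP => i; rewrite !mxE; ring.
  apply: le_lt_trans (ler_normD _ _) _; rewrite !normrZ (ger0_norm t0) ger0_norm ?subr_ge0//.
  have [->|t1'] := eqVneq t 0; first by rewrite mul0r add0r subr0 mul1r.
  have tp : 0 < t by rewrite lt_neqAle eq_sym t1' t0.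
  have : t * `|x - p| < t * r by rewrite ltr_pM2l.
  have : (1 - t) * `|y - p| <= (1 - t) * r by rewrite ler_wpM2l ?subr_ge0// ltW.
  lra.
have ld (t : R) : 0 <= t <= 1 -> is_derive t (1 : R) (f \o l) ('D_w f (l t)).
  move=> t01; have [_ /sgerm_diff fd] := rP (l t) (lr _ t01).
  have lD : differentiable l t.
    apply: differentiableD; first exact: differentiable_cst.
    by apply: (@differentiableZl R R _ id w t).
  apply: DeriveDef; first by apply/derivable1_diffP/differentiable_comp.
  rewrite derive_comp//; congr ('D__ f (l t)).
  rewrite /l deriveD//; last first.
    by apply/derivable1_diffP; exact: (@differentiableZl R R _ id w t).
  rewrite derive_cst add0r deriveE; last exact: (@differentiableZl R R _ id w t).
  by rewrite (@diffZl R R _ id w t)// -deriveE// derive_id scale1r.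
have : {within `[0, 1], continuous (f \o l)}.
  apply: continuous_in_subspaceT => t; rewrite inE /= in_itv/= => /ld [+ _].
  by move=> /derivable1_diffP /differentiable_continuous.
have ld' (t : R) : t \in `]0, 1[%R -> is_derive t (1 : R) (f \o l) ('D_w f (l t)).
  by rewrite in_itv/= => /andP[t0 t1]; apply: ld; rewrite !ltW.
move=> /(MVT ltr01 ld')[c]; rewrite in_itv/= => /andP[c0 c1].
have l1 : l 1 = x by rewrite /l scale1r /w addrC subrK.
have l0 : l 0 = y by rewrite /l scale0r addr0.
rewrite /= l1 l0 subr0 mulr1 => ->.
have c01 : 0 <= c <= 1 by rewrite !ltW.
have [Dc /sgerm_diff fd] := rP (l c) (lr _ c01).
rewrite deriveE// [X in 'd f _ X]row_sum_coord linear_sum.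
apply: le_trans (ler_norm_sum _ _ _) _; rewrite mulr_suml; apply: ler_sum => i _.
rewrite linearZ/= normrZ mulrC; apply: ler_pM => //; last exact: coord_le_norm.
by rewrite -deriveE// ltW//; exact: Dc.
Qed.

(* Images of charts are fat, also at boundary points, so the derivatives of a
   smooth extension do not depend on the extension. *)
Definition fat n (P : set 'rV[R]_n) p := forall h : 'rV[R]_n -> R, differentiable h p ->
  (\forall z \near p, P z -> h z = 0) -> forall v, 'D_v h p = 0.

Lemma fat_interior n (P : set 'rV[R]_n) p : nbhs p P -> fat P p.
Proof.
move=> Pp h hd h0 v; rewrite -(derive_cst (0 : R) p v).
by apply: near_eq_derive; apply: filterS2 Pp h0 => z Pz; exact.
Qed.

Lemma derive_right0 n (h : 'rV[R]_n -> R) p v : derivable h p v ->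
  (\forall t \near 0^'+, h (t *: v + p) = h p) -> 'D_v h p = 0.
Proof.
move=> hd H.
pose g (t : R) := t^-1 *: (h (t *: v + p) - h p).
have c0 : g @ 0^'+ --> (0 : R).
  by apply: cvg_near_cst; apply: filterS H => t; rewrite /g => ->; rewrite subrr scaler0.
have -> : 'D_v h p = lim (g @ 0^'+) by rewrite -cvg_at_rightE.
exact: cvg_lim.
Qed.

Lemma near_right_line n (P : set 'rV[R]_n) (p v : 'rV[R]_n) : nbhs p P ->
  \forall t \near (0 : R)^'+, P (t *: v + p).
Proof.
move=> Pp.
have c : (fun t : R => t *: v + p) @ (0 : R) --> p.
  rewrite -[X in _ --> X]add0r -(scale0r v); apply: cvgD; last exact: cvg_cst.
  exact: cvgZr_tmp.
have c' : \forall t \near (0 : R), P (t *: v + p) by exact: c _ Pp.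
by rewrite near_withinE; apply: filterS c'.
Qed.

Lemma derive_vanish_line n (P : set 'rV[R]_n) (h : 'rV[R]_n -> R) p v :
  differentiable h p -> P p -> (\forall z \near p, P z -> h z = 0) ->
  (\forall t \near (0 : R)^'+, P (t *: v + p)) -> 'D_v h p = 0.
Proof.
move=> hd Pp h0 Pv; have hp0 : h p = 0 by exact: (nbhs_singleton h0).
apply: derive_right0; first exact: diff_derivable.
by apply: filterS2 Pv (near_right_line v h0) => t H /(_ H) ->.
Qed.

Lemma derive_vanish_lines n (P : set 'rV[R]_n) (h : 'rV[R]_n -> R) p v :
  differentiable h p -> P p -> (\forall z \near p, P z -> h z = 0) ->
  (\forall t \near (0 : R)^'+, P (t *: v + p)) \/
  (\forall t \near (0 : R)^'+, P (t *: - v + p)) -> 'D_v h p = 0.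
Proof.
move=> hd Pp h0 [|] /(derive_vanish_line hd Pp h0)//.
by rewrite !deriveE// linearN => /eqP; rewrite oppr_eq0 => /eqP.
Qed.

(** For every direction, [v] or [- v] enters the half space, so one one-sided derivative vanishes,
    and derivatives are odd in the direction. *)
Lemma fat_boundary n (P : set 'rV[R]_n) p : P p -> boundary_point P p -> fat P p.
Proof.
move=> Pp [i _ bP] h hd h0 v; apply: (derive_vanish_lines hd Pp h0).
case: bP => bP; have [v0|v0] := leP 0 (v 0 i).
- left; apply: filterS2 (near_right_line v bP) (nbhs_right_gt 0) => t ->.
  by rewrite !mxE => t0; rewrite lerDr mulr_ge0// ltW.
- right; apply: filterS2 (near_right_line (- v) bP) (nbhs_right_gt 0) => t ->.
  by rewrite !mxE => t0; rewrite lerDr mulrN -mulNr mulr_le0// ?oppr_le0 ltW.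
- right; apply: filterS2 (near_right_line (- v) bP) (nbhs_right_gt 0) => t ->.
  by rewrite !mxE => t0; rewrite gerDr mulrN oppr_le0 mulr_ge0// ltW.
- left; apply: filterS2 (near_right_line v bP) (nbhs_right_gt 0) => t ->.
  by rewrite !mxE => t0; rewrite gerDr mulr_ge0_le0// ltW.
Qed.

(** The functions exp(-1/t) / t^q, extended by 0. The derivative of each is a combination of the
    next two ([is_derive_flatexp]), so smoothness of exp(-1/t) is proved for all [q] at once. *)
Definition flatexp (q : nat) (t : R) : R :=
  if 0 < t then t^-1 ^+ q * expR (- t^-1) else 0.

Lemma flatexp_ge0 q t : 0 <= flatexp q t.
Proof. by rewrite /flatexp; case: ifP => // t0; rewrite mulr_ge0 ?expR_ge0// exprn_ge0// invr_ge0 ltW. Qed.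

Lemma flatexp_le1 (t : R) : flatexp 0 t <= 1.
Proof.
rewrite /flatexp; case: ifP => // t0; rewrite expr0 mul1r -expR0 ler_expR.
by rewrite oppr_le0 invr_ge0 ltW.
Qed.

Lemma flatexp_gt0 q t : 0 < t -> 0 < flatexp q t.
Proof. by rewrite /flatexp => /[dup] t0 ->; rewrite mulr_gt0 ?expR_gt0// exprn_gt0// invr_gt0. Qed.

Lemma flatexp_le0 q t : t <= 0 -> flatexp q t = 0.
Proof. by rewrite /flatexp ltNge => ->. Qed.

(** With u = 1/t this reads u^(q+1) <= (q+1)^(q+1) exp(u), which is the power q+1 of u/(q+1) <=
    exp(u/(q+1)). *)
Lemma flatexp_linear_bound q (t : R) : 0 <= t -> flatexp q t <= (q.+1%:R ^+ q.+1) * t.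
Proof.
rewrite le_eqVlt => /predU1P[<-|t0]; first by rewrite flatexp_le0// mulr0.
rewrite /flatexp t0; set u := t^-1; have u0 : 0 < u by rewrite invr_gt0.
have -> : t = u^-1 by rewrite invrK.
rewrite expRN ler_pdivlMr// mulrAC ler_pdivrMr ?expR_gt0// -exprSr.
have -> : expR u = expR (u / q.+1%:R) ^+ q.+1.
  by rewrite -expRM_natr divfK// pnatr_eq0.
rewrite -exprMn; apply: lerXn2r; rewrite ?nnegrE ?mulr_ge0 ?expR_ge0//; try exact: ltW.
rewrite -ler_pdivrMl// mulrC; apply: le_trans (expR_ge1Dx _).
by rewrite lerDr.
Qed.

Lemma flatexp_quotient q (h : R) : h != 0 -> h^-1 * flatexp q h = flatexp q.+1 h.
Proof.
rewrite /flatexp neq_lt => /orP[h0|h0]; last by rewrite h0 exprS mulrA.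
by rewrite ltNge (ltW h0)/= mulr0.
Qed.

Lemma is_derive_flatexp q (t : R) :
  is_derive t (1 : R) (flatexp q) (flatexp q.+2 t - q%:R * flatexp q.+1 t).
Proof.
have [t0|t0|->] := ltgtP t 0.
- rewrite !flatexp_le0 ?ltW// mulr0 subr0.
  have D0 : is_derive t (1 : R) (fun=> 0 : R) (0 : R) by exact: is_derive_cst.
  apply: near_eq_is_derive D0.
  by apply: filterS (lt_nbhsl t0) => s s0; rewrite flatexp_le0// ltW.
- have E : {near t, flatexp q =1 (fun s => s^-1 ^+ q * expR (- s^-1))}.
    by apply: filterS (lt_nbhsr t0) => s s0; rewrite /flatexp s0.
  rewrite /flatexp t0; have tn0 : t != 0 by rewrite gt_eqF.
  have dV : is_derive t 1 (fun s : R => s^-1) (- t ^- 2 *: 1).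
    exact: (@is_deriveV R id).
  have dX := @is_deriveX R R (fun s : R => s^-1) q t 1 _ dV.
  have dE := @is_derive1_comp R (@expR R) (fun s : R => - s^-1) t _ _ (is_derive_expR _) (is_deriveN dV).
  have D : is_derive t (1 : R) (fun s : R => s^-1 ^+ q * expR (- s^-1))
      (t^-1 ^+ q.+2 * expR (- t^-1) - q%:R * (t^-1 ^+ q.+1 * expR (- t^-1))).
    have -> : (fun s : R => s^-1 ^+ q * expR (- s^-1)) =
        ((fun s : R => s^-1) ^+ q) * ((@expR R) \o (fun s : R => - s^-1)).
      by apply/funext => s; rewrite fctE exprfctE.
    apply: is_derive_eq; rewrite /=.
    case: q dX {E} => [|q] dX; rewrite /GRing.scale /= !exprfctE /=.
      by rewrite -exprVn; ring.
    by rewrite -exprVn !exprS; ring.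
  apply: near_eq_is_derive D; apply: filterS E => s; exact: esym.
- rewrite !flatexp_le0// mulr0 subr0.
  (* At 0 the difference quotient is again [flatexp q.+1], which tends to 0 by the linear bound;
     hence the constant with [q.+2]. *)
  have H : (fun h : R => h^-1 *: (flatexp q (h *: 1 + 0) - flatexp q 0)) @ 0^' --> (0 : R).
    apply/cvgr0Pnorm_le => e e0.
    pose C : R := q.+2%:R ^+ q.+2; have C0 : 0 < C by rewrite exprn_gt0.
    have : \forall h \near (0 : R)^', `|h| <= e / C by apply: dnbhs0_le; rewrite divr_gt0.
    rewrite !near_withinE; apply: filterS => h + h0 => /(_ h0).
    rewrite addr0 [h *: 1]mulr1 (flatexp_le0 q (lexx 0)) subr0 [_ *: _]flatexp_quotient//.
    rewrite ler_pdivlMr// => he; rewrite ger0_norm ?flatexp_ge0//.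
    have [h0'|h0'] := leP 0 h; last by rewrite flatexp_le0 ltW.
    apply: le_trans (flatexp_linear_bound _ h0') _.
    by rewrite mulrC; apply: le_trans he; rewrite ler_pM2r// ler_norm.
  by apply: DeriveDef; [apply/cvg_ex; exists 0; exact: H|exact: cvg_lim H].
Qed.

Lemma Cn_flatexp (V : normedModType R) k q (O : set V) (f : V -> R) : open O ->
  Cn k O f -> Cn k O (fun x => flatexp q (f x)).
Proof.
have dfl q' (t : R) : differentiable (flatexp q') t.
  by apply/derivable1_diffP; have [] := is_derive_flatexp q' t.
move=> Oo; elim: k q => [|k IH] q.
  move=> fc x Ox; apply: continuous_comp; first exact: fc.
  exact: differentiable_continuous.
move=> fk; have f' := Cn_pred fk; move: fk => [df Df].
have cd x : O x -> differentiable (flatexp q \o f) x.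
  by move=> Ox; apply: differentiable_comp => //; exact: df.
split=> // v.
apply: (@Cn_ext _ _ _ _ (fun x => 'D_v f x * (flatexp q.+2 (f x) + - (q%:R * flatexp q.+1 (f x))))) => //.
  move=> x Ox; rewrite [RHS]deriveE; last exact: cd.
  rewrite (@diff_comp _ _ _ _ f (flatexp q)) //=; last exact: df.
  have dq := is_derive_flatexp q (f x).
  have E (a : R) : 'd (flatexp q) (f x) a = a * 'D_(1 : R) (flatexp q) (f x).
    by rewrite deriveE// -[in LHS](mulr1 a) -[a * 1]/(a *: (1 : R)) linearZ.
  by rewrite E (@derive_val _ _ _ _ _ _ _ dq) (deriveE v (df x Ox)).
apply: (@Cn_mul _ _ _ (fun x => 'D_v f x)) => //; first exact: Df.
apply: Cn_add => //; first exact: IH.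
by apply: Cn_opp => //; apply: Cn_mul; [by []|exact: Cn_cst|exact: IH].
Qed.

Lemma sgerm_flatexp n (f : 'rV[R]_n -> R) p : sgerm f p -> sgerm (fun x => flatexp 0 (f x)) p.
Proof. by move=> [ O Op fk]; exists O => // k; apply: Cn_flatexp => //; case: Op. Qed.

(** The norm of row vectors is the maximum norm, which is not smooth, so the bump is a function of
    the sum of squares; it still vanishes off the maximum-norm ball ([rbump_support]). *)
Definition rbump {n} (p : 'rV[R]_n) (r : R) (z : 'rV[R]_n) : R :=
  flatexp 0 (r ^+ 2 - \sum_(i < n) (z 0 i - p 0 i) ^+ 2).

Lemma rbump_smooth n (p : 'rV[R]_n) r q : sgerm (rbump p r) q.
Proof.
apply: sgerm_flatexp; apply: sgermD; first exact: sgermC.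
apply: sgermN; apply: sgerm_sum => i; rewrite /=.
have H : sgerm (fun z : 'rV[R]_n => z 0 i + - p 0 i) q.
  by apply: sgermD; [exact: sgerm_coord|exact: sgermC].
by apply: sgerm_eq (sgermM H H) => z; rewrite expr2.
Qed.

Lemma rbump_ge0 n (p : 'rV[R]_n) r z : 0 <= rbump p r z.
Proof. exact: flatexp_ge0. Qed.

Lemma rbump_center n (p : 'rV[R]_n) r : 0 < r -> 0 < rbump p r p.
Proof.
move=> r0; apply: flatexp_gt0; rewrite big1 ?subr0 ?exprn_gt0// => i _.
by rewrite subrr expr0n.
Qed.

Lemma rbump_support n (p : 'rV[R]_n) r z : 0 < r -> r <= `|z - p| -> rbump p r z = 0.
Proof.
move=> r0 rz; apply: flatexp_le0; rewrite subr_le0.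
have [i ri] : exists i, r <= `|z 0 i - p 0 i|.
  apply: contrapT => /forallNP H; move: rz; rewrite leNgt => /negP; apply.
  apply: mx_norm_ltP => // i j; rewrite ord1 !mxE ltNge; apply/negP; exact: H.
rewrite (bigD1 i)//= -[X in X <= _]addr0; apply: lerD; last first.
  by apply: sumr_ge0 => j _; rewrite sqr_ge0.
by rewrite -(real_normK (num_real (z 0 i - p 0 i))) ler_sqr ?nnegrE ?(ltW r0).
Qed.

End SmoothCalculus.

(** * Functions on manifolds with boundary *)

(** Induction over finite covers without choosing one. If [Q K] failed, the sets whose complement in
    [K] satisfies [Q] would form a proper filter, and a cluster point of it would contradict the
    local hypothesis. *)
Lemma compact_union_ind (T : topologicalType) (K : set T) (Q : set T -> Prop) :
  compact K -> Q set0 -> (forall A B, Q A -> Q B -> Q (A `|` B)) ->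
  (forall A B, A `<=` B -> Q B -> Q A) ->
  (forall x, K x -> exists2 A, nbhs x A & Q A) -> Q K.
Proof.
move=> cK Q0 QU QS QK; apply: contrapT => nQK.
pose F : set_system T := fun B => Q (K `\` B).
have FF : ProperFilter F.
  split; first by rewrite /F setD0.
  split; first by rewrite /F setDT.
  - by move=> A B FA FB; rewrite /F setDIr; exact: QU.
  - by move=> A B AB; apply: QS => x [Kx nB]; split=> // /AB.
have [|x [Kx clx]] := cK F FF; first by rewrite /F setDv.
have [A nA QA] := QK x Kx.
have [|z [nAz Az]] := clx (~` A) A _ nA; last exact: nAz.
by apply: QS QA => y [_]; exact: contrapT.
Qed.

Lemma nbhs_set_type (T : topologicalType) (A : set T) (a : set_type A) (B : set (set_type A)) :
  nbhs a B -> exists U, [/\ open U, U (set_val a) & forall b, U (set_val b) -> B b].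
Proof.
rewrite nbhsE => -[W [[U Uo UW] Wa] WB]; exists U; split=> //.
  by move: Wa; rewrite -UW.
by move=> b Ub; apply: WB; rewrite -UW.
Qed.

(** The subspace [S] is Hausdorff, expressed by ambient open sets; these may meet outside [S]. *)
Definition separated_in (T : topologicalType) (S : set T) := forall a b, S a -> S b -> a <> b ->
  exists A B, [/\ open A, open B, A a, B b & forall z, S z -> A z -> B z -> False].

Lemma hausdorff_separated (T : topologicalType) (S : set T) :
  hausdorff_space (set_type S) -> separated_in S.
Proof.
move=> hS a b Sa Sb ab; apply: contrapT => nE; apply: ab.
pose a' : set_type S := exist _ a (mem_set Sa).
pose b' : set_type S := exist _ b (mem_set Sb).
suff ab' : a' = b' by exact: (congr1 set_val ab').
apply: hS => A B /nbhs_set_type[U [Uo Ua UA]] /nbhs_set_type[V [Vo Vb VB]].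
apply: contrapT => AB0; apply: nE; exists U, V; split=> // z Sz Uz Vz; apply: AB0.
by exists (exist _ z (mem_set Sz)); split; [exact: UA|exact: VB].
Qed.

Section ManifoldTools.
Context {R : realType} {T : topologicalType} (M : @manifold R T).

(** A form of the manifold axioms that passes to an enlarged atlas ([premanifold_add]), to slices
    and to products with an interval. *)
Record premanifold : Prop := {
  pm_separated : separated_in (mset M) ;
  pm_charts : forall c, mcharts M c -> topological_chart (mset M) c ;
  pm_cover : forall x, mset M x -> exists2 c, mcharts M c & cdom c x ;
  pm_smooth : forall c c', mcharts M c -> mcharts M c' -> transition c c' }.

Local Notation "'mn' x" := (within (mset M) (nbhs x)) (at level 10, x at level 9).
Local Notation n := (mdim M).
Notation cimg c := (cmap c @` cdom c).

Section Charts.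
Context (c : @chart R T n) (tc : topological_chart (mset M) c).

Lemma cdom_mset x : cdom c x -> mset M x.
Proof. by have [ O _ ->] := tc_open tc; case. Qed.

Lemma cdom_near x : cdom c x -> \forall y \near mn x, cdom c y.
Proof.
have [ O Oo cO] := tc_open tc; rewrite cO => -[_ Ox].
rewrite near_withinE; apply: filterS (open_nbhs_nbhs (conj Oo Ox)) => y Oy My.
by split.
Qed.

Lemma within_cdom x : cdom c x -> within (cdom c) (nbhs x) = mn x.
Proof.
move=> cx; apply/seteqP; split=> P H.
  have H1 : \forall y \near x, cdom c y -> P y := H.
  have := cdom_near cx; rewrite near_withinE => H2.
  suff : \forall y \near x, mset M y -> P y by [].
  by apply: filterS2 H1 H2 => y H1 H2 My; apply: H1; exact: H2.
have H1 : \forall y \near x, mset M y -> P y := H.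
suff : \forall y \near x, cdom c y -> P y by [].
by apply: filterS H1 => y H1 cy; apply: H1; exact: cdom_mset.
Qed.

Lemma cmap_cvg x : cdom c x -> cmap c y @[y --> mn x] --> cmap c x.
Proof.
by move=> cx; rewrite -within_cdom//; have /subspace_continuousP := tc_cont tc; exact.
Qed.

Lemma cimg_cmap x : cdom c x -> cimg c (cmap c x).
Proof. by move=> cx; exists x. Qed.

Lemma cinv_cimg z : cimg c z -> cdom c (cinv c z) /\ cmap c (cinv c z) = z.
Proof. by move=> [x cx <-]; rewrite (tc_cancel tc). Qed.

Lemma chart_near (Q : set 'rV[R]_n) x : cdom c x ->
  (\forall z \near cmap c x, cimg c z -> Q z) ->
  \forall y \near mn x, cdom c y /\ Q (cmap c y).
Proof.
move=> cx /(cmap_cvg cx) H; apply: filterS2 (cdom_near cx) H => y cy Hy; split=> //.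
by apply: Hy; exact: cimg_cmap.
Qed.

Lemma near_chart (Q : set T) x : cdom c x -> (\forall y \near mn x, Q y) ->
  \forall z \near cmap c x, cimg c z ->
    [/\ Q (cinv c z), cdom c (cinv c z) & cmap c (cinv c z) = z].
Proof.
move=> cx Qx; have px := cimg_cmap cx.
have : cinv c @ within (cimg c) (nbhs (cmap c x)) --> x.
  rewrite -[X in _ --> X](tc_cancel tc cx).
  by have /subspace_continuousP := tc_inv_cont tc; exact.
move=> H0; have H1 : \forall z \near cmap c x, cimg c z ->
  mset M (cinv c z) -> Q (cinv c z) := H0 _ Qx.
apply: filterS H1 => z H1 cz; have [cz1 cz2] := cinv_cimg cz.
by split=> //; apply: H1 => //; exact: cdom_mset.
Qed.

Lemma fat_cimg x : cdom c x -> fat (cimg c) (cmap c x).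
Proof.
move=> cx; have px := cimg_cmap cx; have [] := tc_image tc px.
  exact: fat_interior.
exact: fat_boundary.
Qed.

End Charts.

Definition ext_at (c : @chart R T n) x (phi : T -> R) (g : 'rV[R]_n -> R) :=
  sgerm g (cmap c x) /\ \forall z \near cmap c x, cimg c z -> g z = phi (cinv c z).

Definition smooth_at (phi : T -> R) x :=
  forall c, mcharts M c -> cdom c x -> exists g, ext_at c x phi g.

(** A relation, since the derivative is read off some extension of [phi]; fatness of chart images
    makes [d] unique ([deriv_at_unique]). *)
Definition deriv_at (c : @chart R T n) x (phi : T -> R) v d :=
  exists2 g, ext_at c x phi g & 'D_v g (cmap c x) = d.

Context (pm : premanifold).

Lemma ext_at_center c x phi g : cdom c x -> mcharts M c -> ext_at c x phi g ->
  g (cmap c x) = phi x.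
Proof.
move=> cx Mc [_ /nbhs_singleton ->]; first by rewrite (tc_cancel (pm_charts pm Mc)).
exact: cimg_cmap.
Qed.

Lemma ext_at_eq c x phi psi g : mcharts M c -> cdom c x ->
  (\forall y \near mn x, phi y = psi y) -> ext_at c x phi g -> ext_at c x psi g.
Proof.
move=> Mc cx E [gs H]; split=> //.
have E' := near_chart (pm_charts pm Mc) cx E.
by apply: filterS2 H E' => z H E' cz; rewrite H//; have [] := E' cz.
Qed.

Lemma smooth_at_eq x phi psi :
  (\forall y \near mn x, phi y = psi y) -> smooth_at phi x -> smooth_at psi x.
Proof.
by move=> E s c Mc cx; have [g gs] := s c Mc cx; exists g; exact: ext_at_eq gs.
Qed.

Lemma transition_ext c c' x : mcharts M c -> mcharts M c' -> cdom c x -> cdom c' x ->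
  exists tau, [/\ smooth_rows tau (cmap c x), tau (cmap c x) = cmap c' x &
    \forall z \near cmap c x, cimg c z ->
      [/\ tau z = cmap c' (cinv c z), cimg c' (tau z) & cinv c' (tau z) = cinv c z]].
Proof.
move=> Mc Mc' cx c'x; have tc := pm_charts pm Mc; have tc' := pm_charts pm Mc'.
have pcx : (cmap c @` (cdom c `&` cdom c')) (cmap c x) by exists x.
have [tau /smooth_rowsP taus E] := pm_smooth pm Mc Mc' pcx.
have E' := near_chart tc cx (cdom_near tc' c'x).
have E2 : \forall z \near cmap c x, cimg c z ->
      [/\ tau z = cmap c' (cinv c z), cimg c' (tau z) & cinv c' (tau z) = cinv c z].
  apply: filterS2 E E' => z E E' cz; have [c'z cz1 cz2] := E' cz.
  have tz : tau z = cmap c' (cinv c z) by apply: E; exists (cinv c z).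
  by split=> //; rewrite tz; [exact: cimg_cmap|rewrite (tc_cancel tc')].
exists tau; split=> //.
by have [|-> _ _] := nbhs_singleton E2; [exact: cimg_cmap|rewrite (tc_cancel tc)].
Qed.

Lemma near_comp n1 n2 (tau : 'rV[R]_n1 -> 'rV[R]_n2) p (Q : set 'rV[R]_n2) :
  smooth_rows tau p -> (\forall z \near tau p, Q z) -> \forall z \near p, Q (tau z).
Proof. by move=> /smooth_rows_continuous; apply. Qed.

Lemma ext_at_transition c c' x phi g : mcharts M c -> mcharts M c' ->
  cdom c x -> cdom c' x -> ext_at c x phi g ->
  exists tau, [/\ smooth_rows tau (cmap c' x), tau (cmap c' x) = cmap c x,
    ext_at c' x phi (g \o tau) & \forall z \near cmap c' x, cimg c' z ->
      tau z = cmap c (cinv c' z)].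
Proof.
move=> Mc Mc' cx c'x [gs gE].
have [tau [taus taux tauE]] := transition_ext Mc' Mc c'x cx.
exists tau; split=> //; last by apply: filterS tauE => z H /H[].
split; first by apply: sgerm_comp => //; rewrite taux.
have H : \forall z \near tau (cmap c' x), cimg c z -> g z = phi (cinv c z) by rewrite taux.
apply: filterS2 (near_comp taus H) tauE => z H1 H2 cz.
by have [_ cz1 cz2] := H2 cz; rewrite /= H1// cz2.
Qed.

Lemma smooth_at_chart c x phi g : mcharts M c -> cdom c x -> ext_at c x phi g ->
  smooth_at phi x.
Proof.
move=> Mc cx gs c' Mc' c'x.
by have [tau [_ _ ? _]] := ext_at_transition Mc Mc' cx c'x gs; exists (g \o tau).
Qed.

Lemma smooth_at2 (op : R -> R -> R) phi psi x :
  (forall (f g : 'rV[R]_n -> R) p, sgerm f p -> sgerm g p -> sgerm (fun z => op (f z) (g z)) p) ->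
  smooth_at phi x -> smooth_at psi x -> smooth_at (fun y => op (phi y) (psi y)) x.
Proof.
move=> H s1 s2 c Mc cx; have [f [fs fE]] := s1 c Mc cx; have [g [gs gE]] := s2 c Mc cx.
exists (fun z => op (f z) (g z)); split; first exact: H.
by apply: filterS2 fE gE => z fE gE cz; rewrite fE// gE.
Qed.

Lemma smooth_atD phi psi x : smooth_at phi x -> smooth_at psi x ->
  smooth_at (fun y => phi y + psi y) x.
Proof. by apply: (smooth_at2 (op := fun a b => a + b)) => f g p; exact: sgermD. Qed.

Lemma smooth_atM phi psi x : smooth_at phi x -> smooth_at psi x ->
  smooth_at (fun y => phi y * psi y) x.
Proof. by apply: (smooth_at2 (op := fun a b => a * b)) => f g p; exact: sgermM. Qed.

Lemma smooth_atC a x : smooth_at (fun=> a) x.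
Proof. by move=> c _ _; exists (fun=> a); split; [exact: sgermC|near=> z]. Unshelve. all: by end_near. Qed.

Lemma smooth_atV phi x : phi x != 0 -> smooth_at phi x -> smooth_at (fun y => (phi y)^-1) x.
Proof.
move=> f0 s c Mc cx; have [g gE] := s c Mc cx.
have gx := ext_at_center cx Mc gE; have [gs gE'] := gE.
exists (fun z => (g z)^-1); split; first by apply: sgermV => //; rewrite gx.
by apply: filterS gE' => z H cz; rewrite H.
Qed.

Lemma smooth_at_near phi x : smooth_at phi x -> mset M x ->
  phi y @[y --> mn x] --> phi x.
Proof.
move=> s Mx; have [c Mc cx] := pm_cover pm Mx; have [g gE] := s c Mc cx.
have tc := pm_charts pm Mc.
have gx := ext_at_center cx Mc gE; have [gs gE'] := gE.
move=> A; rewrite -gx => /(sgerm_continuous gs) gA0.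
have gA : \forall z \near cmap c x, A (g z) := gA0.
have H : \forall z \near cmap c x, cimg c z -> A (phi (cinv c z)).
  by apply: filterS2 gA gE' => z gA gE' cz; rewrite -gE'.
apply: filterS (chart_near tc cx H) => y [cy].
by rewrite (tc_cancel tc).
Qed.

Lemma deriv_at_unique c x phi v d d' : mcharts M c -> cdom c x ->
  deriv_at c x phi v d -> deriv_at c x phi v d' -> d = d'.
Proof.
move=> Mc cx [g [gs gE] <-] [g' [gs' gE'] <-].
have ft := fat_cimg (pm_charts pm Mc) cx.
have dv h : sgerm h (cmap c x) -> derivable h (cmap c x) v by exact: sgerm_derivable.
have d1 : differentiable (fun z => g z - g' z) (cmap c x).
  by apply: sgerm_diff; apply: sgermD => //; exact: sgermN.
have := ft _ d1 _ v; rewrite deriveB; [|exact: dv|exact: dv].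
move=> H; apply/eqP; rewrite -subr_eq0; apply/eqP; apply: H.
by apply: filterS2 gE gE' => z gE gE' cz; rewrite gE// gE'// subrr.
Qed.

(** Chain rule for an identity known only on [P]: the difference of [k] and [h \o G] vanishes there,
    and fatness kills its derivative. *)
Lemma derive_push n1 n2 (P : set 'rV[R]_n1) (p : 'rV[R]_n1) (G : 'rV[R]_n1 -> 'rV[R]_n2)
    (h : 'rV[R]_n2 -> R) (k : 'rV[R]_n1 -> R) v : fat P p ->
  smooth_rows G p -> sgerm h (G p) -> sgerm k p ->
  (\forall z \near p, P z -> k z = h (G z)) -> 'D_v k p = 'D_('D_v G p) h (G p).
Proof.
move=> ft Gs hs ks E.
have hG : sgerm (h \o G) p by exact: sgerm_comp.
rewrite -derive_comp; [|exact: smooth_rows_diff|exact: sgerm_diff].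
have d1 : differentiable (fun z => k z - (h \o G) z) p.
  by apply: sgerm_diff; apply: sgermD => //; exact: sgermN.
have := ft _ d1 _ v; rewrite deriveB; [|exact: sgerm_derivable..].
move=> H; apply/eqP; rewrite -subr_eq0; apply/eqP; apply: H.
by apply: filterS E => z E Pz; rewrite E// subrr.
Qed.

Lemma deriv_at_transition c c' x v : mcharts M c -> mcharts M c' -> cdom c x -> cdom c' x ->
  exists w, forall phi d, deriv_at c x phi v d -> deriv_at c' x phi w d.
Proof.
move=> Mc Mc' cx c'x.
have [tau [taus taux tauE]] := transition_ext Mc Mc' cx c'x.
exists ('D_v tau (cmap c x)) => phi d [g gE <-].
have [sig [sigs sigx sE sigE]] := ext_at_transition Mc Mc' cx c'x gE.
exists (g \o sig) => //.
have [gs gE'] := gE; have tc := pm_charts pm Mc.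
have [sgs _] := sE.
rewrite -taux; symmetry.
apply: (@derive_push _ _ (cimg c) (cmap c x) tau (g \o sig) g) => //.
- exact: fat_cimg.
- by rewrite taux.
have H : \forall z \near tau (cmap c x), cimg c' z -> sig z = cmap c (cinv c' z) by rewrite taux.
apply: filterS2 (near_comp taus H) tauE => z H1 H2 cz.
have [_ c'z cz2] := H2 cz; rewrite /= H1// cz2.
by have [_ ->] := cinv_cimg tc cz.
Qed.

Definition surj_in e (c : @chart R T n) (f : 'I_e -> T -> R) x :=
  forall u : 'I_e -> R, exists v, forall i, deriv_at c x (f i) v (u i).

(** The chart may depend on [u], which matches [im_diff]; [surj_atP] moves everything into one
    chart. *)
Definition surj_at e (f : 'I_e -> T -> R) x :=
  forall u : 'I_e -> R, exists c v, [/\ mcharts M c, cdom c x & forall i, deriv_at c x (f i) v (u i)].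

Lemma surj_atP e (f : 'I_e -> T -> R) c x : mcharts M c -> cdom c x ->
  surj_at f x <-> surj_in c f x.
Proof.
move=> Mc cx; split=> H u; last by have [v] := H u; exists c, v.
have [c' [v [Mc' c'x vE]]] := H u.
by have [w wE] := deriv_at_transition v Mc' Mc c'x cx; exists w => i; apply: wE.
Qed.

Lemma deriv_at_eq c x phi psi v d : mcharts M c -> cdom c x ->
  (\forall y \near mn x, phi y = psi y) -> deriv_at c x phi v d -> deriv_at c x psi v d.
Proof. by move=> Mc cx E [g gE <-]; exists g => //; exact: ext_at_eq gE. Qed.

Lemma deriv_atD c x phi psi v d d' : deriv_at c x phi v d -> deriv_at c x psi v d' ->
  deriv_at c x (fun y => phi y + psi y) v (d + d').
Proof.
move=> [g [gs gE] <-] [g' [gs' gE'] <-]; exists (fun z => g z + g' z).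
  by split; [exact: sgermD|apply: filterS2 gE gE' => z gE gE' cz; rewrite gE// gE'].
by rewrite deriveD//; exact: sgerm_derivable.
Qed.

Lemma deriv_atM0 c x phi psi v : mcharts M c -> cdom c x ->
  smooth_at phi x -> smooth_at psi x -> phi x = 0 -> psi x = 0 ->
  deriv_at c x (fun y => phi y * psi y) v 0.
Proof.
move=> Mc cx s1 s2 p0 q0; have [g gE] := s1 c Mc cx; have [h hE] := s2 c Mc cx.
have gx := ext_at_center cx Mc gE; have hx := ext_at_center cx Mc hE.
move: gE hE => [gs gE] [hs hE]; exists (fun z => g z * h z).
  by split; [exact: sgermM|apply: filterS2 gE hE => z gE hE cz; rewrite gE// hE].
rewrite deriveM; [|exact: sgerm_derivable..].
by rewrite gx hx p0 q0 !scale0r addr0.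
Qed.

Lemma deriv_at_exists c x phi v : mcharts M c -> cdom c x -> smooth_at phi x ->
  exists d, deriv_at c x phi v d.
Proof. by move=> Mc cx s; have [g gE] := s c Mc cx; exists ('D_v g (cmap c x)), g. Qed.

(** A compact subset is closed in the manifold. The ambient space need not be Hausdorff, hence the
    argument through [pm_separated] and neighbourhoods within [mset M]. *)
Lemma compact_avoid (S : set T) y : compact S -> S `<=` mset M -> mset M y -> ~ S y ->
  \forall z \near mn y, ~ S z.
Proof.
move=> /compact_near_coveringP cS SM My nSy.
have H x : S x -> \forall x' \near x & z \near mn y, x' <> z.
  move=> Sx; have [|A [B [Ao Bo Ax By AB]]] := pm_separated pm (SM _ Sx) My.
    by move=> E; apply: nSy; rewrite -E.
  exists (A, [set z | mset M z /\ B z]) => /=.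
    split; first exact: open_nbhs_nbhs.
    suff : \forall z \near y, mset M z -> mset M z /\ B z by [].
    by apply: filterS (open_nbhs_nbhs (conj Bo By)) => z Bz Mz.
  by move=> [x' z] /= [Ax' [Mz Bz]] E; apply: (AB z) => //; rewrite -E.
have := cS _ (mn y) (fun z x' => x' <> z) (within_filter _ (nbhs_filter y)) H.
by apply: filterS => z + Sz => /(_ _ Sz).
Unshelve. all: by end_near. Qed.

(** Near a point the chart image coincides with a closed set, the whole space or a closed half
    space, so its trace on a small closed ball is closed and bounded. *)
Lemma cimg_ball_compact c x : mcharts M c -> cdom c x ->
  exists2 r0 : R, 0 < r0 & forall r, 0 <= r < r0 ->
    compact (cimg c `&` [set z | `|z - cmap c x| <= r]).
Proof.
move=> Mc cx; set p := cmap c x.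
have bc r : 0 <= r -> bounded_set [set z | `|z - p| <= r].
  move=> r0; exists (`|p| + r); split; first exact: num_real.
  move=> b br z /= zr; apply: le_trans (ltW br).
  by rewrite -[z](subrK p) addrC (le_trans (ler_normD _ _))// lerD2l.
have cb r : closed [set z | `|z - p| <= r].
  rewrite (_ : [set _ | _] = closed_ball_ Num.norm p r); first exact: closed_closed_ball_.
  by apply/funext => z; rewrite /closed_ball_ /= distrC.
have K (A : set 'rV[R]_n) : closed A -> (\forall z \near p, cimg c z <-> A z) ->
  exists2 r0 : R, 0 < r0 & forall r, 0 <= r < r0 ->
    compact (cimg c `&` [set z | `|z - p| <= r]).
  move=> Ac /near_norm[r0 r00 E]; exists r0 => // r /andP[r1 r2].
  rewrite (_ : _ `&` _ = A `&` [set z | `|z - p| <= r]).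
    apply: bounded_closed_compact; last exact: closedI.
    by have [m [mr H]] := bc r r1; exists m; split=> // b mb z [_ zr]; exact: H.
  by apply/seteqP; split=> z [H1 /= H2]; split=> //; apply/E => //; exact: le_lt_trans r2.
have [H|[i _ [H|H]]] := tc_image (pm_charts pm Mc) (cimg_cmap cx).
- apply: (K setT); first exact: closedT.
  have H' : \forall z \near p, cimg c z := H.
  by apply: filterS H' => z Pz.
- apply: (K [set z | p 0 i <= z 0 i]) => //.
  have cc : continuous ((fun z : 'rV[R]_n => z 0 i) : 'rV[R]_n -> R) by exact: coord_continuous.
  by move/continuous_closedP : cc => /(_ _ (@closed_ge R (p 0 i))).
- apply: (K [set z | z 0 i <= p 0 i]) => //.
  have cc : continuous ((fun z : 'rV[R]_n => z 0 i) : 'rV[R]_n -> R) by exact: coord_continuous.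
  by move/continuous_closedP : cc => /(_ _ (@closed_le R (p 0 i))).
Qed.

(** [rbump] in the chart, extended by 0; the extension is smooth because the compact set [S]
    carrying it is closed in the manifold. The bound 1 on coordinate distances later controls affine
    functions on the support. *)
Lemma manifold_bump c x (W : set T) : mcharts M c -> cdom c x ->
  (\forall y \near mn x, W y) ->
  exists beta : T -> R, [/\ forall y, mset M y -> smooth_at beta y,
    forall y, 0 <= beta y <= 1, 0 < beta x,
    forall y, beta y != 0 -> [/\ cdom c y, W y & `|cmap c y - cmap c x| < 1] &
    forall y, mset M y -> ~ (cdom c y /\ W y) -> \forall z \near mn y, beta z = 0].
Proof.
move=> Mc cx Wx; set p := cmap c x; have tc := pm_charts pm Mc.
have [r0 r00 cr0] := cimg_ball_compact Mc cx.
have [r1 r10 Wr1] := near_norm (near_chart tc cx Wx).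
pose r := Num.min 1 (Num.min r0 r1) / 2.
have mp : 0 < Num.min 1 (Num.min r0 r1) by rewrite !lt_min ltr01 r00.
have rp : 0 < r by rewrite divr_gt0.
have rm : r < Num.min 1 (Num.min r0 r1) by rewrite ltr_pdivrMr// ltr_pMr// ltr1n.
move: rm; rewrite !lt_min => /and3P[rl1 rr0 rr1].
pose beta y := if `[< cdom c y >] then rbump p r (cmap c y) else 0.
pose S := cinv c @` (cimg c `&` [set z | `|z - p| <= r]).
have cS : compact S.
  apply: continuous_compact; last by apply: cr0; rewrite ltW.
  by apply: continuous_subspaceW (tc_inv_cont tc) => z [].
have SM : S `<=` mset M.
  by move=> _ [z [cz _] <-]; apply: (cdom_mset tc); have [] := cinv_cimg tc cz.
have betaS y : beta y != 0 -> [/\ cdom c y, S y & `|cmap c y - p| < r].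
  rewrite /beta; case: asboolP => [cy|]; last by rewrite eqxx.
  have [ry|ry _] := leP r `|cmap c y - p|; first by rewrite rbump_support// eqxx.
  split=> //; exists (cmap c y); last exact: (tc_cancel tc).
  by split; [exact: cimg_cmap|exact: ltW].
have SW y : S y -> cdom c y /\ W y.
  move=> [z [cz /= zr] <-].
  by have [H1 H2 _] := Wr1 z (le_lt_trans zr rr1) cz.
have b0 y : mset M y -> ~ S y -> \forall z \near mn y, beta z = 0.
  move=> My nS; apply: filterS (compact_avoid cS SM My nS) => z nSz.
  by apply/eqP; apply: contraT => /betaS[].
exists beta; split.
- move=> y My; have [Sy|nS] := pselect (S y); last first.
    apply: (smooth_at_eq (phi := fun=> 0)); last exact: smooth_atC.
    by apply: filterS (b0 y My nS).
  have [cy _] := SW y Sy.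
  apply: (smooth_at_chart (c := c) (g := rbump p r)) => //; split; first exact: rbump_smooth.
  apply: filterE => z cz; rewrite /beta; have [c1 c2] := cinv_cimg tc cz.
  by rewrite asboolT// c2.
- move=> y; rewrite /beta; case: asboolP => _; last by rewrite lexx ler01.
  by rewrite rbump_ge0 flatexp_le1.
- by rewrite /beta asboolT// rbump_center.
- by move=> y /betaS[cy /SW[_ Wy] ry]; split=> //; exact: lt_trans rl1.
- by move=> y My nW; apply: b0 => // /SW.
Qed.

(* The quotients Phi i / B of pairs (B, Phi) with B > 0 are combined by adding
   numerators and denominators, so that no partition of unity is needed. *)
Lemma convex_local_to_global (I : Type) (K : set T) (Cst : T -> (I -> R) -> Prop) :
  compact K -> K `<=` mset M ->
  (forall x u v s t, 0 < s -> 0 < t -> s + t = 1 -> Cst x u -> Cst x v ->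
     Cst x (fun i => s * u i + t * v i)) ->
  (forall x, K x -> exists phi : I -> T -> R,
     \forall y \near mn x, (forall i, smooth_at (phi i) y) /\ Cst y (phi^~ y)) ->
  exists phi : I -> T -> R, forall x, K x ->
    \forall y \near mn x, (forall i, smooth_at (phi i) y) /\ Cst y (phi^~ y).
Proof.
move=> cK KM conv loc.
pose Q (A : set T) := exists B : T -> R, exists Phi : I -> T -> R,
  [/\ (forall y, mset M y -> smooth_at B y /\ forall i, smooth_at (Phi i) y),
      (forall y, 0 <= B y), (forall y i, B y = 0 -> Phi i y = 0),
      (forall y, mset M y -> 0 < B y -> Cst y (fun i => Phi i y / B y)) &
      (forall y, A y -> mset M y -> 0 < B y)].
have : Q K.
  apply: (compact_union_ind cK).
  - exists (fun=> 0), (fun _ _ => 0); split=> // [y My|y]; last by rewrite ltxx.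
    by split=> *; exact: smooth_atC.
  - move=> A A' [B [P [sB B0 P0 C BA]]] [B' [P' [sB' B0' P0' C' BA']]].
    exists (fun y => B y + B' y), (fun i y => P i y + P' i y); split.
    + move=> y My; have [h1 h2] := sB y My; have [h1' h2'] := sB' y My.
      by split=> *; exact: smooth_atD.
    + by move=> y; rewrite addr_ge0.
    + move=> y i /eqP; rewrite paddr_eq0// => /andP[/eqP b /eqP b'].
      by rewrite P0// P0'// addr0.
    + move=> y My; have := B0 y; have := B0' y.
      rewrite le_eqVlt => /predU1P[b'|b']; rewrite le_eqVlt => /predU1P[b|b] bb'.
      * by move: bb'; rewrite -b -b' addr0 ltxx.
      * have := C y My b; congr Cst; apply/funext => i.
        by rewrite -b' addr0 (P0' y i (esym b')) addr0.
      * have := C' y My b'; congr Cst; apply/funext => i.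
        by rewrite -b add0r (P0 y i (esym b)) add0r.
      * have := conv y _ _ (B y / (B y + B' y)) (B' y / (B y + B' y)) _ _ _ (C y My b) (C' y My b').
        rewrite -mulrDl divff ?gt_eqF// !divr_gt0// => /(_ isT isT erefl).
        congr Cst; apply/funext => i.
        by rewrite mulrAC [B y * _]mulrC divfK ?gt_eqF// mulrAC [B' y * _]mulrC divfK ?gt_eqF// mulrDl.
    + move=> y [/BA + My|/BA' + My] => /(_ My) b; first by rewrite ltr_wpDr.
      by rewrite ltr_wpDl.
  - move=> A A' AA' [B [P [sB B0 P0 C BA]]]; exists B, P; split=> // y /AA'; exact: BA.
  move=> x Kx; have [phi phiE] := loc x Kx; have [c Mc cx] := pm_cover pm (KM x Kx).
  have [b [sb b01 bx bW b0]] := manifold_bump Mc cx phiE.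
  exists [set y | mset M y -> 0 < b y].
    have /(_ [set t | 0 < t]) := smooth_at_near (sb x (KM x Kx)) (KM x Kx).
    by apply; exact: lt_nbhsr.
  exists b, (fun i y => b y * phi i y); split=> //.
  - move=> y My; split=> [|i]; first exact: sb.
    have [[cy [/(_ i) s _]]|nW] := pselect (cdom c y /\ ((forall i, smooth_at (phi i) y) /\ Cst y (phi^~ y))).
      by apply: smooth_atM => //; exact: sb.
    apply: (smooth_at_eq (phi := fun=> 0)); last exact: smooth_atC.
    by apply: filterS (b0 y My nW) => z ->; rewrite mul0r.
  - by move=> y; have /andP[] := b01 y.
  - by move=> y i ->; rewrite mul0r.
  - move=> y My by0; have [|_ [_ C] _] := bW y; first by rewrite gt_eqF.
    by move: C; congr Cst; apply/funext => i; rewrite mulrAC divff ?gt_eqF// mul1r.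
move=> [B [P [sB B0 P0 C BK]]]; exists (fun i y => P i y / B y) => x Kx.
have Mx := KM x Kx; have [sBx _] := sB x Mx; have Bx := BK x Kx Mx.
have H : \forall y \near mn x, 0 < B y.
  by have /(_ [set t | 0 < t]) := smooth_at_near sBx Mx; apply; exact: lt_nbhsr.
have HM : \forall y \near mn x, mset M y by exact: withinT.
apply: filterS2 H HM => y Hy My; split=> [i|]; last exact: C.
have [sBy sPy] := sB y My.
by apply: smooth_atM => //; apply: smooth_atV => //; rewrite gt_eqF.
Qed.

End ManifoldTools.

(** * Generic affine perturbations *)

Section Genericity.
Context {R : realType}.

Definition nowhere_dense (V : normedModType R) (S : set V) :=
  forall a (rho : R), 0 < rho -> exists a' (rho' : R),
    [/\ 0 < rho', `|a' - a| < rho & forall b, `|b - a'| < rho' -> ~ S b].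

Lemma nowhere_denseU (V : normedModType R) (S S' : set V) :
  nowhere_dense S -> nowhere_dense S' -> nowhere_dense (S `|` S').
Proof.
move=> nS nS' a rho rho0.
have [b [sig [sig0 ba bS]]] := nS a rho rho0.
have m0 : 0 < Num.min sig (rho - `|b - a|) by rewrite lt_min sig0 subr_gt0.
have [d [tau [tau0 + dS']]] := nS' b _ m0.
rewrite lt_min => /andP[dsig dba].
exists d, (Num.min tau (sig - `|d - b|)); split.
- by rewrite lt_min tau0 subr_gt0.
- rewrite -(subrK b d) -addrA; apply: le_lt_trans (ler_normD _ _) _.
  by rewrite -ltrBrDr.
- move=> x; rewrite lt_min => /andP[xt xs] [Sx|Sx]; last exact: dS' Sx.
  apply: bS Sx; rewrite -(subrK d x) -addrA; apply: le_lt_trans (ler_normD _ _) _.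
  by rewrite -ltrBrDr.
Qed.

Lemma nowhere_dense_sub (V : normedModType R) (S S' : set V) :
  S `<=` S' -> nowhere_dense S' -> nowhere_dense S.
Proof.
move=> SS nS a rho rho0; have [b [sig [sig0 ba bS]]] := nS a rho rho0.
by exists b, sig; split=> // x xb /SS; exact: bS.
Qed.

Lemma baire_nowhere_dense (V : completeNormedModType R) (S : nat -> set V) (eps : R) :
  0 < eps -> (forall i, nowhere_dense (S i)) ->
  exists a, `|a| < eps /\ forall i, ~ S i a.
Proof.
move=> eps0 nS.
pose D i := [set a | exists2 r : R, 0 < r & forall b, `|b - a| < r -> ~ S i b].
have DP i : open (D i) /\ dense (D i).
  split.
    rewrite openE => a [r r0 H]; apply/nbhs_ballP; exists (r / 2); first by rewrite /= divr_gt0.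
    move=> b; rewrite -ball_normE /= => ab; exists (r / 2); first by rewrite divr_gt0.
    move=> x xb; apply: H; rewrite -(subrK b x) -addrA; apply: le_lt_trans (ler_normD _ _) _.
    by rewrite [r]splitr ltrD// distrC.
  move=> U [a Ua] Uo.
  have [r r0 rU] := near_norm (open_nbhs_nbhs (conj Uo Ua)).
  have [b [s [s0 ba bS]]] := nS i a r r0.
  by exists b; split; [exact: rU|exists s].
have [||a [aB aD]] := Baire DP (O := ball (0 : V) eps).
- by exists 0; exact: ballxx.
- exact: ball_open.
exists a; split; first by move: aB; rewrite -ball_normE /= sub0r normrN.
by move=> i; have [r r0 H] := aD i I; apply: H; rewrite subrr normr0.
Qed.

Lemma pigeonhole (A B : finType) (f : A -> B) : (#|B| < #|A|)%N ->
  exists x y, x != y /\ f x = f y.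
Proof.
move=> BA; apply: contrapT => H.
have fi : injective f.
  move=> x y fxy; apply/eqP; apply: contrapT => /negP xy.
  by apply: H; exists x, y.
by have := leq_card _ fi; rewrite leqNgt BA.
Qed.

(** A nonzero vector of the left kernel, divided by an entry of largest modulus. The entry 1 later
    lets the kernel equation be solved for row [i0], with coefficients bounded by 1. *)
Lemma not_surj_covector e n (D : 'M[R]_(e, n)) :
  ~ (forall u : 'I_e -> R, exists v : 'rV[R]_n, forall i, \sum_j v 0 j * D i j = u i) ->
  exists (l : 'I_e -> R) i0, [/\ l i0 = 1, forall i, `|l i| <= 1 &
    forall j, \sum_i l i * D i j = 0].
Proof.
move=> nsurj; have /negP nf : ~ row_free D.
  move=> /row_freeP[B DB]; apply: nsurj => u; exists (B *m \col_i u i)^T => i.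
  have : (D *m (B *m \col_i u i)) i 0 = u i by rewrite mulmxA DB mul1mx mxE.
  by rewrite mxE => <-; apply: eq_bigr => j _; rewrite mxE mulrC.
rewrite -kermx_eq0 in nf; have /rowV0Pn[v /sub_kermxP vD v0] := nf.
have [i1 vi1] : exists i, v 0 i != 0.
  apply: contrapT => /forallNP H; case/eqP: v0; apply/rowP => i; rewrite mxE.
  by apply/eqP; apply: contrapT => /negP; exact: H.
have [i0 _ imax] := @arg_maxP _ _ _ i1 xpredT (fun i => `|v 0 i|) isT.
have vi0 : 0 < `|v 0 i0| by apply: lt_le_trans (imax i1 isT); rewrite normr_gt0.
have vi0' : v 0 i0 != 0 by rewrite -normr_gt0.
exists (fun i => v 0 i / v 0 i0), i0; split; first by rewrite divff.
- by move=> i; rewrite normrM normfV ler_pdivrMr// mul1r; exact: imax.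
- move=> j; have := congr1 (fun A : 'rV_n => A 0 j) vD; rewrite !mxE => vDj.
  transitivity ((\sum_i v 0 i * D i j) / v 0 i0); last by rewrite vDj mul0r.
  by rewrite mulr_suml; apply: eq_bigr => i _; rewrite mulrAC.
Qed.

(** Column [ord0] of [A] holds the constant terms, the columns [lift ord0 j] the linear part. *)
Definition aff n e (A : 'M[R]_(e, n.+1)) (i : 'I_e) (z : 'rV[R]_n) : R :=
  A i ord0 + \sum_(j < n) A i (lift ord0 j) * z 0 j.

Lemma aff_smooth n e (A : 'M[R]_(e, n.+1)) i z : sgerm (aff A i) z.
Proof.
apply: sgermD; first exact: sgermC.
by apply: sgerm_sum => j; apply: sgermM; [exact: sgermC|exact: sgerm_coord].
Qed.

Lemma derive_basis n (g : 'rV[R]_n -> R) z v : differentiable g z ->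
  'D_v g z = \sum_(j < n) v 0 j * 'D_(delta_mx 0 j) g z.
Proof.
move=> gd; rewrite deriveE// [X in 'd g z X](row_sum_coord v) linear_sum.
by apply: eq_bigr => j _; rewrite (deriveE _ gd) linearZ.
Qed.

Lemma derive_aff n e (A : 'M[R]_(e, n.+1)) i z v :
  'D_v (aff A i) z = \sum_(j < n) v 0 j * A i (lift ord0 j).
Proof.
have dc j : differentiable (fun x : 'rV[R]_n => x 0 j) z by exact: differentiable_coord.
have dm j : derivable (fun x : 'rV[R]_n => A i (lift ord0 j) * x 0 j) z v.
  by apply: diff_derivable; apply: differentiableM.
have -> : aff A i = (fun=> A i ord0) + \sum_(j < n) (fun x : 'rV[R]_n => A i (lift ord0 j) * x 0 j).
  by apply/funext => x; rewrite /aff !fctE fct_sumE.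
rewrite deriveD; [|exact: derivable_cst|exact: derivable_sum].
rewrite derive_cst add0r derive_sum//; apply: eq_bigr => j _.
rewrite deriveM//; last exact: diff_derivable.
rewrite derive_cst scaler0 addr0 (@derive_coord _ _ _ id)// derive_id.
by rewrite [LHS]mulrC.
Qed.

(** F + w a = w (F/w + a), and at a zero the derivative of [w] is multiplied by F/w + a = 0.
    Degeneracy thus becomes a condition on F/w plus an affine function, in which the parameter
    enters without a weight. *)
Lemma derive_eqn n (F w aA : 'rV[R]_n -> R) z v :
  sgerm F z -> sgerm w z -> sgerm aA z -> w z != 0 -> F z + w z * aA z = 0 ->
  'D_v (fun y => F y + w y * aA y) z =
  w z * ('D_v (fun y => F y / w y) z + 'D_v aA z).
Proof.
move=> Fs ws As w0 E.
have Gs : sgerm (fun y => F y / w y) z by apply: sgermM => //; exact: sgermV.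
have GE : F z / w z + aA z = 0.
  by apply: (mulfI w0); rewrite mulr0 mulrDr mulrCA divff// mulr1.
have wn := near_neq0 (sgerm_continuous ws) w0.
rewrite (@near_eq_derive _ _ _ _ (w * ((fun y => F y / w y) + aA))); last first.
  by apply: filterS wn => y wy; rewrite !fctE mulrDr mulrCA divff// mulr1.
have Gd := sgerm_derivable (v := v) Gs; have Ad := sgerm_derivable (v := v) As.
have wd := sgerm_derivable (v := v) ws; have GAd := derivableD Gd Ad.
have -> := deriveM wd GAd; have -> := deriveD Gd Ad.
by rewrite [X in X *: 'D_v w z]GE scale0r addr0.
Qed.

Lemma sgerm_lipschitz_family (I : finType) n (f : I -> 'rV[R]_n -> R) p :
  (forall i, sgerm (f i) p) -> exists r L : R, [/\ 0 < r, 0 <= L &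
    forall i x y, `|x - p| < r -> `|y - p| < r -> `|f i x - f i y| <= L * `|x - y|].
Proof.
move=> fs; have /choice[rL rLP] : forall i, exists rL : R * R, [/\ 0 < rL.1, 0 <= rL.2 &
    forall x y, `|x - p| < rL.1 -> `|y - p| < rL.1 -> `|f i x - f i y| <= rL.2 * `|x - y|].
  by move=> i; have [r [L H]] := sgerm_lipschitz (fs i); exists (r, L).
exists (\big[Num.min/1]_i (rL i).1), (\sum_i (rL i).2); split.
- by apply: lt_bigmin => // i _; have [] := rLP i.
- by apply: sumr_ge0 => i _; have [] := rLP i.
- move=> i x y xr yr; have [_ L0 H] := rLP i.
  have rle : \big[Num.min/1]_i (rL i).1 <= (rL i).1 by exact: bigmin_le_cond.
  apply: le_trans (H x y (lt_le_trans xr rle) (lt_le_trans yr rle)) _.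
  rewrite ler_wpM2r// (bigD1 i)//= lerDl; apply: sumr_ge0 => j _.
  by have [] := rLP j.
Qed.

Lemma truncn_close (x y : R) : 0 <= x -> 0 <= y -> Num.truncn x = Num.truncn y -> `|x - y| < 1.
Proof.
move=> x0 y0 xy; have /andP[h1 h2] := truncn_itv x0; have /andP[h3 h4] := truncn_itv y0.
move: h3 h4; rewrite -xy => h3 h4; rewrite ltr_norml -natr1 in h2 h4 *; lra.
Qed.

Lemma scale_close (x y a b : R) : 0 < a -> 0 < b ->
  `|x * a / b - y * a / b| < 1 -> `|x - y| < b / a.
Proof.
move=> a0 b0; have ab : 0 < a / b by rewrite divr_gt0.
by rewrite -!mulrA -mulrBl normrM (gtr0_norm ab) -ltr_pdivlMr// mul1r invf_div.
Qed.

Lemma norm_telescope2 (V : normedModType R) (x y z : V) :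
  `|x| <= `|x - y| + `|y - z| + `|z|.
Proof.
have {1}-> : x = (x - y) + (y - z) + z by rewrite addrA !subrK.
by apply: le_trans (ler_normD _ _) _; rewrite lerD2r ler_normD.
Qed.

Lemma norm_le_sub (a x : R) : `|x| <= `|a| + `|a - x|.
Proof. by rewrite -{1}(subKr a x) ler_normB. Qed.

Lemma mul_cancel_eighth (h x : R) : x != 0 -> h / (8 * x) * x = h / 8.
Proof. by move=> x0; field. Qed.

Lemma mul_cancel_twelfth (h x C : R) : x != 0 -> C != 0 ->
  C * (h / (12 * x * C)) * x = h / 12.
Proof. by move=> x0 C0; field; rewrite x0 C0. Qed.

Lemma nat_gap (a b : nat) : (b < a)%N -> 1 <= `|a%:R - b%:R : R|.
Proof.
by move=> ba; rewrite -natrB ?(ltnW ba)// normr_nat ler1n subn_gt0.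
Qed.

Lemma norm_sub_mul_le (a b a' b' A B C D : R) :
  `|a - a'| <= A -> `|b| <= B -> `|a'| <= C -> `|b - b'| <= D ->
  `|a * b - a' * b'| <= A * B + C * D.
Proof.
move=> h1 h2 h3 h4.
rewrite (_ : _ - _ = (a - a') * b + a' * (b - b')); last by ring.
by apply: le_trans (ler_normD _ _) _; rewrite !normrM lerD// ler_pM.
Qed.

Lemma norm_sum_le (I : finType) (f : I -> R) (B : R) :
  (forall i, `|f i| <= B) -> `|\sum_i f i| <= #|I|%:R * B.
Proof.
move=> H; apply: le_trans (ler_norm_sum _ _ _) _.
apply: (@le_trans _ _ (\sum_(i : I) B)); first by apply: ler_sum => i _.
by rewrite sumr_const mulr_natl.
Qed.

Section Covector.
Variables (e n : nat) (C q t : R) (A A' : 'M[R]_(e.+1, n.+1)) (H H' : 'I_e.+1 -> 'I_n -> R).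
Variables (l l' : 'I_e.+1 -> R) (i0 : 'I_e.+1).
Hypotheses (l1 : l i0 = 1) (l1' : l' i0 = 1) (q0 : 0 <= q) (C0 : 0 <= C) (t0 : 0 <= t).
Hypotheses (lE : forall j, \sum_i l i * (H i j + A i (lift ord0 j)) = 0)
  (lE' : forall j, \sum_i l' i * (H' i j + A' i (lift ord0 j)) = 0).
Hypotheses (ll : forall i, `|l i - l' i| <= q) (lb : forall i, `|l' i| <= 1).
Hypotheses (HC : forall i j, `|H i j| <= C) (HH : forall i j, `|H i j - H' i j| <= C * q).
Hypotheses (AC : forall i j, `|A i j| <= C)
  (AA : forall i j, i != i0 -> `|A i (lift ord0 j) - A' i (lift ord0 j)| <= t).

(** Since [l i0 = 1], the kernel equation expresses row [i0] of the linear part through [H], [l] and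
    the other rows; two such expressions are compared summand by summand. *)
Lemma covector_row_close j :
  `|A i0 (lift ord0 j) - A' i0 (lift ord0 j)| <= e.+1%:R * (3 * (C * q) + t).
Proof.
pose f i := (l i * H i j - l' i * H' i j) +
  (if i == i0 then 0 else l i * A i (lift ord0 j) - l' i * A' i (lift ord0 j)).
have -> : A i0 (lift ord0 j) - A' i0 (lift ord0 j) = - \sum_i f i.
  have := lE j; have := lE' j.
  rewrite (bigD1 i0)//= l1' mul1r => E'; rewrite (bigD1 i0)//= l1 mul1r => E.
  rewrite (bigD1 i0)//= {1}/f eqxx addr0 l1 l1' !mul1r.
  rewrite (eq_bigr (fun i => l i * (H i j + A i (lift ord0 j)) - l' i * (H' i j + A' i (lift ord0 j)))).
    by rewrite sumrB; lra.
  by move=> i /negPf ii0; rewrite /f ii0; ring.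
rewrite normrN -[e.+1 in leRHS]card_ord; apply: norm_sum_le => i.
have Cq : 0 <= C * q by rewrite mulr_ge0.
have h1 : `|l i * H i j - l' i * H' i j| <= C * q + 1 * (C * q).
  by rewrite {1}(mulrC C q); exact: norm_sub_mul_le.
rewrite /f; case: eqP => [_|/eqP ii0].
  rewrite addr0; apply: le_trans h1 _; rewrite mul1r.
  have -> : 3 * (C * q) + t = C * q + C * q + (C * q + t) by ring.
  by rewrite lerDl addr_ge0.
apply: le_trans (ler_normD _ _) _.
have h2 : `|l i * A i (lift ord0 j) - l' i * A' i (lift ord0 j)| <= C * q + 1 * t.
  by rewrite (mulrC C q); apply: norm_sub_mul_le => //; exact: AA.
apply: le_trans (lerD h1 h2) _.
by rewrite le_eqVlt; apply/orP; left; apply/eqP; ring.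
Qed.

End Covector.

Section LocalGenericity.
Variables (n e : nat) (F : 'I_e.+1 -> 'rV[R]_n -> R) (w : 'rV[R]_n -> R) (p : 'rV[R]_n).

Definition degenerate_params (r : R) : set 'M[R]_(e.+1, n.+1) :=
  [set A | exists z, [/\ `|z - p| < r, forall i, F i z + w z * aff A i z = 0 &
    ~ forall u : 'I_e.+1 -> R, exists v, forall i,
      'D_v (fun y => F i y + w y * aff A i y) z = u i]].

Let G i y := F i y / w y.
Let H i j z := 'D_(delta_mx 0 j) (G i) z.

Lemma degenerate_witness r A :
  (forall z, `|z - p| < r -> [/\ forall i, sgerm (F i) z, sgerm w z & w z != 0]) ->
  degenerate_params r A -> exists z (l : 'I_e.+1 -> R) i0,
    [/\ `|z - p| < r, forall i, G i z = - aff A i z, l i0 = 1, forall i, `|l i| <= 1 &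
    forall j, \sum_i l i * (H i j z + A i (lift ord0 j)) = 0].
Proof.
move=> good [z [zr Fz ns]]; have [Fs ws w0] := good z zr.
have Gs i : sgerm (G i) z by apply: sgermM => //; exact: sgermV.
have [|l [i0 [l1 l2 l3]]] := @not_surj_covector e.+1 n
    (\matrix_(i, j) (H i j z + A i (lift ord0 j))).
  apply: contra_not ns => S u; have [v vE] := S (fun i => u i / w z); exists v => i.
  rewrite derive_eqn//; last exact: aff_smooth.
  have := vE i; rewrite (derive_basis v (sgerm_diff (Gs i))) derive_aff -big_split/=.
  move=> E; rewrite -[RHS](divfK w0) -E mulrC; congr (_ * _); apply: eq_bigr => j _.
  by rewrite mxE mulrDr.
exists z, l, i0; split=> //.
- move=> i; apply/eqP; rewrite -addr_eq0; apply/eqP/(mulfI w0).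
  by rewrite mulr0 mulrDr /G mulrCA divff// mulr1.
- by move=> j; rewrite -[RHS](l3 j); apply: eq_bigr => i _; rewrite mxE.
Qed.

(* Counting instead of Sard's theorem. If degenerate parameters were dense near A0,
   take one close to each point of a fine grid, with its zero z and a covector l
   normalised by l i0 = 1. Given i0 and the rows of the linear part other than the
   i0-th, the n + e coordinates of (z, l) determine the n + e + 1 remaining entries
   of the parameter up to a Lipschitz error, so two grid points fall in one cell. *)
Lemma local_genericity : (forall i, sgerm (F i) p) -> sgerm w p -> w p != 0 ->
  exists2 r : R, 0 < r & nowhere_dense (degenerate_params r).
Proof.
move=> Fs ws w0.
have Gs i : sgerm (G i) p by apply: sgermM => //; exact: sgermV.
have [r1 [L1 [r10 L10 LG]]] := sgerm_lipschitz_family Gs.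
have Hs (ij : 'I_e.+1 * 'I_n) : sgerm (fun z => H ij.1 ij.2 z) p by exact: sgerm_derive.
have [r2 [L2 [r20 L20 LH]]] := sgerm_lipschitz_family Hs.
have Fn : \forall z \near p, forall i, sgerm (F i) z.
  by apply: (@filter_forall _ _ _ _ (nbhs_filter p)) => i; exact: sgerm_near.
have wn := near_neq0 (sgerm_continuous ws) w0.
have [r3 r30 good3] := near_norm (filterI (filterI Fn (sgerm_near ws)) wn).
pose r := Num.min (Num.min 1 r1) (Num.min r2 r3).
have r0 : 0 < r by rewrite !lt_min ltr01 r10 r20.
have rP z : `|z - p| < r -> [/\ `|z - p| < 1, `|z - p| < r1, `|z - p| < r2 & `|z - p| < r3].
  by rewrite !lt_min => /andP[/andP[? ?] /andP[? ?]].
have good z : `|z - p| < r -> [/\ forall i, sgerm (F i) z, sgerm w z & w z != 0].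
  by move=> /rP[_ _ _ /good3[[? ?] ?]].
exists r => // A0 rho rho0; apply: contrapT => nE.
have bad A1 t : 0 < t -> `|A1 - A0| < rho -> exists A, `|A - A1| < t /\ degenerate_params r A.
  move=> t0 A10; apply: contrapT => nB; apply: nE; exists A1, t; split=> // b bA1 Db.
  by apply: nB; exists b.
pose HP := \sum_(ij : 'I_e.+1 * 'I_n) `|H ij.1 ij.2 p|.
have HP0 : 0 <= HP by exact: sumr_ge0.
(* A common bound for the Lipschitz constants, the derivatives [H], the coordinates of the zeros,
   and the entries of all parameters within [2 * rho] of [A0]. *)
pose C := 1 + L1 + L2 + HP + `|p| + `|A0| + rho + rho.
have C1 : 1 <= C by rewrite /C; have := normr_ge0 p; have := normr_ge0 A0; lra.
have C0 : 0 < C by exact: lt_le_trans C1.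
have HC i j z : `|z - p| < r -> `|H i j z| <= C.
  move=> /rP[z1 _ z2 _]; have pp : `|p - p| < r2 by rewrite subrr normr0.
  have h1 := LH (i, j) z p z2 pp; rewrite /= in h1.
  have h2 : `|H i j p| <= HP.
    rewrite /HP (bigD1 (i, j))//= lerDl; exact: sumr_ge0.
  have h3 : L2 * `|z - p| <= L2 by rewrite ler_piMr// ltW.
  have h4 : `|H i j z| <= `|H i j z - H i j p| + `|H i j p|.
    by rewrite -{1}(subrK (H i j p) (H i j z)) ler_normD.
  by rewrite /C; have := normr_ge0 p; have := normr_ge0 A0; lra.
have zC j z : `|z - p| < r -> `|z 0 j| <= C.
  move=> /rP[z1 _ _ _]; apply: le_trans (coord_le_norm _ _ _) _.
  rewrite -(subrK p z); apply: le_trans (ler_normD _ _) _.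
  by rewrite /C; have := normr_ge0 p; have := normr_ge0 A0; lra.
pose E : R := e.+1%:R; pose N : R := n%:R.
have E1 : 1 <= E by rewrite ler1n.
have N0 : 0 <= N by rewrite ler0n.
(* Zeros and covectors are recorded up to [q = h / kappa], parameters approximated up to
   [t = h / D]; the constants keep the total errors in the last comparisons below the grid step
   [h]. *)
pose kappa := 12 * (E + N + 1) * C.
have kap0 : 0 < kappa by rewrite !mulr_gt0//; lra.
pose s := rho / 2; have s0 : 0 < s by rewrite divr_gt0.
pose c := (Num.truncn (2 * kappa / s)).+1.
have cP : 2 * kappa / s < c%:R.
  have k0 : 0 <= 2 * kappa / s by rewrite divr_ge0 ?(ltW s0)// mulr_ge0// (ltW kap0).
  by have /andP[] := truncn_itv k0.
(* There are m^((e+1)(n+1)) grid points and at most (e+1) (c+1)^(n+e) m^(n+e+en) cells. As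
   (e+1)(n+1) = n+e+en+1, any [m] above (e+1) (c+1)^(n+e) makes the points outnumber the cells. *)
pose m := (e.+1 * c.+1 ^ (n + e)).+1.
pose h := s / m%:R; have m0 : 0 < m%:R :> R by rewrite ltr0n.
have h0 : 0 < h by rewrite divr_gt0.
pose D := 8 * (E + 1 + N * C).
have D0 : 0 < D by rewrite mulr_gt0//; have := mulr_ge0 N0 (ltW C0); lra.
pose t := h / D; have t0 : 0 < t by rewrite divr_gt0.
pose q := h / kappa; have q0 : 0 < q by rewrite divr_gt0.
pose grid := {ffun 'I_e.+1 * 'I_n.+1 -> 'I_m}.
pose Ak (k : grid) := \matrix_(i, j) (A0 i j + h * (k (i, j) : nat)%:R).
have Ak0 k : `|Ak k - A0| < rho.
  apply: mx_norm_ltP => // i j; rewrite !mxE [X in `|X|]addrC addKr ger0_norm.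
    apply: (@le_lt_trans _ _ s); last by rewrite ltr_pdivrMr// ltr_pMr// ltr1n.
    by rewrite /h mulrAC ler_pdivrMr// ler_wpM2l ?(ltW s0)// ler_nat ltnW.
  by rewrite mulr_ge0// ltW.
have /choice[wit witP] : forall k : grid, exists x : 'M[R]_(e.+1, n.+1) * 'rV[R]_n * ('I_e.+1 -> R) * 'I_e.+1,
    let: (A, z, l, i0) := x in [/\ `|A - Ak k| < t, `|z - p| < r &
     [/\ forall i, G i z = - aff A i z, l i0 = 1, forall i, `|l i| <= 1 &
     forall j, \sum_i l i * (H i j z + A i (lift ord0 j)) = 0]].
  move=> k; have [A [AkA /(degenerate_witness good)[z [l [i0 [? ? ? ? ?]]]]]] := bad _ _ t0 (Ak0 k).
  by exists (A, z, l, i0).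
(* Index of the interval of length [q] that contains [x]. The coordinates of [z - p] and of [l] lie
   in [-1, 1] and are shifted by 1, so [x] ranges over [0, 2]. *)
pose idx (x : R) : 'I_(c * m).+1 := inord (Num.truncn (x * kappa / h)).
have idxP x y : 0 <= x <= 2 -> 0 <= y <= 2 -> idx x = idx y -> `|x - y| < q.
  have aux x' : 0 <= x' <= 2 -> (Num.truncn (x' * kappa / h) < (c * m).+1)%N /\ 0 <= x' * kappa / h.
    move=> /andP[x0 x2]; have xk : 0 <= x' * kappa / h.
      by rewrite divr_ge0 ?(ltW h0)// mulr_ge0// (ltW kap0).
    split=> //; rewrite ltnS -(ler_nat R); have /andP[le _] := truncn_itv xk; apply: le_trans le _.
    have -> : x' * kappa / h = (x' * kappa / s) * m%:R by rewrite /h invfM invrK mulrA.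
    rewrite natrM ler_wpM2r ?ler0n//; apply: le_trans (ltW cP).
    rewrite ler_wpM2r ?invr_ge0 ?(ltW s0)//.
    exact: (ler_wpM2r (ltW kap0)).
  by move=> /aux[x1 x2] /aux[y1 y2] /(congr1 val); rewrite /= !inordK// => /(truncn_close x2 y2) /(scale_close kap0 h0).
pose cell (k : grid) : 'I_e.+1 * {ffun 'I_n -> 'I_(c * m).+1} * {ffun 'I_e -> 'I_(c * m).+1} *
    {ffun 'I_e * 'I_n -> 'I_m} :=
  let: (A, z, l, i0) := wit k in
  (i0, [ffun j => idx (z 0 j - p 0 j + 1)], [ffun i => idx (l (lift i0 i) + 1)],
   [ffun ij => k (lift i0 ij.1, lift ord0 ij.2)]).
have [k [k' [kk' cellE]]] : exists x y, x != y /\ cell x = cell y.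
  apply: pigeonhole; rewrite !card_prod !card_ffun !card_prod !card_ord.
  have Nle : ((c * m).+1 <= c.+1 * m)%N by rewrite mulSn -add1n leq_add2r.
  have mono k : ((c * m).+1 ^ k <= (c.+1 * m) ^ k)%N by case: k => // k; rewrite leq_exp2r.
  apply: (@leq_ltn_trans (e.+1 * (c.+1 * m) ^ n * (c.+1 * m) ^ e * m ^ (e * n))).
    by apply: leq_mul => //; apply: leq_mul => //; apply: leq_mul.
  rewrite (_ : (e.+1 * _ * _ * _ = (e.+1 * c.+1 ^ (n + e)) * m ^ (n + e + e * n))%N); last first.
    by rewrite !expnMn !expnD !mulnA -!(mulnAC _ (c.+1 ^ e)%N).
  have -> : (e.+1 * n.+1 = (n + e + e * n).+1)%N by rewrite mulSn mulnS addSn addnA.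
  by rewrite expnS ltn_pmul2r ?ltnSn// expn_gt0.
case/eqP: kk'.
move: cellE (witP k) (witP k'); rewrite /cell.
case: (wit k) => [[[A z] l] i0]; case: (wit k') => [[[A' z'] l'] i0'].
move=> -[<-{i0'} zE lE kE] [AkA zr [Gz l1 lb lA]] [AkA' zr' [Gz' l1' lb' lA']].
have close1 y : `|y - p| < r -> forall j, 0 <= y 0 j - p 0 j + 1 <= 2.
  move=> /rP[x1 _ _ _] j; have := coord_le_norm (y - p) 0 j; rewrite !mxE => xj.
  by have := le_lt_trans xj x1; rewrite ltr_norml => /andP[]; lra.
have zz j : `|z 0 j - z' 0 j| < q.
  have := congr1 (fun f : {ffun _ -> _} => f j) zE; rewrite /= !ffunE => /idxP.
  rewrite !close1// => /(_ isT isT); congr (`|_| < q); lra.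
have znorm : `|z - z'| < q by apply: mx_norm_ltP => // i j; rewrite ord1 !mxE.
have ll i : `|l i - l' i| <= q.
  have [i'|] := unliftP i0 i; last by move=> ->; rewrite l1 l1' subrr normr0 ltW.
  move=> ->; have := congr1 (fun f : {ffun _ -> _} => f i') lE; rewrite /= !ffunE => /idxP.
  have l02 (x : R) : `|x| <= 1 -> 0 <= x + 1 <= 2 by rewrite ler_norml; lra.
  rewrite !l02// => /(_ isT isT) /ltW; congr (`|_| <= q); lra.
have ENC0 : 0 < E + 1 + N * C by have := mulr_ge0 N0 (ltW C0); lra.
have tE : t * (E + 1 + N * C) = h / 8 by apply: mul_cancel_eighth; rewrite gt_eqF.
have XE : C * q * (E + N + 1) = h / 12.
  apply: mul_cancel_twelfth; rewrite gt_eqF//; lra.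
have X0 : 0 <= C * q by rewrite mulr_ge0 ?ltW.
have EX0 : 0 <= C * q * (E - 1) by rewrite mulr_ge0// subr_ge0.
have NX0 : 0 <= C * q * N by rewrite mulr_ge0.
have tE0 : 0 <= t * (E - 1) by rewrite mulr_ge0 ?subr_ge0// ltW.
have tN0 : 0 <= t * (N * C) by rewrite mulr_ge0 ?(ltW t0)// mulr_ge0// (ltW C0).
have trho : t < rho.
  have : h <= s by rewrite ler_pdivrMr// ler_peMr ?ler1n// ltW.
  by rewrite /s; lra.
have ACk (k0 : grid) (B : 'M[R]_(e.+1, n.+1)) : `|B - Ak k0| < t -> forall i j, `|B i j| <= C.
  move=> Bt i j; apply: le_trans (coord_le_norm _ _ _) _.
  apply: le_trans (norm_telescope2 B (Ak k0) A0) _.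
  by have := Ak0 k0; rewrite /C; have := normr_ge0 p; lra.
have coordt (k0 : grid) (B : 'M[R]_(e.+1, n.+1)) i j : `|B - Ak k0| < t ->
    `|B i j - (A0 i j + h * (k0 (i, j) : nat)%:R)| < t.
  by move=> Bt; apply: le_lt_trans Bt; have := coord_le_norm (B - Ak k0) i j; rewrite !mxE.
have diffk i j : `|(A i j - A' i j) - h * ((k (i, j) : nat)%:R - (k' (i, j) : nat)%:R)| < 2 * t.
  have := coordt _ _ i j AkA; have := coordt _ _ i j AkA'; rewrite !ltr_norml; lra.
have keq i j B : `|A i j - A' i j| <= B -> B + 2 * t < h -> k (i, j) = k' (i, j).
  move=> AB Bh; apply/val_inj/eqP; apply: contraT => nk.
  have : 1 <= `|(k (i, j) : nat)%:R - (k' (i, j) : nat)%:R : R|.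
    case/boolP: (k (i, j) < k' (i, j))%N => [kk|].
      by rewrite distrC; exact: nat_gap.
    rewrite -leqNgt leq_eqVlt eq_sym (negPf nk) /= => kk.
    exact: nat_gap.
  rewrite -(ler_pM2l h0) mulr1 -{2}(gtr0_norm h0) -normrM => hk.
  have := diffk i j; move: (h * _) hk => x hk d.
  have : `|x| <= `|A i j - A' i j| + `|(A i j - A' i j) - x|.
    exact: norm_le_sub.
  lra.
have AAk i j : k (i, j) = k' (i, j) -> `|A i j - A' i j| <= 2 * t.
  by move=> kk; have := diffk i j; rewrite kk subrr mulr0 subr0 => /ltW.
have krow i j : i != i0 -> k (i, lift ord0 j) = k' (i, lift ord0 j).
  have [i'|] := unliftP i0 i; last by move=> ->; rewrite eqxx.
  move=> -> _; have := congr1 (fun f : {ffun _ -> _} => f (i', j)) kE.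
  by rewrite /= !ffunE.
have HH i j : `|H i j z - H i j z'| <= C * q.
  have [_ _ z2 _] := rP _ zr; have [_ _ z2' _] := rP _ zr'.
  apply: le_trans (LH (i, j) _ _ z2 z2') _; apply: ler_pM => //; last exact: ltW.
  by rewrite /C; have := normr_ge0 p; have := normr_ge0 A0; lra.
(* Rows other than [i0] coincide because [cell] records them exactly; row [i0] is then pinned down
   by the covector equation. *)
have krow0 i j : k (i, lift ord0 j) = k' (i, lift ord0 j).
  have [->|/krow//] := eqVneq i i0.
  apply: (keq _ _ (E * (3 * (C * q) + 2 * t))).
    apply: (@covector_row_close e n C q (2 * t) A A' (fun i j => H i j z) (fun i j => H i j z') l l') => //.
    - exact: ltW.
    - exact: ltW.
    - by rewrite mulr_ge0// ltW.
    - by move=> i1 j1; exact: HC.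
    - exact: ACk AkA.
    - by move=> i1 j1 /krow/AAk.
  lra.
(* The linear parts agree, so [G i z = - aff A i z] pins down the constant terms. *)
apply/ffunP => -[i j]; have [j'|] := unliftP ord0 j; first by move=> ->.
move=> ->; apply: (keq _ _ (C * q + N * (2 * t * C + C * q))); last lra.
have -> : A i ord0 - A' i ord0 = (G i z' - G i z) -
    \sum_(j < n) (A i (lift ord0 j) * z 0 j - A' i (lift ord0 j) * z' 0 j).
  by rewrite sumrB Gz Gz' /aff; lra.
have [_ z1 _ _] := rP _ zr; have [_ z1' _ _] := rP _ zr'.
apply: le_trans (ler_normB _ _) _; apply: lerD.
  rewrite distrC; apply: le_trans (LG i _ _ z1 z1') _; apply: ler_pM => //; last exact: ltW.
  by rewrite /C; have := normr_ge0 p; have := normr_ge0 A0; lra.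
rewrite /N -[n in n%:R]card_ord; apply: norm_sum_le => j'.
apply: norm_sub_mul_le; [exact: AAk|exact: zC|exact: ACk AkA' _ _|exact/ltW/zz].
Qed.

End LocalGenericity.

End Genericity.

(** Makes matrices a complete normed module, the setting of Baire's theorem. *)
HB.instance Definition _ (R : realType) m n := Complete.on 'M[R]_(m, n).

Lemma nowhere_dense0 (R : realType) (V : normedModType R) : nowhere_dense (set0 : set V).
Proof. by move=> a rho rho0; exists a, rho; split=> [//||b _ []]; rewrite subrr normr0. Qed.

Lemma local_genericity_any (R : realType) n e (F : 'I_e -> 'rV[R]_n -> R) w p :
  (forall i, sgerm (F i) p) -> sgerm w p -> w p != 0 ->
  exists2 r : R, 0 < r & nowhere_dense [set A : 'M[R]_(e, n.+1) |
    exists z, [/\ `|z - p| < r, forall i, F i z + w z * aff A i z = 0 &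
    ~ forall u : 'I_e -> R, exists v, forall i,
      'D_v (fun y => F i y + w y * aff A i y) z = u i]].
Proof.
case: e F => [|e] F Fs ws w0; last exact: (local_genericity Fs ws w0).
exists 1 => //; apply: nowhere_dense_sub (@nowhere_dense0 _ _) => A [z [_ _]].
by apply => u; exists 0 => -[].
Qed.

(** * Generic perturbations on compact subsets of manifolds *)

Section Perturbation.
Context {R : realType} {T : topologicalType} (M : @manifold R T) (pm : premanifold M).
Local Notation "'mn' x" := (within (mset M) (nbhs x)) (at level 10, x at level 9).
Local Notation n := (mdim M).
Local Notation cimg c := (cmap c @` cdom c).

(** [b] bounds the coordinates on the support, hence an affine function there by the size of its
    parameter ([affine_bump_le]). *)
Record bump_in (c : @chart R T n) (beta : T -> R) (b : R) : Prop := {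
  bi_chart : mcharts M c ;
  bi_smooth : forall y, mset M y -> smooth_at M beta y ;
  bi_01 : forall y, 0 <= beta y <= 1 ;
  bi_dom : forall y, beta y != 0 -> cdom c y /\ `|cmap c y| <= b ;
  bi_out : forall y, mset M y -> ~ cdom c y -> \forall z \near mn y, beta z = 0 }.

Section OneStep.
Context (e : nat) (c : @chart R T n) (beta : T -> R) (b : R) (bi : bump_in c beta b).

(* With beta ^+ 2 in place of beta, the differential vanishes where beta does, so
   surjectivity of the differential there is unaffected. *)
Definition affine_bump (A : 'M[R]_(e, n.+1)) (i : 'I_e) (y : T) : R :=
  beta y * (beta y * aff A i (cmap c y)).

Let Mc := bi_chart bi.
Let tc := pm_charts pm Mc.

Lemma ext_aff A (i : 'I_e) y : cdom c y -> ext_at c y (fun y => aff A i (cmap c y)) (aff A i).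
Proof.
move=> cy; split; first exact: aff_smooth.
by apply: filterE => z cz; have [_ ->] := cinv_cimg tc cz.
Qed.

Lemma bump_aff_smooth A (i : 'I_e) y : mset M y ->
  smooth_at M (fun y => beta y * aff A i (cmap c y)) y.
Proof.
move=> My; have [cy|ncy] := pselect (cdom c y).
  apply: smooth_atM => //; first exact: (bi_smooth bi).
  exact: (smooth_at_chart pm Mc cy (ext_aff A i cy)).
apply: (smooth_at_eq pm (phi := fun=> 0)); last exact: smooth_atC.
by apply: filterS (bi_out bi My ncy) => z ->; rewrite mul0r.
Qed.

Lemma affine_bump_smooth A (i : 'I_e) y : mset M y -> smooth_at M (affine_bump A i) y.
Proof.
move=> My; apply: smooth_atM => //; first exact: (bi_smooth bi).
exact: bump_aff_smooth.
Qed.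

Lemma affine_bump_le A (i : 'I_e) y : `|affine_bump A i y| <= `|A| * (1 + n%:R * `|b|).
Proof.
rewrite /affine_bump; have /andP[b0 b1] := bi_01 bi y.
have r0 : 0 <= `|A| * (1 + n%:R * `|b|) by rewrite mulr_ge0// addr_ge0// mulr_ge0.
have [->|/(bi_dom bi)[cy yb]] := eqVneq (beta y) 0; first by rewrite mul0r normr0.
rewrite !normrM ger0_norm//; apply: (@le_trans _ _ `|aff A i (cmap c y)|).
  by rewrite mulrA ler_piMl// mulr_ile1.
rewrite /aff mulrDr mulr1; apply: le_trans (ler_normD _ _) _; apply: lerD.
  exact: coord_le_norm.
rewrite mulrCA -[n in n%:R]card_ord; apply: norm_sum_le => j.
rewrite normrM ler_pM//; first exact: coord_le_norm.
by apply: le_trans (coord_le_norm _ _ _) _; exact: le_trans yb (ler_norm _).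
Qed.

Lemma affine_bump_surj0 (F : 'I_e -> T -> R) A x : mset M x -> beta x = 0 ->
  surj_at M F x -> surj_at M (fun i y => F i y + affine_bump A i y) x.
Proof.
move=> Mx bx S u; have [c' [v [Mc' c'x vE]]] := S u.
exists c', v; split=> // i; rewrite -[u i]addr0; apply: deriv_atD; first exact: vE.
apply: (deriv_atM0 pm) => //; [exact: (bi_smooth bi)|exact: bump_aff_smooth|].
by rewrite bx mul0r.
Qed.

Context (K : set T) (cK : compact K) (KM : K `<=` mset M).
Context (F : 'I_e -> T -> R).
Hypothesis FK : forall x, K x -> forall i, \forall y \near mn x, smooth_at M (F i) y.

(** The threshold [s] keeps the weight beta^2 away from 0, so that [local_genericity_any] applies
    near every relevant point; the values s = 1/(k+1) together exhaust the region where beta is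
    positive. *)
Definition bad_params (s : R) (S : set T) : set 'M[R]_(e, n.+1) :=
  [set A | exists y, [/\ S y, mset M y, s <= beta y,
     forall i, F i y + affine_bump A i y = 0 &
     ~ surj_at M (fun i y => F i y + affine_bump A i y) y]].

Lemma bad_params_local s x : 0 < s -> K x ->
  exists2 S, nbhs x S & nowhere_dense (bad_params s S).
Proof.
move=> s0 Kx; have Mx := KM Kx; have sbx := bi_smooth bi Mx.
have [bx|bx] := ltP (beta x) s.
  exists [set y | mset M y -> beta y < s].
    by have /(_ [set t | t < s]) := smooth_at_near pm sbx Mx; apply; exact: lt_nbhsl.
  apply: nowhere_dense_sub (@nowhere_dense0 _ _) => A [y [H My sy _ _]].
  by have := H My; rewrite ltNge sy.
have bx0 : beta x != 0 by rewrite gt_eqF// (lt_le_trans s0).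
have [cx _] := bi_dom bi bx0.
have Fx i : exists g, ext_at c x (F i) g.
  have := FK Kx i; rewrite near_withinE => /nbhs_singleton /(_ Mx) sF.
  exact: (sF c Mc cx).
have /choice[Ft FtE] := Fx; have [bt btE] := sbx c Mc cx.
have bt0 : bt (cmap c x) = beta x := ext_at_center pm cx Mc btE.
have interior (Q : set 'rV[R]_n) (p : 'rV[R]_n) : (\forall z \near p, Q z) -> \forall q \near p, \forall z \near q, Q z.
  by move=> H; exact: (nbhs_interior H).
have En : \forall z \near cmap c x, [/\ forall i, sgerm (Ft i) z, sgerm bt z,
    forall i, \forall q \near z, cimg c q -> Ft i q = F i (cinv c q) &
    \forall q \near z, cimg c q -> bt q = beta (cinv c q)].
  have E1 : \forall z \near cmap c x, forall i, sgerm (Ft i) z.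
    apply: (@filter_forall _ _ _ _ (nbhs_filter (cmap c x))) => i.
    by apply: sgerm_near; have [] := FtE i.
  have E2 : \forall z \near cmap c x, forall i, \forall q \near z, cimg c q -> Ft i q = F i (cinv c q).
    apply: (@filter_forall _ _ _ _ (nbhs_filter (cmap c x))) => i.
    by apply: interior; have [] := FtE i.
  have [/sgerm_near E3 /interior E4] := btE.
  by apply: filterS (filterI (filterI E1 E2) (filterI E3 E4)) => z [[? ?] [? ?]].
have [r1 r10 Er1] := near_norm En.
have [r r0 nd] : exists2 r : R, 0 < r & nowhere_dense [set A : 'M[R]_(e, n.+1) |
    exists z, [/\ `|z - cmap c x| < r, forall i, Ft i z + (bt z * bt z) * aff A i z = 0 &
    ~ forall u : 'I_e -> R, exists v, forall i,
      'D_v (fun y => Ft i y + (bt y * bt y) * aff A i y) z = u i]].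
  have Fts i : sgerm (Ft i) (cmap c x) by have [] := FtE i.
  have bts : sgerm (fun z => bt z * bt z) (cmap c x) by have [bts _] := btE; exact: sgermM.
  have bb0 : bt (cmap c x) * bt (cmap c x) != 0 by rewrite bt0 mulf_neq0.
  exact: local_genericity_any.
have m0 : 0 < Num.min r r1 by rewrite lt_min r0.
have near_r : \forall z \near cmap c x, cimg c z -> `|z - cmap c x| < Num.min r r1.
  apply/nbhs_ballP; exists (Num.min r r1) => // z.
  by rewrite -ball_normE /= distrC.
have Sx := chart_near tc cx near_r.
exists [set y | mset M y -> cdom c y /\ `|cmap c y - cmap c x| < Num.min r r1]; first exact: Sx.
apply: nowhere_dense_sub nd => A [y [+ My sy zy nsy]] => /(_ My)[cy].
rewrite lt_min => /andP[yr yr1]; have [Fts bts FtN btN] := Er1 _ yr1.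
have gE i : ext_at c y (fun y => F i y + affine_bump A i y)
    (fun z => Ft i z + (bt z * bt z) * aff A i z).
  split; first by apply: sgermD => //; apply: sgermM; [exact: sgermM|exact: aff_smooth].
  apply: filterS2 (FtN i) btN => z H1 H2 cz; rewrite H1// H2//.
  by rewrite /affine_bump mulrA; have [_ ->] := cinv_cimg tc cz.
exists (cmap c y); split=> //.
  by move=> i; rewrite (ext_at_center pm cy Mc (gE i)).
apply: contra_not nsy => S; apply/(surj_atP pm _ Mc cy) => u.
by have [v vE] := S u; exists v => i; exists (fun z => Ft i z + (bt z * bt z) * aff A i z).
Qed.

Lemma bad_params_nowhere_dense s : 0 < s -> nowhere_dense (bad_params s K).
Proof.
move=> s0; apply: (compact_union_ind cK (Q := fun S => nowhere_dense (bad_params s S))).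
- by apply: nowhere_dense_sub (@nowhere_dense0 _ _) => A [y []].
- move=> S S' /nowhere_denseU H /H; apply: nowhere_dense_sub => A [y [[Sy|Sy] ? ? ? ?]].
    by left; exists y.
  by right; exists y.
- by move=> S S' SS; apply: nowhere_dense_sub => A [y [/SS ? ? ? ? ?]]; exists y.
- by move=> x Kx; exact: bad_params_local.
Qed.

Lemma affine_bump_generic eps : 0 < eps -> exists A : 'M[R]_(e, n.+1),
  (forall i y, `|affine_bump A i y| <= eps) /\
  forall x, K x -> 0 < beta x -> (forall i, F i x + affine_bump A i x = 0) ->
    surj_at M (fun i y => F i y + affine_bump A i y) x.
Proof.
move=> eps0; have b0 : 0 < 1 + n%:R * `|b| by rewrite ltr_pwDl// mulr_ge0.
have [|k|A [Aeps Abad]] := @baire_nowhere_dense R 'M[R]_(e, n.+1)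
    (fun k => bad_params k.+1%:R^-1 K) (eps / (1 + n%:R * `|b|)).
- by rewrite divr_gt0.
- by apply: bad_params_nowhere_dense; rewrite invr_gt0.
exists A; split=> [i y|x Kx bx zx].
  by apply: le_trans (affine_bump_le _ _ _) _; rewrite -ler_pdivlMr// ltW.
(* With k the integer part of 1 / beta x, the threshold 1/(k+1) is at most beta x. *)
apply: contrapT => ns; apply: (Abad (Num.truncn (beta x)^-1)); exists x; split=> //.
  exact: KM.
rewrite -[leRHS]invrK lef_pV2 ?posrE ?invr_gt0//.
have b1 : 0 <= (beta x)^-1 by rewrite invr_ge0 ltW.
by have /andP[_ /ltW] := truncn_itv b1.
Qed.

End OneStep.

Section MultiStep.
Context (e : nat) (K : set T) (cK : compact K) (KM : K `<=` mset M).

Definition bumps := seq (@chart R T n * (T -> R) * R).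
Fixpoint bumps_ok (l : bumps) : Prop :=
  if l is b :: l' then bump_in b.1.1 b.1.2 b.2 /\ bumps_ok l' else True.
Fixpoint bumps_pos (l : bumps) (x : T) : Prop :=
  if l is b :: l' then 0 < b.1.2 x \/ bumps_pos l' x else False.

(** The bumps are used one after the other, each parameter being generic for the sum obtained so
    far. Where the new bump is positive this gives surjectivity; where it vanishes the differential
    is that of the previous sum. *)
Lemma bumps_perturbation (l : bumps) (F : 'I_e -> T -> R) eps : bumps_ok l -> 0 < eps ->
  (forall x, K x -> forall i, \forall y \near mn x, smooth_at M (F i) y) ->
  exists g : 'I_e -> T -> R, [/\ forall i y, mset M y -> smooth_at M (g i) y,
    forall i y, `|g i y| <= eps, forall i y, ~ bumps_pos l y -> g i y = 0 &
    forall x, K x -> (forall i, F i x + g i x = 0) ->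
      bumps_pos l x \/ surj_at M F x -> surj_at M (fun i y => F i y + g i y) x].
Proof.
elim: l eps => [|b l IH] eps /=.
  move=> _ eps0 Fs; exists (fun _ _ => 0); split=> //.
  - by move=> *; exact: smooth_atC.
  - by move=> *; rewrite normr0 ltW.
  - move=> x _ _ [//|]; congr surj_at; apply/funext => i; apply/funext => y.
    by rewrite addr0.
move=> [bok lok] eps0 Fs; have eps20 : 0 < eps / 2 by rewrite divr_gt0.
have [g [gs ge g0 gS]] := IH _ lok eps20 Fs.
have F's x : K x -> forall i, \forall y \near mn x, smooth_at M (fun y => F i y + g i y) y.
  move=> Kx i; have HM : \forall y \near mn x, mset M y by exact: withinT.
  by apply: filterS2 (Fs x Kx i) HM => y H My; apply: smooth_atD => //; exact: gs.
have [A [Ae AS]] := affine_bump_generic bok cK KM F's eps20.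
have addE : (fun i y => F i y + (g i y + affine_bump b.1.1 b.1.2 A i y)) =
    (fun i y => F i y + g i y + affine_bump b.1.1 b.1.2 A i y).
  by apply/funext => i; apply/funext => y; rewrite addrA.
exists (fun i y => g i y + affine_bump b.1.1 b.1.2 A i y); split.
- by move=> i y My; apply: smooth_atD => //; [exact: gs|exact: affine_bump_smooth bok _ _ _ _].
- move=> i y; apply: le_trans (ler_normD _ _) _.
  by rewrite [eps]splitr lerD.
- move=> i y np; rewrite g0 ?add0r; last by move=> H; apply: np; right.
  have /andP[b0 _] := bi_01 bok y.
  rewrite /affine_bump; have -> : b.1.2 y = 0; last by rewrite mul0r.
  by apply/eqP; move: b0; rewrite le_eqVlt eq_sym => /predU1P[->//|bp]; case: np; left.
- move=> x Kx; rewrite addE => zx H.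
  have zx' i : F i x + g i x + affine_bump b.1.1 b.1.2 A i x = 0 by rewrite -addrA.
  have [bp|bn] := ltP 0 (b.1.2 x); first exact: AS.
  have bx0 : b.1.2 x = 0 by apply/eqP; rewrite eq_le bn; have /andP[] := bi_01 bok x.
  apply: (affine_bump_surj0 bok) => //; first exact: KM.
  apply: gS => // [i|]; last by move: H; rewrite bx0 ltxx => -[[//|]|]; [left|right].
  by have := zx' i; rewrite /affine_bump bx0 mul0r addr0.
Qed.

(** [Z0] is where the perturbation must vanish, [Z1] where zeros are already known to be transverse.
    A point of [K] that is not interior to [Z1] has a neighbourhood missing [Z0], which leaves room
    for a bump. *)
Lemma generic_perturbation (F : 'I_e -> T -> R) (Z0 Z1 : set T) eps : 0 < eps ->
  (forall x, K x -> forall i, \forall y \near mn x, smooth_at M (F i) y) ->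
  (forall x, K x -> Z1 x -> (forall i, F i x = 0) -> surj_at M F x) ->
  (forall x, K x -> (\forall y \near mn x, Z1 y) \/ (\forall y \near mn x, ~ Z0 y)) ->
  exists g : 'I_e -> T -> R, [/\ forall i y, mset M y -> smooth_at M (g i) y,
    forall i y, `|g i y| <= eps, forall i y, Z0 y -> g i y = 0 &
    forall x, K x -> (forall i, F i x + g i x = 0) ->
      surj_at M (fun i y => F i y + g i y) x].
Proof.
move=> eps0 Fs FS Zalt.
pose Q (S : set T) := exists l, [/\ bumps_ok l, forall y, Z0 y -> ~ bumps_pos l y &
  forall y, S y -> mset M y -> Z1 y \/ bumps_pos l y].
have : Q (K `\` Z1).
  suff : Q K by move=> [l [? ? H]]; exists l; split=> // y [Ky _]; exact: H.
  apply: (compact_union_ind cK).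
  - by exists [::]; split=> // y _ [].
  - move=> S S' [l [lok l0 lS]] [l' [lok' l0' lS']]; exists (l ++ l').
    have posE x : bumps_pos (l ++ l') x <-> bumps_pos l x \/ bumps_pos l' x.
      elim: (l) => [|a k IH] /=; first by split=> [|[]] //; right.
      by rewrite IH; tauto.
    split.
    + by elim: (l) lok => [|a k IH] //= [? ?]; split=> //; exact: IH.
    + by move=> y Zy /posE[]; [exact: l0|exact: l0'].
    + move=> y [Sy|Sy] My; [have [] := lS y Sy My|have [] := lS' y Sy My]; try by left.
        by move=> H; right; apply/posE; left.
      by move=> H; right; apply/posE; right.
  - by move=> S S' SS [l [? ? H]]; exists l; split=> // y /SS; exact: H.
  move=> x Kx; have Mx := KM Kx; have [Z1x|nZ0] := Zalt x Kx.
    exists [set y | mset M y -> Z1 y]; first exact: Z1x.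
    by exists [::]; split=> // [y _ []|y Ay My]; left; exact: Ay.
  have [c Mc cx] := pm_cover pm Mx.
  have [beta [bs b01 bx bW b0]] := manifold_bump pm Mc cx nZ0.
  exists [set y | mset M y -> 0 < beta y].
    have /(_ [set t | 0 < t]) := smooth_at_near pm (bs x Mx) Mx.
    by apply; exact: lt_nbhsr.
  exists [:: (c, beta, `|cmap c x| + 1)]; split.
  - split=> //; split=> //= y.
      move=> /bW[cy _ yx]; split=> //; rewrite -(subrK (cmap c x) (cmap c y)).
      by rewrite addrC (le_trans (ler_normD _ _))// lerD2l ltW.
    by move=> My ncy; apply: b0 => // -[].
  - move=> y Zy /= [by0|//]; have [|_ nZ _] := bW y; first by rewrite gt_eqF.
    exact: nZ.
  - by move=> y H My; right; left; exact: H.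
move=> [l [lok l0 lp]].
have [g [gs ge g0 gS]] := bumps_perturbation lok eps0 Fs.
exists g; split=> // [i y /l0|x Kx zx]; first exact: g0.
(* A zero in [Z1] at which no bump is positive has [g = 0], so it is a zero of [F] and [FS]
   applies. *)
apply: gS => //; have [Z1x|nZ] := pselect (Z1 x).
  have [px|npx] := pselect (bumps_pos l x); [by left|right].
  by apply: FS => // i; have := zx i; rewrite g0// addr0.
by left; have [] := lp x (conj Kx nZ) (KM Kx).
Qed.

End MultiStep.
End Perturbation.

(** * Coordinates on obstruction spaces *)

Section Coordinates.
Context {R : realType} {O : obst R}.
Implicit Types (I J H L : Index O).

(** Coordinates are taken factor by factor, so that the image of [phihat] is a coordinate subspace
    ([range_coiP]). *)
Definition cidx I : finType := {i : elt I & 'I_(dim (oE (sval i)))}.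
Definition edim I := #|cidx I|.
Definition coi I (k : 'I_(edim I)) (e : oEI I) : R :=
  v2r (e (tag (enum_val k))) 0 (tagged (enum_val k)).
Definition mki I (u : 'I_(edim I) -> R) : oEI I :=
  fun i => r2v (\row_l u (enum_rank (Tagged (fun i : elt I => 'I_(dim (oE (sval i)))) l))).

Lemma mkiE I (u : 'I_(edim I) -> R) i l :
  v2r (mki u i) 0 l = u (enum_rank (Tagged (fun i : elt I => 'I_(dim (oE (sval i)))) l)).
Proof. by rewrite /mki r2vK mxE. Qed.

Lemma coi_mki I (u : 'I_(edim I) -> R) k : coi k (mki u) = u k.
Proof.
by rewrite /coi mkiE; congr u; rewrite -[RHS]enum_valK; congr enum_rank; case: (enum_val k).
Qed.

Lemma coi_val I (e : oEI I) i l :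
  v2r (e i) 0 l = coi (enum_rank (Tagged (fun i : elt I => 'I_(dim (oE (sval i)))) l)) e.
Proof. by rewrite /coi enum_rankK. Qed.

Lemma oEI_ext I (e e' : oEI I) : (forall i, e i = e' i) -> e = e'.
Proof. exact: functional_extensionality_dep. Qed.

Lemma coi_inj I (e e' : oEI I) : (forall k, coi k e = coi k e') -> e = e'.
Proof.
move=> H; apply: oEI_ext => i; apply: (can_inj v2rK); apply/rowP => l.
by rewrite !coi_val H.
Qed.

Lemma mki_coi I (e : oEI I) : mki (fun k => coi k e) = e.
Proof. by apply: coi_inj => k; rewrite coi_mki. Qed.

Lemma coi_add I (e e' : oEI I) k : coi k (eadd e e') = coi k e + coi k e'.
Proof. by rewrite /coi /eadd linearD mxE. Qed.

Lemma coi_scale I a (e : oEI I) k : coi k (escale a e) = a * coi k e.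
Proof. by rewrite /coi /escale linearZ mxE. Qed.

Lemma coi0 I k : coi k (e0 : oEI I) = 0.
Proof. by rewrite /coi /e0 linear0 mxE. Qed.

Lemma phihat_in I J (e : oEI I) (j : elt J) (h : sval j \in I) :
  phihat (J := J) e j = e (exist _ (sval j) h).
Proof.
rewrite /phihat /transfer; case: {-}_ / idP => [h'|nh]; last by case: nh.
by rewrite (bool_irrelevance h' h).
Qed.

Lemma phihat_out I J (e : oEI I) (j : elt J) : sval j \notin I -> phihat (J := J) e j = 0.
Proof. by rewrite /phihat /transfer => /negP nh; case: {-}_ / idP. Qed.

Lemma phihat_id I (e : oEI I) : phihat (J := I) e = e.
Proof.
apply: oEI_ext => -[j jI] /=; rewrite (phihat_in e (j := exist _ j jI) jI) /=.
by [].
Qed.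

Lemma phihat_comp I J L (e : oEI I) : I \subset J ->
  phihat (J := L) (phihat (J := J) e) = phihat (J := L) e.
Proof.
move=> IJ; apply: oEI_ext => j; have [jI|jI] := boolP (sval j \in I).
  have jJ : sval j \in J by exact: (fintype.subsetP IJ).
  by rewrite (phihat_in _ jJ) (phihat_in _ jI) (phihat_in (j := exist _ (sval j) jJ) _ jI).
rewrite [RHS]phihat_out//; have [jJ|jJ] := boolP (sval j \in J); last by rewrite phihat_out.
by rewrite (phihat_in _ jJ) phihat_out.
Qed.

Lemma phihat_add I J (e e' : oEI I) :
  phihat (J := J) (eadd e e') = eadd (phihat e) (phihat e').
Proof.
apply: oEI_ext => j; rewrite /eadd; have [jI|jI] := boolP (sval j \in I).
  by rewrite !(phihat_in _ jI).
by rewrite !phihat_out// addr0.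
Qed.

Lemma phihat0 I J : phihat (J := J) (e0 : oEI I) = e0.
Proof.
apply: oEI_ext => j; have [jI|jI] := boolP (sval j \in I).
  by rewrite (phihat_in _ jI).
by rewrite phihat_out.
Qed.

Lemma range_phihatP I J (e : oEI J) :
  range (phihat (I := I) (J := J)) e <-> forall j, sval j \notin I -> e j = 0.
Proof.
split=> [[f _ <-] j jI|H]; first exact: phihat_out.
exists (phihat (J := I) e) => //; apply: oEI_ext => j.
have [jI|jI] := boolP (sval j \in I); last by rewrite phihat_out// H.
rewrite (phihat_in _ jI); case: j jI => j jJ /= jI.
by rewrite (phihat_in (j := exist _ j jI) _ jJ).
Qed.

Lemma range_phihat_sub I J L (e : oEI L) : I \subset J ->
  range (phihat (I := I) (J := L)) e -> range (phihat (I := J) (J := L)) e.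
Proof.
move=> IJ /range_phihatP H; apply/range_phihatP => j jJ; apply: H.
by apply: contra jJ; exact: (fintype.subsetP IJ).
Qed.

Lemma phihat_inj I J (e e' : oEI I) : I \subset J ->
  phihat (J := J) e = phihat (J := J) e' -> e = e'.
Proof.
move=> IJ E; rewrite -(phihat_id e) -(phihat_id e') -(phihat_comp _ e IJ).
by rewrite E phihat_comp.
Qed.

Definition out_coord I J (k : 'I_(edim J)) := sval (tag (enum_val k)) \notin I.

Lemma range_coiP I J (e : oEI J) :
  range (phihat (I := I) (J := J)) e <-> forall k, out_coord I k -> coi k e = 0.
Proof.
rewrite range_phihatP; split=> [H k /H E|H j jI]; first by rewrite /coi E linear0 mxE.
apply: (can_inj v2rK); apply/rowP => l; rewrite coi_val H ?linear0 ?mxE//.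
by rewrite /out_coord enum_rankK.
Qed.

Section Norm.
Context (nrm : forall i, oE (o := O) i -> R) (en : equivariant_norms nrm).

Lemma nrm0 i : nrm (0 : oE i) = 0.
Proof. by rewrite -(scale0r (0 : oE i)) (en_scale en) normr0 mul0r. Qed.

Lemma nrmN i (e : oE i) : nrm (- e) = nrm e.
Proof. by rewrite -scaleN1r (en_scale en) normrN1 mul1r. Qed.

Lemma nrm_ge0 i (e : oE i) : 0 <= nrm e.
Proof.
have := en_triangle en e (- e); rewrite subrr nrm0 nrmN => H.
by lra.
Qed.

Lemma normI_ge0 I (e : oEI I) : 0 <= normI nrm e.
Proof. by apply: bigmax_ge_id. Qed.

Lemma normI_leP I (e : oEI I) r : 0 <= r -> (forall i, nrm (e i) <= r) -> normI nrm e <= r.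
Proof. by move=> r0 H; apply: bigmax_le. Qed.

Lemma le_normI I (e : oEI I) i : nrm (e i) <= normI nrm e.
Proof. exact: (@le_bigmax _ _ _ 0 (fun i => nrm (e i)) i). Qed.

Lemma normI_add I (e e' : oEI I) : normI nrm (eadd e e') <= normI nrm e + normI nrm e'.
Proof.
apply: normI_leP => [|i]; first by rewrite addr_ge0 ?normI_ge0.
by apply: le_trans (en_triangle en _ _) _; rewrite lerD ?le_normI.
Qed.

Lemma normI_scale I a (e : oEI I) : normI nrm (escale a e) <= `|a| * normI nrm e.
Proof.
apply: normI_leP => [|i]; first by rewrite mulr_ge0 ?normI_ge0.
by rewrite (en_scale en) ler_wpM2l ?le_normI.
Qed.

Lemma normI_phihat I J (e : oEI I) : normI nrm (phihat (J := J) e) <= normI nrm e.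
Proof.
apply: normI_leP => [|j]; first exact: normI_ge0.
have [jI|jI] := boolP (sval j \in I); last by rewrite phihat_out// nrm0 normI_ge0.
rewrite (phihat_in _ jI); exact: (le_normI e (exist _ (sval j) jI)).
Qed.

Lemma normI0 I : normI nrm (e0 : oEI I) = 0.
Proof.
by apply/eqP; rewrite eq_le normI_ge0 andbT; apply: normI_leP => // i; rewrite nrm0.
Qed.

(** Turns coordinate bounds, as produced by [generic_perturbation], into bounds for the given norm;
    [B] is built from the norms of basis vectors. *)
Lemma normI_mki I : exists2 B, 0 < B & forall (u : 'I_(edim I) -> R) eps, 0 <= eps ->
  (forall k, `|u k| <= eps) -> normI nrm (mki u) <= B * eps.
Proof.
pose B (i : elt I) := \sum_(l < dim (oE (sval i))) nrm (r2v (delta_mx 0 l) : oE (sval i)).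
have B0 i : 0 <= B i by apply: sumr_ge0 => l _; exact: nrm_ge0.
have BS0 : 0 <= \sum_(i : elt I) B i by exact: sumr_ge0.
exists (1 + \sum_(i : elt I) B i); first by rewrite ltr_pwDl.
move=> u eps eps0 ue; apply: normI_leP => [|i]; first by rewrite mulr_ge0// addr_ge0.
apply: (@le_trans _ _ (B i * eps)); last first.
  rewrite ler_wpM2r// (bigD1 i)//= addrCA lerDl addr_ge0// sumr_ge0//.
rewrite /mki [X in nrm (r2v X)]row_sum_delta linear_sum mulr_suml.
have nrm_sum (J : Type) (r : seq J) (f : J -> oE (sval i)) :
    nrm (\sum_(j <- r) f j) <= \sum_(j <- r) nrm (f j).
  elim: r => [|j r IH]; first by rewrite !big_nil nrm0.
  by rewrite !big_cons; apply: le_trans (en_triangle en _ _) _; rewrite lerD2l.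
apply: le_trans (nrm_sum _ _ _) _; apply: ler_sum => l _.
by rewrite linearZ (en_scale en) mxE mulrC ler_wpM2l ?nrm_ge0.
Qed.

End Norm.
End Coordinates.

Section Bridge.
Context {R : realType} {O : obst R} {T : topologicalType} (M : @manifold R T) (pm : premanifold M).
Context {I : Index O}.
Implicit Types (A : set T) (f : T -> oEI I).
Local Notation "'mn' x" := (within (mset M) (nbhs x)) (at level 10, x at level 9).
Local Notation n := (mdim M).
Local Notation cimg c := (cmap c @` cdom c).

Definition coords f : 'I_(edim I) -> T -> R := fun k x => coi k (f x).

Lemma relopen_near A x : relopen (mset M) A -> A x -> \forall y \near mn x, A y.
Proof.
move=> [ W Wo ->] [_ Wx]; rewrite near_withinE.
by apply: filterS (open_nbhs_nbhs (conj Wo Wx)) => y Wy My; split.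
Qed.

Lemma cimg_near A c x : mcharts M c -> cdom c x -> (\forall y \near mn x, A y) ->
  \forall z \near cmap c x, cimg c z <-> (cmap c @` (A `&` cdom c)) z.
Proof.
move=> Mc cx Ax; apply: filterS (near_chart (pm_charts pm Mc) cx Ax) => z H.
split=> [cz|[y [_ cy] <-]]; last by exists y.
by have [Az cz1 cz2] := H cz; exists (cinv c z).
Qed.

Lemma smooth_vecP A f : (forall x, A x -> \forall y \near mn x, A y) ->
  smooth_vec M A f <-> forall x, A x -> forall k, smooth_at M (coords f k) x.
Proof.
move=> An; split=> [H x Ax k c Mc cx|H c i Mc _ [x [Ax cx] <-]].
  have [|h /smooth_rowsP hs hE] := H c (tag (enum_val k)) Mc (cmap c x); first by exists x.
  exists (fun z => h z 0 (tagged (enum_val k))); split; first exact: hs.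
  apply: filterS2 hE (cimg_near Mc cx (An x Ax)) => z H1 H2 /H2 /H1 ->.
  by [].
have /choice[h hE] : forall l, exists g, ext_at c x
    (coords f (enum_rank (Tagged (fun i : elt I => 'I_(dim (oE (sval i)))) (l : 'I_(dim (oE (sval i))))))) g.
  by move=> l; exact: H.
exists (fun z => \row_l h l z).
  apply/smooth_rowsP => l; have [hs _] := hE l.
  by apply: sgerm_eq hs => z; rewrite mxE.
have : \forall z \near cmap c x, forall l, cimg c z -> h l z =
    coords f (enum_rank (Tagged (fun i : elt I => 'I_(dim (oE (sval i)))) (l : 'I_(dim (oE (sval i)))))) (cinv c z).
  by apply: (@filter_forall _ _ _ _ (nbhs_filter (cmap c x))) => l; have [] := hE l.
apply: filterS => z E [y [Ay cy] yz]; apply/rowP => l.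
by rewrite mxE E ?/local_rep; [rewrite coi_val|exists y].
Qed.

Lemma differential_coords A f (c : @chart R T n) x v e :
  differential A f c x v e <-> forall k, exists g : 'rV[R]_n -> R,
    [/\ sgerm g (cmap c x), \forall z \near cmap c x, (cmap c @` (A `&` cdom c)) z ->
      g z = coords f k (cinv c z) & 'D_v g (cmap c x) = coi k e].
Proof.
split=> [H k|H i].
  have [g [/smooth_rowsP gs gE] ge] := H (tag (enum_val k)).
  exists (fun z => g z 0 (tagged (enum_val k))); split; first exact: gs.
    by apply: filterS gE => z H1 /H1 ->.
  by rewrite /coi ge derive_coord//; exact: smooth_rows_diff.
pose kk (l : 'I_(dim (oE (sval i)))) : 'I_(edim I) :=
  enum_rank (Tagged (fun i : elt I => 'I_(dim (oE (sval i)))) l).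
have /choice[h hE] : forall l, exists g : 'rV[R]_n -> R, [/\ sgerm g (cmap c x),
    \forall z \near cmap c x, (cmap c @` (A `&` cdom c)) z ->
      g z = coords f (kk l) (cinv c z) & 'D_v g (cmap c x) = v2r (e i) 0 l].
  by move=> l; have [g gE] := H (kk l); exists g; rewrite coi_val.
have hs : smooth_rows (fun z => \row_l h l z) (cmap c x).
  by move=> l; have [hs _ _] := hE l; apply: sgerm_eq hs => z; rewrite mxE.
exists (fun z => \row_l h l z).
  split; first exact/smooth_rowsP.
  have : \forall z \near cmap c x, forall l, (cmap c @` (A `&` cdom c)) z -> h l z =
    coords f (kk l) (cinv c z).
    by apply: (@filter_forall _ _ _ _ (nbhs_filter (cmap c x))) => l; have [] := hE l.
  apply: filterS => z E Az; apply/rowP => l.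
  by rewrite mxE E// /local_rep coi_val.
apply/rowP => l; rewrite -derive_coord; last exact: smooth_rows_diff.
by have [_ _ <-] := hE l; congr ('D_v _ _); apply/funext => z; rewrite mxE.
Qed.

Lemma differentialP A f c x v e : mcharts M c -> cdom c x ->
  (\forall y \near mn x, A y) ->
  differential A f c x v e <-> forall k, deriv_at c x (coords f k) v (coi k e).
Proof.
move=> Mc cx Ax; have PE := cimg_near Mc cx Ax.
rewrite differential_coords; split=> H k; have := H k.
  move=> [g [gs gE gD]]; exists g => //; split=> //.
  by apply: filterS2 gE PE => z H1 H2 /H2 /H1 ->.
move=> [g [gs gE] gD]; exists g; split=> //.
by apply: filterS2 gE PE => z H1 H2 /H2 /H1 ->.
Qed.

Lemma im_diffP A f x : (\forall y \near mn x, A y) ->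
  im_diff M A f x = setT <-> surj_at M (coords f) x.
Proof.
move=> Ax; split=> [H u|H].
  have : im_diff M A f x (mki u) by rewrite H.
  move=> [c [v [Mc cx dE]]]; exists c, v; split=> // k.
  by have /(differentialP _ _ _ Mc cx Ax)/(_ k) := dE; rewrite coi_mki.
apply/seteqP; split=> // e _; have [c [v [Mc cx vE]]] := H (fun k => coi k e).
by exists c, v; split=> //; apply/(differentialP _ _ _ Mc cx Ax).
Qed.

End Bridge.

(** * Retractions onto submanifolds *)

Section Trunc.
Context {R : realType}.

Definition trunc n m (z : 'rV[R]_n) : 'rV[R]_n := \row_i (if (i < m)%N then z 0 i else 0).

Lemma trunc_smooth n m (p : 'rV[R]_n) : smooth_rows (@trunc n m) p.
Proof.
move=> i; have [im|im] := boolP (i < m)%N.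
  by apply: sgerm_eq (sgerm_coord i p) => z; rewrite mxE im.
by apply: sgerm_eq (sgermC 0 p) => z; rewrite mxE (negbTE im).
Qed.

Lemma trunc_flat n m (z : 'rV[R]_n) : flat m (trunc m z).
Proof. by move=> i mi; rewrite mxE ltnNge mi. Qed.

Lemma flat_trunc n m (z : 'rV[R]_n) : flat m z -> trunc m z = z.
Proof. by move=> fz; apply/rowP => i; rewrite mxE; case: ltnP => // /fz. Qed.

Lemma flatD n m a (z z' : 'rV[R]_n) : flat m z -> flat m z' -> flat m (a *: z + z').
Proof. by move=> fz fz' i mi; rewrite !mxE fz// fz'// mulr0 addr0. Qed.

Lemma id_smooth n (p : 'rV[R]_n) : smooth_rows id p.
Proof. by move=> i; exact: sgerm_coord. Qed.

End Trunc.

Section AddChart.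
Context {R : realType} {T : topologicalType} (M : @manifold R T).

(** An adapted chart lies in the maximal atlas and need not belong to [mcharts M]. Once it is added,
    the transition lemmas apply to it. *)
Definition add_chart (c : chart T (mdim M)) : @manifold R T :=
  @Manifold R T (mdim M) (mset M) (mcharts M `|` [set c]).

Lemma transition_refl n (c : @chart R T n) : (forall x, cdom c x -> cinv c (cmap c x) = x) ->
  transition c c.
Proof.
move=> cK p _; exists id; first exact/smooth_rowsP/id_smooth.
by apply: filterE => z [y [cy _] <-] /=; rewrite cK.
Qed.

Lemma premanifold_add c : premanifold M -> compatible c -> premanifold (add_chart c).
Proof.
move=> pm [tc comp]; split; first exact: (pm_separated pm).
- by move=> c' [/(pm_charts pm)//|->].
- by move=> x /(pm_cover pm)[c' Mc' cx]; exists c' => //; left.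
- move=> c1 c2 [M1|->] [M2|->]; first exact: (pm_smooth pm).
  + by have [_] := comp _ M1.
  + by have [] := comp _ M2.
  + by apply: transition_refl => x cx; rewrite (tc_cancel tc).
Qed.

End AddChart.

Section Retraction.
Context {R : realType} {T T' : topologicalType} (M : @manifold R T) (M' : @manifold R T').
Local Notation "'mn' x" := (within (mset M) (nbhs x)) (at level 10, x at level 9).
Local Notation "'mn'' x" := (within (mset M') (nbhs x)) (at level 10, x at level 9).
Local Notation cimg c := (cmap c @` cdom c).
Context (A : set T) (f : T -> T').

(* In charts, [P] is a retraction onto the submanifold [A], [F] is [f] composed with
   it, and [H] is a local section of [f]. *)
Record chart_retraction u (c : chart T (mdim M)) (c1 : chart T' (mdim M'))
    P F H : Prop := {
  rt_c : mcharts M c ;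
  rt_cu : cdom c u ;
  rt_c1 : mcharts M' c1 ;
  rt_c1u : cdom c1 (f u) ;
  rt_Ps : smooth_rows P (cmap c u) ;
  rt_Pu : P (cmap c u) = cmap c u ;
  rt_P : \forall z \near cmap c u, cimg c z ->
    [/\ cimg c (P z), A (cinv c (P z)), cdom c1 (f (cinv c (P z))),
        F z = cmap c1 (f (cinv c (P z))) & A (cinv c z) -> P z = z] ;
  rt_Fs : smooth_rows F (cmap c u) ;
  rt_Hs : smooth_rows H (cmap c1 (f u)) ;
  rt_Hu : H (cmap c1 (f u)) = cmap c u ;
  rt_H : \forall z \near cmap c1 (f u), cimg c1 z ->
    [/\ cimg c (H z), A (cinv c (H z)) & f (cinv c (H z)) = cinv c1 z] }.

Definition has_retraction u := exists c c1 P F H, @chart_retraction u c c1 P F H.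

Context (pm : premanifold M) (pm' : premanifold M').

Lemma smooth_at_nearby phi x : smooth_at M phi x -> mset M x ->
  \forall y \near mn x, smooth_at M phi y.
Proof.
move=> s Mx; have [c Mc cx] := pm_cover pm Mx; have [g [gs gE]] := s c Mc cx.
have tc := pm_charts pm Mc.
have H : \forall z \near cmap c x, cimg c z ->
    sgerm g z /\ \forall z' \near z, cimg c z' -> g z' = phi (cinv c z').
  have gE2 : \forall z \near cmap c x, \forall z' \near z, cimg c z' -> g z' = phi (cinv c z').
    have [Q [Qo Qx QE]] := near_open gE.
    by apply: filterS (open_nbhs_nbhs (conj Qo Qx)) => z Qz; apply: filterS (open_nbhs_nbhs (conj Qo Qz)).
  by apply: filterS2 (sgerm_near gs) gE2.
apply: filterS (chart_near tc cx H) => y [cy [sy Ey]].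
by apply: (smooth_at_chart pm Mc cy (g := g)).
Qed.

(** Composing with [pr] pulls a function on [M'] back to a whole neighbourhood of [u], although [f]
    is meaningful on [A] only. All claims concern germs at [u]. *)
Lemma retraction_map u : has_retraction u -> exists pr : T -> T,
  [/\ forall Q, (\forall y \near mn u, Q y) -> \forall y \near mn u, Q (pr y),
      forall Q, (\forall y \near mn' (f u), Q y) -> \forall y \near mn u, Q (f (pr y)),
      \forall y \near mn u, A (pr y) /\ (A y -> pr y = y) &
      forall phi, smooth_at M' phi (f u) -> smooth_at M (fun y => phi (f (pr y))) u].
Proof.
move=> [c [c1 [P [F [H []]]]]] Mc cu Mc1 c1u Ps Pu PE Fs Hs Hu HE.
have tc := pm_charts pm Mc; have tc1 := pm_charts pm' Mc1.
have Fu : F (cmap c u) = cmap c1 (f u).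
  have [|_ _ _ -> _] := nbhs_singleton PE; first exact: cimg_cmap.
  by rewrite Pu (tc_cancel tc).
exists (fun y => cinv c (P (cmap c y))); split.
- move=> Q /(near_chart tc cu); rewrite -Pu => /(near_comp Ps) QE.
  have QP : \forall z \near cmap c u, cimg c z -> Q (cinv c (P z)).
    by apply: filterS2 QE PE => z H1 H2 /H2[/H1[]].
  by apply: filterS (chart_near tc cu QP) => y [].
- move=> Q /(near_chart tc1 c1u); rewrite -Fu => /(near_comp Fs) QE.
  have QF : \forall z \near cmap c u, cimg c z -> Q (f (cinv c (P z))).
    apply: filterS2 QE PE => z H1 H2 /H2[_ _ cf FE _]; move: H1; rewrite FE => H1.
    have [|] := H1; first exact: cimg_cmap.
    by rewrite (tc_cancel tc1).
  by apply: filterS (chart_near tc cu QF) => y [].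
- have AP : \forall z \near cmap c u, cimg c z ->
      A (cinv c (P z)) /\ (A (cinv c z) -> P z = z).
    by apply: filterS PE => z PE /PE[].
  apply: filterS (chart_near tc cu AP) => y [cy [AP1 AP2]]; split=> // Ay.
  by rewrite AP2 ?(tc_cancel tc).
move=> phi sphi; have [g [gs gE]] := sphi c1 Mc1 c1u.
apply: (smooth_at_chart pm Mc cu (g := g \o F)); split.
  by apply: sgerm_comp => //; rewrite Fu.
rewrite -Fu in gE; apply: filterS2 (near_comp Fs gE) PE => z H1 H2 cz.
have [PI _ cf FE _] := H2 cz; have [_ P2] := cinv_cimg tc PI.
have [_ zK] := cinv_cimg tc cz.
by rewrite /= H1 FE ?(tc_cancel tc1)// ?zK//; exact: cimg_cmap.
Qed.

(** [v1] is lifted by the derivative of the local section [H]. As [H] takes values in [A], only the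
    values of [psi] on [A] enter its derivative along the lift. *)
Lemma retraction_lift u : has_retraction u -> exists c c1,
  [/\ mcharts M c, cdom c u, mcharts M' c1, cdom c1 (f u) &
   forall v1, exists v, forall phi psi d, smooth_at M psi u ->
     (\forall y \near mn u, A y -> psi y = phi (f y)) ->
     deriv_at c1 (f u) phi v1 d -> deriv_at c u psi v d].
Proof.
move=> [c [c1 [P [F [H []]]]]] Mc cu Mc1 c1u Ps Pu PE Fs Hs Hu HE.
have tc := pm_charts pm Mc; have tc1 := pm_charts pm' Mc1.
exists c, c1; split=> // v1; exists ('D_v1 H (cmap c1 (f u))).
move=> phi psi d spsi E [g [gs gE] <-].
have [h [hs hE]] := spsi c Mc cu; exists h => //; rewrite -Hu; symmetry.
apply: (@derive_push _ _ _ (cimg c1)) => //; first exact: fat_cimg.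
  by rewrite Hu.
rewrite -Hu in hE; have E' := near_chart tc cu E; rewrite -Hu in E'.
near=> z => cz.
have [HI AH fH] : [/\ cimg c (H z), A (cinv c (H z)) & f (cinv c (H z)) = cinv c1 z].
  by move: cz; near: z.
have -> : g z = phi (cinv c1 z) by move: cz; near: z.
have -> : h (H z) = psi (cinv c (H z)) by move: HI; near: z; exact: near_comp hE.
have [-> //] : [/\ A (cinv c (H z)) -> psi (cinv c (H z)) = phi (f (cinv c (H z))),
  cdom c (cinv c (H z)) & cmap c (cinv c (H z)) = H z].
  by move: HI; near: z; exact: (near_comp (tau := H) Hs E').
by rewrite fH.
Unshelve. all: by end_near. Qed.

(** [P] is truncation to the first [m] coordinates, conjugated from the adapted chart to a chart of
    the atlas; [H] expresses the local inverse of [f] in charts. *)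
Lemma adapted_retraction m u a : local_diffeo M M' A f -> A `<=` mset M ->
  A u -> @adapted_chart R T M m A u a -> has_retraction u.
Proof.
move=> [[fM fc fs] fl] AM Au [[tca comp] au aA].
have [c Mc cu] := pm_cover pm (AM u Au); have [c1 Mc1 c1u] := pm_cover pm' (fM u Au).
have tc := pm_charts pm Mc; have tc1 := pm_charts pm' Mc1.
pose Ma := add_chart a; have pma : premanifold Ma by exact: premanifold_add.
have Mac : mcharts Ma c by left.
have Maa : mcharts Ma a by right.
have [s [ss su sE]] := transition_ext pma Mac Maa cu au.
have [t [ts tu tE]] := transition_ext pma Maa Mac au cu.
pose p := cmap a u.
have fp : flat m p by apply/aA.
have trp : trunc m p = p by exact: flat_trunc.
(* Truncation keeps the coordinate defining the boundary or resets it to its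
   value at the boundary point p, so it preserves the image of the chart. *)
have trI : \forall z \near p, cimg a z -> cimg a (trunc m z).
  have tn (Q : set 'rV[R]_(mdim M)) : (\forall z \near p, Q z) -> \forall z \near p, Q (trunc m z).
    by rewrite -{1}trp => /(near_comp (@trunc_smooth _ _ m p)).
  have [Ip|[i i0 bp]] := tc_image tca (cimg_cmap au); first by apply: filterS (tn _ Ip).
  have tr0 (z : 'rV[R]_(mdim M)) : trunc m z 0 i = z 0 i \/ trunc m z 0 i = p 0 i.
    by rewrite mxE i0; case: m fp {aA trp tn} => [|m] fp; [right; rewrite fp|left].
  case: bp => bp; apply: filterS2 bp (tn _ bp) => z bz btz /bz zi; apply/btz;
    by have [->|->] := tr0 z.
pose P := t \o (trunc m \o s).
have Ps : smooth_rows P (cmap c u).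
  apply: smooth_rows_comp; last by rewrite /= su trp.
  by apply: smooth_rows_comp => //; exact: trunc_smooth.
have Pu : P (cmap c u) = cmap c u by rewrite /P /= su trp tu.
have P1 : \forall z \near cmap c u, cimg c z ->
    [/\ cimg c (P z), A (cinv c (P z)) & A (cinv c z) -> P z = z].
  have tE2 : \forall z \near trunc m (s (cmap c u)), cimg a z ->
    [/\ t z = cmap c (cinv a z), cimg c (t z) & cinv c (t z) = cinv a z].
    by rewrite su trp.
  have trI2 : \forall z \near s (cmap c u), cimg a z -> cimg a (trunc m z) by rewrite su.
  have := near_comp (tau := trunc m \o s)
    (smooth_rows_comp ss (@trunc_smooth _ _ m _)) tE2.
  have := near_comp ss trI2.
  apply: filterS3 sE => z sz H1 H2 cz; have [sz1 asz asz2] := sz cz.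
  have ts1 := H1 asz; have [tz1 ct tz2] := H2 ts1.
  have [ax1 ax2] := cinv_cimg tca ts1.
  split=> //; first by rewrite tz2; apply/aA => //; rewrite ax2; exact: trunc_flat.
  have [cz1 cz2] := cinv_cimg tc cz; have [sa1 sa2] := cinv_cimg tca asz.
  move=> Az; rewrite /P /= tz1 /= flat_trunc ?asz2//.
  by rewrite sz1; apply/aA => //; rewrite -asz2.
have fcont (Q : set T') : (\forall y \near mn' (f u), Q y) ->
    \forall y \near mn u, A y -> Q (f y).
  move=> Qn; have : f @ within A (nbhs u) --> f u by move/subspace_continuousP: fc; exact.
  move=> /(_ _ Qn) H1.
  have H2 : \forall y \near u, A y -> mset M' (f y) -> Q (f y) := H1.
  rewrite near_withinE; apply: filterS H2 => y H2 _ Ay; apply: H2 => //; exact: fM.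
have P2 : \forall z \near cmap c u, cimg c z -> cdom c1 (f (cinv c (P z))).
  have := near_chart tc cu (fcont _ (cdom_near tc1 c1u)); rewrite -{1}Pu => /(near_comp Ps).
  by move=> H1; apply: filterS2 H1 P1 => z H1 P1 /P1[/H1[H2 _ _] AP _]; exact: H2.
have [|F0 /smooth_rowsP F0s F0E] := fs c c1 Mc Mc1 (cmap c u); first by exists u.
have F1 : \forall z \near cmap c u, cimg c z -> F0 (P z) = cmap c1 (f (cinv c (P z))).
  rewrite -Pu in F0E; have := near_comp Ps F0E => H0.
  apply: filterS3 H0 P1 P2 => z H0 P1 P2 cz; have [PI AP _] := P1 cz.
  have [cP Pz] := cinv_cimg tc PI.
  by apply: H0; exists (cinv c (P z)) => //; split; [split|exact: P2].
have [W [Wo Wu] [fWo [g gK [gM gc gs]]]] := fl u Au.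
have [ O _ WE] := Wo.
have WA : W `<=` A by rewrite WE => y [].
have fWu : (f @` W) (f u) by exists u.
have gu : g (f u) = u by exact: gK.
have [|H /smooth_rowsP Hs HE] := gs c1 c Mc1 Mc (cmap c1 (f u)).
  by exists (f u) => //; split=> //; rewrite /preimage/= gu.
have Hu : H (cmap c1 (f u)) = cmap c u.
  rewrite (nbhs_singleton HE) /=; first by rewrite (tc_cancel tc1)// gu.
  by exists (f u) => //; split=> //; rewrite /preimage/= gu.
have gcont (Q : set T) : (\forall y \near mn u, Q y) ->
    \forall y \near mn' (f u), (f @` W) y /\ Q (g y).
  move=> Qn; have : g @ within (f @` W) (nbhs (f u)) --> g (f u).
    by move/subspace_continuousP: gc; exact.
  rewrite gu => /(_ _ Qn) H1.
  have H2 : \forall y \near f u, (f @` W) y -> mset M (g y) -> Q (g y) := H1.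
  have H3 := relopen_near fWo fWu; rewrite near_withinE in H3.
  rewrite near_withinE; apply: filterS2 H2 H3 => y H2 H3 My; split; first exact: H3.
  by apply: H2; [exact: H3|apply: gM; exact: H3].
exists c, c1, P, (F0 \o P), H; split=> //.
- near=> z => cz.
  have [? ? ?] : [/\ cimg c (P z), A (cinv c (P z)) & A (cinv c z) -> P z = z].
    by move: cz; near: z.
  split=> //=; first by move: cz; near: z.
  by move: cz; near: z.
- by apply: smooth_rows_comp => //; rewrite Pu.
have := near_chart tc1 c1u (gcont _ (cdom_near tc cu)).
apply: filterS2 HE => z HE H1 cz; have [[[w Ww wz] cg] c1z zK] := H1 cz.
have gz : g (cinv c1 z) = w by rewrite -wz gK.
have Hz : H z = cmap c w.
  rewrite HE /= ?gz//; exists (cinv c1 z) => //; split=> //; split=> //.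
  by exists w.
move: cg; rewrite gz => cw; rewrite Hz (tc_cancel tc)//; split; last by [].
  exact: cimg_cmap.
exact: WA.
Unshelve. all: by end_near. Qed.

End Retraction.

(** * Local structure of tame atlases *)

Section Complement.
Context {R : realType} {O : obst R} {I : Index O}.
Implicit Types (S C : set (oEI I)) (e : oEI I).

Definition rowE e : 'rV[R]_(edim I) := \row_k coi k e.
Definition Erow (w : 'rV[R]_(edim I)) : oEI I := mki (w 0).

Lemma rowEK : cancel rowE Erow.
Proof. by move=> e; apply: coi_inj => k; rewrite /Erow coi_mki mxE. Qed.

Lemma ErowK : cancel Erow rowE.
Proof. by move=> w; apply/rowP => k; rewrite mxE /Erow coi_mki. Qed.

Lemma rowE_lin a e e' : rowE (eadd (escale a e) e') = a *: rowE e + rowE e'.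
Proof. by apply/rowP => k; rewrite !mxE coi_add coi_scale. Qed.

Lemma rowE0 : rowE e0 = 0.
Proof. by apply/rowP => k; rewrite !mxE coi0. Qed.

Lemma Erow_lin a w w' : Erow (a *: w + w') = eadd (escale a (Erow w)) (Erow w').
Proof. by apply: (can_inj rowEK); rewrite rowE_lin !ErowK. Qed.

(** [A] has maximal rank among the matrices whose rows span a subspace of [S]; a vector of [S]
    outside its row space would enlarge it. *)
Lemma subspace_rowspace S : subspace_of S ->
  exists A : 'M[R]_(edim I), forall e, S e <-> (rowE e <= A)%MS.
Proof.
move=> [S0 Slin].
pose spans (A : 'M[R]_(edim I)) := forall w : 'rV[R]_(edim I), (w <= A)%MS -> S (Erow w).
pose P r := `[< exists2 A, spans A & \rank A = r >].
have P0 : exists r, P r.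
  exists 0%N; apply/asboolP; exists 0; last by rewrite mxrank0.
  by move=> w /submx0null ->; rewrite -rowE0 rowEK.
have Pb r : P r -> (r <= edim I)%N by move=> /asboolP[A _ <-]; exact: rank_leq_row.
case: (ex_maxnP P0 Pb) => r /asboolP[A sA rA] rmax.
exists A => e; split=> [Se|/sA]; last by rewrite rowEK.
pose B := (A + rowE e)%MS.
have sB : spans B.
  move=> w /sub_addsmxP[[x y] /= ->].
  have -> : y *m rowE e = y 0 0 *: rowE e by rewrite [y in LHS]mx11_scalar mul_scalar_mx.
  by rewrite addrC Erow_lin; apply: Slin; [rewrite rowEK|apply: sA; exact: submxMl].
have rB : (\rank B <= \rank A)%N by rewrite rA; apply: rmax; apply/asboolP; exists B.
have sAB : (A <= B)%MS by exact: addsmxSl.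
have [_ AB] := mxrank_leqif_eq sAB.
have /eqmxP -> : (A == B)%MS by rewrite -AB eqn_leq rB mxrankS.
exact: addsmxSr.
Qed.

Lemma subspace_complement S : subspace_of S -> exists2 C, subspace_of C & direct_sum S C.
Proof.
move=> sS; have [A SA] := subspace_rowspace sS.
exists [set e | (rowE e <= A^C)%MS].
  split=> [|a e e' /=]; first by rewrite /= rowE0 sub0mx.
  by move=> Ce Ce'; rewrite rowE_lin addmx_sub// scalemx_sub.
split=> [e|e /SA eA /= eC].
  have /sub_addsmxP[[x y] /= xy] : (rowE e <= A + A^C)%MS.
    by rewrite submx_full// addsmx_compl_full.
  exists (Erow (x *m A)); first by apply/SA; rewrite ErowK submxMl.
  exists (Erow (y *m A^C)%MS); first by rewrite /= ErowK submxMl.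
  apply: (can_inj rowEK).
  have -> : eadd (Erow (x *m A)) (Erow (y *m A^C%MS)) = Erow (1 *: (x *m A) + y *m A^C%MS).
    by rewrite Erow_lin; apply: oEI_ext => i; rewrite /eadd /escale scale1r.
  by rewrite ErowK scale1r.
have : (rowE e <= A :&: A^C)%MS by rewrite sub_capmx eA.
by rewrite capmx_compl => /submx0null e_0; apply: (can_inj rowEK); rewrite rowE0.
Qed.

End Complement.

Section Index.
Context {R : realType} {O : obst R} {I J : Index O}.
Context {T T' : topologicalType} (M : @manifold R T) (M' : @manifold R T').
Context (pm : premanifold M) (pm' : premanifold M').
Local Notation "'mn' x" := (within (mset M) (nbhs x)) (at level 10, x at level 9).
Local Notation n := (mdim M).
Local Notation cimg c := (cmap c @` cdom c).

(** Analogue of [fat_boundary] inside the submanifold: along a tangent direction one of the two rays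
    stays in the image of [A], so the derivative of an extension is determined by its values on
    [A]. *)
Lemma flat_direction m (A : set T) u (a : chart T n) (v : 'rV[R]_n) :
  @adapted_chart R T M m A u a -> A u -> flat m v ->
  (\forall t \near (0 : R)^'+, (cmap a @` (A `&` cdom a)) (t *: v + cmap a u)) \/
  (\forall t \near (0 : R)^'+, (cmap a @` (A `&` cdom a)) (t *: - v + cmap a u)).
Proof.
move=> [[tca _] au aA] Au fv.
have fu : flat m (cmap a u) by apply/aA.
have fN : flat m (- v) by move=> i mi; rewrite mxE fv// oppr0.
have inA (w : 'rV[R]_n) t : flat m w -> cimg a (t *: w + cmap a u) ->
    (cmap a @` (A `&` cdom a)) (t *: w + cmap a u).
  move=> fw [y ay yE]; exists y => //; split=> //; apply/aA => //.
  by rewrite yE; exact: flatD.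
have [Ip|[i _ bP]] := tc_image tca (cimg_cmap au).
  by left; apply: filterS (near_right_line v Ip) => t; exact: inA.
have fin (w : 'rV[R]_n) : flat m w ->
    (\forall t \near (0 : R)^'+, cimg a (t *: w + cmap a u)) ->
    \forall t \near (0 : R)^'+, (cmap a @` (A `&` cdom a)) (t *: w + cmap a u).
  by move=> fw; apply: filterS => t; exact: inA.
case: bP => bP; have [v0|v0] := leP 0 (v 0 i).
- left; apply: fin => //; apply: filterS2 (near_right_line v bP) (nbhs_right_gt 0) => t H t0.
  by apply/H; rewrite !mxE lerDr mulr_ge0// ltW.
- right; apply: fin => //; apply: filterS2 (near_right_line (- v) bP) (nbhs_right_gt 0) => t H t0.
  by apply/H; rewrite !mxE lerDr mulrN -mulNr mulr_le0// ?oppr_le0 ltW.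
- right; apply: fin => //; apply: filterS2 (near_right_line (- v) bP) (nbhs_right_gt 0) => t H t0.
  by apply/H; rewrite !mxE gerDr mulrN oppr_le0 mulr_ge0// ltW.
- left; apply: fin => //; apply: filterS2 (near_right_line v bP) (nbhs_right_gt 0) => t H t0.
  by apply/H; rewrite !mxE gerDr mulr_ge0_le0// ltW.
Qed.

(** The index condition, applied to one complement [C] of the image of d(s' o f), gives E_J = im ds
    + phihat C. The resulting tangent vector is then moved from the adapted chart to a chart of the
    atlas. *)
Lemma coker_index m (A : set T) (f : T -> T') (s : T -> oEI J) (s' : T' -> oEI I) u a :
  A `<=` mset M -> A u -> @adapted_chart R T M m A u a -> has_retraction M M' A f u ->
  (forall k, smooth_at M (coords s k) u) -> (forall k, smooth_at M' (coords s' k) (f u)) ->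
  (forall C : set (oEI I), subspace_of C ->
      direct_sum [set e | exists2 v, flat m v &
        @differential R O T M I A (s' \o f) a u v e] C ->
      direct_sum [set e | exists v, @differential R O T M J (mset M) s a u v e]
        (phihat (J := J) @` C)) ->
  forall e, exists (c : chart T n) v (e' : oEI I), [/\ mcharts M c, cdom c u &
    forall k, deriv_at c u (coords s k) v (coi k (eadd e (escale (-1) (phihat e'))))].
Proof.
move=> AM Au ad rt ss ss' H e.
have [comp au aA] := ad; have [tca _] := comp.
pose Ma := add_chart a; have pma : premanifold Ma by exact: premanifold_add.
have [c Mc cu] := pm_cover pm (AM u Au).
have Mac : mcharts Ma c by left.
have Maa : mcharts Ma a by right.
have [pr [_ _ prA prs]] := retraction_map pm pm' rt.
have /choice[g0 g0E] : forall k, exists g : 'rV[R]_n -> R, sgerm g (cmap a u) /\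
    \forall z \near cmap a u, (cmap a @` (A `&` cdom a)) z -> g z = coords (s' \o f) k (cinv a z).
  move=> k; have [g gE] := prs _ (ss' k) c Mc cu.
  have [g1 [g1s g1E]] := smooth_at_chart pma Mac cu gE Maa au.
  exists g1; split=> //; have := near_chart tca au prA.
  apply: filterS2 g1E => z H1 H2 [y [Ay ay] yz].
  have cz : cimg a z by exists y.
  have [[_ prK] _ _] := H2 cz; rewrite H1// prK//.
  by rewrite -yz (tc_cancel tca).
have g0d k : differentiable (g0 k) (cmap a u) by have [? _] := g0E k; exact: sgerm_diff.
set S := [set e | _] in H.
(* Along flat directions the derivative does not depend on the extension, so the fixed extensions
   [g0] present [S] as the image of a linear map. *)
have SP e' : S e' <-> exists2 v, flat m v & forall k, coi k e' = 'D_v (g0 k) (cmap a u).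
  split=> -[v fv vE]; exists v => //; last first.
    by apply/differential_coords => k; have [g0s g0k] := g0E k; exists (g0 k).
  move=> k; have /differential_coords/(_ k)[g [gs gE <-]] := vE.
  have [g0s g0k] := g0E k.
  have dv h : sgerm h (cmap a u) -> derivable h (cmap a u) v by exact: sgerm_derivable.
  have d1 : differentiable (fun z => g z - g0 k z) (cmap a u).
    by apply: sgerm_diff; apply: sgermD => //; exact: sgermN.
  have := derive_vanish_lines d1 _ _ (flat_direction ad Au fv).
  rewrite deriveB; [|exact: dv|exact: dv].
  move=> D0; apply/eqP; rewrite -subr_eq0; apply/eqP; apply: D0; first by exists u.
  by apply: filterS2 gE g0k => z gE g0k cz; rewrite gE// g0k// subrr.
have sS : subspace_of S.
  split=> [|b e1 e2 /SP[v1 f1 E1] /SP[v2 f2 E2]].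
    by apply/SP; exists 0 => [i _|k]; rewrite ?mxE// coi0 deriveE// linear0.
  apply/SP; exists (b *: v1 + v2); first exact: flatD.
  by move=> k; rewrite coi_add coi_scale E1 E2 !deriveE// linearP.
have [C sC SC] := subspace_complement sS.
have [/(_ e)[e1 [v vE] [_ [e2 _ <-] eE]] _] := H C sC SC.
have [w wE] := deriv_at_transition pma v Maa Mac au cu.
exists c, w, e2; split=> // k; apply: wE.
have -> : eadd e (escale (-1) (phihat e2)) = e1.
  by apply: oEI_ext => i; rewrite eE /eadd /escale scaleN1r addrK.
have /(differentialP pma) : @differential R O T Ma J (mset M) s a u v e1 := vE.
by apply => //; rewrite near_withinE; apply: filterE.
Qed.

End Index.

Section Good.
Context {R : realType} {O : obst R} {T : Index O -> topologicalType} {X : topologicalType}.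
Implicit Types (K : kdata T X) (I J H L : Index O) (d : set (kpoint T) -> set (kpoint T) -> R).
Local Notation mn K I x := (within (kdom K I) (nbhs x)).

(* What the inductive construction uses about a metric tame atlas; cobordisms
   have these properties too. *)
Record good K d : Prop := {
  gd_pm : forall I, idx K I -> premanifold (kU K I) ;
  gd_s : forall I x k, idx K I -> kdom K I x -> smooth_at (kU K I) (coords (ks K I) k) x ;
  gd_Ut : forall I J y, idx K I -> idx K J -> I \proper J ->
    kUt K I J y <-> kdom K J y /\ range (phihat (I := I) (J := J)) (ks K J y) ;
  gd_rho : forall I J y, idx K I -> idx K J -> I \proper J ->
    kUt K I J y -> kdom K I (krho K I J y) ;
  gd_s_rho : forall I J y, idx K I -> idx K J -> I \proper J ->
    kUt K I J y -> ks K J y = phihat (ks K I (krho K I J y)) ;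
  gd_pi : forall I J y, idx K I -> idx K J -> I \subset J ->
    kUt K I J y -> piK K I (krho K I J y) = piK K J y ;
  gd_retr : forall I J u, idx K I -> idx K J -> I \proper J -> kUt K I J u ->
    has_retraction (kU K J) (kU K I) (kUt K I J) (krho K I J) u ;
  gd_index : forall I J u e, idx K I -> idx K J -> I \proper J -> kUt K I J u ->
    exists (c : chart (T J) (mdim (kU K J))) v (e' : oEI I),
    [/\ mcharts (kU K J) c, cdom c u & forall k,
      deriv_at c u (coords (ks K J) k) v (coi k (eadd e (escale (-1) (phihat e'))))] ;
  gd_coc : forall I J L y, idx K I -> idx K J -> idx K L -> I \proper J -> J \proper L ->
    kUt K I L y -> [/\ kUt K J L y, kUt K I J (krho K J L y) &
      krho K I L y = krho K I J (krho K J L y)] ;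
  gd_dxx : forall I x, idx K I -> kdom K I x -> d (piK K I x) (piK K I x) = 0 ;
  gd_sym : forall I J x y, idx K I -> idx K J -> kdom K I x -> kdom K J y ->
    d (piK K I x) (piK K J y) = d (piK K J y) (piK K I x) ;
  gd_tri : forall I J L x y z, idx K I -> idx K J -> idx K L ->
    kdom K I x -> kdom K J y -> kdom K L z ->
    d (piK K I x) (piK K L z) <= d (piK K I x) (piK K J y) + d (piK K J y) (piK K L z) ;
  gd_near : forall I x r, idx K I -> kdom K I x -> 0 < r ->
    \forall y \near mn K I x, d (piK K I x) (piK K I y) < r }.

Lemma manifold_premanifold (S : topologicalType) (M : @manifold R S) :
  is_manifold M -> premanifold M.
Proof. by move=> [/hausdorff_separated ? _ ? ? ?]; split. Qed.

Section Atlas.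
Context K (X0 : set X) (n : int) (wk : weak_kuranishi n X0 K).

(** Gluing with [J = I] and rho_II = id identifies the points of a Gamma_I-orbit. *)
Lemma piK_act I (g : oGI I) x : idx K I -> kdom K I x -> piK K I (kact K g x) = piK K I x.
Proof.
move=> iI Ix; have [_ Ut rho] := wk_id wk iI.
pose gi := ginv g.
have gK : ginv gi = g by apply: functional_extensionality_dep => i; rewrite /ginv invgK.
have E : equiv K (existT _ I (kact K g x)) (existT _ I x).
  apply: rst_step; rewrite -{1}gK -{1}(rho x Ix).
  by apply: Glue => //; rewrite Ut.
apply/seteqP; split=> p; apply: rst_trans => //.
exact: rst_sym.
Qed.

Lemma piK_rho I J y : idx K I -> idx K J -> I \subset J -> kUt K I J y ->
  kdom K I (krho K I J y) -> piK K I (krho K I J y) = piK K J y.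
Proof.
move=> iI iJ IJ Uy Ix.
have E : equiv K (existT _ I (krho K I J y)) (existT _ J y).
  have := Glue g1 iI iJ IJ Uy; have -> : ginv (g1 : oGI I) = g1.
    by apply: functional_extensionality_dep => i; rewrite /ginv /g1 invg1.
  by rewrite (kc_act1 (wk_charts wk iI))//; exact: rst_step.
apply/seteqP; split=> p; apply: rst_trans => //.
exact: rst_sym.
Qed.

Section Change.
Context I J (iI : idx K I) (iJ : idx K J) (IJ : I \proper J).

Lemma rho_kUo y : kUt K I J y -> kUo K I J (krho K I J y).
Proof. by move=> Uy; rewrite -(cc_rho_onto (wk_change wk iI iJ IJ)); exists y. Qed.

Lemma rho_dom y : kUt K I J y -> kdom K I (krho K I J y).
Proof. by move=> /rho_kUo; have [? _ ->] := cc_U_open (wk_change wk iI iJ IJ); case. Qed.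

Lemma kUt_dom y : kUt K I J y -> kdom K J y.
Proof. by have [+ _ _] := cc_Ut_sub (wk_change wk iI iJ IJ); exact. Qed.

(** Tameness with the third index equal to J: U~_IJ is the preimage of E_I under s_J, hence closed
    in U_J. *)
Lemma kUt_range y : tame K ->
  kUt K I J y <-> kdom K J y /\ range (phihat (I := I) (J := J)) (ks K J y).
Proof.
move=> [_ tm]; have := tm I J J iI iJ iJ (proper_sub IJ) (subxx _).
have [UJ _ _] := wk_id wk iJ.
move=> /seteqP[t1 t2]; split=> [Uy|[Jy ry]].
  have [|[_ ]] := t1 y; first by split=> //; split=> //; exact: rho_kUo.
  by rewrite UJ.
by have [|] := t2 y; first by split=> //; split=> //; rewrite UJ.
Qed.

End Change.

Lemma tame_good d : tame K -> admissible_metric K d -> good K d.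
Proof.
move=> tm am; have [[d0 ds dt] _ _ dn] := am.
have rz I x : idx K I -> kdom K I x -> realization K (piK K I x) by exists I, x.
have pm I : idx K I -> premanifold (kU K I).
  by move=> iI; apply: manifold_premanifold; exact: (kc_manifold (wk_charts wk iI)).
have sm I x k : idx K I -> kdom K I x -> smooth_at (kU K I) (coords (ks K I) k) x.
  move=> iI Ix; have [//|+ _] := smooth_vecP (pm I iI) (A := kdom K I) (ks K I).
    by move=> y Iy; rewrite near_withinE; apply: filterE.
  by move/(_ (kc_s_smooth (wk_charts wk iI))); apply.
have rt I J u : idx K I -> idx K J -> I \proper J -> kUt K I J u ->
    has_retraction (kU K J) (kU K I) (kUt K I J) (krho K I J) u.
  move=> iI iJ IJ Uu; have cc := wk_change wk iI iJ IJ.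
  have [sub _ /(_ u Uu)[a aA]] := cc_Ut_sub cc.
  exact: (adapted_retraction (pm J iJ) (pm I iI) (cc_rho_diffeo cc) sub Uu aA).
split=> //.
- by move=> I J y iI iJ IJ; exact: kUt_range.
- by move=> I J y iI iJ IJ; exact: rho_dom.
- by move=> I J y iI iJ IJ; exact: (cc_s (wk_change wk iI iJ IJ)).
- move=> I J y iI iJ IJ Uy; apply: piK_rho => //.
  have := IJ; rewrite subEproper => /predU1P[E|IJ']; last exact: rho_dom Uy.
  by move: Uy; rewrite E; have [_ -> +] := wk_id wk iJ => E' /[dup] yJ /E' ->.
- move=> I J u e iI iJ IJ Uu; have cc := wk_change wk iI iJ IJ.
  have [sub _ /(_ u Uu)[a aA]] := cc_Ut_sub cc.
  apply: (coker_index (pm J iJ) (pm I iI) sub Uu aA (rt _ _ _ iI iJ IJ Uu)).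
  + by move=> k; apply: sm => //; exact: sub.
  + by move=> k; apply: sm => //; exact: rho_dom Uu.
  + exact: (cc_coker cc Uu aA).
(* Strong cocycle condition: by [kUt_range] all domains are cut out by conditions on s, and E_I lies
   in E_J, so every point of U~_IL satisfies the hypotheses of the weak cocycle condition. *)
- move=> I J L y iI iJ iL IJ JL Uy; have IL := proper_trans IJ JL.
  have /(kUt_range iI iL IL _ tm)[Ly rI] := Uy.
  have UJL : kUt K J L y.
    apply/(kUt_range iJ iL JL _ tm); split=> //.
    exact: range_phihat_sub (proper_sub IJ) rI.
  have UIJ : kUt K I J (krho K J L y).
    apply/(kUt_range iI iJ IJ _ tm); split; first exact: rho_dom UJL.
    move: rI; rewrite (cc_s (wk_change wk iJ iL JL) UJL) => -[e _ eE].
    exists e => //; apply: (phihat_inj (proper_sub JL)).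
    by rewrite phihat_comp// proper_sub.
  by split=> //; apply: (wk_cocycle wk iI iJ iL) => //; exact: rho_kUo UJL.
- by move=> I x iI Ix; apply/d0 => //; exact: rz.
- by move=> *; apply: ds; exact: rz.
- by move=> *; apply: dt; exact: rz.
move=> I x r iI Ix r0.
(* The metric ball is invariant under Gamma_I, so the compatibility of [d] with the quotient
   topology applies to it. *)
pose W := [set y | kdom K I y /\ d (piK K I x) (piK K I y) < r].
have WI : W `<=` kdom K I by move=> y [].
have Winv : kinvariant K W.
  move=> g y [Iy yr]; split; last by rewrite piK_act.
  by have [+ _ _] := kc_act_smooth (wk_charts wk iI) g; exact.
have Wo : relopen (kdom K I) W.
  apply/(dn I W iI WI Winv) => y [Iy yr].
  exists (r - d (piK K I x) (piK K I y)); first by rewrite subr_gt0.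
  move=> z Iz zr; split=> //.
  apply: le_lt_trans (dt _ (piK K I y) _ _ _ _) _; [exact: rz..|].
  by rewrite -ltrBrDl.
have Wx : W x by split=> //; rewrite (proj2 (d0 _ _ _ _))//; exact: rz.
by apply: filterS (relopen_near Wo Wx) => y [].
Qed.

End Atlas.
End Good.

Section Preliminaries.
Context {R : realType}.

Lemma precompact_closure_compact (T : topologicalType) (A A' B : set T) :
  precompact_in A' B -> A `<=` A' -> compact (B `&` closure A).
Proof.
move=> [A'B]; rewrite precompactE => cA' AA'.
have cA : compact (closure ((@set_val T B) @^-1` A)).
  apply: (subclosed_compact _ cA'); first exact: closed_closure.
  by apply: closureS => x; exact: AA'.
have -> : B `&` closure A = @set_val T B @` closure ((@set_val T B) @^-1` A).
  apply/seteqP; split=> [x [Bx clx]|_ [y cly <-]].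
    exists (@SigSub _ _ _ x (mem_set Bx)) => // W /nbhs_set_type[U [Uo Ux UW]].
    have [|z [Az Uz]] := clx U; first exact: open_nbhs_nbhs.
    by exists (@SigSub _ _ _ z (mem_set (A'B z (AA' z Az)))); split=> //; exact: UW.
  split=> [|W Wy]; first exact: set_valP.
  have [|z [Az Wz]] := cly (set_val @^-1` W); last by exists (set_val z).
  exact: (@initial_continuous _ _ set_val y _ Wy).
apply: continuous_compact cA; apply: continuous_subspaceT.
exact: (@initial_continuous _ _ set_val).
Qed.

Section Dat.
Context {T : topologicalType} (M : @manifold R T) (pm : premanifold M).

Lemma deriv_atDv c x phi v w d e : mcharts M c -> cdom c x -> deriv_at c x phi v d -> deriv_at c x phi w e ->
  deriv_at c x phi (v + w) (d + e).
Proof.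
move=> Mc cx [g gE gd] H2; exists g => //.
have [gs _] := gE; have gdf := sgerm_diff gs.
have <- : 'D_w g (cmap c x) = e by apply: (deriv_at_unique pm Mc cx (v := w) (phi := phi)) H2; exists g.
by rewrite -gd !deriveE// linearD.
Qed.

Lemma deriv_at_cst c x (a : R) (v : 'rV[R]_(mdim M)) : deriv_at c x (fun=> a) v 0.
Proof.
exists (fun=> a); first by split; [exact: sgermC|exact: filterE].
by rewrite derive_cst.
Qed.

End Dat.

Context {O : obst R}.
Implicit Types (I J H L : Index O).

Lemma coi_phihat I J (k : 'I_(edim J)) :
  (exists k', forall e : oEI I, coi k (phihat e) = coi k' e) \/
  (forall e : oEI I, coi k (phihat e) = 0).
Proof.
rewrite /coi; set i := tag _; set l := tagged _.
have [iI|iI] := boolP (sval i \in I); last first.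
  by right=> e; rewrite phihat_out// linear0 mxE.
left; exists (enum_rank (Tagged (fun i : elt I => 'I_(dim (oE (sval i)))) (l : 'I_(dim (oE (sval (exist _ (sval i) iI : elt I))))))) => e.
by rewrite enum_rankK (phihat_in _ iI).
Qed.

Lemma mki_lin I (s t : R) (u v : 'I_(edim I) -> R) :
  mki (fun k => s * u k + t * v k) = eadd (escale s (mki u)) (escale t (mki v)).
Proof. by apply: coi_inj => k; rewrite coi_add !coi_scale !coi_mki. Qed.

Lemma eadd0 I (e : oEI I) : eadd e e0 = e.
Proof. by apply: oEI_ext => i; rewrite /eadd /e0 addr0. Qed.

Lemma range_lin I J s t (e e' : oEI J) : range (phihat (I := I) (J := J)) e ->
  range (phihat (I := I) (J := J)) e' -> range (phihat (I := I) (J := J)) (eadd (escale s e) (escale t e')).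
Proof.
move=> /range_coiP H /range_coiP H'; apply/range_coiP => k ok.
by rewrite coi_add !coi_scale H// H'// !mulr0 addr0.
Qed.

Lemma range0 I J : range (phihat (I := I) (J := J)) e0.
Proof. by apply/range_coiP => k _; exact: coi0. Qed.

Lemma range_zero I J (e e' : oEI J) : eadd e e' = e0 ->
  range (phihat (I := I) (J := J)) e' -> range (phihat (I := I) (J := J)) e.
Proof.
move=> E /range_coiP H; apply/range_coiP => k ok.
by have := congr1 (coi k) E; rewrite coi_add coi0 H// addr0.
Qed.

Lemma chain_max (P : pred (Index O)) I0 : P I0 ->
  (forall I J, P I -> P J -> I \subset J \/ J \subset I) ->
  exists2 Im, P Im & forall I, P I -> I \subset Im.
Proof.
move=> P0 ch; case: (arg_maxnP (fun I : Index O => #|I|) P0) => Im Pm mx.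
exists Im => // I PI; have [//|mI] := ch I Im PI Pm.
by have /eqP -> : Im == I by rewrite eqEcard mI; exact: mx.
Qed.

End Preliminaries.

(** * Transversality along the submanifolds U~_IJ *)

Section Extension.
Context {R : realType} {O : obst R} {T : Index O -> topologicalType} {X : topologicalType}.
Context (K : kdata T X) (d : set (kpoint T) -> set (kpoint T) -> R) (gd : good K d).
Implicit Types (I J H L : Index O).
Local Notation mn I x := (within (kdom K I) (nbhs x)).
Context I J (iI : idx K I) (iJ : idx K J) (IJ : I \proper J).

(** The index condition writes w = ds_J(v) + phihat e'. Since nu_J takes values in E_I near x, d
    nu_J(v) = phihat e2, and therefore w = d(s_J + nu_J)(v) + phihat(e' - e2). The last term is
    reached by lifting a tangent vector of U_I, where s_I + nu_I is transverse. *)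
Lemma transverse_extension (nuJ : T J -> oEI J) (nuI : T I -> oEI I) x :
  kUt K I J x -> (forall k, smooth_at (kU K J) (coords nuJ k) x) ->
  (\forall y \near mn J x, range (phihat (I := I) (J := J)) (nuJ y) /\
     (kUt K I J y -> nuJ y = phihat (nuI (krho K I J y)))) ->
  surj_at (kU K I) (coords (fun y => eadd (ks K I y) (nuI y))) (krho K I J x) ->
  surj_at (kU K J) (coords (fun y => eadd (ks K J y) (nuJ y))) x.
Proof.
move=> Ux snu nuE sI w; pose e := mki w.
have pJ := gd_pm gd iJ; have pI := gd_pm gd iI.
have Jx : kdom K J x by have [] := (gd_Ut gd x iI iJ IJ).1 Ux.
have [c [v [e' [Mc cx sv]]]] := gd_index gd e iI iJ IJ Ux.
have /choice[dk dkE] : forall k, exists q, deriv_at c x (coords nuJ k) v q.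
  by move=> k; exact: deriv_at_exists.
have : range (phihat (I := I) (J := J)) (mki dk).
  apply/range_coiP => k ok; rewrite coi_mki.
  apply: (deriv_at_unique pJ Mc cx (dkE k)); apply: deriv_at_eq (deriv_at_cst c x 0 v) => //.
  by apply: filterS nuE => y [/range_coiP H _]; rewrite /coords H.
move=> [e2 _ e2E].
pose e3 := eadd e' (escale (-1) e2).
have [c2 [c1 [Mc2 c2x Mc1 c1x lift]]] := retraction_lift pJ pI (gd_retr gd iI iJ IJ Ux).
have /(_ (fun k => coi k e3))[v1 v1E] := (surj_atP pI _ Mc1 c1x).1 sI.
have [v2 v2E] := lift v1; have [v3 v3E] := deriv_at_transition pJ v2 Mc2 Mc c2x cx.
have snuJ k : smooth_at (kU K J) (coords (fun y => eadd (ks K J y) (nuJ y)) k) x.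
  apply: (smooth_at_eq pJ (phi := fun y => coords (ks K J) k y + coords nuJ k y)).
    by apply: filterE => y; rewrite /coords coi_add.
  by apply: smooth_atD; [exact: (gd_s gd)|exact: snu].
have KU : \forall y \near mn J x, kUt K I J y -> eadd (ks K J y) (nuJ y) =
    phihat (eadd (ks K I (krho K I J y)) (nuI (krho K I J y))).
  by apply: filterS nuE => y [_ H] Uy; rewrite (gd_s_rho gd iI iJ IJ Uy) H// phihat_add.
exists c, (v + v3); split=> // k.
have -> : w k = coi k (eadd e (escale (-1) (phihat e'))) + coi k (mki dk) + coi k (phihat (J := J) e3).
  rewrite -e2E phihat_add coi_add coi_scale coi_add.
  have -> : phihat (J := J) (escale (-1) e2) = escale (-1) (phihat e2).
    apply: oEI_ext => j; rewrite /escale; have [jI|jI] := boolP (sval j \in I).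
      by rewrite !(phihat_in _ jI).
    by rewrite !phihat_out// scaler0.
  by rewrite coi_scale coi_mki; ring.
apply: (deriv_atDv pJ Mc cx).
  apply: (deriv_at_eq pJ (phi := fun y => coords (ks K J) k y + coords nuJ k y)) => //.
    by apply: filterE => y; rewrite /coords coi_add.
  by apply: deriv_atD => //; rewrite coi_mki.
apply: v3E; have [[k' kE]|kE] := coi_phihat I k.
  rewrite kE; apply: (v2E (coords (fun y => eadd (ks K I y) (nuI y)) k')) => //.
  by apply: filterS KU => y H Uy; rewrite /coords H// kE.
rewrite kE; apply: (v2E (fun=> 0)) => //; last exact: deriv_at_cst.
by apply: filterS KU => y H Uy; rewrite /coords H// kE.
Qed.

End Extension.

(** * Inductive construction of perturbations *)

Section Construction.
Context {R : realType} {O : obst R} {T : Index O -> topologicalType} {X : topologicalType}.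
Context (K : kdata T X) (d : set (kpoint T) -> set (kpoint T) -> R) (gd : good K d).
Context (V C : forall I, set (T I)).
Arguments V : clear implicits.
Arguments C : clear implicits.
Implicit Types (I J H L : Index O).
Local Notation mn I x := (within (kdom K I) (nbhs x)).

(* For r = 2^-k delta these are V^k_I, N^k_JI and the neighbourhoods of N_JI in U_J. *)
Definition VR r I := Bhat K d r (V I).
Arguments VR : clear implicits.
Definition NR r I J := VR r J `&` (kUt K I J `&` krho K I J @^-1` VR r I).
Arguments NR : clear implicits.
Definition DR c r I J := Bhat K d r (NR c I J).
Arguments DR : clear implicits.

Section Metric.
Context I J L (x : T I) (y : T J) (z : T L).
Context (iI : idx K I) (iJ : idx K J) (iL : idx K L) (Ix : kdom K I x) (Jy : kdom K J y) (Lz : kdom K L z).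

Lemma d_ge0 : 0 <= d (piK K I x) (piK K J y).
Proof.
have := gd_tri gd iI iJ iI Ix Jy Ix; rewrite (gd_dxx gd)// (gd_sym gd iJ iI)//.
by rewrite -mulr2n pmulrn_lge0.
Qed.

Lemma d_lt r s t : d (piK K I x) (piK K J y) < r -> d (piK K J y) (piK K L z) < s ->
  r + s <= t -> d (piK K I x) (piK K L z) < t.
Proof.
by move=> xy yz; apply: lt_le_trans; apply: le_lt_trans (gd_tri gd iI iJ iL Ix Jy Lz) (ltrD xy yz).
Qed.

Lemma d_lt_sym r : d (piK K I x) (piK K J y) < r -> d (piK K J y) (piK K I x) < r.
Proof. by rewrite (gd_sym gd). Qed.

End Metric.

Lemma near_dom I (x : T I) : \forall y \near mn I x, kdom K I y.
Proof. by rewrite near_withinE; exact: filterE. Qed.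

Context (VU : forall I, idx K I -> V I `<=` kdom K I).

Lemma VR_mono r r' I : r <= r' -> VR r I `<=` VR r' I.
Proof. by move=> rr x [Ix [v Vv vr]]; split=> //; exists v => //; exact: lt_le_trans rr. Qed.

Lemma DR_mono c c' r r' I J : c <= c' -> r <= r' -> DR c r I J `<=` DR c' r' I J.
Proof.
move=> cc rr x [Jx [s [s1 [Us s2]] sr]]; split=> //; exists s; last exact: lt_le_trans rr.
by split; [|split=> //]; exact: VR_mono cc _ _.
Qed.

Lemma sub_VR r I : idx K I -> 0 < r -> V I `<=` VR r I.
Proof. by move=> iI r0 x Vx; split; [exact: VU|exists x => //; rewrite (gd_dxx gd)//; exact: VU]. Qed.

Lemma Bhat_pi I J (r s : R) (S : set (T I)) x y : idx K I -> idx K J -> S `<=` kdom K I ->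
  kdom K J y -> Bhat K d r S x -> d (piK K I x) (piK K J y) < s ->
  exists2 v, S v & d (piK K J y) (piK K I v) < r + s.
Proof.
move=> iI iJ SU Jy [Ix [v Sv vr]] xy; exists v => //.
have Iv := SU v Sv; rewrite addrC.
by apply: (d_lt iJ iI iI Jy Ix Iv) vr _ => //; exact: d_lt_sym.
Qed.

Lemma Bhat_near I (r s : R) (S : set (T I)) x y : idx K I -> S `<=` kdom K I ->
  kdom K I y -> Bhat K d r S x -> d (piK K I x) (piK K I y) < s -> Bhat K d (r + s) S y.
Proof. by move=> iI SU Iy H xy; split=> //; exact: (Bhat_pi iI iI SU Iy H xy). Qed.

Lemma Bhat_open I r (S : set (T I)) x : idx K I -> S `<=` kdom K I -> Bhat K d r S x ->
  \forall y \near mn I x, Bhat K d r S y.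
Proof.
move=> iI SU [Ix [v Sv vr]]; pose e := r - d (piK K I x) (piK K I v).
have e0 : 0 < e by rewrite subr_gt0.
apply: filterS2 (gd_near gd iI Ix e0) (near_dom x) => y xy Iy; split=> //; exists v => //.
have Iv := SU v Sv.
apply: le_lt_trans (gd_tri gd iI iI iI Iy Ix Iv) _; rewrite (gd_sym gd)//.
by rewrite -ltrBrDr.
Qed.

Lemma Bhat_far I r r' (S : set (T I)) x : idx K I -> S `<=` kdom K I -> kdom K I x -> r' < r ->
  ~ Bhat K d r S x -> \forall y \near mn I x, ~ Bhat K d r' S y.
Proof.
move=> iI SU Ix rr nB; have e0 : 0 < r - r' by rewrite subr_gt0.
apply: filterS2 (gd_near gd iI Ix e0) (near_dom x) => y xy Iy By; apply: nB.
have -> : r = r' + (r - r') by ring.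
by apply: Bhat_near By _ => //; exact: d_lt_sym.
Qed.

Lemma Bhat_closure I r r' (S : set (T I)) x : idx K I -> S `<=` kdom K I -> r < r' ->
  closure_in K (Bhat K d r S) x -> Bhat K d r' S x.
Proof.
move=> iI SU rr [Ix clx]; have e0 : 0 < r' - r by rewrite subr_gt0.
have := gd_near gd iI Ix e0; rewrite near_withinE => H.
have [y [By xy]] := clx _ H; have [Iy _] := By.
have -> : r' = r + (r' - r) by ring.
by apply: Bhat_near By _ => //; apply: d_lt_sym => //; exact: xy.
Qed.

Lemma NR_sub r I J : NR r I J `<=` kdom K J.
Proof. by move=> x [[]]. Qed.

Context (nrm : forall i, oE (o := O) i -> R) (en : equivariant_norms nrm).
Context (delta w sig : R) (dl : Index O -> R) (tau : nat -> R).
Context (BB : nat -> set (set (kpoint T))) (gap : nat -> R) (g : forall I, T I -> oEI I).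
Arguments g : clear implicits.
Context (VP : forall I, idx K I -> precompact_in (VR (2 * delta) I) (kdom K I)).
Context (Vsep : forall I J, idx K I -> idx K J ->
  (nbhd K d (2 * delta) (piK K I @` V I) `&` nbhd K d (2 * delta) (piK K J @` V J)) !=set0 ->
  I \subset J \/ J \subset I).
(** [ww] says that 2 (1 - w) dl J + w^3 dl J < dl J, room for two steps of size (1 - w) dl J; [wh]
    says that the final radius dl J / 2 is at most w^3 dl J. Both hold for w = 2^(-1/4). *)
Context (w0 : 0 < w) (w1 : w < 1) (ww : w ^+ 3 + 2 * (1 - w) < 1)
  (wh : 2^-1 <= w ^+ 3).
Context (dl0 : forall I, 0 < dl I) (dld : forall I, idx K I -> dl I <= delta)
  (dlS : forall I J, idx K I -> I \proper J -> 2 * dl J <= dl I).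
Context (tau0 : 0 <= tau 0) (tauS : forall n, tau n < tau n.+1) (tau_sig : forall n, tau n < sig).
Context (gap0 : forall n, 0 < gap n)
  (BBgap : forall n I J x y, idx K I -> idx K J -> kdom K I x -> kdom K J y ->
    BB n.+1 (piK K I x) -> d (piK K I x) (piK K J y) < gap n -> BB n (piK K J y)).
Context (sigP : forall J x, idx K J -> closure_in K (VR (dl J / 2) J) x -> ~ Ctilde K C x ->
  (forall I, idx K I -> I \proper J -> ~ DR (w ^+ 3 * dl J) (w ^+ 2 * (1 - w) * dl J) I J x) ->
  sig <= normI nrm (ks K J x)).

(* The values [g] are prescribed over the decreasing sets [BB n]; this is how the
   boundary perturbations enter. It is vacuous when [BB] is empty. *)
Record prescribed J : Prop := {
  pr_smooth : forall x k, VR (dl J) J x -> BB 0 (piK K J x) ->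
    smooth_at (kU K J) (coords (g J) k) x ;
  pr_compat : forall I x, idx K I -> I \proper J -> VR (dl J) J x -> BB 0 (piK K J x) ->
    kUt K I J x -> VR (dl J) I (krho K I J x) -> g J x = phihat (g I (krho K I J x)) ;
  pr_range : forall I x, idx K I -> I \proper J -> VR (dl J) J x -> BB 0 (piK K J x) ->
    DR (w ^+ 3 * dl J) (w * (1 - w) * dl J) I J x ->
    range (phihat (I := I) (J := J)) (g J x) ;
  pr_surj : forall x, VR (dl J) J x -> BB 0 (piK K J x) -> eadd (ks K J x) (g J x) = e0 ->
    surj_at (kU K J) (coords (fun y => eadd (ks K J y) (g J y))) x ;
  pr_norm : forall x, VR (dl J) J x -> BB 0 (piK K J x) -> normI nrm (g J x) <= tau 0 }.

(** Data given at radius [dl J] yield conclusions at [dl J / 2]; by [dlS] the earlier stages are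
    available on all of radius [dl J]. With m = |J| - 1, the collar levels of stage J are: 5m+1 to
    choose the prescribed local solution, 5m+2 where its value is forced, 5m+3 where transversality
    is known, 5m+4 as separation, and 5m+5 where the generic term vanishes. *)
Record extends (mu : forall I, T I -> oEI I) J (f : T J -> oEI J) : Prop := {
  ex_smooth : forall x k, VR (dl J / 2) J x -> smooth_at (kU K J) (coords f k) x ;
  ex_compat : forall I x, idx K I -> I \proper J -> VR (dl J / 2) J x -> kUt K I J x ->
    VR (dl J / 2) I (krho K I J x) -> f x = phihat (mu I (krho K I J x)) ;
  ex_range : forall I x, idx K I -> I \proper J -> VR (dl J / 2) J x ->
    DR (dl J / 2) ((1 - w) * (dl J / 2)) I J x -> range (phihat (I := I) (J := J)) (f x) ;
  ex_surj : forall x, VR (dl J / 2) J x -> eadd (ks K J x) (f x) = e0 ->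
    surj_at (kU K J) (coords (fun y => eadd (ks K J y) (f y))) x ;
  ex_zero : forall x, VR (dl J / 2) J x -> eadd (ks K J x) (f x) = e0 ->
    piKV K C (piK K J x) ;
  ex_norm : forall x, VR (dl J / 2) J x -> normI nrm (f x) <= tau #|J| ;
  ex_BB : forall x, VR (dl J / 2) J x -> BB (5 * #|J|) (piK K J x) -> f x = g J x }.

Lemma tau_mono m n : (m <= n)%N -> tau m <= tau n.
Proof.
elim: n => [|n IH]; first by rewrite leqn0 => /eqP ->.
by rewrite leq_eqVlt => /predU1P[->//|/IH]; move/le_trans; apply; exact: ltW.
Qed.

Lemma BB_mono m n I x : idx K I -> kdom K I x -> (m <= n)%N -> BB n (piK K I x) -> BB m (piK K I x).
Proof.
move=> iI Ix; elim: n => [|n IH]; first by rewrite leqn0 => /eqP ->.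
rewrite leq_eqVlt => /predU1P[->//|/IH H] /BBgap => Hb; apply: H; apply: Hb => //.
by rewrite (gd_dxx gd).
Qed.

Lemma BB_near n I x : idx K I -> kdom K I x -> BB n.+1 (piK K I x) ->
  \forall y \near mn I x, BB n (piK K I y).
Proof.
move=> iI Ix Bx; apply: filterS2 (gd_near gd iI Ix (gap0 n)) (near_dom x) => y xy Iy.
exact: (BBgap iI iI Ix Iy Bx xy).
Qed.

Lemma BB_far n I x : idx K I -> kdom K I x -> ~ BB n (piK K I x) ->
  \forall y \near mn I x, ~ BB n.+1 (piK K I y).
Proof.
move=> iI Ix nB; apply: filterS2 (gd_near gd iI Ix (gap0 n)) (near_dom x) => y xy Iy By.
by apply: nB; apply: (BBgap iI iI Iy Ix By); exact: d_lt_sym.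
Qed.

Section Step.
Context J (iJ : idx K J) (gJ : prescribed J) (mu : forall I, T I -> oEI I).
Arguments mu : clear implicits.
Context (muP : forall I, idx K I -> I \proper J -> extends mu (mu I)).

(** Neighbourhoods of the N_JI taken at radius [c3]: an index I is relevant to a point within [ra],
    the glued solution takes values in E_I within [rb], and the generic term vanishes within
    [rc]. *)
Local Notation c3 := (w ^+ 3 * dl J).
Local Notation ra := ((1 - w) * dl J).
Local Notation rb := (w * (1 - w) * dl J).
Local Notation rc := (w ^+ 2 * (1 - w) * dl J).
Local Notation m := (#|J|.-1).

Lemma step_radii : [/\ 0 < c3, rc < rb, rb < ra, 0 < rc & 2 * ra + c3 < dl J].
Proof.
have := dl0 J => D0; have v0 : 0 < 1 - w by rewrite subr_gt0.
have w2 : 0 < w ^+ 2 by exact: exprn_gt0.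
have w3 : 0 < w ^+ 3 by exact: exprn_gt0.
split; first by rewrite mulr_gt0.
- by rewrite ltr_pM2r// ltr_pM2r// expr2 gtr_pMl.
- by rewrite ltr_pM2r// gtr_pMl.
- by rewrite !mulr_gt0.
by rewrite mulrA -mulrDl addrC gtr_pMl.
Qed.

Lemma card_m : #|J| = m.+1.
Proof. by have [/set0Pn[i iJ'] _] := iJ; rewrite prednK//; apply/card_gt0P; exists i. Qed.

Lemma proper_card_m I : I \proper J -> (#|I| <= m)%N.
Proof. by move=> /proper_card; rewrite card_m ltnS. Qed.

Lemma proper_radius I : idx K I -> I \proper J -> dl J <= dl I / 2.
Proof. by move=> iI /(dlS iI); lra. Qed.

Lemma DR_pi I c r x : idx K I -> I \proper J -> DR c r I J x ->
  exists2 v, V I v & d (piK K J x) (piK K I v) < r + c.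
Proof.
move=> iI IJ [Jx [s [_ [Us [Is [v Vv vs]]]] xs]]; exists v => //.
have Js := ((gd_Ut gd s iI iJ IJ).1 Us).1.
apply: (d_lt iJ iJ iI Jx Js (VU iI Vv) xs) => //.
by rewrite -(gd_pi gd iI iJ (proper_sub IJ) Us).
Qed.

Lemma DR_rho I c r r' x : idx K I -> I \proper J -> DR c r I J x -> kUt K I J x -> r + c <= r' ->
  VR r' I (krho K I J x).
Proof.
move=> iI IJ Dx Ux rr; have Ix := gd_rho gd iI iJ IJ Ux.
split=> //; have [v Vv vx] := DR_pi iI IJ Dx; exists v => //.
by rewrite (gd_pi gd iI iJ (proper_sub IJ) Ux); exact: lt_le_trans rr.
Qed.

(** Such a point is at distance less than ra + c3 < dl J <= delta from both pi(V_I) and pi(V_I'),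
    and the sets pi(V_I) of incomparable indices are further apart. *)
Lemma DR_chain I I' x : idx K I -> idx K I' -> I \proper J -> I' \proper J ->
  DR c3 ra I J x -> DR c3 ra I' J x -> I \subset I' \/ I' \subset I.
Proof.
move=> iI iI' IJ IJ' Dx Dx'; have [_ ? ? ? num] := step_radii.
have := dl0 J; have := dld iJ => dJ d0.
have Jx : kdom K J x by case: Dx.
apply: Vsep => //; exists (piK K J x).
have near_pi I2 : idx K I2 -> I2 \proper J -> DR c3 ra I2 J x ->
    nbhd K d (2 * delta) (piK K I2 @` V I2) (piK K J x).
  move=> i2 I2J D2; split; first by exists J, x.
  have [v Vv vx] := DR_pi i2 I2J D2; exists (piK K I2 v); first by exists v.
  by apply: lt_le_trans vx _; lra.
by split; exact: near_pi.
Qed.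

(** Pointwise and convex in [e], as [convex_local_to_global] requires. The bound [tau m] is
    inherited from the earlier stages, whose indices have at most m elements. *)
Definition admits x (e : oEI J) :=
  [/\ forall I, idx K I -> I \proper J -> DR c3 rb I J x ->
        range (phihat (I := I) (J := J)) e /\
        (kUt K I J x -> e = phihat (mu I (krho K I J x))),
      BB (5 * m).+2 (piK K J x) -> e = g J x & normI nrm e <= tau m].

Lemma admits_convex x (u v : 'I_(edim J) -> R) s t : 0 < s -> 0 < t -> s + t = 1 ->
  admits x (mki u) -> admits x (mki v) -> admits x (mki (fun k => s * u k + t * v k)).
Proof.
move=> s0 t0 st [u1 u2 u3] [v1 v2 v3]; rewrite mki_lin.
have same (e : oEI J) : eadd (escale s e) (escale t e) = e.
  by apply: oEI_ext => i; rewrite /eadd /escale -scalerDl st scale1r.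
split=> [I iI IJ Dx|Bx|]; last first.
- apply: le_trans (normI_add en _ _) _.
  apply: (@le_trans _ _ (s * tau m + t * tau m)); last by rewrite -mulrDl st mul1r.
  apply: lerD; apply: le_trans (normI_scale en _ _) _; rewrite gtr0_norm//;
    by rewrite ler_wpM2l// ltW.
- by rewrite u2// v2// same.
have [ru eu] := u1 I iI IJ Dx; have [rv ev] := v1 I iI IJ Dx.
split; first exact: range_lin.
by move=> Ux; rewrite eu// ev// same.
Qed.

Definition locally_admitted (x0 : T J) := exists f : T J -> oEI J,
  \forall y \near mn J x0, (forall k, smooth_at (kU K J) (coords f k) y) /\ admits y (f y).

Lemma near_all_coords (f : T J -> oEI J) x : kdom K J x ->
  (forall k, smooth_at (kU K J) (coords f k) x) ->
  \forall y \near mn J x, forall k, smooth_at (kU K J) (coords f k) y.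
Proof.
move=> Jx sf; apply: (@filter_forall _ _ _ _ (within_filter _ (nbhs_filter x))) => k.
exact: (smooth_at_nearby (gd_pm gd iJ)).
Qed.

Lemma near_DR x : kdom K J x ->
  \forall y \near mn J x, forall I, idx K I -> I \proper J -> DR c3 rb I J y -> DR c3 ra I J x.
Proof.
move=> Jx; have [_ _ num _ _] := step_radii; have e0 : 0 < ra - rb by rewrite subr_gt0.
apply: filterS (gd_near gd iJ Jx e0) => y xy I iI IJ Dy; have [Jy _] := Dy.
have -> : ra = rb + (ra - rb) by ring.
by apply: Bhat_near Dy _ => //; [exact: NR_sub|exact: d_lt_sym].
Qed.

(** 0 lies in every E_I, and the equations with [mu] are vacuous where no relevant U~_IJ comes
    near. *)
Lemma local_zero x0 : kdom K J x0 -> ~ BB (5 * m).+1 (piK K J x0) ->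
  (forall I, idx K I -> I \proper J -> DR c3 ra I J x0 ->
     \forall y \near mn J x0, ~ kUt K I J y) -> locally_admitted x0.
Proof.
move=> Jx nB nU; exists (fun=> e0).
have sU : \forall y \near mn J x0, forall I, idx K I /\ I \proper J /\ DR c3 ra I J x0 -> ~ kUt K I J y.
  apply: (@filter_forall _ _ _ _ (within_filter _ (nbhs_filter x0))) => I.
  have [[iI [IJ Dx]]|nI] := EM (idx K I /\ I \proper J /\ DR c3 ra I J x0).
    by apply: filterS (nU I iI IJ Dx).
  by apply: filterE.
apply: filterS3 sU (near_DR Jx) (BB_far iJ Jx nB) => y yU yD yB; split.
  move=> k; rewrite (_ : coords _ k = fun=> 0); first exact: smooth_atC.
  by apply/funext => z; rewrite /coords coi0.
split=> [I iI IJ Dy|/yB//|].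
  split; first exact: range0.
  by move=> Uy; case: (yU I) => //; split=> //; split=> //; exact: yD.
by rewrite normI0//; apply: le_trans tau0 (tau_mono _).
Qed.

(** [g J] is compatible with the earlier [mu I] because these equal [g I] on the level [5 * #|I|],
    which contains level 5m. *)
Lemma local_prescribed x0 : VR (dl J) J x0 -> BB (5 * m).+1 (piK K J x0) -> locally_admitted x0.
Proof.
move=> Vx Bx; have [Jx _] := Vx; exists (g J).
have [_ numc num1 num2 num3] := step_radii.
apply: filterS2 (Bhat_open iJ (VU iJ) Vx) (BB_near iJ Jx Bx) => y Vy By.
have [Jy _] := Vy; have B0 := BB_mono iJ Jy (leq0n _) By.
split=> [k|]; first exact: (pr_smooth gJ).
split=> [I iI IJ Dy|//|]; last first.
  by apply: le_trans (pr_norm gJ Vy B0) (tau_mono _).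
split=> [|Uy]; first exact: (pr_range gJ).
have Vry : VR (dl J) I (krho K I J y) by apply: (DR_rho iI IJ Dy Uy); lra.
rewrite (pr_compat gJ iI IJ)//; congr phihat; symmetry.
apply: (ex_BB (muP iI IJ)); first by apply: VR_mono Vry; exact: proper_radius.
rewrite (gd_pi gd iI iJ (proper_sub IJ) Uy); apply: BB_mono By => //.
by rewrite leq_mul2l/= proper_card_m.
Qed.

(** The solution is pulled back from the largest relevant index [Ir]. Its conditions for a smaller I
    come from those of stage [Ir] for I, the cocycle condition identifying rho_IJ with the composite
    through U_Ir. *)
Lemma local_induced Ir x0 : idx K Ir -> Ir \proper J -> ~ BB (5 * m).+1 (piK K J x0) ->
  DR c3 ra Ir J x0 -> kUt K Ir J x0 ->
  (forall I, idx K I -> I \proper J -> DR c3 ra I J x0 -> I \subset Ir) -> locally_admitted x0.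
Proof.
move=> ir IrJ nB Dx Ux mx; have [Jx _] := Dx.
have [num0 numc num1 num2 num3] := step_radii.
have [pr [prn prf prU prs]] := retraction_map (gd_pm gd iJ) (gd_pm gd ir) (gd_retr gd ir iJ IrJ Ux).
have Vrx : VR (dl J) Ir (krho K Ir J x0) by apply: (DR_rho ir IrJ Dx Ux); lra.
have rad := proper_radius ir IrJ.
exists (fun y => phihat (mu Ir (krho K Ir J (pr y)))).
(* Leaves room for [y] and [pr y] to be within [e] of [x0] while two such steps and [rb] still fit
   into [ra]. *)
pose e := (ra - rb) / 4; have e0 : 0 < e by rewrite /e; lra.
have fs : \forall y \near mn J x0, forall k,
    smooth_at (kU K J) (coords (fun y => phihat (J := J) (mu Ir (krho K Ir J (pr y)))) k) y.
  apply: near_all_coords => // k; have [[k' kE]|kE] := coi_phihat Ir k.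
    apply: (smooth_at_eq (gd_pm gd iJ) (phi := fun y => coords (mu Ir) k' (krho K Ir J (pr y)))).
      by apply: filterE => y; rewrite /coords kE.
    by apply: prs; apply: (ex_smooth (muP ir IrJ)); exact: VR_mono Vrx.
  rewrite (_ : coords _ k = fun=> 0); first exact: smooth_atC.
  by apply/funext => z; rewrite /coords kE.
have n1 := gd_near gd iJ Jx e0.
have n2 := prn _ n1; have n5 := prn _ (near_dom x0).
have n3 := prf _ (Bhat_open ir (VU ir) Vrx).
near=> y.
have Jy : kdom K J y by near: y; exact: near_dom.
have [Upy prK] : kUt K Ir J (pr y) /\ (kUt K Ir J y -> pr y = y) by near: y.
have xy : d (piK K J x0) (piK K J y) < e by near: y.
have xpy : d (piK K J x0) (piK K J (pr y)) < e by near: y.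
have Jpy : kdom K J (pr y) by near: y.
have Vy : VR (dl J) Ir (krho K Ir J (pr y)) by near: y.
have Vy' := VR_mono rad Vy.
have nBy : ~ BB (5 * m).+2 (piK K J y) by near: y; exact: BB_far.
have yD : forall I, idx K I -> I \proper J -> DR c3 rb I J y -> DR c3 ra I J x0.
  by near: y; exact: near_DR.
split; first by near: y.
split=> [I iI IJ Dy|//|]; last first.
  apply: le_trans (normI_phihat en _ _) _; apply: le_trans (ex_norm (muP ir IrJ) Vy') _.
  exact: tau_mono (proper_card_m IrJ).
have := mx I iI IJ (yD I iI IJ Dy); rewrite subEproper => /predU1P[EI|IIr].
  by subst I; split=> [|Uy]; [exists (mu Ir (krho K Ir J (pr y)))|rewrite prK].
split; last first.
  move=> Uy; have [Uy' UI rhoE] := gd_coc gd iI ir iJ IIr IrJ Uy.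
  rewrite prK// (ex_compat (muP ir IrJ) iI IIr)//; last first.
  - by rewrite -rhoE; apply: VR_mono rad _ _; apply: (DR_rho iI IJ Dy Uy); lra.
  - by move: Vy'; rewrite prK.
  by rewrite phihat_comp ?proper_sub// rhoE.
have [_ [s [Vs [Us Vrs]] ys]] := Dy.
have Js : kdom K J s by case: Vs.
have [Us' UI rhoE] := gd_coc gd iI ir iJ IIr IrJ Us.
have Is' := gd_rho gd ir iJ IrJ Us'.
have piS := gd_pi gd ir iJ (proper_sub IrJ) Us'.
have piP := gd_pi gd ir iJ (proper_sub IrJ) Upy.
have [|e1 _ e1E] := @ex_range _ _ _ (muP ir IrJ) I (krho K Ir J (pr y)) iI IIr Vy'; last first.
  by rewrite -e1E phihat_comp ?proper_sub//; exists e1.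
split; first exact: (gd_rho gd ir iJ IrJ Upy).
(* The point [s] of N_JI near [y] descends to a point of the corresponding set in U_Ir, within ra <=
   (1 - w) dl Ir / 2 of the image of [pr y]; there stage [Ir] already takes values in E_I. *)
exists (krho K Ir J s).
  split.
    split=> //; have [v Vv vx] := DR_pi ir IrJ Dx; exists v => //; rewrite piS.
    apply: (d_lt iJ iJ ir Js Jx (VU ir Vv) (r := rb + e)) vx _; last by rewrite /e; lra.
    by apply: (d_lt iJ iJ iJ Js Jy Jx (r := rb) (s := e)) => //; exact: d_lt_sym.
  by split=> //; rewrite /preimage/= -rhoE; apply: VR_mono Vrs; lra.
rewrite piS piP.
apply: (d_lt iJ iJ iJ Jpy Jx Js (r := e) (s := e + rb)).
- exact: d_lt_sym.
- exact: (d_lt iJ iJ iJ Jx Jy Js xy ys).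
apply: (@le_trans _ _ ra); first by rewrite /e; lra.
by rewrite ler_pM2l// subr_gt0.
Unshelve. all: by end_near. Qed.

Lemma local_solution x0 : VR (dl J) J x0 -> locally_admitted x0.
Proof.
move=> Vx; have [Jx _] := Vx.
have [|nB] := EM (BB (5 * m).+1 (piK K J x0)); first exact: local_prescribed.
pose Ch : pred (Index O) := fun I => `[< [/\ idx K I, I \proper J & DR c3 ra I J x0] >].
have [[I0 ch0]|noCh] := EM (exists I, Ch I); last first.
  by apply: local_zero => // I iI IJ Dx; exfalso; apply: noCh; exists I; exact/asboolP.
have [|Ir /asboolP[ir IrJ Dr] mx] := chain_max ch0.
  by move=> I I' /asboolP[iI IJ D] /asboolP[iI' IJ' D']; exact: (DR_chain iI iI' IJ IJ' D D').
have mx' I : idx K I -> I \proper J -> DR c3 ra I J x0 -> I \subset Ir.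
  by move=> iI IJ D; apply: mx; exact/asboolP.
have [Ux|nU] := EM (kUt K Ir J x0); first exact: (local_induced ir IrJ nB Dr Ux mx').
apply: local_zero => // I iI IJ D.
(* Some coordinate of s_J outside E_Ir is nonzero at [x0], hence nearby; for smaller I the set U~_IJ
   lies inside U~_IrJ. *)
have nIr : \forall y \near mn J x0, ~ kUt K Ir J y.
  have : ~ forall k, out_coord Ir k -> coi k (ks K J x0) = 0.
    by move=> H; apply: nU; apply/(gd_Ut gd _ ir iJ IrJ); split=> //; exact/range_coiP.
  move=> /existsNP[k /not_implyP[ok /eqP sk]].
  have sc := smooth_at_near (gd_pm gd iJ) (gd_s gd (x := x0) k iJ Jx) Jx.
  have : \forall y \near mn J x0, coords (ks K J) k y != 0.
    by apply: (sc [set r | r != 0]); apply: (@near_neq0 _ R id) => //; exact: cvg_id.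
  by apply: filterS => y + /(gd_Ut gd _ ir iJ IrJ)[_ /range_coiP/(_ k ok) E]; rewrite /coords E eqxx.
apply: filterS nIr => y nU' Uy; apply: nU'.
have := mx' I iI IJ D; rewrite subEproper => /predU1P[<-//|IIr].
by have [] := gd_coc gd iI ir iJ IIr IrJ Uy.
Qed.

Lemma near_self (x : T J) (P : set (T J)) : kdom K J x -> (\forall y \near mn J x, P y) -> P x.
Proof. by move=> Jx; rewrite near_withinE => /nbhs_singleton; exact. Qed.

Lemma VR_closure_compact r : r <= 2 * delta -> compact (closure_in K (VR r J)).
Proof. by move=> rd; apply: (precompact_closure_compact (VP iJ)); exact: VR_mono. Qed.

Local Notation Kp := (closure_in K (VR (3 / 4 * dl J) J)).
Local Notation K0 := (closure_in K (VR (dl J / 2) J)).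

Lemma glued_solution : exists f : T J -> oEI J, forall x, Kp x ->
  (forall k, smooth_at (kU K J) (coords f k) x) /\
  \forall y \near mn J x, admits y (f y).
Proof.
have dJ := dld iJ; have d0 := dl0 J.
have cK : compact Kp by apply: VR_closure_compact; lra.
have KM : Kp `<=` mset (kU K J) by move=> x [].
have [|phi phiP] := convex_local_to_global (gd_pm gd iJ) cK KM admits_convex.
  move=> x Kx; have [|f fP] := local_solution (x0 := x).
    by apply: Bhat_closure Kx => //; [exact: VU|lra].
  exists (coords f); apply: filterS fP => y [sf ay]; split=> //.
  by rewrite (_ : mki _ = f y)//; exact: mki_coi.
exists (fun x => mki (phi^~ x)) => x Kx; have [Jx _] := Kx.
have phx := phiP x Kx; split=> [k|]; last by apply: filterS phx => y [].
have [sk _] := near_self Jx phx.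
by rewrite (_ : coords _ k = phi k)//; apply/funext => y; rewrite /coords coi_mki.
Qed.

Lemma surj_at_eq e (phi psi : 'I_e -> T J -> R) x : kdom K J x ->
  (\forall y \near mn J x, forall k, phi k y = psi k y) ->
  surj_at (kU K J) phi x -> surj_at (kU K J) psi x.
Proof.
move=> Jx E sphi u; have [c [v [Mc cx H]]] := sphi u; exists c, v; split=> // k.
by apply: (deriv_at_eq (gd_pm gd iJ)) (H k) => //; apply: filterS E => y; exact.
Qed.

Lemma range_kUt I x (e : oEI J) : idx K I -> I \proper J -> kdom K J x ->
  range (phihat (I := I) (J := J)) e -> eadd (ks K J x) e = e0 -> kUt K I J x.
Proof.
by move=> iI IJ Jx re E; apply/(gd_Ut gd x iI iJ IJ); split=> //; exact: range_zero re.
Qed.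

Lemma induced_zero I x (e : oEI J) : idx K I -> I \proper J -> kUt K I J x ->
  e = phihat (mu I (krho K I J x)) -> eadd (ks K J x) e = e0 ->
  eadd (ks K I (krho K I J x)) (mu I (krho K I J x)) = e0.
Proof.
move=> iI IJ Ux eE E; apply: (phihat_inj (proper_sub IJ)).
by rewrite phihat0 phihat_add -(gd_s_rho gd iI iJ IJ Ux) -eE.
Qed.

Lemma DR_VR I x : idx K I -> I \proper J -> DR c3 rb I J x -> kUt K I J x ->
  VR (dl I / 2) I (krho K I J x).
Proof.
move=> iI IJ Dx Ux; have [_ ? ? ? ?] := step_radii.
by apply: VR_mono (proper_radius iI IJ) _ _; apply: (DR_rho iI IJ Dx Ux); lra.
Qed.

(** At a zero where [f] takes its value in E_I, so does s_J; by tameness the point lies on U~_IJ,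
    and transversality is carried over from stage I. On the collar it is that of the prescribed
    section. *)
Lemma glued_surj (f : T J -> oEI J) x : VR (dl J) J x ->
  (forall k, smooth_at (kU K J) (coords f k) x) ->
  (\forall y \near mn J x, admits y (f y)) -> eadd (ks K J x) (f x) = e0 ->
  (exists I, [/\ idx K I, I \proper J & DR c3 rb I J x]) \/ BB (5 * m).+3 (piK K J x) ->
  surj_at (kU K J) (coords (fun y => eadd (ks K J y) (f y))) x.
Proof.
move=> Vx sf adm E; have [Jx _] := Vx; have [ad1 ad2 ad3] := near_self Jx adm.
case=> [[I [iI IJ Dx]]|Bx].
  have [rx eqx] := ad1 I iI IJ Dx; have Ux := range_kUt iI IJ Jx rx E.
  apply: (transverse_extension gd iI iJ IJ (nuI := mu I) Ux sf).
    apply: filterS2 adm (Bhat_open iJ (@NR_sub _ _ _) Dx) => y [H _ _] Dy.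
    exact: H.
  apply: (ex_surj (muP iI IJ)); first exact: DR_VR.
  exact: (induced_zero iI IJ Ux (eqx Ux) E).
have B2 := BB_near iJ Jx Bx.
apply: (surj_at_eq Jx (phi := coords (fun y => eadd (ks K J y) (g J y)))).
  by apply: filterS2 adm B2 => y [_ H _] /H fE k; rewrite /coords fE.
apply: (pr_surj gJ) => //; first exact: BB_mono Bx.
by rewrite -ad2//; exact: BB_mono Bx.
Qed.

Lemma normI_sub_zero (e e' : oEI J) : eadd e e' = e0 -> normI nrm e <= normI nrm e'.
Proof.
move=> E; have -> : e = escale (-1) e'.
  apply: oEI_ext => i; have := congr1 (fun h : oEI J => h i) E.
  by rewrite /eadd /escale /e0 scaleN1r => /eqP; rewrite addr_eq0 => /eqP.
by apply: le_trans (normI_scale en _ _) _; rewrite normrN1 mul1r.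
Qed.

Lemma inductive_step : exists f : T J -> oEI J, extends mu f.
Proof.
have [f fP] := glued_solution; have [num0 numc numb numr num] := step_radii.
have d0 := dl0 J; have dJ := dld iJ.
have K0p x : K0 x -> Kp x.
  by move=> [Jx clx]; split=> //; apply: closureS clx; apply: VR_mono; lra.
have VK x : VR (dl J / 2) J x -> K0 x.
  by move=> Vx; have [Jx _] := Vx; split=> //; exact: subset_closure.
have KV x : K0 x -> VR (dl J) J x by apply: Bhat_closure => //; [exact: VU|lra].
(* The generic term has to vanish on [Z0], and transversality is known on [Z1]. The gap between [rc]
   and [rb] and the intermediate collar level separate [Z0] from the complement of [Z1]. *)
pose Z0 := [set x | (exists I, [/\ idx K I, I \proper J & DR c3 rc I J x]) \/
                    BB (5 * m).+4.+1 (piK K J x)].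
pose Z1 := [set x | (exists I, [/\ idx K I, I \proper J & DR c3 rb I J x]) \/
                    BB (5 * m).+3 (piK K J x)].
have [B B0 BP] := normI_mki en J.
(* The generic term may use up the increment of [tau] at this stage; [B] converts coordinate bounds
   into norm bounds. *)
pose eps := (tau m.+1 - tau m) / B.
have eps0 : 0 < eps by rewrite divr_gt0// subr_gt0.
pose F := coords (fun y => eadd (ks K J y) (f y)).
have Fs x : K0 x -> forall k, smooth_at (kU K J) (F k) x.
  move=> Kx k; have [Jx _] := Kx; have [sf _] := fP x (K0p x Kx).
  rewrite (_ : F k = fun y => coords (ks K J) k y + coords f k y); last first.
    by apply/funext => y; rewrite /F /coords coi_add.
  by apply: smooth_atD; [exact: (gd_s gd)|exact: sf].
have Ezero e : (forall k, coi k e = 0) -> e = (e0 : oEI J).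
  by move=> H; apply: coi_inj => k; rewrite H coi0.
have cK0 : compact K0 by apply: VR_closure_compact; lra.
have KM : K0 `<=` mset (kU K J) by move=> x [].
have [||x Kx|h [hs hle hZ hsurj]] :=
    generic_perturbation (gd_pm gd iJ) cK0 KM (F := F) (Z0 := Z0) (Z1 := Z1) eps0.
- move=> x Kx k; have [Jx _] := Kx.
  by apply: (smooth_at_nearby (gd_pm gd iJ)) => //; exact: Fs.
- move=> x Kx Zx Fx; have [sf ad] := fP x (K0p x Kx).
  by apply: glued_surj => //; [exact: KV|exact: Ezero].
- have [Jx _] := Kx.
  have [[I [iI IJ Dx]]|nD] := EM (exists I, [/\ idx K I, I \proper J & DR c3 rb I J x]).
    left; apply: filterS (Bhat_open iJ (@NR_sub _ _ _) Dx) => y Dy.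
    by left; exists I.
  have [Bx|nB] := EM (BB (5 * m).+4 (piK K J x)).
    by left; apply: filterS (BB_near iJ Jx Bx) => y By; right.
  right.
  have fD : \forall y \near mn J x, forall I, idx K I /\ I \proper J -> ~ DR c3 rc I J y.
    apply: (@filter_forall _ _ _ _ (within_filter _ (nbhs_filter x))) => I.
    have [[iI IJ]|nI] := EM (idx K I /\ I \proper J); last exact: filterE.
    apply: filterS (Bhat_far iJ (@NR_sub _ _ _) Jx numc (_ : ~ DR c3 rb I J x)) => [y //|Dx].
    by apply: nD; exists I.
  by apply: filterS2 fD (BB_far iJ Jx nB) => y yD yB [[I [iI IJ Dy]]|//]; exact: (yD I).
pose nu x := eadd (f x) (mki (h^~ x)).
exists nu.
have nuZ x : Z0 x -> nu x = f x.
  by move=> Zx; rewrite /nu (_ : mki _ = e0) ?eadd0//; apply: Ezero => k; rewrite coi_mki hZ.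
have adm x : K0 x -> admits x (f x).
  by move=> Kx; have [Jx _] := Kx; have [_] := fP x (K0p x Kx); exact: near_self.
have nuN x : K0 x -> normI nrm (nu x) <= tau #|J|.
  move=> Kx; have [_ _ fN] := adm x Kx; apply: le_trans (normI_add en _ _) _.
  rewrite card_m -[leRHS](subrK (tau m)) addrC lerD//.
  have -> : tau m.+1 - tau m = B * eps by rewrite mulrC /eps divfK// gt_eqF.
  by apply: BP => [|k]; [exact: ltW|exact: hle].
have DRZ I x : idx K I -> I \proper J -> DR c3 rc I J x -> Z0 x.
  by move=> iI IJ Dx; left; exists I.
have DRbc I : DR c3 rc I J `<=` DR c3 rb I J by apply: DR_mono => //; exact: ltW.
split.
- move=> x k /VK Kx; have [Jx _] := Kx; have [sf _] := fP x (K0p x Kx).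
  rewrite (_ : coords nu k = fun y => coords f k y + h k y); last first.
    by apply/funext => y; rewrite /nu /coords coi_add coi_mki.
  by apply: smooth_atD; [exact: sf|exact: hs].
- move=> I x iI IJ Vx Ux Vrx; have [Jx _] := Vx.
  (* By [wh], a point of U~_IJ at the final radius belongs to N_JI at radius [c3] itself, where the
     generic term vanishes. *)
  have le3 : dl J / 2 <= c3 by rewrite mulrC ler_pM2r.
  have Dx : DR c3 rc I J x.
    split=> //; exists x; last by rewrite (gd_dxx gd).
    by split; [exact: VR_mono Vx|split=> //; exact: VR_mono Vrx].
  rewrite nuZ; last exact: DRZ Dx.
  by have [/(_ I iI IJ (DRbc I x Dx))[_ ->]] := adm x (VK x Vx).
- move=> I x iI IJ Vx Dx.
  have {}Dx : DR c3 rc I J x.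
    apply: DR_mono Dx; first by rewrite mulrC ler_pM2r.
    have H : 2^-1 <= w ^+ 2 by apply: le_trans wh _; rewrite exprSr ger_pMr ?exprn_gt0// ltW.
    have -> : (1 - w) * (dl J / 2) = 2^-1 * ra by ring.
    by rewrite -[rc]mulrA ler_pM2r// mulr_gt0// subr_gt0.
  rewrite nuZ; last exact: DRZ Dx.
  by have [/(_ I iI IJ (DRbc I x Dx))[]] := adm x (VK x Vx).
- move=> x Vx E; have := hsurj x (VK x Vx).
  rewrite (_ : coords _ = fun i y => F i y + h i y); last first.
    by apply/funext => k; apply/funext => y; rewrite /F /coords !coi_add coi_mki addrA.
  apply=> k; have := congr1 (coi k) E.
  by rewrite !coi_add coi_mki coi0 addrA /F /coords coi_add.
(* A point of C~_J lies over C. Near some N_JI the zero is on U~_IJ and descends to a zero of stage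
   I. Anywhere else the norm of s_J is at least sigma and that of the perturbation is smaller. *)
- move=> x Vx E; have [Jx _] := Vx; have Kx := VK x Vx; have [ad1 _ _] := adm x Kx.
  have [[L [iL JL [y [Cy Uy] yx]]]|nC] := EM (Ctilde K C x).
    exists L => //; exists y => //.
    by rewrite -yx (gd_pi gd iJ iL JL Uy).
  have [[I [iI IJ Dx]]|nD] := EM (exists I, [/\ idx K I, I \proper J & DR c3 rc I J x]).
    rewrite nuZ in E; last exact: DRZ Dx.
    have {}Dx := DRbc I x Dx; have [rx eqx] := ad1 I iI IJ Dx.
    have Ux := range_kUt iI IJ Jx rx E.
    rewrite -(gd_pi gd iI iJ (proper_sub IJ) Ux).
    apply: (ex_zero (muP iI IJ)); first exact: DR_VR.
    exact: (induced_zero iI IJ Ux (eqx Ux) E).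
  have := sigP iJ Kx nC (fun I iI IJ Dx => nD (ex_intro _ I (And3 iI IJ Dx))).
  rewrite leNgt; case/negP; apply: le_lt_trans (normI_sub_zero E) _.
  exact: le_lt_trans (nuN x Kx) (tau_sig _).
- by move=> x /VK; exact: nuN.
move=> x Vx Bx; have [Jx _] := Vx; have [_ ad2 _] := adm x (VK x Vx).
have {}Bx : BB (5 * m).+4.+1 (piK K J x).
  by move: Bx; rewrite card_m mulnS addnC !addnS addn0.
rewrite nuZ; last by right.
by apply: ad2; apply: BB_mono Bx => //; rewrite !ltnS; do !apply: leqW.
Qed.

End Step.

Lemma extends_eq (mu mu' : forall I, T I -> oEI I) J (f : T J -> oEI J) :
  (forall I, I \proper J -> mu' I = mu I) -> extends mu f -> extends mu' f.
Proof.
move=> E [h1 h2 h3 h4 h5 h6 h7]; split=> // I x iI IJ Vx Ux Vr.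
by rewrite E//; exact: h2.
Qed.

(** Induction on the cardinality of the index: [extends] at J only involves [mu] on proper subsets,
    so filling in one layer leaves the lower ones intact. *)
Theorem perturbation_extends : (forall J, idx K J -> prescribed J) ->
  exists mu : forall I, T I -> oEI I, forall I, idx K I -> extends mu (mu I).
Proof.
move=> gP.
suff H n : exists mu : forall I, T I -> oEI I,
    forall I, idx K I -> (#|I| <= n)%N -> extends mu (mu I).
  have [mu muP] := H (oN O); exists mu => I iI; apply: muP => //.
  by rewrite -[leqRHS]card_ord; exact: max_card.
elim: n => [|n [mu muP]].
  exists (fun I _ => e0) => I [I0 _]; rewrite leqn0 cards_eq0 => /eqP E.
  by rewrite E eqxx in I0.
have nx J : exists f : T J -> oEI J, (idx K J -> #|J| = n.+1 -> extends mu f) /\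
    (#|J| <> n.+1 -> f = mu J).
  have [Jn|nJ] := EM (#|J| = n.+1); last by exists (mu J); split.
  have [iJ|nJ] := EM (idx K J); last by exists (mu J); split.
  have [|f fP] := @inductive_step J iJ (gP J iJ) mu; last by exists f; split.
  by move=> I iI IJ; apply: muP => //; rewrite -ltnS -Jn; exact: proper_card.
pose mu' I := projT1 (cid (nx I)).
have mu'E I : (#|I| <= n)%N -> mu' I = mu I.
  rewrite /mu'; case: cid => f [_ fE] /= In; apply: fE => E.
  by move: In; rewrite E ltnn.
exists mu' => I iI In; apply: (extends_eq (mu := mu)).
  by move=> H /proper_card HI; apply: mu'E; rewrite -ltnS; exact: leq_trans In.
move: In; rewrite leq_eqVlt => /predU1P[En|In]; last by rewrite mu'E//; exact: muP.
by rewrite /mu'; case: cid => f [fP _] /=; exact: fP.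
Qed.

End Construction.

(** * Perturbations of atlases *)

Section Radii.
Context {R : realType}.
Local Notation w := (2 `^ (- 4^-1) : R).

Lemma w_pow4 : w ^+ 4 = 2^-1.
Proof.
by rewrite -powR_mulrn ?powR_ge0// -powRrM mulNr mulVf ?powRN ?powRr1//.
Qed.

(** The third inequality is (1 - w)(w^2 + w - 1) > 0, and w + w^2 > 1 because w > w^2 >= 1/2. *)
Lemma w_bounds : [/\ 0 < w, w < 1, w ^+ 3 + 2 * (1 - w) < 1 & 2^-1 <= w ^+ 3].
Proof.
have w0 : 0 < w by exact: powR_gt0.
have w4 := w_pow4.
have w1 : w < 1.
  rewrite ltNge; apply/negP => w1; have : 1 <= w ^+ 4 by exact: exprn_ege1.
  by rewrite w4; lra.
have w3 : 2^-1 <= w ^+ 3 by rewrite -w4 exprSr ger_pMr ?exprn_gt0// ltW.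
have w2 : 2^-1 <= w ^+ 2 by apply: le_trans w3 _; rewrite exprSr ger_pMr ?exprn_gt0// ltW.
have w2w : w ^+ 2 < w by rewrite expr2 gtr_pMl.
split=> //; rewrite -subr_gt0.
have -> : 1 - (w ^+ 3 + 2 * (1 - w)) = (1 - w) * (w ^+ 2 + w - 1) by ring.
by rewrite mulr_gt0 ?subr_gt0//; lra.
Qed.

Lemma pow_quarter (L : R) q : 2 `^ (- (L + q%:R / 4)) = w ^+ q * 2 `^ (- L).
Proof.
rewrite opprD powRD; last by rewrite pnatr_eq0 implybT.
rewrite mulrC; congr (_ * _).
by rewrite -powR_mulrn ?powR_ge0// -powRrM; congr (_ `^ _); rewrite mulNr mulrC.
Qed.

Context {O : obst R} (a delta : R).
Implicit Types (I J : Index O).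

(** Starting radius of stage I, with [a = 0] for atlases and [a = 1] for cobordisms. Half of it is
    the radius of V_I^(|I|+a), and [radius_c3] and [radius_rc] recover the sets in the definitions
    of sigma and sigma'. *)
Definition radius I : R := 2 `^ (- (#|I|%:R - 1 + a)) * delta.

Lemma radius_half I : 2 `^ (- (#|I|%:R + a)) * delta = radius I / 2.
Proof.
have -> : #|I|%:R + a = #|I|%:R - 1 + a + 4%:R / 4 by lra.
by rewrite pow_quarter w_pow4 /radius; lra.
Qed.

Lemma radius_c3 I : 2 `^ (- (#|I|%:R - 4^-1 + a)) * delta = w ^+ 3 * radius I.
Proof.
have -> : #|I|%:R - 4^-1 + a = #|I|%:R - 1 + a + 3%:R / 4 by lra.
by rewrite pow_quarter mulrA.
Qed.

Lemma radius_rc I : eta delta (#|I|%:R - 2^-1 + a) = w ^+ 2 * (1 - w) * radius I.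
Proof.
rewrite /eta; have -> : #|I|%:R - 2^-1 + a = #|I|%:R - 1 + a + 2%:R / 4 by lra.
by rewrite pow_quarter /radius; ring.
Qed.

Lemma pow2N_le (k l : R) : k <= l -> (2 `^ (- l) : R) <= 2 `^ (- k).
Proof. by move=> kl; rewrite ler_powR ?lerN2// ler1n. Qed.

Context (d0 : 0 < delta) (a0 : 0 <= a).

Lemma radius_gt0 I : 0 < radius I.
Proof. by rewrite mulr_gt0// powR_gt0. Qed.

Lemma radius_le I : I != finset.set0 -> radius I <= delta.
Proof.
move=> /set0Pn[i iI]; have I1 : 1 <= #|I|%:R :> R by rewrite ler1n card_gt0; apply/set0Pn; exists i.
rewrite ger_pMl// -[leRHS](powRr0 2) -[X in _ <= _ `^ X]oppr0.
by apply: pow2N_le; rewrite addr_ge0// subr_ge0.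
Qed.

Lemma radius_proper I J : I \proper J -> 2 * radius J <= radius I.
Proof.
move=> /proper_card IJ; have IJ' : #|I|%:R + 1 <= #|J|%:R :> R by rewrite natr1 ler_nat.
have H : radius J <= radius I / 2.
  rewrite -radius_half ler_pM2r// pow2N_le// lerD2r lerBrDr.
  exact: IJ'.
by lra.
Qed.

End Radii.

Lemma tau_exists (R : realType) (t0 sig : R) : t0 < sig ->
  exists tau : nat -> R, [/\ tau 0%N = t0, forall n, tau n < tau n.+1 & forall n, tau n < sig].
Proof.
move=> ts; exists (fun n => sig - (sig - t0) / n.+1%:R); split=> [|n|n].
- by rewrite divr1; ring.
- by rewrite ltrD2l ltrN2 ltr_pM2l ?subr_gt0// ltf_pV2 ?posrE// ltr_nat.
by rewrite gtrBl divr_gt0// subr_gt0.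
Qed.

Section Level.
Context {R : realType} {O : obst R} {T : Index O -> topologicalType} {X : topologicalType}.
Context (K : kdata T X) (d : set (kpoint T) -> set (kpoint T) -> R) (gd : good K d).
Context (V C : forall I, set (T I)) (nrm : forall i, oE (o := O) i -> R).
Context (a delta sig : R) (tau : nat -> R).
Context (BB : nat -> set (set (kpoint T))) (gap : nat -> R) (g : forall I, T I -> oEI I).
Arguments V : clear implicits.
Arguments C : clear implicits.
Arguments g : clear implicits.
Implicit Types (I J H L : Index O).
Local Notation mn I x := (within (kdom K I) (nbhs x)).
Local Notation w := (2 `^ (- 4^-1) : R).
Local Notation dl := (radius (O := O) a delta).
Local Notation VR r I := (VR K d V r (I := I)).
Local Notation DR c r I J := (DR K d V c r I (J := J)).

Lemma im_diff_range I J (A : set (T J)) (f : T J -> oEI J) x : idx K J -> kdom K J x ->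
  (\forall y \near mn J x, A y) ->
  (\forall y \near mn J x, range (phihat (I := I) (J := J)) (f y)) ->
  im_diff (kU K J) A f x `<=` range (phihat (I := I) (J := J)).
Proof.
move=> iJ Jx An fr e [c [v [Mc cx /(differentialP (gd_pm gd iJ) f v e Mc cx An) dE]]].
apply/range_coiP => k ok; apply: (deriv_at_unique (gd_pm gd iJ) Mc cx (dE k)).
apply: (deriv_at_eq (gd_pm gd iJ)) (deriv_at_cst c x 0 v) => //.
by apply: filterS fr => y /range_coiP H; rewrite /coords H.
Qed.

Context (Vo : forall I, idx K I -> relopen (kdom K I) (V I)).
Context (d0 : 0 < delta) (a0 : 0 <= a).

Lemma level_VU I : idx K I -> V I `<=` kdom K I.
Proof. by move=> /Vo[W _ ->] x []. Qed.

Lemma level_sub r I : idx K I -> 0 < r -> V I `<=` VR r I.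
Proof. by move=> iI r0; apply: sub_VR => //; exact: level_VU. Qed.

Lemma level_open I (A : set (T I)) x : relopen (kdom K I) A -> A x -> \forall y \near mn I x, A y.
Proof. exact: relopen_near. Qed.

Section Consequences.
Context (mu : forall I, T I -> oEI I).
Arguments mu : clear implicits.
Context (muP : forall I, idx K I -> extends K d V C nrm w dl tau BB g mu (mu I)).

Section Subset.
Context I (iI : idx K I) (A : set (T I)) (AV : A `<=` VR (dl I / 2) I).
Context (Ao : forall x, A x -> \forall y \near mn I x, A y).

Lemma level_smooth : smooth_vec (kU K I) A (mu I).
Proof.
apply/(smooth_vecP (gd_pm gd iI)) => // x Ax k.
by apply: (ex_smooth (muP iI)); exact: AV.
Qed.

Lemma level_transverse_on : transverse_on K mu A.
Proof.
move=> x Ax E; apply/(im_diffP (gd_pm gd iI)); first exact: Ao.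
by apply: (ex_surj (muP iI)) => //; exact: AV.
Qed.

End Subset.

Lemma level_perturbation : perturbation K V mu.
Proof.
have r0 I : 0 < dl I / 2 by rewrite divr_gt0// radius_gt0.
split=> [I iI|I J y iI iJ IJ Vy Uy Vr].
  by apply: level_smooth => //; [exact: level_sub|move=> x; apply: level_open; exact: Vo].
apply: (ex_compat (muP iJ) iI IJ) => //; exact: (level_sub _ (r0 J)).
Qed.

Lemma level_transverse : transverse K V mu.
Proof.
have r0 I : 0 < dl I / 2 by rewrite divr_gt0// radius_gt0.
move=> I iI; apply: level_transverse_on => //; first exact: level_sub.
by move=> x; apply: level_open; exact: Vo.
Qed.

Lemma level_zero : pert_zero K V mu `<=` piKV K C.
Proof.
have r0 I : 0 < dl I / 2 by rewrite divr_gt0// radius_gt0.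
move=> p [I iI [x [Vx E] <-]]; apply: (ex_zero (muP iI)) => //.
exact: (level_sub iI (r0 I)).
Qed.

(** By [ex_range] the perturbation takes values in E_I on a whole neighbourhood of such a point, so
    its differential does as well. *)
Lemma level_admissible : admissible_pert K V mu.
Proof.
have r0 I : 0 < dl I / 2 by rewrite divr_gt0// radius_gt0.
have [w0 w1 _ _] := @w_bounds R.
move=> I J y iI iJ IJ Vy Uy Vr; have Jy := level_VU iJ Vy.
have Vn := level_open (Vo iJ) Vy.
apply: im_diff_range => //.
have Dy : DR (dl J / 2) ((1 - w) * (dl J / 2)) I J y.
  split=> //; exists y; last by rewrite (gd_dxx gd)// mulr_gt0 ?subr_gt0.
  by split; [exact: (level_sub iJ (r0 J))|split=> //; exact: (level_sub iI (r0 J))].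
have Dn := Bhat_open gd iJ (@NR_sub _ _ _ _ _ _ _ _ _ _) Dy.
apply: filterS2 Vn Dn => z Vz Dz; apply: (ex_range (muP iJ)) => //.
exact: (level_sub iJ (r0 J)).
Qed.

End Consequences.

Context (en : equivariant_norms nrm).
Context (VP : forall I, idx K I -> precompact_in (Bhat K d (2 * delta) (V I)) (kdom K I)).
Context (Vsep : forall I J, idx K I -> idx K J ->
  (nbhd K d (2 * delta) (piK K I @` V I) `&` nbhd K d (2 * delta) (piK K J @` V J)) !=set0 ->
  I \subset J \/ J \subset I).
Context (tau0 : 0 <= tau 0) (tauS : forall n, tau n < tau n.+1) (tau_sig : forall n, tau n < sig).
Context (gap0 : forall n, 0 < gap n)
  (BBgap : forall n I J x y, idx K I -> idx K J -> kdom K I x -> kdom K J y ->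
    BB n.+1 (piK K I x) -> d (piK K I x) (piK K J y) < gap n -> BB n (piK K J y)).
Context (sigS : (sig%:E <= sigma_shift a K d V C nrm delta)%E).

Lemma sigma_shift_le J x : idx K J -> closure_in K (VR (dl J / 2) J) x -> ~ Ctilde K C x ->
  (forall I, idx K I -> I \proper J -> ~ DR (w ^+ 3 * dl J) (w ^+ 2 * (1 - w) * dl J) I J x) ->
  sig <= normI nrm (ks K J x).
Proof.
move=> iJ clx nC nD; rewrite -lee_fin; apply: le_trans sigS _.
rewrite /sigma_shift; apply: (@bigmin_inf _ _ _ _ J); first exact/asboolP.
apply: ereal_inf_lbound; exists x => //; split; first by rewrite /Vk radius_half.
move=> [//|[I [iI IJ] DI]]; apply: (nD I iI IJ).
by move: DI; rewrite /Nk /Vk radius_c3 radius_rc.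
Qed.

Lemma level_extends : (forall J, idx K J -> prescribed K d V nrm w dl tau BB g J) ->
  exists mu : forall I, T I -> oEI I,
    forall I, idx K I -> extends K d V C nrm w dl tau BB g mu (mu I).
Proof.
have [w0 w1 ww wh] := @w_bounds R.
apply: (perturbation_extends gd level_VU en (delta := delta) (sig := sig) (gap := gap)) => //.
- by move=> I; exact: radius_gt0.
- by move=> I [I0 _]; exact: radius_le.
- by move=> I J _; exact: radius_proper.
- exact: sigma_shift_le.
Qed.

End Level.

Section AtlasPerturbation.
Context {R : realType} {O : obst R} {T : Index O -> topologicalType} {X : topologicalType}.
Implicit Types (I J H L : Index O).

Lemma radius0 (delta : R) I : radius (O := O) 0 delta I / 2 = 2 `^ (- #|I|%:R) * delta.
Proof. by rewrite -radius_half addr0. Qed.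

(** The induction with [a = 0] and nothing prescribed, all sets [BB n] being empty. *)
Lemma adapted_exists (X0 : set X) (n : int) (K : kdata T X) (d : set (kpoint T) -> set (kpoint T) -> R)
    (V C : forall I, set (T I)) (nrm : forall i, @oE R O i -> R) (dV delta sig : R) :
  metric_tame_atlas n X0 K d -> reduction K V -> equivariant_norms nrm ->
  is_delta_V K d V dV -> 0 < delta < dV ->
  0 < sig -> (sig%:E <= sigma_V K d V C nrm delta)%E ->
  exists nu : forall I, T I -> oEI I, adapted K d V C nrm delta sig nu.
Proof.
move=> [[wk _] tm am] red en [_ dVP] /andP[delta0 ddV] sig0 sigS.
have gd := tame_good wk tm am.
have /dVP[VP Vsep] : 0 < delta < dV by apply/andP.
have [tau [tau0 tauS tau_sig]] := tau_exists sig0.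
have Vo := rd_open red.
have a0 : 0 <= 0 :> R by [].
have tau0' : 0 <= tau 0%N by rewrite tau0.
have [//|//|J iJ|mu muP] := level_extends gd (BB := fun _ => set0) (gap := fun _ => 1)
  (g := fun _ _ => e0) Vo delta0 a0 en VP Vsep tau0' tauS tau_sig _ _ sigS.
  by split.
exists mu; split; first exact: (level_perturbation gd Vo delta0 muP).
exists mu; split=> [I iI|k _ I iI Ik].
  split=> //; apply: (level_smooth gd muP) => //.
    by rewrite /Vk -radius0.
  by move=> x Vx; apply: (Bhat_open gd iI) => //; exact: (level_VU Vo).
(* For k >= |I| the sets V^k and N^k are contained in those at level |I|, so all conditions follow
   from level |I|. *)
pose r : R := 2 `^ (- k%:R) * delta.
have rI : r <= radius 0 delta I / 2.
  by rewrite radius0 ler_pM2r// pow2N_le// ler_nat.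
have Vkr H : Vk K d V delta k%:R (I := H) = VR K d V r (I := H) by [].
have VkV : VR K d V r (I := I) `<=` VR K d V (radius 0 delta I / 2) (I := I) by exact: VR_mono.
split.
- move=> H x iH HI Vx Ux Vr; apply: (ex_compat (muP I iI) iH HI) => //; first exact: VkV.
  exact: VR_mono rI _ Vr.
- apply: (level_transverse_on gd muP) => // x Vx; apply: (Bhat_open gd iI) => //.
  exact: (level_VU Vo).
- move=> H x iH HI; rewrite /Vk -radius0 => Vx Dx.
  apply: (ex_range (muP I iI) iH HI) => //; have [w0 w1 _ _] := @w_bounds R.
  have {}Dx : DR K d V r (eta delta k%:R) H (J := I) x by exact: Dx.
  apply: DR_mono Dx => //.
  by rewrite /eta mulrAC mulrC ler_pM2l// subr_gt0.
- by move=> x Vx; apply: (ex_zero (muP I iI)); exact: VkV.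
apply: (@le_lt_trans _ _ (tau #|I|)%:E); last by rewrite lte_fin.
by apply: ge_ereal_sup => _ [x Vx <-]; rewrite lee_fin (ex_norm (muP I iI))//; exact: VkV.
Qed.

End AtlasPerturbation.

(** * Prescribed values on collars *)

(** The gap between the prescribed values and [s] pays for the generic terms; an empty [A] gets the
    bound 0. *)
Lemma ereal_sup_lt_bound (R : realType) (T : Type) (A : set T) (f : T -> R) (s : R) : 0 < s ->
  (ereal_sup [set (f x)%:E | x in A] < s%:E)%E ->
  exists t, [/\ 0 <= t, t < s & forall x, A x -> f x <= t].
Proof.
move=> s0; set S := ereal_sup _ => Ss.
have fS x : A x -> ((f x)%:E <= S)%E by move=> Ax; apply: ereal_sup_ubound; exists x.
case: S Ss fS => [r|//|_ fS].
  rewrite lte_fin => rs fS; exists (Num.max 0 r); split.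
  - by rewrite le_max lexx.
  - by rewrite gt_max s0.
  - by move=> x /fS; rewrite lee_fin => fr; rewrite le_max fr orbT.
by exists 0; split=> // x /fS; rewrite leeNy_eq.
Qed.

Definition bd_dist (R : realType) (alpha : bool) (t : R) : R := `|endpoint alpha - t|.

Lemma bd_dist_lt (R : realType) alpha (t t' r s : R) : bd_dist alpha t <= r -> `|t' - t| < s ->
  bd_dist alpha t' < r + s.
Proof.
move=> tr ts; rewrite /bd_dist.
have -> : endpoint alpha - t' = (endpoint alpha - t) - (t' - t) by ring.
by apply: le_lt_trans (ler_normB _ _) _; exact: ler_ltD.
Qed.

Lemma add_le_bound (R : realType) (x r e e' l : R) : x < r -> e' <= e -> r + e <= l -> x + e' <= l.
Proof. lra. Qed.

Lemma add_sub_le_bound (R : realType) (x a b r e l : R) : x < b -> a <= r -> r + e <= l -> 0 < e ->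
  x + (a - b) <= l.
Proof. lra. Qed.

Section CollarModel.
Context {R : realType} {O : obst R} {T : Index O -> topologicalType} {Y : topologicalType}.
Implicit Types (I J H L : Index O) (alpha : bool).
Context (Q : cobdata T Y) (d : set (kpoint T) -> set (kpoint T) -> R) (V : forall I, set (T I)).
Context (ell r0 : R) (A : bool -> set R) (pr : bool -> forall I, T I -> T I).
Arguments V : clear implicits.
Arguments pr : clear implicits.
Local Notation bd alpha := (cbd Q alpha).
Local Notation dist := bd_dist.

(* [ciota] is a product structure over the parameters [A alpha], with projection
   [pr] to the boundary charts, which contains all points at distance less than
   [ell] from the boundary. For a product cobordism [A alpha] is all of [0, 1] and
   [ell] is arbitrary, hence the absence of a bound by the collar width. *)
Record collar_model : Prop := {
  cmd_pm : forall alpha I, idx (bd alpha) I -> premanifold (kU (bd alpha) I) ;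
  cmd_idx : forall alpha I, idx (bd alpha) I -> idx Q I ;
  cmd_down : forall alpha I J, idx Q I -> I \subset J -> idx (bd alpha) J -> idx (bd alpha) I ;
  cmd_dom : forall alpha I t x, idx (bd alpha) I -> A alpha t -> kdom (bd alpha) I x ->
    kdom Q I (ciota Q alpha t x) ;
  cmd_pr : forall alpha I t x, idx (bd alpha) I -> A alpha t -> kdom (bd alpha) I x ->
    pr alpha I (ciota Q alpha t x) = x ;
  cmd_s : forall alpha I t x, idx (bd alpha) I -> A alpha t -> kdom (bd alpha) I x ->
    ks Q I (ciota Q alpha t x) = ks (bd alpha) I x ;
  cmd_s_smooth : forall alpha I x k, idx (bd alpha) I -> kdom (bd alpha) I x ->
    smooth_at (kU (bd alpha) I) (coords (ks (bd alpha) I) k) x ;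
  cmd_Ut : forall alpha I J t x, idx (bd alpha) I -> idx (bd alpha) J -> I \proper J ->
    A alpha t -> kdom (bd alpha) J x -> kUt Q I J (ciota Q alpha t x) ->
    [/\ kUt (bd alpha) I J x, kdom (bd alpha) I (krho (bd alpha) I J x) &
      krho Q I J (ciota Q alpha t x) = ciota Q alpha t (krho (bd alpha) I J x)] ;
  cmd_pi : forall alpha I J t x y, idx (bd alpha) I -> idx Q J -> A alpha t ->
    kdom (bd alpha) I x -> kdom Q J y -> piK Q J y = piK Q I (ciota Q alpha t x) ->
    exists x', [/\ idx (bd alpha) J, kdom (bd alpha) J x' & y = ciota Q alpha t x'] ;
  cmd_far : forall alpha I J t x y, idx (bd alpha) I -> idx Q J -> A alpha t ->
    kdom (bd alpha) I x -> kdom Q J y ->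
    dist alpha t + d (piK Q J y) (piK Q I (ciota Q alpha t x)) < ell ->
    exists t' x', [/\ A alpha t', idx (bd alpha) J, kdom (bd alpha) J x' & y = ciota Q alpha t' x'] ;
  cmd_d : forall alpha I J t t' x x', idx (bd alpha) I -> idx (bd alpha) J ->
    A alpha t -> A alpha t' -> kdom (bd alpha) I x -> kdom (bd alpha) J x' ->
    d (piK Q I (ciota Q alpha t x)) (piK Q J (ciota Q alpha t' x')) =
    `|t - t'| + bd_metric Q d alpha (piK (bd alpha) I x) (piK (bd alpha) J x') ;
  cmd_V : forall alpha I t x, idx (bd alpha) I -> A alpha t -> kdom (bd alpha) I x ->
    V I (ciota Q alpha t x) <-> V I x ;
  cmd_near : forall alpha I t x (P : set (T I)), idx (bd alpha) I -> A alpha t ->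
    kdom (bd alpha) I x ->
    (\forall y \near within (kdom Q I) (nbhs (ciota Q alpha t x)), P y) ->
    \forall x' \near within (kdom (bd alpha) I) (nbhs x), P (ciota Q alpha t x') ;
  cmd_disj : forall I t t' x x', idx (bd false) I -> idx (bd true) I ->
    A false t -> A true t' -> kdom (bd false) I x -> kdom (bd true) I x' ->
    dist false t < r0 -> dist true t' < r0 -> ciota Q false t x <> ciota Q true t' x' ;
  cmd_smooth : forall alpha I t x phi, idx (bd alpha) I -> A alpha t -> kdom (bd alpha) I x ->
    smooth_at (kU (bd alpha) I) phi x ->
    smooth_at (kU Q I) (fun y => phi (pr alpha I y)) (ciota Q alpha t x) ;
  cmd_surj : forall alpha I t x e (phi : 'I_e -> T I -> R), idx (bd alpha) I ->
    A alpha t -> kdom (bd alpha) I x -> (forall k, smooth_at (kU (bd alpha) I) (phi k) x) ->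
    surj_at (kU (bd alpha) I) phi x ->
    surj_at (kU Q I) (fun k y => phi k (pr alpha I y)) (ciota Q alpha t x) }.

Context (cmd : collar_model) (gd : good Q d).
Context (C : forall I, set (T I)) (nrm : forall i, @oE R O i -> R) (delta sig : R) (tau : nat -> R).
Arguments C : clear implicits.
Context (nub mub : bool -> forall I, T I -> oEI I).
Arguments nub : clear implicits.
Arguments mub : clear implicits.
Context (Vo : forall I, idx Q I -> relopen (kdom Q I) (V I)) (en : equivariant_norms nrm).
Context (delta0 : 0 < delta) (r00 : 0 < r0) (rl : r0 + delta <= ell).
Local Notation w := (2 `^ (- 4^-1) : R).
Local Notation dl := (radius (O := O) 1 delta).
Local Notation mn I x := (within (kdom Q I) (nbhs x)).
Local Notation VR r I := (VR Q d V r (I := I)).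
Local Notation DR c r I J := (DR Q d V c r I (J := J)).
Local Notation dK alpha := (bd_metric Q d alpha).
Local Notation bV alpha := (bd_set Q V alpha).
Local Notation Vb alpha r I := (Bhat (bd alpha) (dK alpha) r (bV alpha I)).

Definition rad n : R := r0 / n.+1%:R.
Definition near_bd n alpha I (y : T I) := exists t x,
  [/\ idx (bd alpha) I, A alpha t, kdom (bd alpha) I x, dist alpha t < rad n &
      y = ciota Q alpha t x].
(** Defined inside |K|, so that lying in a collar does not depend on the chart representing a point
    ([BB_near_bd]). *)
Definition BB n : set (set (kpoint T)) :=
  [set p | exists alpha I y, near_bd n alpha y /\ p = piK Q I y].

Lemma rad_gt0 n : 0 < rad n.
Proof. by rewrite divr_gt0. Qed.

Lemma rad_lt n : rad n.+1 < rad n.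
Proof. by rewrite ltr_pM2l// ltf_pV2 ?posrE// ltr_nat. Qed.

Lemma rad_le n : rad n <= r0.
Proof. by rewrite ger_pMr// invf_le1// ler1n. Qed.

Lemma rad_mono m n : (m <= n)%N -> rad n <= rad m.
Proof. by move=> mn; rewrite ler_pM2l// lef_pV2 ?posrE// ler_nat ltnS. Qed.

Lemma BB_near_bd n J y : idx Q J -> kdom Q J y -> BB n (piK Q J y) ->
  exists alpha, near_bd n alpha y.
Proof.
move=> iJ Jy [alpha [I [_ [[t [x [iI At Ix tr ->]]] E]]]].
have [x' [iJ' Jx' ->]] := cmd_pi cmd iI iJ At Ix Jy E.
by exists alpha, t, x'.
Qed.

Lemma dK_ge0 alpha I J x x' t : A alpha t -> idx (bd alpha) I -> idx (bd alpha) J ->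
  kdom (bd alpha) I x -> kdom (bd alpha) J x' ->
  0 <= dK alpha (piK (bd alpha) I x) (piK (bd alpha) J x').
Proof.
move=> At iI iJ Ix Jx'; have := cmd_d cmd iI iJ At At Ix Jx'.
rewrite subrr normr0 add0r => <-.
by apply: (d_ge0 gd); [exact: (cmd_idx cmd iI)|exact: (cmd_idx cmd iJ)|exact: (cmd_dom cmd)..].
Qed.

(** Within [ell] of the end a nearby point lies in the collar too, and there [d] is the sum of the
    parameter distance and the boundary distance, so each of them is less than [s]. *)
Lemma near_collar alpha I J t x y s : idx (bd alpha) I -> idx Q J -> A alpha t ->
  kdom (bd alpha) I x -> kdom Q J y -> d (piK Q J y) (piK Q I (ciota Q alpha t x)) < s ->
  dist alpha t + s <= ell ->
  exists t' x', [/\ A alpha t', idx (bd alpha) J, kdom (bd alpha) J x', y = ciota Q alpha t' x' &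
    `|t' - t| < s /\ dK alpha (piK (bd alpha) J x') (piK (bd alpha) I x) < s].
Proof.
move=> iI iJ At Ix Jy yx sl.
have [|t' [x' [At' iJ' Jx' yE]]] := cmd_far cmd iI iJ At Ix Jy.
  by apply: lt_le_trans sl; rewrite ltrD2l.
exists t', x'; split=> //; move: yx; rewrite yE (cmd_d cmd)// => yx.
have := dK_ge0 At' iJ' iI Jx' Ix => dK0.
by split; apply: le_lt_trans yx; rewrite ?lerDl ?lerDr.
Qed.

Lemma BB_gap n I J x y : idx Q I -> idx Q J -> kdom Q I x -> kdom Q J y ->
  BB n.+1 (piK Q I x) -> d (piK Q I x) (piK Q J y) < rad n - rad n.+1 -> BB n (piK Q J y).
Proof.
move=> iI iJ Ix Jy /(BB_near_bd iI Ix)[alpha [t [x' [iI' At Ix' tr xE]]]] xy.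
have := rad_lt n; have := rad_le n => rn rlt.
have [||t' [y' [At' iJ' Jy' yE [tt _]]]] := near_collar (s := rad n - rad n.+1) iI' iJ At Ix' Jy.
- by rewrite -xE; apply: d_lt_sym xy.
- by apply: (add_sub_le_bound tr rn rl delta0).
exists alpha, J, y; split=> //; exists t', y'; split=> //.
have -> : rad n = rad n.+1 + (rad n - rad n.+1) by ring.
exact: bd_dist_lt (ltW tr) tt.
Qed.

(** The boundary perturbations, extended constantly along the collar parameter. The two collars of
    size [r0] are disjoint, so the order of the cases is irrelevant on them; elsewhere the value is
    arbitrary. *)
Definition g J : T J -> oEI J := fun y =>
  if pselect (near_bd 0 false y) then mub false J (pr false J y) else mub true J (pr true J y).
Arguments g : clear implicits.

Lemma g_collar alpha J y : near_bd 0 alpha y -> g J y = mub alpha J (pr alpha J y).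
Proof.
rewrite /g; case: pselect => [|nf]; last by case: alpha.
case: alpha => // -[t [x [iJ At Jx tr yE]]] [t' [x' [iJ' At' Jx' tr' yE']]].
have r1 : rad 0 = r0 by rewrite /rad divr1.
by case: (cmd_disj cmd iJ iJ' At At' Jx Jx' _ _); rewrite -?r1// -yE.
Qed.

(** Projecting a collar to the boundary does not increase distances. *)
Lemma VR_bd alpha r J t x : idx (bd alpha) J -> A alpha t -> kdom (bd alpha) J x ->
  dist alpha t + r <= ell -> VR r J (ciota Q alpha t x) -> Vb alpha r J x.
Proof.
move=> iJ At Jx tl [Jy [v Vv yv]]; have iQ := cmd_idx cmd iJ.
have Jv : kdom Q J v by have [W _ E] := Vo iQ; move: Vv; rewrite E => -[].
have [|t' [x' [At' _ Jx' vE [_ dx]]]] := near_collar (s := r) iJ iQ At Jx Jv _ tl.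
  exact: d_lt_sym.
split=> //; exists x'; first by split=> //; move: Vv; rewrite vE => /(cmd_V cmd iJ At' Jx').
rewrite vE in yv; move: yv; rewrite (cmd_d cmd)//; apply: le_lt_trans.
by rewrite lerDr.
Qed.

Lemma radius1 I : radius 1 delta I = 2 `^ (- #|I|%:R) * delta.
Proof. by rewrite /radius subrK. Qed.

Lemma dl_le J : idx Q J -> dl J <= delta.
Proof. by move=> [J0 _]; apply: radius_le. Qed.

Lemma Vb_open alpha t r J x : A alpha t -> idx (bd alpha) J -> Vb alpha r J x ->
  \forall x' \near within (kdom (bd alpha) J) (nbhs x), Vb alpha r J x'.
Proof.
move=> At iJ [Jx [v [Jv Vv] xv]]; have iQ := cmd_idx cmd iJ.
pose e := r - dK alpha (piK (bd alpha) J x) (piK (bd alpha) J v).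
have e0 : 0 < e by rewrite subr_gt0.
have Qx := cmd_dom cmd iJ At Jx; have Qv := cmd_dom cmd iJ At Jv.
have := cmd_near cmd iJ At Jx (gd_near gd iQ Qx e0).
have dom : \forall x' \near within (kdom (bd alpha) J) (nbhs x), kdom (bd alpha) J x'.
  by rewrite near_withinE; exact: filterE.
apply: filterS2 dom => x' Jx' xx'; split=> //; exists v => //.
have dE a b : kdom (bd alpha) J a -> kdom (bd alpha) J b ->
    dK alpha (piK (bd alpha) J a) (piK (bd alpha) J b) =
    d (piK Q J (ciota Q alpha t a)) (piK Q J (ciota Q alpha t b)).
  by move=> Ja Jb; rewrite (cmd_d cmd)// subrr normr0 add0r.
have Qx' := cmd_dom cmd iJ At Jx'.
rewrite dE//; apply: le_lt_trans (gd_tri gd iQ iQ iQ Qx' Qx Qv) _.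
rewrite (gd_sym gd)// -(dE x v)// -ltrBrDr.
exact: xx'.
Qed.

Lemma near_bd_open alpha J y : idx Q J -> kdom Q J y -> near_bd 0 alpha y ->
  \forall z \near mn J y, near_bd 0 alpha z.
Proof.
move=> iJ Jy [t [x [iJ' At Jx tr yE]]]; have r1 : rad 0 = r0 by rewrite /rad divr1.
pose e := r0 - dist alpha t; have e0 : 0 < e by rewrite subr_gt0 -r1.
apply: filterS2 (gd_near gd iJ Jy e0) (near_dom Q y) => z yz Jz.
have [||t' [x' [At' _ Jx' zE [tt _]]]] := near_collar (s := e) iJ' iJ At Jx Jz.
- by rewrite -yE; apply: d_lt_sym yz.
- by rewrite addrC subrK; apply: le_trans rl; rewrite lerDl ltW.
exists t', x'; split=> //; rewrite r1.
have -> : r0 = dist alpha t + e by rewrite addrC subrK.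
exact: bd_dist_lt (lexx _) tt.
Qed.

(** With [a = 1] the starting radius [dl I] is 2^(-|I|) delta, so these are the adaptedness
    conditions at level k = |I|. *)
Context (mubP : forall alpha I, idx (bd alpha) I ->
  [/\ forall H x, idx (bd alpha) H -> H \proper I -> Vb alpha (dl I) I x ->
        kUt (bd alpha) H I x -> Vb alpha (dl I) H (krho (bd alpha) H I x) ->
        mub alpha I x = phihat (mub alpha H (krho (bd alpha) H I x)),
      transverse_on (bd alpha) (mub alpha) (Vb alpha (dl I) I),
      forall H x, idx (bd alpha) H -> H \proper I -> Vb alpha (dl I) I x ->
        Bhat (bd alpha) (dK alpha) ((1 - w) * dl I)
          (Vb alpha (dl I) I `&` (kUt (bd alpha) H I `&`
             krho (bd alpha) H I @^-1` Vb alpha (dl I) H)) x ->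
        range (phihat (I := H) (J := I)) (mub alpha I x) &
      forall x, Vb alpha (dl I) I x -> normI nrm (mub alpha I x) <= tau 0]).
Context (mubS : forall alpha I, idx (bd alpha) I ->
  smooth_vec (kU (bd alpha) I) (Vb alpha (dl I) I) (mub alpha I)).

Lemma prescribed_collar J : idx Q J -> prescribed Q d V nrm w dl tau BB g J.
Proof.
move=> iJ; have r1 : rad 0 = r0 by rewrite /rad divr1.
have dlJ := dl_le iJ; have dl0 : 0 < dl J by exact: radius_gt0.
have [w0 w1 _ _] := @w_bounds R.
have BBP y : VR (dl J) J y -> BB 0 (piK Q J y) -> exists alpha t x,
    [/\ idx (bd alpha) J, A alpha t, kdom (bd alpha) J x, dist alpha t < r0 &
      y = ciota Q alpha t x /\ Vb alpha (dl J) J x].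
  move=> Vy By; have [Jy _] := Vy.
  have [alpha [t [x [iJ' At Jx tr yE]]]] := BB_near_bd iJ Jy By.
  exists alpha, t, x; split=> //; rewrite -?r1//; split=> //.
  apply: (VR_bd iJ' At Jx); last by rewrite -yE.
  by rewrite r1 in tr; apply: add_le_bound tr _ rl.
have gE alpha I t x : idx (bd alpha) I -> A alpha t -> kdom (bd alpha) I x -> dist alpha t < r0 ->
    g I (ciota Q alpha t x) = mub alpha I x.
  move=> iI At Ix tr; rewrite (g_collar (alpha := alpha)) ?(cmd_pr cmd)//.
  by exists t, x; split=> //; rewrite r1.
have down alpha I : idx (bd alpha) J -> idx Q I -> I \proper J -> idx (bd alpha) I.
  by move=> iJ' iI IJ; exact: (cmd_down cmd iI (proper_sub IJ) iJ').
have gnear alpha t x : idx (bd alpha) J -> A alpha t -> kdom (bd alpha) J x -> dist alpha t < r0 ->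
    \forall z \near mn J (ciota Q alpha t x), g J z = mub alpha J (pr alpha J z).
  move=> iJ' At Jx tr; have nb : near_bd 0 alpha (ciota Q alpha t x).
    by exists t, x; split=> //; rewrite r1.
  have := near_bd_open iJ (cmd_dom cmd iJ' At Jx) nb.
  by apply: filterS => z; exact: g_collar.
have smub alpha t x k : idx (bd alpha) J -> A alpha t -> Vb alpha (dl J) J x ->
    smooth_at (kU (bd alpha) J) (coords (mub alpha J) k) x.
  move=> iJ' At Vx.
  have := smooth_vecP (cmd_pm cmd iJ') (A := Vb alpha (dl J) J) (mub alpha J).
  case=> [z|sv _]; first exact: (Vb_open At iJ').
  by apply: sv => //; exact: mubS.
split.
- move=> y k Vy By; have [alpha [t [x [iJ' At Jx tr [yE Vx]]]]] := BBP y Vy By.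
  rewrite yE; apply: (smooth_at_eq (gd_pm gd iJ)
    (phi := fun z => coords (mub alpha J) k (pr alpha J z))).
    by apply: filterS (gnear _ _ _ iJ' At Jx tr) => z; rewrite /coords => ->.
  exact: (cmd_smooth cmd (phi := coords (mub alpha J) k) iJ' At Jx (smub _ _ _ _ iJ' At Vx)).
- move=> I y iI IJ Vy By Uy Vr; have [alpha [t [x [iJ' At Jx tr [yE Vx]]]]] := BBP y Vy By.
  have iI' := down _ _ iJ' iI IJ; rewrite yE in Uy Vr *.
  have [Ux Irx rhoE] := cmd_Ut cmd iI' iJ' IJ At Jx Uy; rewrite rhoE in Vr *.
  rewrite !gE//; have [mubA _ _ _] := mubP iJ'; apply: mubA => //.
  exact: (VR_bd iI' At Irx (add_le_bound tr dlJ rl) Vr).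
- move=> I y iI IJ Vy By [_ [s [Vs [Us Vrs]] ys]].
  have [alpha [t [x [iJ' At Jx tr [yE Vx]]]]] := BBP y Vy By.
  have iI' := down _ _ iJ' iI IJ; rewrite yE in ys *; rewrite gE//.
  have [_ _ mubC _] := mubP iJ'; apply: (mubC I) => //.
  have Js : kdom Q J s by case: Vs.
  have rb : w * (1 - w) * dl J <= (1 - w) * dl J.
    by rewrite -mulrA ger_pMl ?ltW// mulr_gt0 ?subr_gt0.
  have rbc : (1 - w) * dl J + w ^+ 3 * dl J <= dl J.
    have w3 : w ^+ 3 <= w by rewrite exprS ger_pMr// exprn_ile1// ltW.
    by rewrite -mulrDl ger_pMl// -lerBrDl opprB addrC subrK.
  have c3 : w ^+ 3 * dl J <= dl J by rewrite ger_pMl// exprn_ile1// ltW.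
  (* The nearby point [s] of N_JI has its own parameter t'. The collar still contains its
     neighbourhood of radius w^3 dl J, because r0 + w (1 - w) dl J + w^3 dl J <= r0 + delta <=
     ell. *)
  have [||t' [x' [At' _ Jx' sE [tt dx]]]] :=
      near_collar (s := w * (1 - w) * dl J) iJ' iJ At Jx Js.
  + by apply: d_lt_sym ys => //; exact: (cmd_dom cmd).
  + apply: add_le_bound tr _ rl; apply: le_trans dlJ; apply: le_trans rb _.
    by rewrite ger_pMl// gerBl ltW.
  have rc : w * (1 - w) * dl J + w ^+ 3 * dl J <= delta.
    exact: le_trans (lerD rb (lexx _)) (le_trans rbc dlJ).
  have tr' : dist alpha t' < r0 + w * (1 - w) * dl J.
    exact: bd_dist_lt (ltW tr) tt.
  have tc : dist alpha t' + w ^+ 3 * dl J <= ell.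
    by apply: add_le_bound tr' (lexx _) _; rewrite -addrA; apply: le_trans rl; rewrite lerD2l.
  rewrite sE in Us Vs Vrs.
  have [Ux' Irx rhoE] := cmd_Ut cmd iI' iJ' IJ At' Jx' Us.
  have Vb_mono H : Vb alpha (w ^+ 3 * dl J) H `<=` Vb alpha (dl J) H by exact: VR_mono.
  split=> //; exists x'; last first.
    have dE a b : kdom (bd alpha) J a -> kdom (bd alpha) J b ->
        dK alpha (piK (bd alpha) J a) (piK (bd alpha) J b) =
        d (piK Q J (ciota Q alpha t a)) (piK Q J (ciota Q alpha t b)).
      by move=> Ja Jb; rewrite (cmd_d cmd)// subrr normr0 add0r.
    have Qx := cmd_dom cmd iJ' At Jx; have Qx' := cmd_dom cmd iJ' At Jx'.
    rewrite dE// (gd_sym gd)// -(dE x' x)//.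
    exact: lt_le_trans dx rb.
  split; first by apply: Vb_mono; apply: (VR_bd iJ' At' Jx' tc Vs).
  split=> //; rewrite /preimage/=; apply: Vb_mono.
  by move: Vrs; rewrite /preimage/= rhoE; exact: (VR_bd iI' At' Irx tc).
- move=> y Vy By E; have [alpha [t [x [iJ' At Jx tr [yE Vx]]]]] := BBP y Vy By.
  rewrite yE gE// (cmd_s cmd)// in E *.
  have [_ mubB _ _] := mubP iJ'; have := mubB x Vx E.
  move=> /(im_diffP (cmd_pm cmd iJ')) sx.
  have {}sx := sx (Vb_open At iJ' Vx).
  have {}sx := cmd_surj cmd iJ' At Jx _ sx.
  have nb : near_bd 0 alpha (ciota Q alpha t x) by exists t, x; split=> //; rewrite r1.
  apply: (surj_at_eq gd iJ (cmd_dom cmd iJ' At Jx) _ (sx _)) => [|k].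
    apply: filterS (near_bd_open iJ (cmd_dom cmd iJ' At Jx) nb) => z nz k.
    have [t' [x' [_ At' Jx' _ zE]]] := nz.
    by rewrite /coords (g_collar nz) zE (cmd_pr cmd)// (cmd_s cmd).
  rewrite (_ : coords _ k = fun z => coords (ks (bd alpha) J) k z + coords (mub alpha J) k z).
    exact: smooth_atD (cmd_s_smooth cmd k iJ' Jx) (smub _ _ _ k iJ' At Vx).
  by apply/funext => z; rewrite /coords coi_add.
move=> y Vy By; have [alpha [t [x [iJ' At Jx tr [yE Vx]]]]] := BBP y Vy By.
by rewrite yE gE//; have [_ _ _] := mubP iJ'; apply.
Qed.

(** As |I| <= N for every index, the collar of level 5 N is one on which no stage changes the
    prescribed values. *)
Lemma nub_eq (mu : forall I, T I -> oEI I) alpha I t x :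
  (forall I, idx Q I -> extends Q d V C nrm w dl tau BB g mu (mu I)) ->
  (forall x, bV alpha I x -> mub alpha I x = nub alpha I x) ->
  idx (bd alpha) I -> A alpha t -> bd_dist alpha t < rad (5 * oN O) -> bV alpha I x ->
  mu I (ciota Q alpha t x) = nub alpha I x.
Proof.
move=> muP mubE iI At tr [Ix Vx]; have iQ := cmd_idx cmd iI.
have Qx := cmd_dom cmd iI At Ix.
have Vi : V I (ciota Q alpha t x) by apply/(cmd_V cmd iI At Ix).
have tr' n : (n <= 5 * oN O)%N -> bd_dist alpha t < rad n.
  by move=> nN; apply: lt_le_trans tr (rad_mono nN).
have nb n : (n <= 5 * oN O)%N -> near_bd n alpha (ciota Q alpha t x).
  by move=> nN; exists t, x; split=> //; exact: tr'.
rewrite (ex_BB (muP I iQ)).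
- rewrite (g_collar (alpha := alpha)) ?(cmd_pr cmd)//; first exact: mubE.
  exact: nb.
- by apply: (level_sub gd Vo iQ) => //; rewrite divr_gt0// radius_gt0.
exists alpha, I, (ciota Q alpha t x); split=> //; apply: nb.
by rewrite leq_mul2l/= -[leqRHS]card_ord; exact: max_card.
Qed.

End CollarModel.

Theorem collar_perturbation (R : realType) (O : obst R) (T : Index O -> topologicalType)
    (Y : topologicalType) (Q : cobdata T Y) (d : set (kpoint T) -> set (kpoint T) -> R)
    (V C : forall I, set (T I)) (nrm : forall i, @oE R O i -> R) (ell r0 delta sig : R)
    (A : bool -> set R) (pr : bool -> forall I, T I -> T I) (nub : bool -> forall I, T I -> oEI I) :
  collar_model Q d V ell r0 A pr -> good Q d ->
  (forall I, idx Q I -> relopen (kdom Q I) (V I)) -> equivariant_norms nrm ->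
  0 < delta -> 0 < r0 -> r0 + delta <= ell ->
  (forall I, idx Q I -> precompact_in (Bhat Q d (2 * delta) (V I)) (kdom Q I)) ->
  (forall I J, idx Q I -> idx Q J ->
    (nbhd Q d (2 * delta) (piK Q I @` V I) `&` nbhd Q d (2 * delta) (piK Q J @` V J)) !=set0 ->
    I \subset J \/ J \subset I) ->
  0 < sig -> (sig%:E <= sigma_V' Q d V C nrm delta)%E ->
  (forall alpha, bd_adapted Q d V C nrm delta sig alpha (nub alpha)) ->
  exists nu : forall I, T I -> oEI I,
    [/\ perturbation Q V nu, admissible_pert Q V nu, transverse Q V nu,
        pert_zero Q V nu `<=` piKV Q C &
        exists2 r, 0 < r & forall alpha I t x, idx (cbd Q alpha) I -> A alpha t ->
          bd_dist alpha t < r -> bd_set Q V alpha I x -> nu I (ciota Q alpha t x) = nub alpha I x].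
Proof.
move=> cmd gd Vo en delta0 r00 rl VP Vsep sig0 sigS adp.
have /choice[mub mubH] : forall alpha, exists mu, _ := fun alpha => ad_ext (adp alpha).
pose w : R := 2 `^ (- 4^-1); pose dl := radius (O := O) 1 delta.
have dlE (I : Index O) : 2 `^ (- #|I|%:R) * delta = dl I by rewrite /dl radius1.
have mubK alpha (I : Index O) : idx (cbd Q alpha) I ->
    (1 <= #|I| <= \max_(I : Index O | `[< idx (cbd Q alpha) I >]) #|I|)%N.
  move=> iI; have [I0 _] := iI; rewrite card_gt0 I0 /=.
  by apply: (@leq_bigmax_cond _ _ (fun I : Index O => #|I|)); exact/asboolP.
have /choice[tb tbP] : forall p : bool * Index O, exists t, [/\ 0 <= t, t < sig &
    idx (cbd Q p.1) p.2 -> forall x, Bhat (cbd Q p.1) (bd_metric Q d p.1) (dl p.2)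
      (bd_set Q V p.1 p.2) x -> normI nrm (mub p.1 p.2 x) <= t].
  move=> [alpha I] /=; have [iI|nI] := EM (idx (cbd Q alpha) I); last by exists 0.
  have [_ /(_ _ (mubK alpha I iI) I iI (leqnn _))[_ _ _ _]] := mubH alpha.
  rewrite /Vk dlE => /(ereal_sup_lt_bound sig0)[t [t0 ts tP]].
  by exists t.
(* Finitely many bounds, one for each end and index, have a maximum that is still below [sig]; [tau]
   starts there. *)
pose t0 := \big[Num.max/0]_(p : bool * Index O) tb p.
have t00 : 0 <= t0 by exact: bigmax_ge_id.
have [|tau [tau0 tauS tau_sig]] := @tau_exists _ t0 sig.
  by apply/bigmax_ltP; split=> // p _; have [] := tbP p.
have tau00 : 0 <= tau 0%N by rewrite tau0.
have gap0 n : 0 < rad r0 n - rad r0 n.+1 by rewrite subr_gt0; exact: rad_lt.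
have pres (J : Index O) : idx Q J -> prescribed Q d V nrm w dl tau (BB Q r0 A) (g Q r0 A pr mub) J.
  apply: (prescribed_collar cmd gd Vo delta0 rl) => [alpha I iI|alpha I iI].
    have [_ /(_ _ (mubK alpha I iI) I iI (leqnn _))[ma mb mc _ _]] := mubH alpha.
    rewrite /Vk dlE in ma mb mc; split=> //.
    + move=> H x iH HI Vx Dx; apply: (mc H) => //.
      by rewrite /Nk /Vk dlE /eta mulrAC dlE mulrC.
    + move=> x Vx; rewrite tau0; have [_ _ H] := tbP (alpha, I).
      by apply: le_trans (H iI x Vx) _; exact: (@le_bigmax _ _ _ 0 tb (alpha, I)).
  by have [/(_ I iI)[_]] := mubH alpha; rewrite /Vk dlE.
have [|mu muP] := level_extends gd Vo delta0 ler01 en VP Vsep tau00 tauS tau_sig gap0 _ sigS pres.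
  by move=> n I J x y; exact: (BB_gap cmd gd delta0 r00 rl).
exists mu; split.
- exact: (level_perturbation gd Vo delta0 muP).
- exact: (level_admissible gd Vo delta0 muP).
- exact: (level_transverse gd Vo delta0 muP).
- exact: (level_zero gd Vo delta0 muP).
exists (rad r0 (5 * oN O)); first exact: rad_gt0.
move=> alpha I t x iI At tr Vx; apply: (nub_eq cmd gd Vo delta0 r00 muP) => // y Vy.
by have [/(_ I iI)[E _] _] := mubH alpha; exact: E.
Qed.

(** * Products with an interval *)

Section LocalMin.
Context {R : realType}.

Lemma derive_min_ge0 n (h : 'rV[R]_n -> R) p v : derivable h p v ->
  (\forall z \near p, h p <= h z) -> 0 <= 'D_v h p.
Proof.
move=> hd mn; pose g (t : R) := t^-1 *: (h (t *: v + p) - h p).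
have -> : 'D_v h p = lim (g @ 0^'+) by rewrite -cvg_at_rightE.
apply: limr_ge; first exact: (cvgP _ (cvg_dnbhs_at_right hd)).
apply: filterS2 (near_right_line v mn) (nbhs_right_gt 0) => t ht t0.
by apply: mulr_ge0; rewrite ?invr_ge0 ?subr_ge0// ltW.
Qed.

Lemma derive_local_min n (h : 'rV[R]_n -> R) p v : differentiable h p ->
  (\forall z \near p, h p <= h z) -> 'D_v h p = 0.
Proof.
move=> hd mn; have dv w : derivable h p w by exact: diff_derivable.
apply/eqP; rewrite eq_le derive_min_ge0// andbT -oppr_ge0.
by have := derive_min_ge0 (dv (- v)) mn; rewrite !deriveE// linearN.
Qed.

End LocalMin.

Section PairMatrix.
Context {R : realType} {n : nat}.

Definition pairmx (t : R) (z : 'rV[R]_n) : 'rV[R]_(1 + n) := row_mx (const_mx t) z.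

Lemma pairmx_l t z : lsubmx (pairmx t z) 0 0 = t.
Proof. by rewrite row_mxKl mxE. Qed.

Lemma pairmx_r t z : rsubmx (pairmx t z) = z.
Proof. exact: row_mxKr. Qed.

Lemma pairmx_eta (z : 'rV[R]_(1 + n)) : pairmx (lsubmx z 0 0) (rsubmx z) = z.
Proof.
rewrite -[RHS]hsubmxK; congr row_mx; apply/matrixP => a b.
by rewrite [LHS]mxE !ord1.
Qed.

Lemma pairmx_smooth t (p : 'rV[R]_n) : smooth_rows (pairmx t) p.
Proof.
move=> i; rewrite -(fintype.splitK i); case: (fintype.split i) => k /=.
  by apply: sgerm_eq (sgermC t p) => z; rewrite row_mxEl mxE.
by apply: sgerm_eq (sgerm_coord k p) => z; rewrite row_mxEr.
Qed.

Lemma rsubmx_smooth (p : 'rV[R]_(1 + n)) : smooth_rows (fun z : 'rV[R]_(1 + n) => rsubmx z : 'rV[R]_n) p.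
Proof. by move=> i; apply: sgerm_eq (sgerm_coord (rshift 1 i) p) => z; rewrite mxE. Qed.

Lemma lsubmx_smooth (p : 'rV[R]_(1 + n)) :
  sgerm (fun z : 'rV[R]_(1 + n) => (lsubmx z : 'rV[R]_1) 0 0) p.
Proof. by apply: sgerm_eq (sgerm_coord (lshift n ord0) p) => z; rewrite mxE. Qed.

End PairMatrix.

Section ProductCollar.
Context {R : realType} {T : topologicalType} (M Mb : @manifold R T).
Context (pm : premanifold M) (pmb : premanifold Mb) (A : set R) (iota : R -> T -> T).
Local Notation "'mn' x" := (within (mset M) (nbhs x)) (at level 10, x at level 9).
Local Notation "'mb' x" := (within (mset Mb) (nbhs x)) (at level 10, x at level 9).
Local Notation cimg c := (cmap c @` cdom c).
Local Notation W := [set iota p.1 p.2 | p in A `*` mset Mb].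
Context (sI : smooth_map (itv_prod A Mb) M (A `*` mset Mb) (fun p => iota p.1 p.2)).
Context (j : T -> R * T) (jK : forall t x, A t -> mset Mb x -> j (iota t x) = (t, x)).
Context (sj : smooth_map M (itv_prod A Mb) W j) (Wo : relopen (mset M) W).

Lemma product_mset t x : A t -> mset Mb x -> mset M (iota t x).
Proof. by move=> At Mx; have [IM _ _] := sI; apply: (IM (t, x)); split. Qed.

Lemma iota_cont (P : set T) t x : A t -> mset Mb x -> (\forall y \near mn (iota t x), P y) ->
  \forall s \near t & x' \near x, A s -> mset Mb x' -> P (iota s x').
Proof.
move=> At Mx H; have [IM cI _] := sI.
have : (fun p : R * T => iota p.1 p.2) @ within (A `*` mset Mb) (nbhs (t, x)) --> iota t x.
  by move/subspace_continuousP: cI => /(_ (t, x)); apply; split.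
move=> /(_ _ H) H1.
have H2 : \forall p \near (t, x), (A `*` mset Mb) p -> mset M (iota p.1 p.2) -> P (iota p.1 p.2) := H1.
apply: filterS H2 => -[s x'] /= H2 As Mx'; apply: H2; first by split.
by apply: (IM (s, x')); split.
Qed.

Lemma slice_cont (P : set T) t x : A t -> mset Mb x -> (\forall y \near mn (iota t x), P y) ->
  \forall x' \near mb x, P (iota t x').
Proof.
move=> At Mx /(iota_cont At Mx) H; rewrite near_withinE.
have [[B1 B2] /= [/nbhs_singleton Bt Bx] BH] := H.
by apply: filterS Bx => x' Bx' Mx'; apply: (BH (t, x')).
Qed.

Lemma iota_chart t x c c0 : A t -> mset Mb x -> mcharts M c -> cdom c (iota t x) ->
  mcharts Mb c0 -> cdom c0 x -> exists F : 'rV[R]_(1 + mdim Mb) -> 'rV[R]_(mdim M),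
    smooth_rows F (pairmx t (cmap c0 x)) /\
    \forall z \near pairmx t (cmap c0 x), A (lsubmx z 0 0) -> cimg c0 (rsubmx z) ->
      cdom c (iota (lsubmx z 0 0) (cinv c0 (rsubmx z))) /\
      F z = cmap c (iota (lsubmx z 0 0) (cinv c0 (rsubmx z))).
Proof.
move=> At Mx Mc cx Mc0 c0x; have [_ _ sm] := sI.
have tc := pm_charts pm Mc; have tc0 := pm_charts pmb Mc0.
have Pc : mcharts (itv_prod A Mb) (prod_chart A c0) by exists c0.
have [|F /smooth_rowsP Fs FE] := sm _ _ Pc Mc (pairmx t (cmap c0 x)).
  by exists (t, x) => //; split=> //; split.
exists F; split=> //.
have [[B1 B2] /= [Bt Bx] BH] := iota_cont At Mx (cdom_near tc cx).
have Bx' : \forall y \near mb x, B2 y by rewrite near_withinE; apply: filterS Bx.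
have H2 := near_chart tc0 c0x Bx'; rewrite -{1}(pairmx_r t (cmap c0 x)) in H2.
have {}H2 := near_comp (tau := fun z : 'rV[R]_(1 + mdim Mb) => rsubmx z : 'rV[R]__)
  (rsubmx_smooth _) H2.
have H1 : \forall z \near pairmx t (cmap c0 x), B1 (lsubmx z 0 0).
  have := sgerm_continuous (lsubmx_smooth (pairmx t (cmap c0 x))).
  by apply; rewrite pairmx_l.
apply: filterS3 FE H1 H2 => z FE H1 H2 Az cz.
have [B2z cz1 cz2] := H2 cz; have Mz := cdom_mset tc0 cz1.
have ciz : cdom c (iota (lsubmx z 0 0) (cinv c0 (rsubmx z))).
  by apply: (BH (_, _)) => //; split.
split=> //; apply: FE; exists (lsubmx z 0 0, cinv c0 (rsubmx z)); first by split=> //; split.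
by rewrite /= cz2; exact: pairmx_eta.
Qed.

Lemma j_chart t x c c0 : A t -> mset Mb x -> mcharts M c -> cdom c (iota t x) ->
  mcharts Mb c0 -> cdom c0 x -> exists H : 'rV[R]_(mdim M) -> 'rV[R]_(1 + mdim Mb),
    [/\ smooth_rows H (cmap c (iota t x)), H (cmap c (iota t x)) = pairmx t (cmap c0 x) &
    \forall z \near cmap c (iota t x), cimg c z -> exists s x',
      [/\ A s, cdom c0 x', iota s x' = cinv c z & H z = pairmx s (cmap c0 x')]].
Proof.
move=> At Mx Mc cx Mc0 c0x; have [jM jc sm] := sj.
have tc := pm_charts pm Mc; have tc0 := pm_charts pmb Mc0.
have Pc : mcharts (itv_prod A Mb) (prod_chart A c0) by exists c0.
have Wx : W (iota t x) by exists (t, x).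
have [|H /smooth_rowsP Hs HE] := sm _ _ Mc Pc (cmap c (iota t x)).
  by exists (iota t x) => //; split=> //; rewrite /preimage/= jK.
have H0 : H (cmap c (iota t x)) = pairmx t (cmap c0 x).
  rewrite (nbhs_singleton HE) /=; first by rewrite (tc_cancel tc)// jK.
  by exists (iota t x) => //; split=> //; rewrite /preimage/= jK.
exists H; split=> //.
have cj : \forall y \near mn (iota t x), W y /\ (A `*` cdom c0) (j y).
  have c1 : j @ within W (nbhs (iota t x)) --> j (iota t x).
    by move/subspace_continuousP: jc; apply.
  have c2 : \forall p \near (t, x), mset Mb p.2 -> cdom c0 p.2.
    have := cdom_near tc0 c0x; rewrite near_withinE => Hx.
    exists (setT, [set x' | mset Mb x' -> cdom c0 x']) => /=; first by split=> //; exact: filterT.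
    by move=> [s x'] /= [_]; exact.
  rewrite jK// in c1; have := c1 _ c2 => c3.
  have c4 : \forall y \near iota t x, W y -> mset Mb (j y).2 -> cdom c0 (j y).2 := c3.
  have := relopen_near Wo Wx; rewrite near_withinE => Wn.
  rewrite near_withinE; apply: filterS2 c4 Wn => y c4 Wn My; have Wy := Wn My.
  by have [A1 M2] := jM y Wy; split=> //; split=> //; exact: c4.
apply: filterS2 HE (near_chart tc cx cj) => z HE cz ciz.
have [[Wz [Az c0z]] cz1 cz2] := cz ciz; have [[s x'] [/= As Mx'] sx] := Wz.
move: Az c0z HE; rewrite -sx jK//= => _ c0z HE.
exists s, x'; split=> //; rewrite HE /= -?sx ?jK//.
by exists (cinv c z) => //; split=> //; rewrite /preimage/= -sx jK.
Qed.

Lemma collar_smooth phi t x : A t -> mset Mb x -> smooth_at Mb phi x ->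
  smooth_at M (fun y => phi (j y).2) (iota t x).
Proof.
move=> At Mx sphi c Mc cx; have [c0 Mc0 c0x] := pm_cover pmb Mx.
have [H [Hs H0 HE]] := j_chart At Mx Mc cx Mc0 c0x.
have tc0 := pm_charts pmb Mc0; have [g [gs gE]] := sphi c0 Mc0 c0x.
exists (fun z => g (rsubmx (H z))); split.
  apply: (sgerm_comp (f := fun z => rsubmx (H z) : 'rV[R]__) (g := g)).
    by apply: (smooth_rows_comp Hs); exact: rsubmx_smooth.
  by rewrite H0 pairmx_r.
have gE' : \forall z \near cmap c (iota t x), cimg c0 (rsubmx (H z)) ->
    g (rsubmx (H z)) = phi (cinv c0 (rsubmx (H z))).
  apply: (near_comp (tau := fun z => rsubmx (H z) : 'rV[R]__)
    (Q := fun z => cimg c0 z -> g z = phi (cinv c0 z))).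
    by apply: (smooth_rows_comp Hs); exact: rsubmx_smooth.
  by rewrite H0 pairmx_r.
apply: filterS2 gE' HE => z gE' HE cz; have [s [x' [As c0x' sx Hz]]] := HE cz.
have Mx' := cdom_mset tc0 c0x'.
by rewrite gE' Hz pairmx_r ?(tc_cancel tc0)// -?sx ?jK//; exact: cimg_cmap.
Qed.

(** A tangent vector of the boundary is pushed forward along the slice at parameter [t]. As [j]
    inverts [iota], functions of the projection have the same derivative along it. *)
Lemma collar_surj e (phi : 'I_e -> T -> R) t x : A t -> mset Mb x ->
  (forall k, smooth_at Mb (phi k) x) -> surj_at Mb phi x ->
  surj_at M (fun k y => phi k (j y).2) (iota t x).
Proof.
move=> At Mx sphi sj' u; have [c0 [v [Mc0 c0x vE]]] := sj' u.
have My := product_mset At Mx; have [c Mc cx] := pm_cover pm My.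
have tc0 := pm_charts pmb Mc0; have tc := pm_charts pm Mc.
have [F [Fs FE]] := iota_chart At Mx Mc cx Mc0 c0x.
pose G (z : 'rV[R]_(mdim Mb)) := F (pairmx t z).
have Gs : smooth_rows G (cmap c0 x) by exact: (smooth_rows_comp (pairmx_smooth t _) Fs).
have GE : \forall z \near cmap c0 x, cimg c0 z ->
    cdom c (iota t (cinv c0 z)) /\ G z = cmap c (iota t (cinv c0 z)).
  have := near_comp (tau := pairmx t) (pairmx_smooth t _) FE.
  by apply: filterS => z; rewrite pairmx_l pairmx_r => H cz; exact: H.
have G0 : G (cmap c0 x) = cmap c (iota t x).
  have [|_ ->] := nbhs_singleton GE; first exact: cimg_cmap.
  by rewrite (tc_cancel tc0).
exists c, ('D_v G (cmap c0 x)); split=> // k.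
have [g [gs gE] gd] := vE k.
have [h [hs hE]] := collar_smooth At Mx (sphi k) Mc cx.
exists h => //; rewrite -gd -G0; symmetry.
apply: (@derive_push _ _ _ (cimg c0)) => //; first exact: fat_cimg.
  by rewrite G0.
rewrite -G0 in hE; have hE' := near_comp Gs hE.
apply: filterS3 gE GE hE' => z gE GE hE' cz; have [ciz Gz] := GE cz.
have [cz1 _] := cinv_cimg tc0 cz; have Mz := cdom_mset tc0 cz1.
rewrite gE// hE' Gz; last exact: cimg_cmap.
by rewrite (tc_cancel tc)// jK.
Qed.

(** Invariance of the boundary. Near this parameter the product has no boundary, so the boundary
    coordinate, read through [F], would have a local extremum at an interior point; its vanishing
    derivative contradicts F o H = id. *)
Lemma collar_interior t x : nbhs t A -> mset Mb x -> mbdry Mb = set0 -> ~ mbdry M (iota t x).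
Proof.
move=> nA Mx nb [c [Mc cx bp]]; have At := nbhs_singleton nA.
have [c0 Mc0 c0x] := pm_cover pmb Mx.
have tc0 := pm_charts pmb Mc0; have tc := pm_charts pm Mc.
have [F [Fs FE]] := iota_chart At Mx Mc cx Mc0 c0x.
have [H [Hs H0 HE]] := j_chart At Mx Mc cx Mc0 c0x.
have I0 : nbhs (cmap c0 x) (cimg c0).
  have [//|bp0] := tc_image tc0 (cimg_cmap c0x).
  have : mbdry Mb x by exists c0.
  by rewrite nb.
have Fc : \forall z \near pairmx t (cmap c0 x), cimg c (F z).
  have n1 : \forall z \near pairmx t (cmap c0 x), A (lsubmx z 0 0).
    have := sgerm_continuous (lsubmx_smooth (pairmx t (cmap c0 x))).
    by apply; rewrite pairmx_l.
  have n2 : \forall z \near pairmx t (cmap c0 x), cimg c0 (rsubmx z).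
    apply: (near_comp (tau := fun z : 'rV[R]_(1 + mdim Mb) => rsubmx z : 'rV[R]__)
      (rsubmx_smooth _)).
    by rewrite pairmx_r.
  by apply: filterS3 FE n1 n2 => z FE n1 n2; have [? ->] := FE n1 n2; exact: cimg_cmap.
have F0 : F (pairmx t (cmap c0 x)) = cmap c (iota t x).
  have := nbhs_singleton FE; rewrite pairmx_l pairmx_r (tc_cancel tc0)//.
  by case=> //; exact: cimg_cmap.
have FH : \forall z \near cmap c (iota t x), cimg c z -> F (H z) = z.
  rewrite -H0 in FE; have FE' := near_comp Hs FE.
  apply: filterS2 FE' HE => z FE' HE cz; have [s [x' [As c0x' sx Hz]]] := HE cz.
  move: FE'; rewrite Hz pairmx_l pairmx_r (tc_cancel tc0)// => -[//||_ ->].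
    exact: cimg_cmap.
  by rewrite sx; have [_ ->] := cinv_cimg tc cz.
have [i _ bpi] := bp.
(* The image of [F] stays on one side of the boundary hyperplane and touches it at this point. *)
have Fi0 v : 'D_v (fun z => F z 0 i) (pairmx t (cmap c0 x)) = 0.
  have dF := sgerm_diff (Fs i).
  case: bpi; rewrite -F0 => /(near_comp Fs) Hb.
    by apply: derive_local_min => //; apply: filterS2 Hb Fc => z Hb /Hb.
  have N0 : 'D_v (fun z => - F z 0 i) (pairmx t (cmap c0 x)) = 0.
    apply: derive_local_min; first by apply: sgerm_diff; exact: sgermN.
    by apply: filterS2 Hb Fc => z Hb /Hb; rewrite lerN2.
  by move: N0; rewrite deriveN ?opprE; [move/eqP; rewrite oppr_eq0 => /eqP|exact: sgerm_derivable].
have := @derive_push _ _ _ (cimg c) (cmap c (iota t x)) H (fun z => F z 0 i) (fun z => z 0 i)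
  (delta_mx 0 i) (fat_cimg tc cx) Hs.
rewrite H0 Fi0 => E.
have : 'D_(delta_mx 0 i) (fun z : 'rV[R]_(mdim M) => z 0 i) (cmap c (iota t x)) = 0.
  apply: E; [exact: Fs|exact: sgerm_coord|].
  by apply: filterS FH => z FH cz; rewrite FH.
rewrite (derive_coord (f := id)); last exact/smooth_rows_diff/id_smooth.
by rewrite derive_id mxE !eqxx => /eqP; rewrite oner_eq0.
Qed.

End ProductCollar.

(** * Perturbations of cobordisms *)

Lemma collar_dist (R : realType) alpha (e t : R) : collar alpha e t -> bd_dist alpha t < e.
Proof.
rewrite /collar /bd_dist /endpoint; case: alpha => /= /andP[t1 t2].
  by rewrite ger0_norm ?subr_ge0// ltrBlDr -ltrBlDl.
by rewrite sub0r normrN ger0_norm.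
Qed.

Lemma collar_sub (R : realType) alpha (e e' t : R) : e <= e' -> collar alpha e t -> collar alpha e' t.
Proof.
rewrite /collar; case: alpha => /= ee /andP[t1 t2]; apply/andP; split=> //.
  by apply: le_lt_trans t1; rewrite lerD2l lerN2.
exact: lt_le_trans ee.
Qed.

Section Cobordism.
Context {R : realType} {O : obst R} {T : Index O -> topologicalType} {Y : topologicalType}.
Implicit Types (I J H L : Index O) (alpha : bool).
Context (Q : cobdata T Y) (d : set (kpoint T) -> set (kpoint T) -> R).
Context (eps : R) (n : int) (Y0 : set Y) (kb : kuranishi_cobordism eps n Y0 Q).
Local Notation bd alpha := (cbd Q alpha).
Definition kpt I (x : T I) : kpoint T := existT _ I x.
Local Notation wk := (kb_main kb).
Local Notation wb alpha := (proj1 (kb_bd kb alpha)).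

Lemma equiv_piK (K : kdata T Y) p I (x : T I) : equiv K p (kpt x) -> equiv K p = piK K I x.
Proof.
by move=> E; apply/seteqP; split=> q; apply: rst_trans => //; exact: rst_sym.
Qed.

Lemma piK_equiv (K : kdata T Y) I J (x : T I) (y : T J) : piK K I x = piK K J y ->
  equiv K (kpt x) (kpt y).
Proof. by move=> E; change (piK K I x (kpt y)); rewrite E; exact: rst_refl. Qed.

Lemma bd_footprint alpha I : footprint (bd alpha) I `<=` footprint Q I.
Proof. by move=> y H i iI; have := H i iI; rewrite (kb_bd_F kb) => -[]. Qed.

Lemma bd_idx alpha I : idx (bd alpha) I -> idx Q I.
Proof. by move=> [I0 [y Fy]]; split=> //; exists y; exact: bd_footprint Fy. Qed.

Lemma bd_down alpha I J : idx Q I -> I \subset J -> idx (bd alpha) J -> idx (bd alpha) I.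
Proof.
move=> [I0 _] IJ [_ [y Fy]]; split=> //; exists y => i iI; apply: Fy.
exact: (fintype.subsetP IJ).
Qed.

Lemma bd_proper alpha I J : I \proper J -> idx Q I -> idx (bd alpha) J -> idx (bd alpha) I.
Proof. by move=> IJ iI; apply: bd_down => //; exact: proper_sub. Qed.

Section Collar.
Context (alpha : bool) (t : R) (ct : collar alpha eps t).
Local Notation iota := (fun I => ciota Q alpha (I := I) t).

Lemma bd_dom I x : idx (bd alpha) I -> kdom (bd alpha) I x -> kdom Q I (ciota Q alpha t x).
Proof.
by move=> iI Ix; have [IM _ _] := cl_smooth (kb_charts kb iI); apply: (IM (t, x)); split.
Qed.

Lemma bd_act I g x : idx (bd alpha) I -> kdom (bd alpha) I x -> kdom (bd alpha) I (kact (bd alpha) g x).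
Proof.
move=> iI; have [+ _ _] := kc_act_smooth (wk_charts (wb alpha) iI) g; exact.
Qed.

Lemma bd_inj I t' x x' : idx (bd alpha) I -> collar alpha eps t' -> kdom (bd alpha) I x ->
  kdom (bd alpha) I x' -> ciota Q alpha t x = ciota Q alpha t' x' -> t = t' /\ x = x'.
Proof.
move=> iI ct' Ix Ix' E; have [j jK _] := cl_inv (kb_charts kb iI).
by have := jK t x ct Ix; rewrite E jK// => -[-> ->].
Qed.

Lemma bd_Ut I J x : idx (bd alpha) I -> idx (bd alpha) J -> I \proper J ->
  kdom (bd alpha) J x -> kUt Q I J (ciota Q alpha t x) <-> kUt (bd alpha) I J x.
Proof.
move=> iI iJ IJ Jx; have := cg_Ut (kb_changes kb iI iJ IJ) => /seteqP[U1 U2].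
split=> [Uy|Ux]; last first.
  by have [|] := U2 (ciota Q alpha t x); first by exists (t, x).
have [|[t' x'] [/= ct' Ux'] E] := U1 (ciota Q alpha t x).
  by split=> //; exists (t, x).
have Jx' := kUt_dom (wb alpha) iI iJ IJ Ux'.
by have [_ ->] := bd_inj iJ ct' Jx Jx' (esym E).
Qed.

Lemma bd_rho I J x : idx (bd alpha) I -> idx (bd alpha) J -> I \proper J ->
  kUt (bd alpha) I J x -> kdom (bd alpha) I (krho (bd alpha) I J x) /\
  krho Q I J (ciota Q alpha t x) = ciota Q alpha t (krho (bd alpha) I J x).
Proof.
move=> iI iJ IJ Ux; split; first exact: (rho_dom (wb alpha) iI iJ IJ Ux).
exact: (cg_rho (kb_changes kb iI iJ IJ)).
Qed.

Lemma bd_piK_rho I J x : idx (bd alpha) I -> idx (bd alpha) J -> I \proper J ->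
  kUt (bd alpha) I J x -> piK (bd alpha) I (krho (bd alpha) I J x) = piK (bd alpha) J x.
Proof.
move=> iI iJ IJ Ux; apply: (piK_rho (wb alpha)) => //; first exact: proper_sub.
exact: (rho_dom (wb alpha) iI iJ IJ Ux).
Qed.

(** Checked on generators: within one chart the collar map is equivariant, and between charts the
    coordinate changes have product form. Hence it descends to the realizations ([iotaK_piK]). *)
Lemma iota_equiv p q : equiv (bd alpha) p q ->
  equiv Q (kpt (ciota Q alpha t (projT2 p))) (kpt (ciota Q alpha t (projT2 q))).
Proof.
elim=> [_ _ [I J g y iI iJ IJ Uy] /=|p'|p' q' _ H|p' q' r' _ H1 _ H2]; last first.
- exact: rst_trans H1 H2.
- exact: rst_sym.
- exact: rst_refl.
have [iI' iJ'] := (bd_idx iI, bd_idx iJ); apply: piK_equiv.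
have := IJ; rewrite subEproper => /predU1P[EI|IJ'].
  subst I; have [_ Ut rho] := wk_id (wb alpha) iJ; rewrite Ut in Uy.
  rewrite rho// (cl_equiv (kb_charts kb iJ))//.
  by apply: (piK_act wk) => //; exact: bd_dom.
have [Ir rhoE] := bd_rho iI iJ IJ' Uy.
rewrite (cl_equiv (kb_charts kb iI))// (piK_act wk)//; last exact: bd_dom.
have Jy := kUt_dom (wb alpha) iI iJ IJ' Uy.
rewrite -rhoE; apply: (piK_rho wk) => //; first exact/(bd_Ut iI iJ IJ' Jy).
by rewrite rhoE; exact: bd_dom.
Qed.

Lemma iotaK_piK I x : iotaK Q alpha t (piK (bd alpha) I x) = piK Q I (ciota Q alpha t x).
Proof.
apply/seteqP; split=> [q [x' /iota_equiv E xq]|q xq]; first exact: rst_trans E xq.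
by exists (kpt x) => //; exact: rst_refl.
Qed.

(* Stable under the generators of the equivalence relation, so the collar
   parameter and the boundary class are well defined on |K|. *)
Definition in_slice (p0 : set (kpoint T)) (q : kpoint T) := exists x,
  [/\ idx (bd alpha) (projT1 q), kdom (bd alpha) (projT1 q) x,
      projT2 q = ciota Q alpha t x & piK (bd alpha) (projT1 q) x = p0].

Lemma slice_act p0 I (g : oGI I) y : idx Q I -> kdom Q I y ->
  in_slice p0 (kpt (kact Q g y)) <-> in_slice p0 (kpt y).
Proof.
have dir h z : idx Q I -> kdom Q I z -> in_slice p0 (kpt z) -> in_slice p0 (kpt (kact Q h z)).
  move=> iI Iz [x [/= iI' Ix zE pE]].
  exists (kact (bd alpha) h x); split=> //=; first exact: bd_act.
    by rewrite (cl_equiv (kb_charts kb iI'))// zE.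
  by rewrite (piK_act (wb alpha)).
move=> iI Iy; split; last exact: dir.
have ga : kact Q (ginv g) (kact Q g y) = y.
  rewrite -(kc_actM (wk_charts wk iI))// (_ : gmul _ _ = g1) ?(kc_act1 (wk_charts wk iI))//.
  by apply: functional_extensionality_dep => i; rewrite /gmul /ginv mulVg.
move=> /(dir (ginv g)); rewrite ga; apply=> //.
by have [+ _ _] := kc_act_smooth (wk_charts wk iI) g; exact.
Qed.

(** From I to J: [kb_changes_int] puts J among the boundary indices, and the product form of U_IJ
    yields a boundary point with the same image under rho_IJ. It differs from [y] by an element of
    the kernel, which acts on boundary points as well. *)
Lemma slice_rho p0 I J y : idx Q I -> idx Q J -> I \proper J -> kUt Q I J y ->
  in_slice p0 (kpt (krho Q I J y)) <-> in_slice p0 (kpt y).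
Proof.
move=> iI iJ IJ Uy; have cc := wk_change wk iI iJ IJ.
split=> -[x [/= iE Ex yE pE]].
  have iJ' : idx (bd alpha) J.
    apply: contrapT => nJ; have := kb_changes_int kb iE iJ IJ nJ => /seteqP[H _].
    apply: (H (krho Q I J y)); split; first exact: (rho_kUo wk iI iJ IJ).
    by exists (t, x).
  have : kUo Q I J (krho Q I J y) by exact: (rho_kUo wk iI iJ IJ).
  move=> UI; have := cg_U (kb_changes kb iE iJ' IJ) => /seteqP[H _].
  have [|[t' x'] [/= ct' Ux'] E] := H (krho Q I J y); first by split=> //; exists (t, x).
  have Ix' : kdom (bd alpha) I x'.
    by have [? _ UE] := cc_U_open (wk_change (wb alpha) iE iJ' IJ); move: Ux'; rewrite UE => -[].
  rewrite yE in E; have [tt xx] := bd_inj iE ct' Ex Ix' (esym E).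
  move: Ux'; rewrite -xx -(cc_rho_onto (wk_change (wb alpha) iE iJ' IJ)) => -[z Uz zx].
  have Jz := kUt_dom (wb alpha) iE iJ' IJ Uz.
  have UQz : kUt Q I J (ciota Q alpha t z) by apply/bd_Ut.
  have [_ rz] := bd_rho iE iJ' IJ Uz.
  have [|h hI yz] := (cc_rho_fib cc UQz Uy).1 _; first by rewrite rz zx.
  exists (kact (bd alpha) h z); split=> //=; first exact: bd_act.
    by rewrite (cl_equiv (kb_charts kb iJ'))// -yz.
  by rewrite (piK_act (wb alpha))// -pE -zx bd_piK_rho.
have iI' := bd_proper IJ iI iE.
have Ux : kUt (bd alpha) I J x by apply/(bd_Ut iI' iE IJ Ex); rewrite -yE.
have [Ir rE] := bd_rho iI' iE IJ Ux.
exists (krho (bd alpha) I J x); split=> //=; first by rewrite yE rE.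
by rewrite bd_piK_rho.
Qed.

Lemma slice_equiv p0 p q : equiv Q p q -> in_slice p0 p <-> in_slice p0 q.
Proof.
elim=> [_ _ [I J g y iI iJ IJ Uy]|p' //|p' q' _ H|p' q' r' _ H1 _ H2]; last first.
- exact: iff_trans H1 H2.
- exact: iff_sym.
have := IJ; rewrite subEproper => /predU1P[EI|IJ'].
  subst I; have [_ Ut rho] := wk_id wk iJ; rewrite Ut in Uy.
  by rewrite rho//; exact: slice_act.
apply: iff_trans (slice_act _ _ iI (rho_dom wk iI iJ IJ' Uy)) _.
exact: slice_rho.
Qed.

Lemma slice_class I J x y : idx (bd alpha) I -> kdom (bd alpha) I x ->
  piK Q J y = piK Q I (ciota Q alpha t x) ->
  exists x', [/\ idx (bd alpha) J, kdom (bd alpha) J x' & y = ciota Q alpha t x'].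
Proof.
move=> iI Ix /esym/piK_equiv/(slice_equiv (piK (bd alpha) I x))[+ _].
case=> [|x' [/= iJ Jx' yE _]]; first by exists x.
by exists x'.
Qed.

End Collar.

Context (tm : tame Q) (am : admissible_metric Q d) (cm : collared_metric eps Q d).
Context (V : forall I, set (T I)) (cr : cobordism_reduction eps Q V).
Arguments V : clear implicits.
Let gd : good Q d := tame_good wk tm am.
Local Notation mn I x := (within (kdom Q I) (nbhs x)).

Lemma bd_pm alpha I : idx (bd alpha) I -> premanifold (kU (bd alpha) I).
Proof. by move=> iI; apply: manifold_premanifold; exact: (kc_manifold (wk_charts (wb alpha) iI)). Qed.

Lemma collar_end alpha : collar alpha eps (endpoint alpha : R).
Proof.
have e0 := kb_eps kb; rewrite /collar /endpoint.
by case: alpha => /=; rewrite ?lexx ?andbT// ltrBlDr ltrDl.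
Qed.

Lemma cob_d alpha I J t t' x x' : idx (bd alpha) I -> idx (bd alpha) J ->
  collar alpha eps t -> collar alpha eps t' -> kdom (bd alpha) I x -> kdom (bd alpha) J x' ->
  d (piK Q I (ciota Q alpha t x)) (piK Q J (ciota Q alpha t' x')) =
  `|t - t'| + bd_metric Q d alpha (piK (bd alpha) I x) (piK (bd alpha) J x').
Proof.
move=> iI iJ ct ct' Ix Jx'; rewrite -!iotaK_piK//; apply: (cm_prod cm) => //.
  by exists I, x.
by exists J, x'.
Qed.

(** [cm_far] excludes points outside the collar, and [slice_class] turns an equality of classes in
    |K| into an equality of points of the chart. *)
Lemma cob_far alpha I J t x y : idx (bd alpha) I -> idx Q J -> collar alpha eps t ->
  kdom (bd alpha) I x -> kdom Q J y ->
  bd_dist alpha t + d (piK Q J y) (piK Q I (ciota Q alpha t x)) < eps ->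
  exists t' x', [/\ collar alpha eps t', idx (bd alpha) J, kdom (bd alpha) J x' &
    y = ciota Q alpha t' x'].
Proof.
move=> iI iJ ct Ix Jy; rewrite -iotaK_piK// => far.
have rp : realization (bd alpha) (piK (bd alpha) I x) by exists I, x.
have rq : realization Q (piK Q J y) by exists J, y.
apply: contrapT => nex.
have := cm_far cm ct rp rq; rewrite leNgt; case/(_ _)/negP; last by rewrite ltrBrDl.
move=> t' _ ct' [L [z [iL Lz ->]]] E; apply: nex.
rewrite iotaK_piK// in E; have [x' [iJ' Jx' yE]] := slice_class ct' iL Lz E.
by exists t', x'.
Qed.

Section Chart.
Context (alpha : bool) I (iI : idx (bd alpha) I).

Lemma chart_smooth : smooth_map (itv_prod (collar alpha eps) (kU (bd alpha) I)) (kU Q I)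
  (collar alpha eps `*` mset (kU (bd alpha) I)) (fun p => ciota Q alpha p.1 p.2).
Proof. exact: (cl_smooth (kb_charts kb iI)). Qed.

Lemma chart_proj : exists p : T I -> T I, forall t x, collar alpha eps t -> kdom (bd alpha) I x ->
  [/\ p (ciota Q alpha t x) = x,
      forall phi, smooth_at (kU (bd alpha) I) phi x ->
        smooth_at (kU Q I) (fun y => phi (p y)) (ciota Q alpha t x) &
      forall e (phi : 'I_e -> T I -> R), (forall k, smooth_at (kU (bd alpha) I) (phi k) x) ->
        surj_at (kU (bd alpha) I) phi x ->
        surj_at (kU Q I) (fun k y => phi k (p y)) (ciota Q alpha t x)].
Proof.
have [j jK js] := cl_inv (kb_charts kb iI); have Wo := cl_open (kb_charts kb iI).
have pQ := gd_pm gd (bd_idx iI); have pb := bd_pm iI.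
exists (fun y => (j y).2) => t x ct Ix; split; first by rewrite jK.
  by move=> phi; exact: (collar_smooth pQ pb jK js Wo ct Ix).
by move=> e phi; exact: (collar_surj pQ pb chart_smooth jK js Wo ct Ix).
Qed.

Lemma collar_chart_near t x (P : set (T I)) : collar alpha eps t -> kdom (bd alpha) I x ->
  (\forall y \near mn I (ciota Q alpha t x), P y) ->
  \forall x' \near within (kdom (bd alpha) I) (nbhs x), P (ciota Q alpha t x').
Proof. exact: (slice_cont chart_smooth). Qed.

Lemma chart_mbdry t x : collar alpha eps t -> kdom (bd alpha) I x -> t != endpoint alpha ->
  ~ mbdry (kU Q I) (ciota Q alpha t x).
Proof.
move=> ct Ix te; have [j jK js] := cl_inv (kb_charts kb iI).
have Wo := cl_open (kb_charts kb iI).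
apply: (collar_interior (gd_pm gd (bd_idx iI)) (bd_pm iI) chart_smooth jK js Wo _ Ix).
  move: ct te; rewrite /collar /endpoint; case: alpha => /= /andP[t1 t2] te.
    have t3 : t < 1 by rewrite lt_neqAle te.
    have : t \in `]1 - eps, 1[ by rewrite in_itv/= t1.
    move=> /near_in_itvoo; apply: filterS => s /=; rewrite in_itv/= => /andP[-> s1].
    by rewrite ltW.
  have t3 : 0 < t by rewrite lt_neqAle eq_sym te.
  have : t \in `]0, eps[ by rewrite in_itv/= t3.
  move=> /near_in_itvoo; apply: filterS => s /=; rewrite in_itv/= => /andP[s1 ->].
  by rewrite ltW.
exact: (proj2 (kb_bd kb alpha) I iI).
Qed.

End Chart.

(** If the collars met, the boundary point [x] of the end 0 would be close enough to lie in the
    collar of the end 1. There it is an interior point of U_I or a boundary point of the other end,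
    and both are impossible. *)
Lemma collars_disjoint I t t' x x' : idx (bd false) I -> idx (bd true) I ->
  collar false eps t -> collar true eps t' -> kdom (bd false) I x -> kdom (bd true) I x' ->
  bd_dist false t + bd_dist true t' < eps -> ciota Q false t x <> ciota Q true t' x'.
Proof.
move=> i0 i1 ct ct' Ix Ix' tt E; have iQ := bd_idx i0.
have c0 := collar_end false.
have b0 : ciota Q false (endpoint false) x = x by exact: (cl_incl (kb_charts kb i0)).
have Qx : kdom Q I x by rewrite -b0; exact: bd_dom.
have dxx : bd_metric Q d false (piK (bd false) I x) (piK (bd false) I x) = 0.
  have := cob_d i0 i0 c0 c0 Ix Ix; rewrite subrr normr0 add0r => <-.
  by rewrite b0 (gd_dxx gd).
have [|t2 [x2 [ct2 _ Ix2 xE]]] := cob_far i1 iQ ct' Ix' Qx.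
  rewrite -E -{1}b0 cob_d// dxx addr0 addrC; exact: tt.
have bx : mbdry (kU Q I) x by rewrite (kb_bdry kb iQ); left.
have [t2e|t2n] := eqVneq t2 (endpoint true); last first.
  by apply: (chart_mbdry i1 ct2 Ix2 t2n); rewrite -xE.
have := kb_bdry_disj kb iQ => /seteqP[/(_ x) H _]; apply: H; split=> //.
by rewrite xE t2e (cl_incl (kb_charts kb i1)).
Qed.

Definition cob_pr alpha I : T I -> T I :=
  match pselect (idx (bd alpha) I) with
  | left iI => projT1 (cid (chart_proj iI))
  | right _ => id
  end.

Lemma cob_prP alpha I t x : idx (bd alpha) I -> collar alpha eps t -> kdom (bd alpha) I x ->
  [/\ @cob_pr alpha I (ciota Q alpha t x) = x,
      forall phi, smooth_at (kU (bd alpha) I) phi x ->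
        smooth_at (kU Q I) (fun y => phi (@cob_pr alpha I y)) (ciota Q alpha t x) &
      forall e (phi : 'I_e -> T I -> R), (forall k, smooth_at (kU (bd alpha) I) (phi k) x) ->
        surj_at (kU (bd alpha) I) phi x ->
        surj_at (kU Q I) (fun k y => phi k (@cob_pr alpha I y)) (ciota Q alpha t x)].
Proof.
rewrite /cob_pr; case: pselect => // iI _ ct Ix.
by case: cid => p pP /=; exact: pP.
Qed.

Lemma cobordism_collar_model r0 : r0 + r0 <= eps ->
  collar_model Q d V eps r0 (fun alpha => collar alpha eps) cob_pr.
Proof.
move=> rr; split.
- by move=> alpha I; exact: bd_pm.
- exact: bd_idx.
- exact: bd_down.
- by move=> alpha I t x iI ct; exact: bd_dom.
- by move=> alpha I t x iI ct Ix; have [] := cob_prP iI ct Ix.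
- by move=> alpha I t x iI; exact: (cl_s (kb_charts kb iI)).
- move=> alpha I x k iI Ix.
  have := smooth_vecP (bd_pm iI) (A := kdom (bd alpha) I) (ks (bd alpha) I).
  case=> [z _|sv _]; first by rewrite near_withinE; exact: filterE.
  by apply: sv => //; exact: (kc_s_smooth (wk_charts (wb alpha) iI)).
- move=> alpha I J t x iI iJ IJ ct Jx /(bd_Ut ct iI iJ IJ Jx) Ux.
  by have [] := bd_rho ct iI iJ IJ Ux.
- by move=> alpha I J t x y iI _ ct Ix _; exact: slice_class.
- by move=> alpha I J t x y; exact: cob_far.
- by move=> *; exact: cob_d.
- by move=> alpha I t x iI ct Ix; rewrite (cr_collar cr)//; split=> [[]|].
- by move=> alpha I t x P iI; exact: collar_chart_near.
- move=> I t t' x x' i0 i1 ct ct' Ix Ix' tr tr'; apply: collars_disjoint => //.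
  by apply: lt_le_trans rr; exact: ltrD.
- by move=> alpha I t x phi iI ct Ix; have [_ + _] := cob_prP iI ct Ix; exact.
- by move=> alpha I t x e phi iI ct Ix; have [_ _] := cob_prP iI ct Ix; exact.
Qed.

End Cobordism.

Theorem cobordism_perturbation_exists (R : realType) (O : obst R) (T : Index O -> topologicalType)
    (Y : topologicalType) (Y0 : set Y) (n : int) (K : cobdata T Y)
    (d : set (kpoint T) -> set (kpoint T) -> R)
    (V C : forall I, set (T I)) (nrm : forall i, @oE R O i -> R)
    (eps dV delta sig : R) (nub : bool -> forall I, T I -> oEI I) :
  metric_tame_cobordism eps n Y0 K d ->
  cobordism_reduction eps K V -> cobordism_reduction eps K C ->
  nested K C V ->
  equivariant_norms nrm ->
  is_delta_V K d V dV -> 0 < delta < Num.min eps dV ->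
  0 < sig -> (sig%:E <= sigma_rel K d V C nrm delta)%E ->
  (forall alpha, bd_adapted K d V C nrm delta sig alpha (nub alpha)) ->
  exists nu : forall I, T I -> oEI I,
    [/\ cobordism_perturbation K V nu,
        [/\ admissible_pert K V nu, precompact_pert K V nu
          & transverse K V nu],
        pert_zero K V nu `<=` piKV K C
      & forall alpha, restricts_to K V alpha nu (nub alpha)].
Proof.
move=> [kb tm am cm] crV crC nCV en [_ dVP] /andP[delta0 ded] sig0 sigS adp.
move: ded; rewrite lt_min => /andP[de ddV].
have eps0 := kb_eps kb.
(* The first term leaves room for [delta]-neighbourhoods inside the collar, the second keeps the two
   collars of size [r0] disjoint. *)
pose r0 := Num.min ((eps - delta) / 2) (eps / 2).
have r00 : 0 < r0 by rewrite lt_min !divr_gt0// subr_gt0.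
have r0d : r0 + delta <= eps.
  have : r0 <= (eps - delta) / 2 by rewrite ge_min lexx.
  by lra.
have r02 : r0 + r0 <= eps.
  have : r0 <= eps / 2 by rewrite ge_min lexx orbT.
  by lra.
have /dVP[VP Vsep] : 0 < delta < dV by apply/andP.
have gd := tame_good (kb_main kb) tm am.
have Vo := rd_open (cr_red crV).
have sigS' : (sig%:E <= sigma_V' K d V C nrm delta)%E.
  by apply: le_trans sigS _; rewrite /sigma_rel !ge_min lexx !orbT.
have [nu [nu1 nu2 nu3 nu4 [r rpos nuE]]] :=
  collar_perturbation (cobordism_collar_model kb tm am cm crV r02) gd Vo en delta0 r00 r0d
    VP Vsep sig0 sigS' adp.
exists nu; split=> //.
- split=> //; exists (Num.min r eps); first by rewrite lt_min rpos.
  move=> alpha; exists (nub alpha) => I t x iI ct Vx.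
  have cte : collar alpha eps t.
    by apply: collar_sub ct; rewrite ge_min lexx orbT.
  apply: nuE => //; apply: lt_le_trans (collar_dist ct) _.
  by rewrite ge_min lexx.
- split=> //; exists C, eps; split=> //.
move=> alpha I x iI Vx; have [Ix _] := Vx.
have ce := @collar_end _ _ _ _ _ _ _ _ kb alpha.
rewrite -(nuE alpha I (endpoint alpha) x)//.
  by rewrite (cl_incl (kb_charts kb iI)).
by rewrite /bd_dist subrr normr0.
Qed.

(** * Slices of manifolds and products with an interval *)

Section Slice.
Context {R : realType} {T : topologicalType} (M : @manifold R T) (pm : premanifold M) (e : R).
Local Notation S := (slice e M).
Local Notation cimg c := (cmap c @` cdom c).

Lemma slice_image c (B : set T) :
  cmap (slice_chart e c) @` ([set e] `*` B) = cmap c @` B :> set 'rV[R]_(mdim M).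
Proof.
apply/seteqP; split=> [_ [[s x] [/= _ Bx] <-]|_ [x Bx <-]]; first by exists x.
by exists (e, x).
Qed.

Lemma near_snd (t : R) (x : T) (P : set T) : (\forall y \near x, P y) ->
  \forall p \near (t, x), P p.2.
Proof.
by move=> H; exists (setT, P) => /=; [split=> //; exact: filterT|move=> [s y] /= []].
Qed.

Lemma near_slice (t : R) (x : T) (P : set (R * T)) : (\forall p \near (t, x), P p) ->
  \forall y \near x, P (t, y).
Proof.
by move=> [[A B] /= [/nbhs_singleton At Bx] AB]; apply: filterS Bx => y By; exact: (AB (t, y)).
Qed.

Lemma open_snd (U : set T) : open U -> open [set p : R * T | U p.2].
Proof.
move=> Uo; rewrite openE => -[s x] /= Ux.
by apply: (near_snd s (P := U)); exact: open_nbhs_nbhs.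
Qed.

Lemma relopen_setX (A : set R) (B W : set T) : relopen B W -> relopen (A `*` B) (A `*` W).
Proof.
move=> [ O Oo ->]; exists [set p : R * T | O p.2]; first exact: open_snd.
by apply/seteqP; split=> [[s x] [/= ? [? ?]]|[s x] [[/= ? ?] ?]].
Qed.

Lemma separated_setX (A : set R) : separated_in (mset M) -> separated_in (A `*` mset M).
Proof.
move=> sep [s x] [t y] [/= As Mx] [/= At My] ne.
have [st|/eqP st] := eqVneq s t; last first.
  pose r := `|s - t| / 2.
  have r0 : 0 < r by rewrite divr_gt0// normr_gt0 subr_eq0; apply/eqP.
  have op (a : R) : open [set p : R * T | `|p.1 - a| < r].
    have -> : [set p : R * T | `|p.1 - a| < r] = fst @^-1` ball a r.
      by apply/seteqP; split=> p; rewrite /preimage/= /ball/= distrC.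
    by apply: open_comp; [move=> p _; exact: cvg_fst|exact: ball_open].
  exists [set p | `|p.1 - s| < r], [set p | `|p.1 - t| < r]; split; rewrite /= ?subrr ?normr0//.
  move=> [z1 z2] _ /= zs zt; have : `|s - t| <= `|z1 - s| + `|z1 - t|.
    rewrite distrC [`|z1 - t|]distrC; have -> : t - s = (t - z1) + (z1 - s) by ring.
    by rewrite addrC; apply: le_trans (ler_normD _ _) _; rewrite addrC.
  rewrite leNgt; case/negP; have -> : `|s - t| = r + r by rewrite /r; lra.
  exact: ltrD.
have [|B [C [Bo Co Bx Cy BC]]] := sep x y Mx My; first by move=> xy; apply: ne; rewrite st xy.
exists [set p | B p.2], [set p | C p.2]; split=> //; [exact: open_snd..|].
by move=> [z1 z2] [/= _ Mz] Bz Cz; exact: (BC z2).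
Qed.

Lemma slice_topological (c : chart T (mdim M)) : topological_chart (mset M) c -> topological_chart (mset S) (slice_chart e c).
Proof.
move=> tc; have img : cmap (slice_chart e c) @` cdom (slice_chart e c) = cimg c.
  exact: slice_image.
split.
- exact: relopen_setX (tc_open tc).
- by move=> [s x] [/= -> cx]; rewrite (tc_cancel tc).
- apply/subspace_continuousP => -[s x] [/= -> cx] P /= Pn.
  have H : \forall y \near x, cdom c y -> P (cmap c y).
    have : cmap c @ within (cdom c) (nbhs x) --> cmap c x.
      by move/subspace_continuousP: (tc_cont tc); exact.
    by move=> /(_ _ Pn).
  suff : \forall p \near (e, x), ([set e] `*` cdom c) p -> P (cmap c p.2) by [].
  by apply: filterS (near_snd e H) => -[a b] /= Hb [_]; exact: Hb.
- rewrite img; apply/subspace_continuousP => z cz P /= Pn.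
  have H : \forall y \near z, cimg c y -> P (e, cinv c y).
    have : cinv c @ within (cimg c) (nbhs z) --> cinv c z.
      by move/subspace_continuousP: (tc_inv_cont tc); exact.
    by move=> /(_ _ (near_slice Pn)).
  exact: H.
by move=> p; rewrite img; exact: (tc_image tc).
Qed.

Lemma slice_premanifold : premanifold S.
Proof.
split.
- exact: separated_setX (pm_separated pm).
- by move=> _ [c Mc <-]; apply: slice_topological; exact: (pm_charts pm).
- move=> [s x] [/= -> Mx]; have [c Mc cx] := pm_cover pm Mx.
  by exists (slice_chart e c) => //; exists c.
move=> _ _ [c Mc <-] [c' Mc' <-]; rewrite /transition.
have -> : cdom (slice_chart e c) `&` cdom (slice_chart e c') = [set e] `*` (cdom c `&` cdom c').
  by apply/seteqP; split=> [[s x] [[/= ? ?] [? ?]]|[s x] [/= ? [? ?]]].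
by rewrite slice_image; exact: (pm_smooth pm).
Qed.

Lemma slice_smooth phi x : mset M x ->
  smooth_at S phi (e, x) -> smooth_at M (fun y => phi (e, y)) x.
Proof.
move=> Mx sphi; have [c Mc cx] := pm_cover pm Mx.
have [||g [gs gE]] := sphi (slice_chart e c); [by exists c|by split|].
apply: (smooth_at_chart pm Mc cx (g := g)); split=> //.
by move: gE; rewrite slice_image.
Qed.

Lemma slice_surj k (phi : 'I_k -> R * T -> R) x : mset M x ->
  surj_at S phi (e, x) -> surj_at M (fun i y => phi i (e, y)) x.
Proof.
move=> Mx sphi u; have [_ [v [[c Mc <-] [/= _ cx] vE]]] := sphi u.
exists c, v; split=> // i; have [g [gs gE] gd] := vE i; exists g => //; split=> //.
by move: gE; rewrite slice_image.
Qed.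

End Slice.

Section Product.
Context {R : realType} {T : topologicalType} (M : @manifold R T) (pm : premanifold M) (A : set R).
Local Notation P := (itv_prod A M).
Local Notation n := (mdim M).
Local Notation cimg c := (cmap c @` cdom c).

Lemma pairmx_smooth2 l k (a : 'rV[R]_l -> R) (b : 'rV[R]_l -> 'rV[R]_k) p : sgerm a p ->
  smooth_rows b p -> smooth_rows (fun z => pairmx (a z) (b z)) p.
Proof.
move=> sa sb i; rewrite -(fintype.splitK i); case: (fintype.split i) => j /=.
  by apply: sgerm_eq sa => z; rewrite row_mxEl mxE.
by apply: sgerm_eq (sb j) => z; rewrite row_mxEr.
Qed.

Lemma prod_cimg (c : chart T n) (z : 'rV[R]_(1 + n)) :
  cimg (prod_chart A c) z <-> A (lsubmx z 0 0) /\ cimg c (rsubmx z).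
Proof.
split=> [[[s x] [/= As cx] <-]|[Az [x cx xz]]].
  by rewrite (pairmx_l s (cmap c x)) (pairmx_r s (cmap c x)); split=> //; exists x.
exists (lsubmx z 0 0, x) => //=.
by rewrite xz; exact: pairmx_eta.
Qed.

Lemma near_lsub (t : R) (p : 'rV[R]_n) (B : set R) : nbhs t B ->
  \forall z \near pairmx t p, B (lsubmx z 0 0).
Proof.
move=> Bt; have := sgerm_continuous (lsubmx_smooth (pairmx t p)).
by apply; rewrite pairmx_l.
Qed.

Lemma near_rsub (t : R) (p : 'rV[R]_n) (B : set 'rV[R]_n) : nbhs p B ->
  \forall z \near pairmx t p, B (rsubmx z).
Proof.
move=> Bp; apply: (near_comp (tau := fun z : 'rV[R]_(1 + n) => rsubmx z : 'rV[R]__)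
  (rsubmx_smooth _)).
by rewrite pairmx_r.
Qed.

Lemma prod_ext (c : chart T n) t x phi g : ext_at (M := M) c x phi g ->
  ext_at (M := P) (prod_chart A c) (t, x) (fun p => phi p.2) (fun z : 'rV[R]_(1 + n) => g (rsubmx z)).
Proof.
move=> [gs gE]; split.
  apply: (sgerm_comp (f := fun z : 'rV[R]_(1 + n) => rsubmx z : 'rV[R]__) (g := g)).
    exact: rsubmx_smooth.
  by rewrite [rsubmx _](pairmx_r t (cmap c x)).
have := near_rsub t gE; apply: filterS => z H /prod_cimg[_ cz].
by rewrite H.
Qed.

Lemma prod_deriv_at (c : chart T n) t x phi v d : deriv_at (M := M) c x phi v d ->
  deriv_at (M := P) (prod_chart A c) (t, x) (fun p => phi p.2) (pairmx 0 v) d.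
Proof.
move=> [g gE <-]; exists (fun z : 'rV[R]_(1 + n) => g (rsubmx z)); first exact: prod_ext.
have [gs _] := gE; pose rs := fun z : 'rV[R]_(1 + n) => rsubmx z : 'rV[R]_n.
have rx : rs (cmap (prod_chart A c) (t, x)) = cmap c x by exact: (pairmx_r t (cmap c x)).
rewrite (derive_comp (f := rs) (g := g)); last 2 first.
- by apply: smooth_rows_diff; exact: rsubmx_smooth.
- by rewrite rx; exact: sgerm_diff.
rewrite rx; congr ('D_ _ _ _); apply/rowP => i.
rewrite -derive_coord; last by apply: smooth_rows_diff; exact: rsubmx_smooth.
rewrite (_ : (fun z => rs z 0 i) = fun z : 'rV[R]_(1 + n) => z 0 (rshift 1 i)); last first.
  by apply/funext => z; rewrite /rs mxE.
rewrite (derive_coord (f := id)); last exact/smooth_rows_diff/id_smooth.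
by rewrite derive_id row_mxEr.
Qed.

Lemma prod_surj k (phi : 'I_k -> T -> R) t x : A t -> surj_at M phi x ->
  surj_at P (fun i p => phi i p.2) (t, x).
Proof.
move=> At sphi u; have [c [v [Mc cx vE]]] := sphi u.
exists (prod_chart A c), (pairmx 0 v); split=> [||i]; first by exists c.
  by split.
exact: prod_deriv_at.
Qed.

(** Chart images of the factor are open here, so boundary points come from end points of [A]. Since
    [boundary_point] requires the coordinate of index 0, the parameter comes first in
    [prod_chart]. *)
Lemma prod_topological (c : chart T n) : topological_chart (mset M) c ->
  (forall p, cimg c p -> nbhs p (cimg c)) ->
  (forall t, A t -> nbhs t A \/ (\forall s \near t, A s <-> t <= s) \/ (\forall s \near t, A s <-> s <= t)) ->
  topological_chart (mset P) (prod_chart A c).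
Proof.
move=> tc cint Aint; split.
- exact: relopen_setX (tc_open tc).
- by move=> [s x] [/= As cx]; rewrite (pairmx_l s (cmap c x)) (pairmx_r s (cmap c x)) (tc_cancel tc).
- apply/subspace_continuousP => -[t x] [/= At cx].
  have E : (fun p : R * T => row_mx (const_mx p.1) (cmap c p.2)) =
      fun p : R * T => p.1 *: pairmx 1 0 + pairmx 0 (cmap c p.2) :> 'rV[R]_(1 + n).
    apply/funext => -[s y] /=; apply/rowP => i; rewrite [RHS]mxE [X in _ = X + _]mxE /pairmx.
    rewrite -(fintype.splitK i); case: (fintype.split i) => j /=.
      by rewrite !row_mxEl !mxE mulr1 addr0.
    by rewrite !row_mxEr !mxE mulr0 add0r.
  have FF : Filter (within (A `*` cdom c) (nbhs (t, x))) := within_filter _ (nbhs_filter _).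
  have c0 : p.1 @[p --> within (A `*` cdom c) (nbhs (t, x))] --> t.
    by apply: cvg_trans (@cvg_fst _ _ (nbhs t) (nbhs x) _); apply: cvg_app; exact: cvg_within.
  have c1 : cmap c p.2 @[p --> within (A `*` cdom c) (nbhs (t, x))] --> cmap c x.
    move=> Q Qn.
    have H : \forall y \near x, cdom c y -> Q (cmap c y).
      have : cmap c @ within (cdom c) (nbhs x) --> cmap c x.
        by move/subspace_continuousP: (tc_cont tc); exact.
      by move=> /(_ _ Qn).
    suff : \forall p \near (t, x), (A `*` cdom c) p -> Q (cmap c p.2) by [].
    by apply: filterS (near_snd t H) => -[a b] /= Hb [_]; exact: Hb.
  have c2 : pairmx 0 (cmap c p.2) @[p --> within (A `*` cdom c) (nbhs (t, x))] -->
      pairmx 0 (cmap c x).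
    by move=> Q /(smooth_rows_continuous (pairmx_smooth 0 (cmap c x)))/c1.
  have c3 := cvgD (cvgZr_tmp (a := pairmx 1 0 : 'rV[R]_(1 + n)) c0) c2.
  have l0 : row_mx (const_mx t) (cmap c x) = t *: pairmx 1 0 + pairmx 0 (cmap c x) :> 'rV[R]_(1 + n).
    exact: (congr1 (fun F => F (t, x)) E).
  change ((fun p : R * T => row_mx (const_mx p.1) (cmap c p.2)) @
    within (A `*` cdom c) (nbhs (t, x)) --> (row_mx (const_mx t) (cmap c x) : 'rV[R]_(1 + n))).
  by rewrite E l0; exact: (c3 FF FF).
- apply/subspace_continuousP => z cz Q /= [[B C] /= [Bz Cz] BC].
  have [Az ciz] := (prod_cimg c z).1 cz.
  have H1 : \forall y \near rsubmx z, cimg c y -> C (cinv c y).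
    have : cinv c @ within (cimg c) (nbhs (rsubmx z : 'rV[R]_n)) --> cinv c (rsubmx z).
      by move/subspace_continuousP: (tc_inv_cont tc); apply.
    by move=> /(_ _ Cz).
  suff : \forall y \near z, cimg (prod_chart A c) y -> Q (lsubmx y 0 0, cinv c (rsubmx y)) by [].
  rewrite -(pairmx_eta z); apply: filterS2 (near_lsub (rsubmx z) Bz) (near_rsub (lsubmx z 0 0) H1).
  by move=> y By Cy /prod_cimg[_ cy]; apply: (BC (_, _)); split=> //; exact: Cy.
move=> z cz; have [Az ciz] := (prod_cimg c z).1 cz.
have cn := near_rsub (lsubmx z 0 0) (cint _ ciz); rewrite pairmx_eta in cn.
have z0 (y : 'rV[R]_(1 + n)) : y 0 (lshift n ord0) = lsubmx y 0 0 by rewrite mxE.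
have [nA|[nA|nA]] := Aint _ Az.
- left; have := near_lsub (rsubmx z) nA; rewrite pairmx_eta.
  by apply: filterS2 cn => y cy Ay; apply/prod_cimg.
- right; exists (lshift n ord0) => //; left; rewrite !z0.
  have := near_lsub (rsubmx z) nA; rewrite pairmx_eta.
  apply: filterS2 cn => y cy Ay; rewrite z0; split=> [/prod_cimg[/Ay]|/Ay Ay'] //.
  exact/prod_cimg.
- right; exists (lshift n ord0) => //; right; rewrite !z0.
  have := near_lsub (rsubmx z) nA; rewrite pairmx_eta.
  apply: filterS2 cn => y cy Ay; rewrite z0; split=> [/prod_cimg[/Ay]|/Ay Ay'] //.
  exact/prod_cimg.
Qed.

Lemma prod_premanifold : mbdry M = set0 ->
  (forall t, A t -> nbhs t A \/ (\forall s \near t, A s <-> t <= s) \/ (\forall s \near t, A s <-> s <= t)) ->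
  premanifold P.
Proof.
move=> nb Aint; split.
- exact: separated_setX (pm_separated pm).
- move=> _ [c Mc <-]; have tc := pm_charts pm Mc; apply: prod_topological => // _ [x cx <-].
  have [//|bp] := tc_image tc (cimg_cmap cx).
  have : mbdry M x by exists c.
  by rewrite nb.
- move=> [t x] [/= At Mx]; have [c Mc cx] := pm_cover pm Mx.
  by exists (prod_chart A c) => //; exists c.
move=> _ _ [c Mc <-] [c' Mc' <-] _ [[t x] [[/= At cx] [_ c'x]] <-].
have [|tau /smooth_rowsP taus tauE] := pm_smooth pm Mc Mc' (p := cmap c x); first by exists x.
exists (fun z : 'rV[R]_(1 + n) => pairmx (lsubmx z 0 0) (tau (rsubmx z))).
  apply/smooth_rowsP; apply: pairmx_smooth2; first exact: lsubmx_smooth.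
  apply: (smooth_rows_comp (f := fun z : 'rV[R]_(1 + n) => rsubmx z : 'rV[R]__)).
    exact: rsubmx_smooth.
  by rewrite [rsubmx _](pairmx_r t (cmap c x)).
have := near_rsub t tauE; apply: filterS => z H [[s y] [[/= As cy] [_ c'y]] zE].
rewrite H; first by [].
by exists y => //; rewrite -zE [rsubmx _](pairmx_r s (cmap c y)).
Qed.

Lemma prod_smooth phi t x : premanifold P -> A t -> mset M x -> smooth_at M phi x ->
  smooth_at P (fun p => phi p.2) (t, x).
Proof.
move=> pP At Mx sphi; have [c Mc cx] := pm_cover pm Mx.
have [g gE] := sphi c Mc cx.
have Pc : mcharts P (prod_chart A c) by exists c.
by apply: (smooth_at_chart pP Pc _ (prod_ext t gE)); split.
Qed.

End Product.

Section ProductRetraction.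
Context {R : realType} {T T' : topologicalType} (M : @manifold R T) (M' : @manifold R T').
Context (pm : premanifold M) (pm' : premanifold M') (A : set R) (B : set T) (f : T -> T').
Local Notation n := (mdim M).
Local Notation n' := (mdim M').

(** Every map of the given retraction is extended by the identity on the parameter. *)
Lemma prod_retraction t u : A t -> has_retraction M M' B f u ->
  has_retraction (itv_prod A M) (itv_prod A M') (A `*` B) (fun p => (p.1, f p.2)) (t, u).
Proof.
move=> At [c [c1 [P [F [H []]]]]] Mc cu Mc1 c1u Ps Pu PE Fs Hs Hu HE.
have tc := pm_charts pm Mc; have tc1 := pm_charts pm' Mc1.
pose lift k k' (G : 'rV[R]_k -> 'rV[R]_k') (z : 'rV[R]_(1 + k)) : 'rV[R]_(1 + k') :=
  pairmx (lsubmx z 0 0) (G (rsubmx z)).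
have ls k k' (G : 'rV[R]_k -> 'rV[R]_k') p : smooth_rows G p -> smooth_rows (lift k k' G) (pairmx t p).
  move=> Gs; apply: pairmx_smooth2; first exact: lsubmx_smooth.
  apply: (smooth_rows_comp (f := fun z : 'rV[R]_(1 + k) => rsubmx z : 'rV[R]__)).
    exact: rsubmx_smooth.
  by rewrite pairmx_r.
exists (prod_chart A c), (prod_chart A c1), (lift _ _ P), (lift _ _ F), (lift _ _ H); split.
- by exists c.
- by split.
- by exists c1.
- by split.
- exact: ls.
- by rewrite /lift /= (pairmx_l t (cmap c u)) (pairmx_r t (cmap c u)) Pu.
- have := near_rsub t PE; apply: filterS => z zP /prod_cimg[Az cz].
  have [PI BP c1f FE PK] := zP cz; rewrite /lift; split.
  + by apply/prod_cimg; rewrite pairmx_l pairmx_r.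
  + by split=> /=; rewrite ?pairmx_l ?pairmx_r.
  + by split=> /=; rewrite ?pairmx_l ?pairmx_r.
  + by rewrite /= pairmx_l pairmx_r FE.
  by move=> [_ /= /PK ->]; exact: pairmx_eta.
- exact: ls.
- exact: ls.
- by rewrite /lift /= (pairmx_l t (cmap c1 (f u))) (pairmx_r t (cmap c1 (f u))) Hu.
have := near_rsub t HE; apply: filterS => z zH /prod_cimg[Az cz].
have [HI BH fH] := zH cz; rewrite /lift; split.
- by apply/prod_cimg; rewrite pairmx_l pairmx_r.
- by split=> /=; rewrite ?pairmx_l ?pairmx_r.
by rewrite /= pairmx_l pairmx_r fH.
Qed.

End ProductRetraction.

(** * Product cobordisms *)

Section Precompact.
Context {T : topologicalType}.

Lemma compact_set_val (D S : set T) : compact S -> S `<=` D ->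
  compact ((@set_val T D) @^-1` S).
Proof.
move=> cS SD F FF FS.
have [|p [Sp clp]] := cS (set_val @ F); first exact: FS.
exists (@SigSub _ _ _ p (mem_set (SD p Sp))); split=> // A B FA /nbhs_set_type[U [Uo Up UB]].
have FA' : F (set_val @^-1` (set_val @` A)) by apply: filterS FA; exact: preimage_image.
have nU : nbhs p U by apply: open_nbhs_nbhs; split.
have [z [[a Aa az] Uz]] := clp _ _ FA' nU.
by exists a; split=> //; apply: UB; rewrite az.
Qed.

Lemma precompact_inP (A D : set T) : precompact_in A D <-> A `<=` D /\ compact (D `&` closure A).
Proof.
split=> [pA|[AD cA]]; first by split; [case: pA|exact: precompact_closure_compact pA _].
split=> //; rewrite precompactE; apply: (subclosed_compact (@closed_closure _ _)).
  by apply: (compact_set_val cA) => x [].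
move=> y cly; split; first exact: set_valP.
move=> W Wy; have [|z [Az Wz]] := cly (set_val @^-1` W); last by exists (set_val z).
exact: (@initial_continuous _ _ set_val y _ Wy).
Qed.

End Precompact.

Section PrecompactProd.
Context {R : realType} {T : topologicalType}.

Lemma closure_setX (B : set R) (A : set T) t x : closure (B `*` A) (t, x) -> closure A x.
Proof. by move=> cl U Ux; have [[s y] [[/= _ Ay] Uy]] := cl _ (near_snd t Ux); exists y. Qed.

Lemma precompact_setX (B : set R) (A D : set T) : compact B -> precompact_in A D ->
  precompact_in (B `*` A) (B `*` D).
Proof.
move=> cB /precompact_inP[AD cA]; apply/precompact_inP; split.
  by move=> [t x] [/= Bt Ax]; split=> //; exact: AD.
have -> : (B `*` D) `&` closure (B `*` A) = B `*` (D `&` closure A).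
  apply/seteqP; split=> [[t x] [[/= Bt Dx] /closure_setX clx]//|[t x] [/= Bt [Dx clx]]].
  split=> // U [[U1 U2] /= [U1t U2x] UU]; have [y [Ay Uy]] := clx U2 U2x.
  exists (t, y); split; first by split.
  by apply: UU; split=> //; exact: nbhs_singleton.
exact: compact_setX.
Qed.

End PrecompactProd.

Section Param.
Context {R : realType} {O : obst R} {T : Index O -> topologicalType} {X : topologicalType}.
Implicit Types (I J H L : Index O).
Context (K : kdata T X) (A : set R) (prodM : forall I, @manifold R (T I) -> @manifold R (prodT T I)).
Local Notation P := (param_product A prodM K).

Lemma param_footprint I : I != finset.set0 -> footprint P I = A `*` footprint K I.
Proof.
move=> /set0Pn[i iI]; apply/seteqP; split=> [[t x] H|[t x] [/= At Fx] j jI]; last first.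
  by split=> //; exact: Fx.
by split=> /= [|j jI]; [have [] := H i iI|have [] := H j jI].
Qed.

Lemma param_idx I : A !=set0 -> idx P I <-> idx K I.
Proof.
move=> [t At]; split=> -[I0].
  by rewrite param_footprint// => -[[s x] [_ Fx]]; split=> //; exists x.
by move=> [x Fx]; split=> //; exists (t, x); rewrite param_footprint.
Qed.

Lemma param_equiv t p q : A t -> equiv K p q ->
  equiv P (@kpt R O (prodT T) (projT1 p) (t, projT2 p)) (@kpt R O (prodT T) (projT1 q) (t, projT2 q)).
Proof.
move=> At; have A0 : A !=set0 by exists t.
elim=> [_ _ [I J g y iI iJ IJ Uy] /=|p'|p' q' _ H|p' q' r' _ H1 _ H2]; last first.
- exact: rst_trans H1 H2.
- exact: rst_sym.
- exact: rst_refl.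
apply: rst_step; have := @Glue R O (prodT T) (R * X)%type P I J g (t, y).
by apply=> //; apply/param_idx.
Qed.

(** All generators of the gluing relation preserve the parameter; together with [param_equiv] this
    identifies the realization with [A] times |K| as a set. *)
Lemma param_equiv_inv p q : equiv P p q -> (projT2 p).1 = (projT2 q).1 /\
  equiv K (@kpt R O T (projT1 p) (projT2 p).2) (@kpt R O T (projT1 q) (projT2 q).2).
Proof.
elim=> [_ _ [I J g [t y] iI iJ IJ [At Uy]] /=|p'|p' q' _ [H1 H2]|p' q' r' _ [H1 H2] _ [H3 H4]].
- split=> //; apply: rst_step; have A0 : A !=set0 by exists t.
  by apply: (@Glue R O T X K I J g y) => //; apply/(param_idx _ A0).
- by split=> //; exact: rst_refl.
- by split=> //; exact: rst_sym.
- by split; [rewrite H1|exact: rst_trans H2 H4].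
Qed.

Lemma param_piK I J t x y : A t -> piK K I x = piK K J y ->
  piK P I ((t, x) : prodT T I) = piK P J ((t, y) : prodT T J).
Proof. by move=> At /piK_equiv/(param_equiv At)/equiv_piK. Qed.

Lemma param_piK_inv I J t s x y : piK P I ((t, x) : prodT T I) = piK P J ((s, y) : prodT T J) ->
  t = s /\ piK K I x = piK K J y.
Proof. by move=> /piK_equiv/param_equiv_inv[/= ts /equiv_piK]. Qed.

End Param.

Section ProductAtlas.
Context {R : realType} {O : obst R} {T : Index O -> topologicalType} {X : topologicalType}.
Implicit Types (I J H L : Index O) (alpha : bool).
Context (X0 : set X) (n : int) (K : kdata T X) (d0 : set (kpoint T) -> set (kpoint T) -> R).
Context (wk : weak_kuranishi n X0 K) (nb : without_boundary K) (tm : tame K) (am : admissible_metric K d0).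
Context (d : set (kpoint (prodT T)) -> set (kpoint (prodT T)) -> R) (pd : product_metric X0 K d0 d).
Local Notation Q := (product_cobordism X0 K).
Local Notation bd alpha := (cbd Q alpha).
Let gd : good K d0 := tame_good wk tm am.

Lemma unit_end alpha : unit_itv (endpoint alpha : R).
Proof. by rewrite /unit_itv /endpoint; case: alpha => /=; rewrite ?lexx ?ler01. Qed.

Lemma collar_unit alpha (t : R) : collar alpha 1 t -> unit_itv t.
Proof. by rewrite /collar /unit_itv; case: alpha => /=; lra. Qed.

Lemma unit_local (t : R) : unit_itv t -> nbhs t (unit_itv : set R) \/
  (\forall s \near t, unit_itv s <-> t <= s) \/ (\forall s \near t, unit_itv s <-> s <= t).
Proof.
rewrite /unit_itv /= => /andP[t0 t1].
have [->|t0'] := eqVneq t 0.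
  right; left; have : \forall s \near (0 : R), s < 1 by exact: lt_nbhsl.
  by apply: filterS => s s1; rewrite (ltW s1) andbT.
have [->|t1'] := eqVneq t 1.
  right; right; have : \forall s \near (1 : R), 0 < s by exact: (lt_nbhsr ltr01).
  by apply: filterS => s s1; rewrite (ltW s1).
left; have : t \in `]0, 1[ by rewrite in_itv/= lt_neqAle eq_sym t0' t0 lt_neqAle t1' t1.
move=> /near_in_itvoo; apply: filterS => s; rewrite in_itv/= => /andP[s0 s1].
by rewrite !ltW.
Qed.

Lemma prodQ_idx I : idx Q I <-> idx K I.
Proof. by apply: param_idx; exists (endpoint false); exact: unit_end. Qed.

Lemma prodbd_idx alpha I : idx (bd alpha) I <-> idx K I.
Proof. by apply: param_idx; exists (endpoint alpha). Qed.

(** Each clause is inherited from the factor, the metric ones through the formula for the product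
    metric. *)
Lemma product_good : good Q d.
Proof.
have pmQ I : idx K I -> premanifold (itv_prod unit_itv (kU K I)).
  by move=> iI; apply: prod_premanifold; [exact: (gd_pm gd)|exact: nb|exact: unit_local].
split.
- by move=> I /prodQ_idx; exact: pmQ.
- move=> I [t x] k /prodQ_idx iI [/= ut Ix].
  by apply: (prod_smooth (gd_pm gd iI) (phi := coords (ks K I) k) (pmQ I iI)) => //; exact: (gd_s gd).
- move=> I J [t y] /prodQ_idx iI /prodQ_idx iJ IJ; split=> [[/= ut /(gd_Ut gd _ iI iJ IJ)[Jy ry]]|].
    by split.
  by move=> [[/= ut Jy] ry]; split=> //; apply/(gd_Ut gd _ iI iJ IJ).
- by move=> I J [t y] /prodQ_idx iI /prodQ_idx iJ IJ [/= ut Uy]; split=> //; exact: (gd_rho gd).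
- by move=> I J [t y] /prodQ_idx iI /prodQ_idx iJ IJ [/= ut Uy]; exact: (gd_s_rho gd).
- move=> I J [t y] /prodQ_idx iI /prodQ_idx iJ IJ [/= ut Uy].
  by apply: param_piK => //; exact: (gd_pi gd).
- move=> I J [t u] /prodQ_idx iI /prodQ_idx iJ IJ [/= ut Uu].
  exact: (prod_retraction (gd_pm gd iJ) (gd_pm gd iI) ut (gd_retr gd iI iJ IJ Uu)).
- move=> I J [t u] e /prodQ_idx iI /prodQ_idx iJ IJ [/= ut Uu].
  have [c [v [e' [Mc cu vE]]]] := gd_index gd e iI iJ IJ Uu.
  exists (prod_chart unit_itv c), (pairmx 0 v), e'; split; [by exists c|by split|move=> k].
  exact: (prod_deriv_at unit_itv t (vE k)).
- move=> I J L [t y] /prodQ_idx iI /prodQ_idx iJ /prodQ_idx iL IJ JL [/= ut Uy].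
  have [U1 U2 E] := gd_coc gd iI iJ iL IJ JL Uy; split; [by split..|].
  by rewrite /= E.
- move=> I [t x] /prodQ_idx iI [/= ut Ix].
  by rewrite pd// subrr normr0 add0r (gd_dxx gd).
- move=> I J [t x] [s y] /prodQ_idx iI /prodQ_idx iJ [/= ut Ix] [/= us Jy].
  by rewrite !pd// distrC (gd_sym gd).
- move=> I J L [t x] [s y] [r z] /prodQ_idx iI /prodQ_idx iJ /prodQ_idx iL
    [/= ut Ix] [/= us Jy] [/= ur Lz].
  rewrite !pd// addrACA lerD//; first exact: ler_distD.
  exact: (gd_tri gd).
move=> I [t x] r /prodQ_idx iI [/= ut Ix] r0.
have r2 : 0 < r / 2 by rewrite divr_gt0.
have := gd_near gd iI Ix r2; rewrite !near_withinE => H.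
exists ([set s | `|t - s| < r / 2],
    [set y | kdom K I y -> d0 (piK K I x) (piK K I y) < r / 2]) => /=.
  split=> //; exact: (nbhsx_ballx (t : R) _ r2).
move=> [s y] /= [ts Hy] [/= us Iy]; rewrite pd// [r](splitr r).
by apply: ltrD => //; exact: Hy.
Qed.

Lemma bd_piK alpha I (x : T I) :
  iotaK Q alpha (endpoint alpha) (piK (bd alpha) I ((endpoint alpha, x) : prodT T I)) =
  piK Q I ((endpoint alpha, x) : prodT T I).
Proof.
apply/seteqP; split=> [q [x' /param_equiv_inv[/= xt E] xq]|q xq].
  by apply: rst_trans xq; exact: (param_equiv _ (unit_end alpha) E).
by exists (@kpt R O (prodT T) I (endpoint alpha, x)) => //; exact: rst_refl.
Qed.

Lemma bd_dist_piK alpha I J (x : T I) (y : T J) : idx K I -> idx K J -> kdom K I x -> kdom K J y ->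
  bd_metric Q d alpha (piK (bd alpha) I ((endpoint alpha, x) : prodT T I))
    (piK (bd alpha) J ((endpoint alpha, y) : prodT T J)) = d0 (piK K I x) (piK K J y).
Proof.
move=> iI iJ Ix Jy; rewrite /bd_metric !bd_piK pd//; try exact: unit_end.
by rewrite subrr normr0 add0r.
Qed.

Definition prod_pr alpha I (p : prodT T I) : prodT T I := (endpoint alpha, p.2).

(** Every point of the product lies in some slice, which settles [cmd_far] for any [ell]. The size
    1/2 separates the ends because |t| + |1 - t| >= 1. *)
Lemma product_collar_model (V : forall I, set (T I)) ell :
  collar_model Q d (product_sets V) ell 2^-1 (fun _ => unit_itv) prod_pr.
Proof.
have ne alpha : unit_itv (endpoint alpha : R) by exact: unit_end.
split.
- by move=> alpha I /prodbd_idx iI; apply: slice_premanifold; exact: (gd_pm gd).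
- by move=> alpha I /prodbd_idx/prodQ_idx.
- by move=> alpha I J /prodQ_idx iI _ _; apply/prodbd_idx.
- by move=> alpha I t [s x] _ ut [_ Ix]; split.
- by move=> alpha I t [s x] _ _ [/= -> _].
- by [].
- move=> alpha I [s x] k /prodbd_idx iI [/= -> Ix] _ [c Mc <-] [/= _ cx].
  have [g [gs gE]] := gd_s gd k iI Ix Mc cx; exists g; split=> //.
  by move: gE; rewrite slice_image.
- move=> alpha I J t [s x] /prodbd_idx iI /prodbd_idx iJ IJ ut [/= -> Jx] [/= _ Ux].
  by split=> //; split=> //; exact: (gd_rho gd).
- move=> alpha I J t [s x] [r y] /prodbd_idx iI /prodQ_idx iJ ut _ [/= ur Jy] /param_piK_inv[-> _].
  by exists (endpoint alpha, y); split=> //; exact/prodbd_idx.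
- move=> alpha I J t [s x] [r y] _ /prodQ_idx iJ _ _ [/= ur Jy] _.
  by exists r, (endpoint alpha, y); split=> //; exact/prodbd_idx.
- move=> alpha I J t t' [s x] [s' x'] /prodbd_idx iI /prodbd_idx iJ ut ut' [/= -> Ix] [/= -> Jx'].
  by rewrite bd_dist_piK// pd.
- move=> alpha I t [s x] _ ut [/= -> Ix]; split=> -[/= _ Vx]; split=> //; exact: ne.
- move=> alpha I t [s x] B _ ut [/= -> Ix]; rewrite !near_withinE => /near_slice H.
  apply: filterS (near_snd (endpoint alpha) H) => -[r y] /= By [/= _ Iy]; apply: By.
  by split.
- move=> I t t' [s x] [s' x'] _ _ _ _ _ _; rewrite /bd_dist /endpoint /= => h1 h2 [tt _].
  move: h1 h2; rewrite -tt sub0r normrN => h1 h2.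
  have := ler_normD t (1 - t); rewrite addrC subrK normr1 leNgt; case/negP.
  by move: h1 h2; lra.
- move=> alpha I t [s x] phi /prodbd_idx iI ut [/= -> Ix] sphi.
  have pI := gd_pm gd iI.
  apply: (prod_smooth pI (phi := fun y => phi (endpoint alpha, y))) => //.
    by apply: prod_premanifold => //; [exact: nb|exact: unit_local].
  exact: slice_smooth.
move=> alpha I t [s x] e phi /prodbd_idx iI ut [/= -> Ix] _ sphi.
by apply: (prod_surj (phi := fun k y => phi k (endpoint alpha, y))) => //; exact: slice_surj sphi.
Qed.

Section Reduction.
Context (W : forall I, set (T I)) (red : reduction K W).
Arguments W : clear implicits.
Local Notation PW := (product_sets W).

Lemma unit_compact : compact (unit_itv : set R).
Proof.
have -> : (unit_itv : set R) = `[0, 1]%classic.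
  by apply/seteqP; split=> t; rewrite /unit_itv /= in_itv.
exact: segment_compact.
Qed.

Lemma product_reduction : reduction Q PW.
Proof.
have u0 : unit_itv (endpoint false : R) by exact: unit_end.
split.
- by move=> I /prodQ_idx iI; apply: relopen_setX; exact: (rd_open red).
- by move=> I /prodQ_idx iI g [t x] [/= ut Wx]; split=> //; exact: (rd_inv red iI).
- move=> I /prodQ_idx iI; apply: precompact_setX; first exact: unit_compact.
  exact: (rd_prec red).
- move=> I /prodQ_idx iI [[t x] [/= ut Wx]].
  have [|z [Wz [Iz sz]]] := rd_zero red iI; first by exists x.
  by exists (t, z); split.
- move=> I J /prodQ_idx iI /prodQ_idx iJ [p [[[t x] [[/= _ Ix] /closure_setX clx] <-]]].
  move=> [[s y] [[/= _ Jy] /closure_setX cly] /param_piK_inv[_ E]].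
  apply: (rd_disj red iI iJ); exists (piK K I x); split; first by exists x.
  by exists y.
move=> p [I /prodQ_idx iI [[t x] [[/= ut Ix] sx] <-]].
have [|J iJ [y Wy yE]] := rd_cover red (t := piK K I x); first by exists I => //; exists x.
exists J; first exact/prodQ_idx.
by exists (t, y) => //; apply: param_piK.
Qed.

Lemma product_cobordism_reduction : cobordism_reduction 1 Q PW.
Proof.
split; first exact: product_reduction.
- move=> alpha I /prodbd_idx iI; split.
    move=> [[s x] [[/= -> Ix] [/= _ Wx]]].
    have [|z [Wz [Iz sz]]] := rd_zero red iI; first by exists x.
    exists (endpoint alpha, z); split=> //; [by split=> //; exact: unit_end|by split=> //; split=> //; exact: unit_end|].
    split=> //=; have ch := wk_charts wk iI.
    have : footprint K I (kpsi K I z) by rewrite -(kc_psi_onto ch); exists z.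
    by have [ O' _ ->] := kc_F_open ch; case.
  move=> [[t x] [[/= ut Wx] _ _]]; exists (endpoint alpha, x).
  have Ix : kdom K I x by have [+ _] := rd_prec red iI; exact.
  by split; split=> //; exact: unit_end.
move=> alpha I t [s x] _ ct [/= -> Ix].
have ut := collar_unit ct.
split=> [[/= _ Wx]|[_ [/= _ Wx]]]; last by split.
by split; split=> //; exact: unit_end.
Qed.

End Reduction.
End ProductAtlas.

Theorem product_perturbation_exists (R : realType) (O : obst R) (T : Index O -> topologicalType)
    (X : topologicalType) (X0 : set X) (n : int) (K0 : kdata T X)
    (d0 : set (kpoint T) -> set (kpoint T) -> R)
    (V0 C0 : forall I, set (T I)) (nrm : forall i, @oE R O i -> R)
    (d : set (kpoint (prodT T)) -> set (kpoint (prodT T)) -> R)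
    (dV delta sig : R) (nub : bool -> forall I, prodT T I -> oEI I) :
  let K := product_cobordism X0 K0 in
  let V := product_sets V0 in
  let C := product_sets C0 in
  metric_tame_atlas n X0 K0 d0 ->
  reduction K0 V0 -> reduction K0 C0 -> nested K0 C0 V0 ->
  equivariant_norms nrm ->
  product_metric X0 K0 d0 d ->
  is_delta_V K d V dV -> 0 < delta < dV ->
  0 < sig -> (sig%:E <= sigma_rel K d V C nrm delta)%E ->
  (forall alpha, bd_adapted K d V C nrm delta sig alpha (nub alpha)) ->
  exists nu : forall I, prodT T I -> oEI I,
    [/\ cobordism_perturbation K V nu,
        [/\ admissible_pert K V nu, precompact_pert K V nu
          & transverse K V nu],
        pert_zero K V nu `<=` piKV K C
      & forall alpha, restricts_to K V alpha nu (nub alpha)].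
Proof.
move=> K V C [[wk nb] tm am] redV redC nCV en pd [_ dVP] dd sig0 sigS adp.
have /andP[delta0 ddV] := dd; have [VP Vsep] := dVP _ dd.
have gd := product_good wk nb tm am pd.
have Vo := rd_open (product_reduction X0 redV).
have half : 0 < 2^-1 :> R by rewrite invr_gt0.
have sigS' : (sig%:E <= sigma_V' K d V C nrm delta)%E.
  by apply: le_trans sigS _; rewrite /sigma_rel !ge_min lexx !orbT.
(* The width [ell] is chosen after [delta], just large enough for collars of size 1/2. *)
have cmd := product_collar_model wk nb tm am pd V0 (2^-1 + delta).
have [nu [nu1 nu2 nu3 nu4 [r rpos nuE]]] := collar_perturbation cmd gd Vo en delta0 half (lexx _)
  VP Vsep sig0 sigS' adp.
exists nu; split=> //.
- split=> //; exists (Num.min r 1); first by rewrite lt_min rpos ltr01.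
  move=> alpha; exists (nub alpha) => I t x iI ct Vx.
  have ct1 : collar alpha 1 t by apply: collar_sub ct; rewrite ge_min lexx orbT.
  apply: nuE => //; last by apply: lt_le_trans (collar_dist ct) _; rewrite ge_min lexx.
  exact: collar_unit ct1.
- split=> //; exists C, 1; split=> //; first exact (product_cobordism_reduction wk redC).
  move=> I /prodQ_idx iI; apply: precompact_setX; first exact: unit_compact.
  exact: nCV.
move=> alpha I [s x] iI Vx; have [[/= sE Ix] _] := Vx.
have := nuE alpha I (endpoint alpha) (s, x) iI (unit_end alpha) _ Vx.
rewrite /bd_dist subrr normr0 => /(_ rpos) <-.
by rewrite /= sE.
Qed.

Theorem proposition3p3p3 (R : realType) :
  (* (i) *)
  (forall (O : obst R) (T : Index O -> topologicalType) (X : topologicalType)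
      (X0 : set X) (n : int) (K : kdata T X)
      (d : set (kpoint T) -> set (kpoint T) -> R)
      (V C : forall I, set (T I)) (nrm : forall i, @oE R O i -> R)
      (dV delta sig : R),
    metric_tame_atlas n X0 K d ->
    reduction K V -> reduction K C -> nested K C V ->
    equivariant_norms nrm ->
    is_delta_V K d V dV -> 0 < delta < dV ->
    0 < sig -> (sig%:E <= sigma_V K d V C nrm delta)%E ->
    exists nu : forall I, T I -> oEI I, adapted K d V C nrm delta sig nu)
  /\
  (* (ii) *)
  (forall (O : obst R) (T : Index O -> topologicalType) (Y : topologicalType)
      (Y0 : set Y) (n : int) (K : cobdata T Y)
      (d : set (kpoint T) -> set (kpoint T) -> R)
      (V C : forall I, set (T I)) (nrm : forall i, @oE R O i -> R)
      (eps dV delta sig : R) (nub : bool -> forall I, T I -> oEI I),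
    metric_tame_cobordism eps n Y0 K d ->
    cobordism_reduction eps K V -> cobordism_reduction eps K C ->
    nested K C V ->
    equivariant_norms nrm ->
    is_delta_V K d V dV -> 0 < delta < Num.min eps dV ->
    0 < sig -> (sig%:E <= sigma_rel K d V C nrm delta)%E ->
    (forall alpha, bd_adapted K d V C nrm delta sig alpha (nub alpha)) ->
    exists nu : forall I, T I -> oEI I,
      [/\ cobordism_perturbation K V nu,
          [/\ admissible_pert K V nu, precompact_pert K V nu
            & transverse K V nu],
          pert_zero K V nu `<=` piKV K C
        & forall alpha, restricts_to K V alpha nu (nub alpha)])
  /\
  (* (iii) *)
  (forall (O : obst R) (T : Index O -> topologicalType) (X : topologicalType)
      (X0 : set X) (n : int) (K0 : kdata T X)
      (d0 : set (kpoint T) -> set (kpoint T) -> R)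
      (V0 C0 : forall I, set (T I)) (nrm : forall i, @oE R O i -> R),
    let K := product_cobordism X0 K0 in
    let V := product_sets V0 in
    let C := product_sets C0 in
    forall (d : set (kpoint (prodT T)) -> set (kpoint (prodT T)) -> R)
      (dV delta sig : R) (nub : bool -> forall I, prodT T I -> oEI I),
    metric_tame_atlas n X0 K0 d0 ->
    reduction K0 V0 -> reduction K0 C0 -> nested K0 C0 V0 ->
    equivariant_norms nrm ->
    product_metric X0 K0 d0 d ->
    is_delta_V K d V dV -> 0 < delta < dV ->
    0 < sig -> (sig%:E <= sigma_rel K d V C nrm delta)%E ->
    (forall alpha, bd_adapted K d V C nrm delta sig alpha (nub alpha)) ->
    exists nu : forall I, prodT T I -> oEI I,
      [/\ cobordism_perturbation K V nu,
          [/\ admissible_pert K V nu, precompact_pert K V nu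
            & transverse K V nu],
          pert_zero K V nu `<=` piKV K C
        & forall alpha, restricts_to K V alpha nu (nub alpha)]).
Proof.
split; [|split].
- move=> O T X X0 n K d V C nrm dV delta sig mK rV _ _ en.
  exact: adapted_exists mK rV en.
- exact: cobordism_perturbation_exists.
- exact: product_perturbation_exists.
Qed.
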